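(* Let $m$ and $n$ be even positive integers. For the piecewise linear system $Z_\varepsilon$ described in the context, the following hold: (1) $m_1(m,n)=0$ and $m_2(m,n)=1$ if $\frac{m}{n}=1$; (2) $m_1(m,n)=2$ and $m_2(m,n)=4$ if $\frac{m}{n}\in\left[\frac15,\frac13\right]\cup\left[\frac12,1\right)\cup(1,2]\cup[3,5]$; (3) $m_1(m,n)=2$ and $m_2(m,n)=5$ if $\frac{m}{n}\in\left(0,\frac15\right)\cup\left(\frac13,\frac12\right)\cup(2,3)\cup(5,\infty)$. Consequently $H(m,n)\ge 1$ if $\frac mn=1$; $H(m,n)\ge 4$ if $\frac mn\in\left[\frac15,\frac13\right]\cup\left[\frac12,1\right)\cup(1,2]\cup[3,5]$; and $H(m,n)\ge 5$ if $\frac mn\in\left(0,\frac15\right)\cup\left(\frac13,\frac12\right)\cup(2,3)\cup(5,\infty)$.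
   Context: For positive integers $m,n$ and an integer $k\ge 1$, consider the planar piecewise linear vector field $Z_\varepsilon$ with switching curve $\Sigma=\{(x,y): y^n-x^m=0\}$ defined by $\dot x = y+\sum_{i=1}^k\varepsilon^i(a_{0i}+a_{1i}x+a_{2i}y)$, $\dot y=-x+\sum_{i=1}^k\varepsilon^i(b_{0i}+b_{1i}x+b_{2i}y)$ in the region $y^n-x^m>0$, and $\dot x = y+\sum_{i=1}^k\varepsilon^i(\alpha_{0i}+\alpha_{1i}x+\alpha_{2i}y)$, $\dot y=-x+\sum_{i=1}^k\varepsilon^i(\beta_{0i}+\beta_{1i}x+\beta_{2i}y)$ in the region $y^n-x^m<0$, with arbitrary real coefficients $a_{ji},b_{ji},\alpha_{ji},\beta_{ji}$ ($j\in\{0,1,2\}$, $i\in\{1,\dots,k\}$). For $\varepsilon=0$ this is the linear center. In polar coordinates $x=r\cos\theta$, $y=r\sin\theta$, taking $\theta$ as independent variable, the orbits satisfy a piecewise smooth, $2\pi$-periodic equation $dr/d\theta=\sum_{i=1}^k\varepsilon^iF_i(\theta,r)+O(\varepsilon^{k+1})$, whose pieces are switched where the orbit meets $\Sigma$. If $r(\theta,r_0,\varepsilon)$ denotes its solution with $r(0)=r_0>0$, the displacement expands as $r(2\pi,r_0,\varepsilon)-r_0=\sum_{i=1}^k\varepsilon^i\Delta_i(r_0)+O(\varepsilon^{k+1})$; $\Delta_i$ is the Melnikov function of order $i$ (it depends only on the coefficients with index $\le i$). $m_\ell(m,n)$ denotes the maximum, over all choices of coefficients for which $\Delta_1\equiv\cdots\equiv\Delta_{\ell-1}\equiv0$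 and $\Delta_\ell\not\equiv0$, of the number of simple zeros of $\Delta_\ell$ in $(0,\infty)$, i.e. the maximum number of limit cycles of $Z_\varepsilon$ (for $|\varepsilon|\neq0$ small) detectable by the Melnikov function of order $\ell$. $H(m,n)$ denotes the maximum number of limit cycles of $Z_\varepsilon$ for $|\varepsilon|\ne0$ sufficiently small over all such systems. *)

(* Defs.v *)
From Stdlib Require Import Reals List.
From Coquelicot Require Import Coquelicot.
Open Scope R_scope.

Fixpoint psum (k : nat) (f : nat -> R) : R :=
  match k with
  | O => 0
  | S k' => psum k' f + f (S k')
  end.

(* Coefficients of the perturbation: c j i stands for c_{ji}
   (only j in {0,1,2} and i in {1..k} are used). *)
Record Coeffs := mkCoeffs {
  ca  : nat -> nat -> R;   (* a_{ji}     : x-component, region y^n - x^m > 0 *)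
  cb  : nat -> nat -> R;   (* b_{ji}     : y-component, region y^n - x^m > 0 *)
  cal : nat -> nat -> R;   (* alpha_{ji} : x-component, region y^n - x^m < 0 *)
  cbe : nat -> nat -> R    (* beta_{ji}  : y-component, region y^n - x^m < 0 *)
}.

Definition pert (c : nat -> nat -> R) (k : nat) (eps x y : R) : R :=
  psum k (fun i => eps ^ i * (c 0%nat i + c 1%nat i * x + c 2%nat i * y)).

Definition Pplus  (cf : Coeffs) k eps x y := y + pert (ca cf) k eps x y.
Definition Qplus  (cf : Coeffs) k eps x y := - x + pert (cb cf) k eps x y.
Definition Pminus (cf : Coeffs) k eps x y := y + pert (cal cf) k eps x y.
Definition Qminus (cf : Coeffs) k eps x y := - x + pert (cbe cf) k eps x y.

Definition swf (m n : nat) (x y : R) : R := y ^ n - x ^ m.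

(* dr/dtheta for a planar field (P,Q) at (x,y) = (r cos th, r sin th):
   dr/dth = (dr/dt)/(dth/dt) = r (x P + y Q) / (x Q - y P). *)
Definition polar_rhs (P Q : R -> R -> R) (th r : R) : R :=
  let x := r * cos th in let y := r * sin th in
  r * (x * P x y + y * Q x y) / (x * Q x y - y * P x y).

Definition Frhs (cf : Coeffs) (k m n : nat) (eps th r : R) : R :=
  let x := r * cos th in let y := r * sin th in
  if Rlt_dec 0 (swf m n x y)
  then polar_rhs (Pplus cf k eps) (Qplus cf k eps) th r
  else polar_rhs (Pminus cf k eps) (Qminus cf k eps) th r.

(* r is a solution on [0, 2 pi] of the piecewise equation with r(0) = r0:
   r is positive and continuous on [0,2pi], and outside a finite set of
   (switching) angles the point (r cos th, r sin th) lies off Sigma and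
   r satisfies the equation of the corresponding region. *)
Definition IsSol (cf : Coeffs) (k m n : nat) (eps r0 : R) (r : R -> R) : Prop :=
  r 0 = r0 /\
  (forall th, 0 <= th <= 2 * PI -> 0 < r th /\ continuous r th) /\
  exists L : list R,
    forall th, 0 < th < 2 * PI -> ~ In th L ->
      swf m n (r th * cos th) (r th * sin th) <> 0 /\
      is_derive r th (Frhs cf k m n eps th (r th)).

Definition MelnikovExpansion (cf : Coeffs) (k m n : nat) (D : nat -> R -> R) : Prop :=
  forall r0, 0 < r0 ->
    exists C eps0, 0 < eps0 /\
      forall eps, Rabs eps < eps0 ->
        (exists r, IsSol cf k m n eps r0 r) /\
        (forall r, IsSol cf k m n eps r0 r ->
           Rabs (r (2 * PI) - r0 - psum k (fun i => eps ^ i * D i r0))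
             <= C * Rabs eps ^ (S k)).

Definition simple_zero (f : R -> R) (z : R) : Prop :=
  f z = 0 /\ exists d, is_derive f z d /\ d <> 0.

Definition first_nonzero (D : nat -> R -> R) (l : nat) : Prop :=
  (forall i, (1 <= i < l)%nat -> forall r, 0 < r -> D i r = 0) /\
  (exists r, 0 < r /\ D l r <> 0).

Definition simple_zeros_list (f : R -> R) (zs : list R) : Prop :=
  NoDup zs /\ forall z, In z zs -> 0 < z /\ simple_zero f z.

Definition m_ell (k m n l M : nat) : Prop :=
  (exists cf D, MelnikovExpansion cf k m n D /\ first_nonzero D l /\
     exists zs, simple_zeros_list (D l) zs /\ length zs = M) /\
  (forall cf D, MelnikovExpansion cf k m n D -> first_nonzero D l ->
     forall zs, simple_zeros_list (D l) zs -> (length zs <= M)%nat).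

(* Limit cycle of Z_eps through (z,0), z > 0: the orbit through (z,0) is
   periodic (zero of the displacement function) and isolated among the
   periodic orbits (isolated zero of the displacement function). *)
Definition limit_cycle_at (cf : Coeffs) (k m n : nat) (eps z : R) : Prop :=
  (exists r, IsSol cf k m n eps z r /\ r (2 * PI) = z) /\
  exists delta, 0 < delta /\
    forall z', 0 < z' -> Rabs (z' - z) < delta -> z' <> z ->
      forall r, IsSol cf k m n eps z' r -> r (2 * PI) <> z'.

Definition H_ge (m n N : nat) : Prop :=
  exists (k : nat) (cf : Coeffs), (1 <= k)%nat /\
    exists eps0, 0 < eps0 /\
      forall eps, 0 < Rabs eps < eps0 ->
        exists zs : list R, NoDup zs /\ length zs = N /\
          forall z, In z zs -> 0 < z /\ limit_cycle_at cf k m n eps z.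

Definition ratio (m n : nat) : R := INR m / INR n.

Definition case1 (q : R) : Prop := q = 1.
Definition case2 (q : R) : Prop :=
  (1/5 <= q <= 1/3) \/ (1/2 <= q < 1) \/ (1 < q <= 2) \/ (3 <= q <= 5).
Definition case3 (q : R) : Prop :=
  (0 < q < 1/5) \/ (1/3 < q < 1/2) \/ (2 < q < 3) \/ (5 < q).

(* Main.v *)
Require Import Defs.
From Stdlib Require Import Reals Ranalysis5 Lra Lia List Arith ClassicalEpsilon.
From Coquelicot Require Import Coquelicot.
Import ListNotations.
Open Scope R_scope.

(* For even m and n the circle of radius r meets the switching curve at the four angles
   phi, PI - phi, PI + phi, 2 PI - phi, where phi = phi(r) lies in the first quadrant. In each of the
   five sectors they cut out of [0, 2 PI] one chooses u_i so that r + sum eps^i u_i(theta, r) is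
   constant along solutions up to O(eps^(k+1)); matching the choices on the curve and normalising
   u_i(2 PI, .) = 0 makes the i-th Melnikov function equal to u_i(0, .), and also gives a Lipschitz
   bound on the remainder, so that simple zeros persist as isolated periodic orbits.

   If m <> n and the first Melnikov function vanishes, the second one divided by r is, as a function
   of s = tan phi or its inverse, an arbitrary element of the span of
     1, atan s, s/(1+s^2), s/(1+d+s^2), s^(3+2/d)/((1+s^2)(1+d+s^2)),   1 + d = max(m/n, n/m).
   Differentiating and dividing (Rolle) removes these functions one after the other and leaves a
   quadratic polynomial which has no relevant root unless 1 < d < 2 or 4 < d, and then at most one; this
   bounds the number of zeros by 4, respectively 5. The bound is attained by adding to an
   element of the span that is O(s^5) at 0 elements of lower and lower order, with alternating signs
   and rapidly decreasing coefficients. The zeros so obtained are simple, for a degenerate one could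
   be perturbed into three zeros, exceeding the bound. *)

(** The right-hand side is discontinuous in r, so the Picard theorem and the Gronwall inequality do
    not apply directly. They are replaced by a measure argument: two curves at distance D lie in
    different sectors only for a set of theta of length O(D), while the field itself is O(eps).
    Hence the Picard operator is a contraction for small eps in spite of the jumps, and the same
    estimate yields the Lipschitz bound on the remainder. Since [m_ell] ranges over every family
    satisfying the expansion, uniqueness of the coefficients is needed as well.

    The five functions have separate sources: 1 and atan s measure the widths of the sectors,
    s/(1+s^2) is sin phi cos phi, the denominator 1+d+s^2 is that of phi'(r), and the last function
    comes from the constant terms of the field, which carry 1/r^2; the power s^(2/d) appears when r
    is expressed through s by the equation of the curve. For m = n the angle phi is constantly PI/4
    and the vanishing of the first order imposes fewer conditions, so this case has its own
    computation. *)

(** * Counting zeros along increasing lists; Rolle's theorem *)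

Fixpoint chain (x : R) (l : list R) : Prop :=
  match l with
  | [] => True
  | y :: l' => x < y /\ chain y l'
  end.

(** Increasing lists are the form on which Rolle's theorem acts; [atmost_NoDup] transfers the bound
    to arbitrary lists without repetition. *)
Definition atmost (N : nat) (Z : R -> Prop) : Prop :=
  forall x l, chain x l -> List.Forall Z (x :: l) -> (S (length l) <= N)%nat.

Lemma atmost_mono (N M : nat) (Z Z' : R -> Prop) :
  (N <= M)%nat -> (forall x, Z' x -> Z x) -> atmost N Z -> atmost M Z'.
Proof.
  intros HNM HZ H x l Hc Hl.
  apply Nat.le_trans with N; [|exact HNM].
  apply (H x l Hc). revert Hl. apply Forall_impl. exact HZ.
Qed.

Lemma chain_map (h : R -> R) (D : R -> Prop) (l : list R) : forall x,
  (forall x y, D x -> D y -> x < y -> h x < h y) ->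
  List.Forall D (x :: l) -> chain x l -> chain (h x) (map h l).
Proof.
  induction l as [|y l IH]; intros x Hh HD Hc; simpl; auto.
  destruct Hc as [Hxy Hc]. inversion HD as [|? ? Dx HD']; subst.
  inversion HD' as [|? ? Dy HD'']; subst.
  split; auto.
Qed.

Lemma atmost_map (h : R -> R) (N : nat) (Z Z' : R -> Prop) :
  (forall x y, Z' x -> Z' y -> x < y -> h x < h y) ->
  (forall x, Z' x -> Z (h x)) -> atmost N Z -> atmost N Z'.
Proof.
  intros Hh HZ H x l Hc Hl.
  rewrite <- (length_map h l).
  apply (H (h x)).
  - now apply chain_map with Z'.
  - change (List.Forall Z (map h (x :: l))). apply Forall_map.
    revert Hl. apply Forall_impl. exact HZ.
Qed.

Lemma atmost0 (Z : R -> Prop) : (forall x, ~ Z x) -> atmost 0 Z.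
Proof. intros H x l _ Hl. inversion Hl. now elim (H x). Qed.

Lemma atmost1 (Z : R -> Prop) : (forall x y, Z x -> Z y -> x < y -> False) -> atmost 1 Z.
Proof.
  intros H x [|y l] Hc Hl; simpl; [lia|].
  inversion Hl as [|? ? Zx Hl']; subst. inversion Hl'; subst.
  destruct Hc. exfalso. eauto.
Qed.

Definition convex (D : R -> Prop) : Prop :=
  forall x y z, D x -> D z -> x <= y <= z -> D y.

Lemma rolle (D : R -> Prop) (f df : R -> R) (x y : R) :
  convex D -> (forall x, D x -> is_derive f x (df x)) ->
  D x -> D y -> x < y -> f x = f y -> exists z, x < z < y /\ D z /\ df z = 0.
Proof.
  intros HD Hf Dx Dy Hxy Hfe.
  destruct (MVT_cor2 f df x y Hxy) as (c & Hc & Hxcy).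
  - intros c Hc. apply is_derive_Reals, Hf. now apply (HD x c y).
  - exists c. repeat split; try tauto.
    + apply (HD x c y); auto; lra.
    + assert (df c * (y - x) = 0) as E by lra.
      apply Rmult_integral in E. lra.
Qed.

Lemma atmost_rolle (D : R -> Prop) (f df : R -> R) (N : nat) :
  convex D -> (forall x, D x -> is_derive f x (df x)) ->
  atmost N (fun x => D x /\ df x = 0) -> atmost (S N) (fun x => D x /\ f x = 0).
Proof.
  intros HD Hf H.
  (* The clause x < y lets the induction extend the new list on the left: the Rolle point between x
     and a lies before all the points found beyond a. *)
  assert (A : forall l x, chain x l -> List.Forall (fun x => D x /\ f x = 0) (x :: l) ->
    l <> [] -> exists y l', x < y /\ chain y l' /\
      List.Forall (fun x => D x /\ df x = 0) (y :: l') /\ S (length l') = length l).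
  { induction l as [|a l IH]; intros x Hc Hl Hn; [congruence|].
    destruct Hc as [Hxa Hc].
    inversion Hl as [|? ? [Dx Zx] Hl']; subst.
    inversion Hl' as [|? ? [Da Za] Hl'']; subst.
    destruct (rolle D f df x a HD Hf Dx Da Hxa) as (y & Hy & Dy & Zy); [lra|].
    destruct l as [|b l].
    - exists y, []. repeat split; auto; try tauto.
    - destruct (IH a Hc Hl') as (y' & l' & H1 & H2 & H3 & H4); [congruence|].
      exists y, (y' :: l'). simpl in *. repeat split; auto; try tauto; try lra. }
  intros x l Hc Hl. destruct l as [|a l]; [simpl; lia|].
  destruct (A (a :: l) x Hc Hl) as (y & l' & _ & H2 & H3 & H4); [congruence|].
  apply le_n_S. rewrite <- H4. now apply (H y).
Qed.

Fixpoint insert (x : R) (l : list R) : list R :=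
  match l with
  | [] => [x]
  | y :: l' => if Rlt_dec x y then x :: l else y :: insert x l'
  end.

Definition sorted (l : list R) : Prop :=
  match l with [] => True | x :: l' => chain x l' end.

Lemma insert_chain (x : R) (l : list R) : forall y,
  y < x -> ~ In x l -> chain y l -> chain y (insert x l).
Proof.
  induction l as [|z l IH]; intros y Hyx Hn Hc; simpl; auto.
  destruct Hc as [H1 H2].
  destruct (Rlt_dec x z) as [Hxz|Hxz]; simpl; auto.
  split; auto. apply IH; auto.
  - assert (x <> z) by (intro; subst; apply Hn; now left). lra.
  - intro Hi; apply Hn; now right.
Qed.

Lemma insert_sorted (x : R) (l : list R) :
  ~ In x l -> sorted l -> sorted (insert x l).
Proof.
  destruct l as [|z l]; simpl; auto. intros Hn Hc.
  destruct (Rlt_dec x z) as [Hxz|Hxz]; simpl; auto.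
  apply insert_chain; auto.
  assert (x <> z) by (intro; subst; apply Hn; now left). lra.
Qed.

Lemma insert_In (x : R) (l : list R) : forall y, In y (insert x l) <-> y = x \/ In y l.
Proof.
  induction l as [|z l IH]; intros y; simpl.
  - intuition congruence.
  - destruct (Rlt_dec x z); simpl; [intuition congruence|]. rewrite IH. tauto.
Qed.

Lemma insert_length (x : R) (l : list R) : length (insert x l) = S (length l).
Proof.
  induction l as [|z l IH]; simpl; auto. destruct (Rlt_dec x z); simpl; auto.
Qed.

Lemma sort_exists (l : list R) : NoDup l ->
  exists l', sorted l' /\ length l' = length l /\ forall y, In y l' <-> In y l.
Proof.
  induction l as [|x l IH]; intros Hn.
  - exists []. simpl. tauto.
  - inversion Hn; subst. destruct IH as (l' & H3 & H4 & H5); auto.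
    exists (insert x l'). repeat split.
    + apply insert_sorted; auto. rewrite H5. auto.
    + rewrite insert_length. simpl. congruence.
    + intros Hy; apply insert_In in Hy. simpl. rewrite <- H5. intuition.
    + intros Hy. apply insert_In. simpl in Hy. rewrite H5. intuition.
Qed.

Lemma atmost_NoDup (N : nat) (Z : R -> Prop) (l : list R) :
  atmost N Z -> NoDup l -> (forall x, In x l -> Z x) -> (length l <= N)%nat.
Proof.
  intros H Hn HZ. destruct (sort_exists l Hn) as (l' & H1 & H2 & H3).
  rewrite <- H2. destruct l' as [|x l']; simpl; [lia|].
  apply (H x l' H1). apply Forall_forall. intros y Hy. apply HZ, H3, Hy.
Qed.

(** * Upper bound for the number of zeros in the model family *)

Definition pw (a t : R) : R := exp (a * ln t).

(* The second Melnikov function divided by r, as a function of the slope t of the switching ray, for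
   m/n = 1 + d > 1 and vanishing first Melnikov function. *)
Definition gq (d c0 c1 c2 c3 c4 t : R) : R :=
  c0 + c1 * atan t + c2 * (t / (1 + t ^ 2)) + c3 * (t / (1 + (1 + d) * t ^ 2))
  + c4 * (t * pw (- (2 / d)) t / ((1 + t ^ 2) * (1 + (1 + d) * t ^ 2))).

(** Up to the factor 1/d, the numerator of t times the logarithmic derivative of the c4 term of
    [gq], over the denominator (1 + v) (1 + (1 + d) v), with v = t^2. *)
Definition Bq (d v : R) : R := (d - 2) - (d + 2) ^ 2 * v - (1 + d) * (3 * d + 2) * v ^ 2.

(* n1 is (1 + v)^2 times the derivative of gq, in v = t^2; n2 is the derivative of n1; n4 is the
   derivative of n2 divided by a factor (positive for d <= 4) chosen so that its c3 part is constant. *)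
Definition n1 (d c1 c2 c3 c4 v : R) : R :=
  c1 * (1 + v) + c2 * (1 - v)
  + c3 * ((1 - (1 + d) * v) * (1 + v) ^ 2 / (1 + (1 + d) * v) ^ 2)
  + c4 / d * (pw (- / d) v * Bq d v / (1 + (1 + d) * v) ^ 2).

Lemma pw_sq (d t : R) : 0 < t -> d <> 0 -> pw (- (2 / d)) t = pw (- / d) (t ^ 2).
Proof.
  intros Ht Hd. unfold pw. f_equal.
  replace (t ^ 2) with (t * t) by ring. rewrite ln_mult by assumption. field. exact Hd.
Qed.

Lemma pw_pos (a t : R) : 0 < pw a t.
Proof. apply exp_pos. Qed.

Lemma is_derive_gq (d c0 c1 c2 c3 c4 t : R) : 0 < d -> 0 < t ->
  is_derive (gq d c0 c1 c2 c3 c4) t (n1 d c1 c2 c3 c4 (t ^ 2) / (1 + t ^ 2) ^ 2).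
Proof.
  intros Hd Ht.
  assert (0 < t ^ 2) as Hv by (apply pow_lt; assumption).
  assert (0 < (1 + d) * t ^ 2) as Hw by (apply Rmult_lt_0_compat; lra).
  unfold gq, n1. rewrite <- (pw_sq d t) by lra. unfold pw, Bq.
  auto_derive.
  - repeat split; try lra. apply Rgt_not_eq, Rmult_lt_0_compat; lra.
  - field. repeat split; lra.
Qed.

Definition n2 (d c1 c2 c3 c4 v : R) : R :=
  c1 - c2
  + c3 * ((1 + v) * (- (1 + d) * (1 + v) * (1 + (1 + d) * v) + 2 * (1 - (1 + d) * v) * (1 + (1 + d) * v)
                     - 2 * (1 + d) * (1 - (1 + d) * v) * (1 + v)) / (1 + (1 + d) * v) ^ 3)
  + c4 / d * (pw (- / d) v * ((- / d / v * Bq d v + (- (d + 2) ^ 2 - 2 * (1 + d) * (3 * d + 2) * v)) * (1 + (1 + d) * v)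
      - 2 * (1 + d) * Bq d v) / (1 + (1 + d) * v) ^ 3).

Lemma is_derive_n1 (d c1 c2 c3 c4 v : R) : 0 < d -> 0 < v ->
  is_derive (n1 d c1 c2 c3 c4) v (n2 d c1 c2 c3 c4 v).
Proof.
  intros Hd Hv. assert (0 < (1 + d) * v) as Hw by (apply Rmult_lt_0_compat; lra).
  unfold n1, n2, pw, Bq. auto_derive.
  - repeat split; try lra; try (apply (pow_nonzero _ 2); lra).
  - field. repeat split; lra.
Qed.

(** Both polynomials are in w = 1 + (1 + d) v. [Mq] is the numerator of the c4 part of [n4]; on
    differentiating that part a factor w^3 splits off, and the quadratic [Qq] is all that remains to
    be studied. *)
Definition Mq (d w : R) : R :=
  - (1 + d) * (3 * d + 2) * w ^ 4 - d * (d - 2) * (2 * d + 1) * (d + 1) * w ^ 3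
  + 2 * d ^ 2 * (4 * d - 1) * (2 * d + 1) * w ^ 2 - 2 * d ^ 3 * (13 * d + 2) * w + 12 * d ^ 4.

Definition Qq (d w : R) : R :=
  - (4 - d) * (d - 1) * (3 * d + 2) * w ^ 2
  - 2 * d * (d ^ 3 + 17 * d ^ 2 - 7 * d - 14) * w - 4 * d ^ 2 * (2 * d ^ 2 - 7 * d - 7).

Definition n4 (d c3 c4 v : R) : R :=
  2 * d * c3 + c4 / (d ^ 3 * (1 + d)) *
    (pw (- / d) v * Mq d (1 + (1 + d) * v) / (v ^ 2 * ((4 - d) * (1 + (1 + d) * v) + 6 * d))).

Lemma is_derive_n2 (d c1 c2 c3 c4 v : R) : 0 < d <= 4 -> 0 < v ->
  is_derive (n2 d c1 c2 c3 c4) v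
    (((4 - d) * (1 + (1 + d) * v) + 6 * d) / (1 + (1 + d) * v) ^ 4 * n4 d c3 c4 v).
Proof.
  intros Hd Hv. assert (0 < (1 + d) * v) as Hw by (apply Rmult_lt_0_compat; lra).
  assert (0 <= (4 - d) * (1 + (1 + d) * v)) as Hl by (apply Rmult_le_pos; lra).
  unfold n2, n4, pw, Bq, Mq. auto_derive.
  - assert (1 + (1 + d) * v <> 0) by lra.
    repeat split; try lra; try (apply (pow_nonzero _ 2); lra); apply (pow_nonzero _ 3); lra.
  - field. repeat split; lra.
Qed.

Lemma is_derive_n4 (d c3 c4 v : R) : 0 < d <= 4 -> 0 < v ->
  is_derive (n4 d c3 c4) v
    (c4 * (pw (- / d) v * (1 + (1 + d) * v) ^ 3
      / (d ^ 4 * v ^ 3 * ((4 - d) * (1 + (1 + d) * v) + 6 * d) ^ 2)) * Qq d (1 + (1 + d) * v)).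
Proof.
  intros Hd Hv. assert (0 < (1 + d) * v) as Hw by (apply Rmult_lt_0_compat; lra).
  assert (0 <= (4 - d) * (1 + (1 + d) * v)) as Hl by (apply Rmult_le_pos; lra).
  unfold n4, pw, Mq, Qq. auto_derive.
  - repeat split; auto; try lra.
    apply Rgt_not_eq. apply Rmult_lt_0_compat; nra.
  - field. repeat split; lra.
Qed.

Lemma convex_pos : convex (fun t => 0 < t).
Proof. intros x y z Hx _ H. lra. Qed.

Definition allzero (c0 c1 c2 c3 c4 : R) : Prop :=
  c0 = 0 /\ c1 = 0 /\ c2 = 0 /\ c3 = 0 /\ c4 = 0.

Lemma gq_rolle_n1 (N : nat) (d c0 c1 c2 c3 c4 : R) : 0 < d ->
  atmost N (fun v => 0 < v /\ n1 d c1 c2 c3 c4 v = 0) ->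
  atmost (S N) (fun t => 0 < t /\ gq d c0 c1 c2 c3 c4 t = 0).
Proof.
  intros Hd H.
  apply atmost_rolle with (fun t => n1 d c1 c2 c3 c4 (t ^ 2) / (1 + t ^ 2) ^ 2).
  - apply convex_pos.
  - intros t Ht. apply is_derive_gq; assumption.
  - revert H. apply atmost_map with (h := fun t => t ^ 2).
    + intros x y [Hx _] _ Hxy. nra.
    + intros x [Hx Hz]. split; [apply pow_lt; assumption|].
      apply Rmult_integral in Hz. destruct Hz as [Hz|Hz]; [exact Hz|].
      exfalso. revert Hz. apply Rinv_neq_0_compat, pow_nonzero.
      assert (0 <= x ^ 2) by apply pow2_ge_0. lra.
Qed.

Lemma n1_rolle_n2 (N : nat) (d c1 c2 c3 c4 : R) : 0 < d ->
  atmost N (fun v => 0 < v /\ n2 d c1 c2 c3 c4 v = 0) ->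
  atmost (S N) (fun v => 0 < v /\ n1 d c1 c2 c3 c4 v = 0).
Proof.
  intros Hd. apply atmost_rolle; [apply convex_pos|].
  intros v Hv. now apply is_derive_n1.
Qed.

Lemma n2_rolle_n4 (N : nat) (d c1 c2 c3 c4 : R) : 0 < d <= 4 ->
  atmost N (fun v => 0 < v /\ n4 d c3 c4 v = 0) ->
  atmost (S N) (fun v => 0 < v /\ n2 d c1 c2 c3 c4 v = 0).
Proof.
  intros Hd H. eapply atmost_rolle; [apply convex_pos| |].
  - intros v Hv. now apply is_derive_n2.
  - revert H. apply atmost_mono; [lia|]. intros v [Hv Hz]. split; auto.
    assert (0 < (1 + d) * v) as Hw by (apply Rmult_lt_0_compat; lra).
    assert (0 <= (4 - d) * (1 + (1 + d) * v)) as Hl by (apply Rmult_le_pos; lra).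
    apply Rmult_integral in Hz. destruct Hz as [Hz|Hz]; [|exact Hz]. exfalso.
    apply Rmult_integral in Hz. destruct Hz as [Hz|Hz]; [lra|].
    revert Hz. apply Rinv_neq_0_compat, pow_nonzero. lra.
Qed.

Lemma n4_rolle (N : nat) (d c3 c4 : R) : 0 < d <= 4 -> c4 <> 0 ->
  atmost N (fun v => 0 < v /\ Qq d (1 + (1 + d) * v) = 0) ->
  atmost (S N) (fun v => 0 < v /\ n4 d c3 c4 v = 0).
Proof.
  intros Hd H4 H. eapply atmost_rolle; [apply convex_pos| |].
  - intros v Hv. now apply is_derive_n4.
  - revert H. apply atmost_mono; [lia|]. intros v [Hv Hz]. split; auto.
    assert (0 < (1 + d) * v) as Hw by (apply Rmult_lt_0_compat; lra).
    assert (0 <= (4 - d) * (1 + (1 + d) * v)) as Hl by (apply Rmult_le_pos; lra).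
    apply Rmult_integral in Hz. destruct Hz as [Hz|Hz]; [|exact Hz]. exfalso.
    apply Rmult_integral in Hz. destruct Hz as [Hz|Hz]; [lra|].
    apply Rmult_integral in Hz. destruct Hz as [Hz|Hz].
    + apply Rmult_integral in Hz. generalize (pw_pos (- / d) v).
      assert (0 < (1 + (1 + d) * v) ^ 3) by (apply pow_lt; lra). lra.
    + revert Hz. apply Rinv_neq_0_compat.
      repeat apply Rmult_integral_contrapositive_currified; first [apply pow_nonzero; lra | lra].
Qed.

(** The first of c4, c3, c1 - c2, c1 + c2, c0 that does not vanish decides where the chain of
    derivatives ends: with c4 = 0 the function [n4] is a multiple of c3, then [n2] is the constant
    c1 - c2, then [n1] is the constant c1 + c2. Every earlier stop allows fewer zeros. *)
Lemma gq_atmost_small (N : nat) (d c0 c1 c2 c3 c4 : R) : 0 < d <= 4 ->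
  atmost N (fun v => 0 < v /\ Qq d (1 + (1 + d) * v) = 0) ->
  ~ allzero c0 c1 c2 c3 c4 ->
  atmost (4 + N) (fun t => 0 < t /\ gq d c0 c1 c2 c3 c4 t = 0).
Proof.
  intros Hd HQ Hnz.
  assert (Hmono : forall M Z, (M <= 4 + N)%nat -> atmost M Z -> atmost (4 + N) Z)
    by (intros M Z HM; apply atmost_mono; auto).
  destruct (Req_dec c4 0) as [H4|H4].
  2:{ apply gq_rolle_n1, n1_rolle_n2, n2_rolle_n4, n4_rolle; auto; lra. }
  destruct (Req_dec c3 0) as [H3|H3].
  2:{ apply (Hmono 3%nat); [lia|].
      apply gq_rolle_n1, n1_rolle_n2, n2_rolle_n4; try lra.
      apply atmost0. intros v [Hv Hz]. unfold n4 in Hz. rewrite H4 in Hz.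
      apply H3. unfold Rdiv in Hz. rewrite !Rmult_0_l, Rplus_0_r in Hz.
      apply Rmult_integral in Hz. lra. }
  subst c3 c4.
  destruct (Req_dec (c1 - c2) 0) as [H2|H2].
  2:{ apply (Hmono 2%nat); [lia|].
      apply gq_rolle_n1, n1_rolle_n2; try lra.
      apply atmost0. intros v [Hv Hz]. unfold n2 in Hz. unfold Rdiv in Hz. lra. }
  destruct (Req_dec (c1 + c2) 0) as [H1|H1].
  2:{ apply (Hmono 1%nat); [lia|].
      apply gq_rolle_n1; try lra.
      apply atmost0. intros v [Hv Hz]. unfold n1, Rdiv in Hz. nra. }
  apply (Hmono 0%nat); [lia|].
  apply atmost0. intros t [Ht Hz]. apply Hnz. unfold gq, Rdiv in Hz.
  assert (c1 = 0) by lra. assert (c2 = 0) by lra. subst c1 c2.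
  repeat split; auto. lra.
Qed.

(** Two roots x and y beyond 1 would give the value A (x - 1) (y - 1) at the point 1, which has the
    sign of A. *)
Lemma quad_atmost1 (A B C : R) : A * (A + B + C) < 0 ->
  atmost 1 (fun w => 1 < w /\ A * w ^ 2 + B * w + C = 0).
Proof.
  intros H. apply atmost1. intros x y [Hx Zx] [Hy Zy] Hxy.
  assert (A * (x + y) + B = 0) as E.
  { apply Rmult_eq_reg_l with (y - x); [|lra].
    replace ((y - x) * (A * (x + y) + B)) with (A * y ^ 2 + B * y + C - (A * x ^ 2 + B * x + C)) by ring.
    lra. }
  assert (C = A * x * y) as EC by nra.
  assert (A + B + C = A * ((x - 1) * (y - 1))) as EQ by (rewrite EC; nra).
  rewrite EQ in H. assert (0 < (x - 1) * (y - 1)) by (apply Rmult_lt_0_compat; lra).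
  nra.
Qed.

(** The point w = 1 corresponds to v = 0. Compared with the leading coefficient - (4 - d) (d - 1) (3
    d + 2), this value explains the thresholds 1, 2 and 4: the signs are opposite exactly for 1 < d
    < 2 and for d > 4. *)
Lemma Qq_1 (d : R) : Qq d 1 = (2 - d) * (d + 1) * (2 * d + 1) * (5 * d + 4).
Proof. unfold Qq. ring. Qed.

Lemma Qq_atmost1 (d : R) : 1 < d < 2 \/ 4 < d ->
  atmost 1 (fun v => 0 < v /\ Qq d (1 + (1 + d) * v) = 0).
Proof.
  intros Hd.
  generalize (quad_atmost1 (- (4 - d) * (d - 1) * (3 * d + 2))
    (- 2 * d * (d ^ 3 + 17 * d ^ 2 - 7 * d - 14)) (- 4 * d ^ 2 * (2 * d ^ 2 - 7 * d - 7))).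
  intros H. refine (atmost_map (fun v => 1 + (1 + d) * v) _ _ _ _ _ (H _)).
  - intros x y _ _ Hxy. nra.
  - intros x [Hx Hz]. split; [nra|]. rewrite <- Hz. unfold Qq. ring.
  - replace (- (4 - d) * (d - 1) * (3 * d + 2) + - 2 * d * (d ^ 3 + 17 * d ^ 2 - 7 * d - 14)
      + - 4 * d ^ 2 * (2 * d ^ 2 - 7 * d - 7)) with (Qq d 1) by (unfold Qq; ring).
    rewrite Qq_1.
    replace (- (4 - d) * (d - 1) * (3 * d + 2) * ((2 - d) * (d + 1) * (2 * d + 1) * (5 * d + 4)))
      with (- ((4 - d) * (2 - d) * ((d - 1) * ((3 * d + 2) * ((d + 1) * ((2 * d + 1) * (5 * d + 4))))))) by ring.
    apply Ropp_lt_gt_0_contravar.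
    apply Rmult_lt_0_compat; [nra|]. repeat apply Rmult_lt_0_compat; lra.
Qed.

(** For d <= 1 no coefficient of [Qq] is negative and two are positive. For 2 <= d <= 4 the value at
    w = 1 is not positive, and expanding around w = 1 shows that [Qq] decreases strictly from
    there. *)
Lemma Qq_none (d : R) : 0 < d <= 1 \/ 2 <= d <= 4 ->
  atmost 0 (fun v => 0 < v /\ Qq d (1 + (1 + d) * v) = 0).
Proof.
  intros Hd. apply atmost0. intros v [Hv Hz].
  set (w := 1 + (1 + d) * v) in *. assert (1 < w) as Hw by (unfold w; nra). clearbody w.
  unfold Qq in Hz. destruct Hd as [Hd|Hd].
  - assert (0 <= (4 - d) * (1 - d) * (3 * d + 2) * w ^ 2)
      by (repeat apply Rmult_le_pos; try lra; apply pow2_ge_0).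
    assert (0 < d * (14 + 7 * d - 17 * d ^ 2 - d ^ 3) * w)
      by (repeat apply Rmult_lt_0_compat; nra).
    assert (0 < d ^ 2 * (7 + 7 * d - 2 * d ^ 2)) by (apply Rmult_lt_0_compat; nra).
    nra.
  - assert (E := Qq_1 d). unfold Qq in E.
    assert (0 <= (4 - d) * (d - 1) * (3 * d + 2) * (w ^ 2 - 1))
      by (repeat apply Rmult_le_pos; try lra; nra).
    assert (0 < d * (d ^ 3 + 17 * d ^ 2 - 7 * d - 14) * (w - 1)).
    { apply Rmult_lt_0_compat; [|lra]. apply Rmult_lt_0_compat; [lra|].
      assert (0 < d ^ 3) by (apply pow_lt; lra). nra. }
    assert (0 <= (d - 2) * (d + 1) * (2 * d + 1) * (5 * d + 4)) by (repeat apply Rmult_le_pos; lra).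
    nra.
Qed.

(* For d > 4 the chain starting with n1 breaks down since (4 - d) w + 6 d changes sign. Instead gq is
   multiplied by (1 + v)(1 + (1+d) v)/t: two differentiations then kill c2 and c3, a third one c4. *)
Definition f0 (d c0 c1 c2 c3 c4 t : R) : R :=
  (c0 + c1 * atan t) * (/ t + (2 + d) * t + (1 + d) * t ^ 3)
  + c2 * (1 + (1 + d) * t ^ 2) + c3 * (1 + t ^ 2) + c4 * pw (- (2 / d)) t.

Definition f1 (d c0 c1 c2 c3 c4 t : R) : R :=
  (c0 + c1 * atan t) * (- / t ^ 3 + (2 + d) / t + 3 * (1 + d) * t)
  + c1 * (1 + (1 + d) * t ^ 2) / t ^ 2 + 2 * (1 + d) * c2 + 2 * c3
  - 2 / d * c4 * pw (- (2 / d)) t / t ^ 2.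

Definition f2 (d c0 c1 c4 t : R) : R :=
  pw (2 / d) t * ((c0 + c1 * atan t) * (3 / t - (2 + d) * t + 3 * (1 + d) * t ^ 3)
    + c1 * (- 2 + (- 1 + (2 + d) * t ^ 2 + 3 * (1 + d) * t ^ 4) / (1 + t ^ 2)))
  + 2 / d * (2 / d + 2) * c4.

Definition ad (d v : R) : R :=
  3 * (2 - d) - (d + 2) ^ 2 * v + 3 * (d + 1) * (3 * d + 2) * v ^ 2.

Definition Rd (d v : R) : R :=
  3 * (d - 2) + (d ^ 2 + 9 * d - 6) * v + (14 * d ^ 2 + 21 * d + 6) * v ^ 2
  + 3 * (d + 1) * (3 * d + 2) * v ^ 3.

Definition f3 (d c0 c1 t : R) : R :=
  (c0 + c1 * atan t) * ad d (t ^ 2) + c1 * (t * Rd d (t ^ 2) / (1 + t ^ 2) ^ 2).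

Lemma pw_mul (a t : R) : pw a t * pw (- a) t = 1.
Proof. unfold pw. rewrite <- exp_plus, <- exp_0. f_equal. ring. Qed.

Lemma f0_gq (d c0 c1 c2 c3 c4 t : R) : 0 < d -> 0 < t ->
  f0 d c0 c1 c2 c3 c4 t = gq d c0 c1 c2 c3 c4 t * ((1 + t ^ 2) * (1 + (1 + d) * t ^ 2) / t).
Proof.
  intros Hd Ht. unfold f0, gq. assert (0 < t ^ 2) by (apply pow_lt; lra).
  assert (0 < (1 + d) * t ^ 2) by (apply Rmult_lt_0_compat; lra).
  field. repeat split; lra.
Qed.

Lemma is_derive_f0 (d c0 c1 c2 c3 c4 t : R) : 0 < d -> 0 < t ->
  is_derive (f0 d c0 c1 c2 c3 c4) t (t * f1 d c0 c1 c2 c3 c4 t).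
Proof.
  intros Hd Ht. unfold f0, f1, pw. assert (0 < t ^ 2) by (apply pow_lt; lra).
  auto_derive.
  - repeat split; lra.
  - field. repeat split; lra.
Qed.

Lemma is_derive_f1 (d c0 c1 c2 c3 c4 t : R) : 0 < d -> 0 < t ->
  is_derive (f1 d c0 c1 c2 c3 c4) t (pw (- (2 / d)) t / t ^ 3 * f2 d c0 c1 c4 t).
Proof.
  intros Hd Ht. unfold f2.
  rewrite Rmult_plus_distr_l.
  (* The factor [pw (2 / d) t] in [f2] serves to make its c4 term constant; here it cancels against
     [pw (- (2 / d)) t], so that only a rational identity is left after differentiation. *)
  replace (pw (- (2 / d)) t / t ^ 3 * (pw (2 / d) t *
    ((c0 + c1 * atan t) * (3 / t - (2 + d) * t + 3 * (1 + d) * t ^ 3) +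
     c1 * (-2 + (-1 + (2 + d) * t ^ 2 + 3 * (1 + d) * t ^ 4) / (1 + t ^ 2)))))
    with ((pw (2 / d) t * pw (- (2 / d)) t) / t ^ 3 *
    ((c0 + c1 * atan t) * (3 / t - (2 + d) * t + 3 * (1 + d) * t ^ 3) +
     c1 * (-2 + (-1 + (2 + d) * t ^ 2 + 3 * (1 + d) * t ^ 4) / (1 + t ^ 2)))) by (unfold Rdiv; ring).
  rewrite pw_mul. unfold f1, pw. assert (0 < t ^ 2) by (apply pow_lt; lra).
  auto_derive.
  - repeat split; try lra; try (apply (pow_nonzero _ 2); lra); try (apply (pow_nonzero _ 3); lra).
  - field. repeat split; lra.
Qed.

Lemma is_derive_f2 (d c0 c1 c4 t : R) : 0 < d -> 0 < t ->
  is_derive (f2 d c0 c1 c4) t (pw (2 / d) t / (d * t ^ 2) * f3 d c0 c1 t).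
Proof.
  intros Hd Ht. unfold f2, f3, ad, Rd, pw. assert (0 < t ^ 2) by (apply pow_lt; lra).
  auto_derive.
  - repeat split; lra.
  - field. repeat split; lra.
Qed.

Lemma gq_atmost_f3 (N : nat) (d c0 c1 c2 c3 c4 : R) : 0 < d ->
  atmost N (fun t => 0 < t /\ f3 d c0 c1 t = 0) ->
  atmost (S (S (S N))) (fun t => 0 < t /\ gq d c0 c1 c2 c3 c4 t = 0).
Proof.
  intros Hd H.
  apply (atmost_mono (S (S (S N))) _ (fun t => 0 < t /\ f0 d c0 c1 c2 c3 c4 t = 0)).
  - lia.
  - intros t [Ht Hz]. split; auto. rewrite f0_gq, Hz by assumption. ring.
  - eapply atmost_rolle; [apply convex_pos| |].
    { intros t Ht. apply is_derive_f0; assumption. }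
    apply (atmost_mono (S (S N)) _ (fun t => 0 < t /\ f1 d c0 c1 c2 c3 c4 t = 0)); [lia| |].
    { intros t [Ht Hz]. split; auto. apply Rmult_integral in Hz. lra. }
    eapply atmost_rolle; [apply convex_pos| |].
    { intros t Ht. apply is_derive_f1; assumption. }
    apply (atmost_mono (S N) _ (fun t => 0 < t /\ f2 d c0 c1 c4 t = 0)); [lia| |].
    { intros t [Ht Hz]. split; auto. apply Rmult_integral in Hz. destruct Hz as [Hz|Hz]; auto.
      apply Rmult_integral in Hz. generalize (pw_pos (- (2 / d)) t). destruct Hz as [Hz|Hz]; [lra|].
      exfalso; revert Hz. apply Rinv_neq_0_compat, pow_nonzero; lra. }
    eapply atmost_rolle; [apply convex_pos| |].
    { intros t Ht. apply is_derive_f2; assumption. }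
    revert H; apply atmost_mono; [lia|].
    intros t [Ht Hz]. split; auto. apply Rmult_integral in Hz. destruct Hz as [Hz|Hz]; auto.
    apply Rmult_integral in Hz. generalize (pw_pos (2 / d) t). destruct Hz as [Hz|Hz]; [lra|].
    exfalso; revert Hz. apply Rinv_neq_0_compat.
    apply Rmult_integral_contrapositive_currified; [lra|]. apply pow_nonzero; lra.
Qed.

(* Zeros of f3 d c0 c1 are level points of chi, away from the zeros of ad. *)
Definition chi (d t : R) : R := atan t + t * Rd d (t ^ 2) / ((1 + t ^ 2) ^ 2 * ad d (t ^ 2)).

(** The quadratic [Qq] of the first chain reappears, so a single root count serves both chains. *)
Lemma is_derive_chi (d t : R) : 0 < d -> ad d (t ^ 2) <> 0 ->
  is_derive (chi d) t (32 * t ^ 4 * Qq d (1 + (1 + d) * t ^ 2)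
    / ((1 + d) * (1 + t ^ 2) ^ 3 * ad d (t ^ 2) ^ 2)).
Proof.
  intros Hd Ha. unfold chi, Qq. assert (0 <= t ^ 2) by apply pow2_ge_0.
  unfold Rd, ad in *. auto_derive.
  - repeat split; auto.
    apply Rmult_integral_contrapositive_currified; [|exact Ha].
    apply (pow_nonzero _ 2); nra.
  - field. repeat split; lra.
Qed.

Lemma f3_chi (d c0 c1 t : R) : ad d (t ^ 2) <> 0 ->
  f3 d c0 c1 t = ad d (t ^ 2) * (c0 + c1 * chi d t).
Proof.
  intros Ha. unfold f3, chi. assert (0 <= t ^ 2) by apply pow2_ge_0.
  field. split; [exact Ha|lra].
Qed.

Lemma Rd_pos (d v : R) : 2 < d -> 0 <= v -> 0 < Rd d v.
Proof.
  intros Hd Hv. unfold Rd.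
  assert (0 <= (d ^ 2 + 9 * d - 6) * v) by (apply Rmult_le_pos; nra).
  assert (0 <= (14 * d ^ 2 + 21 * d + 6) * v ^ 2) by (apply Rmult_le_pos; [nra|apply pow2_ge_0]).
  assert (0 <= 3 * (d + 1) * (3 * d + 2) * v ^ 3)
    by (repeat apply Rmult_le_pos; try lra; apply pow_le; lra).
  lra.
Qed.

(** For d > 2 the quadratic [ad d] is negative at 0 and has a positive leading coefficient, hence
    changes sign exactly once on v >= 0. This lemma and the next two are the forms in which that
    fact is used. *)
Lemma ad_neg_down (d u v : R) : 2 < d -> 0 <= v <= u -> ad d u < 0 -> ad d v < 0.
Proof.
  intros Hd Hv. unfold ad. intros H.
  set (A := (d + 2) ^ 2) in *. set (B := 3 * (d + 1) * (3 * d + 2)) in *.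
  assert (0 < B) by (unfold B; nra).
  destruct (Rle_lt_dec (- A + B * v) 0) as [H1|H1].
  - assert (v * (- A + B * v) <= 0) by nra. nra.
  - assert (v * (- A + B * v) <= u * (- A + B * u)) by (apply Rmult_le_compat; nra). nra.
Qed.

Lemma ad_pos_up (d u v : R) : 2 < d -> 0 <= v <= u -> 0 < ad d v -> 0 < ad d u.
Proof.
  intros Hd Hv. unfold ad. intros H.
  set (A := (d + 2) ^ 2) in *. set (B := 3 * (d + 1) * (3 * d + 2)) in *.
  assert (0 < B) by (unfold B; nra).
  assert (0 < v * (- A + B * v)) by nra.
  assert (0 < - A + B * v) by nra.
  assert (v * (- A + B * v) <= u * (- A + B * u)) by (apply Rmult_le_compat; nra). nra.
Qed.

Lemma ad_root (d u v : R) : 2 < d -> 0 <= v < u -> ad d v = 0 -> 0 < ad d u.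
Proof.
  intros Hd Hv. unfold ad. intros H.
  set (A := (d + 2) ^ 2) in *. set (B := 3 * (d + 1) * (3 * d + 2)) in *.
  assert (0 < B) by (unfold B; nra).
  assert (0 < v * (- A + B * v)) by nra.
  assert (0 < - A + B * v) by nra.
  assert (v * (- A + B * v) < u * (- A + B * u)) by (apply Rmult_le_0_lt_compat; nra). nra.
Qed.

(** [Qq] equals a positive multiple of [ad], with multiplier fitted to the v^2 coefficient, minus a
    positive constant and a nonnegative multiple of v. *)
Lemma Qq_ad (d v : R) : 4 < d -> 0 <= v -> ad d v < 0 -> Qq d (1 + (1 + d) * v) < 0.
Proof.
  intros Hd Hv Ha.
  replace (Qq d (1 + (1 + d) * v)) with
    ((d - 4) * (d - 1) * (d + 1) / 3 * ad d v - (d - 2) * (d + 1) * (9 * d ^ 2 + 18 * d)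
     - (d + 1) / 3 * (5 * d ^ 4 + 85 * d ^ 3 + 48 * d ^ 2 - 92 * d - 64) * v)
    by (unfold Qq, ad; field).
  assert (0 < (d - 4) * (d - 1) * (d + 1) / 3 * - ad d v)
    by (repeat apply Rmult_lt_0_compat; lra).
  assert (0 < (d - 2) * (d + 1) * (9 * d ^ 2 + 18 * d)) by (repeat apply Rmult_lt_0_compat; nra).
  assert (0 <= (d + 1) / 3 * (5 * d ^ 4 + 85 * d ^ 3 + 48 * d ^ 2 - 92 * d - 64) * v).
  { repeat apply Rmult_le_pos; try lra.
    assert (0 < d ^ 4) by (apply pow_lt; lra). assert (0 < d ^ 3) by (apply pow_lt; lra). nra. }
  lra.
Qed.

(** [chi] starts at 0 and decreases as long as [ad] is negative, because [Qq] is negative there. *)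
Lemma chi_neg (d t : R) : 4 < d -> 0 < t -> ad d (t ^ 2) < 0 -> chi d t < 0.
Proof.
  intros Hd Ht Ha.
  destruct (MVT_cor2 (chi d) (fun t => 32 * t ^ 4 * Qq d (1 + (1 + d) * t ^ 2)
    / ((1 + d) * (1 + t ^ 2) ^ 3 * ad d (t ^ 2) ^ 2)) 0 t Ht) as (c & Hc & H0ct).
  - intros c Hc. apply is_derive_Reals, is_derive_chi; [lra|].
    apply Rlt_not_eq. apply (ad_neg_down d (t ^ 2)); [lra| |exact Ha]. nra.
  - assert (Ac : ad d (c ^ 2) < 0) by (apply (ad_neg_down d (t ^ 2)); [lra| |exact Ha]; nra).
    assert (chi d 0 = 0) as E0.
    { unfold chi. rewrite atan_0. unfold Rdiv. ring. }
    rewrite E0, !Rminus_0_r in Hc. rewrite Hc.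
    assert (Qq d (1 + (1 + d) * c ^ 2) < 0) by (apply Qq_ad; [lra|apply pow2_ge_0|exact Ac]).
    assert (HX : 0 < 32 * c ^ 4 / ((1 + d) * (1 + c ^ 2) ^ 3 * ad d (c ^ 2) ^ 2)).
    { apply Rdiv_lt_0_compat.
      - apply Rmult_lt_0_compat; [lra|apply pow_lt; lra].
      - assert (0 <= c ^ 2) by apply pow2_ge_0.
        apply Rmult_lt_0_compat; [|apply pow2_gt_0; lra].
        apply Rmult_lt_0_compat; [lra|apply pow_lt; lra]. }
    set (X := 32 * c ^ 4 / _) in HX. set (Y := Qq d _) in *.
    match goal with |- ?u < 0 => replace u with (X * Y * t) by (unfold X, Rdiv; ring) end.
    clearbody X Y. assert (0 < X * - Y * t) by (repeat apply Rmult_lt_0_compat; lra). lra.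
Qed.

Lemma chi_pos (d t : R) : 2 < d -> 0 < t -> 0 < ad d (t ^ 2) -> 0 < chi d t.
Proof.
  intros Hd Ht Ha. unfold chi.
  assert (0 < atan t) by (rewrite <- atan_0; apply atan_increasing; lra).
  assert (0 <= t ^ 2) by apply pow2_ge_0.
  assert (0 < t * Rd d (t ^ 2) / ((1 + t ^ 2) ^ 2 * ad d (t ^ 2))).
  { apply Rdiv_lt_0_compat; apply Rmult_lt_0_compat; try lra.
    - apply Rd_pos; lra.
    - apply pow_lt; lra. }
  lra.
Qed.

Lemma dchi_zero (d t : R) : 0 < d -> 0 < t -> ad d (t ^ 2) <> 0 ->
  32 * t ^ 4 * Qq d (1 + (1 + d) * t ^ 2) / ((1 + d) * (1 + t ^ 2) ^ 3 * ad d (t ^ 2) ^ 2) = 0 ->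
  Qq d (1 + (1 + d) * t ^ 2) = 0.
Proof.
  intros Hd Ht Ha Hz. assert (0 <= t ^ 2) by apply pow2_ge_0.
  apply Rmult_integral in Hz. destruct Hz as [Hz|Hz].
  - apply Rmult_integral in Hz. destruct Hz as [Hz|Hz]; auto.
    exfalso. apply Rmult_integral in Hz. destruct Hz as [Hz|Hz]; [lra|].
    revert Hz. apply pow_nonzero; lra.
  - exfalso. revert Hz. apply Rinv_neq_0_compat.
    repeat apply Rmult_integral_contrapositive_currified; try lra; apply pow_nonzero; auto; lra.
Qed.

(** [chi] and [ad] have the same sign, so the sign of c0 / c1 confines the level set chi = - c0 / c1
    to one side of the root of [ad]. Where [ad] is negative, [chi] is strictly monotone and one
    solution is possible; where [ad] is positive, the derivative of [chi] vanishes at most once and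
    two are possible. *)
Lemma f3_atmost (d c0 c1 : R) : 4 < d -> (c0 <> 0 \/ c1 <> 0) ->
  atmost 2 (fun t => 0 < t /\ f3 d c0 c1 t = 0).
Proof.
  intros Hd Hc.
  destruct (Req_dec c1 0) as [H1|H1].
  { apply atmost_mono with 1%nat (fun t => 0 < t /\ ad d (t ^ 2) = 0); [lia| |].
    - intros t [Ht Hz]. split; auto. unfold f3 in Hz. subst c1.
      rewrite !Rmult_0_l, !Rplus_0_r in Hz. apply Rmult_integral in Hz. intuition.
    - apply atmost1. intros x y [Hx Zx] [Hy Zy] Hxy.
      assert (0 < ad d (y ^ 2)) by (apply (ad_root d (y ^ 2) (x ^ 2)); auto; nra). lra. }
  assert (Ha : forall t, 0 < t -> f3 d c0 c1 t = 0 -> ad d (t ^ 2) <> 0 /\ c0 / c1 + chi d t = 0).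
  { intros t Ht Hz. assert (ad d (t ^ 2) <> 0) as Hne.
    { intro E. unfold f3 in Hz. rewrite E, Rmult_0_r, Rplus_0_l in Hz.
      assert (0 <= t ^ 2) by apply pow2_ge_0.
      assert (0 < t * Rd d (t ^ 2) / (1 + t ^ 2) ^ 2).
      { apply Rdiv_lt_0_compat; [apply Rmult_lt_0_compat; [lra|apply Rd_pos; lra]|apply pow_lt; lra]. }
      apply Rmult_integral in Hz. lra. }
    split; auto. rewrite f3_chi in Hz by exact Hne.
    apply Rmult_integral in Hz. destruct Hz as [Hz|Hz]; [tauto|].
    replace (c0 / c1 + chi d t) with ((c0 + c1 * chi d t) / c1) by (field; auto).
    rewrite Hz. unfold Rdiv. ring. }
  assert (Hder : forall t, ad d (t ^ 2) <> 0 -> is_derive (fun t => c0 / c1 + chi d t) t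
    (32 * t ^ 4 * Qq d (1 + (1 + d) * t ^ 2) / ((1 + d) * (1 + t ^ 2) ^ 3 * ad d (t ^ 2) ^ 2))).
  { intros t Ht. evar_last.
    - apply (is_derive_plus (fun _ => c0 / c1) (chi d)); [apply is_derive_const|].
      apply is_derive_chi; [lra|exact Ht].
    - apply Rplus_0_l. }
  destruct (Rlt_le_dec 0 (c0 / c1)) as [Hm|Hm].
  - apply atmost_mono with 1%nat (fun t => (0 < t /\ ad d (t ^ 2) < 0) /\ c0 / c1 + chi d t = 0); [lia| |].
    + intros t [Ht Hz]. destruct (Ha t Ht Hz) as [H2 H3]. repeat split; auto.
      destruct (Rlt_le_dec (ad d (t ^ 2)) 0) as [H4|H4]; auto.
      assert (0 < chi d t) by (apply chi_pos; lra). lra.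
    + eapply atmost_rolle.
      * intros x y z [Hx _] [Hz Az] Hy. split; [lra|].
        apply (ad_neg_down d (z ^ 2)); auto; nra.
      * intros t [Ht At]. apply Hder. lra.
      * apply atmost0. intros t [[Ht At] Hz]. apply dchi_zero in Hz; try lra.
        assert (Qq d (1 + (1 + d) * t ^ 2) < 0) by (apply Qq_ad; auto; try lra; apply pow2_ge_0).
        lra.
  - apply atmost_mono with 2%nat (fun t => (0 < t /\ 0 < ad d (t ^ 2)) /\ c0 / c1 + chi d t = 0); [lia| |].
    + intros t [Ht Hz]. destruct (Ha t Ht Hz) as [H2 H3]. repeat split; auto.
      destruct (Rlt_le_dec 0 (ad d (t ^ 2))) as [H4|H4]; auto.
      assert (chi d t < 0) by (apply chi_neg; lra). lra.
    + eapply atmost_rolle.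
      * intros x y z [Hx Ax] _ Hy. split; [lra|].
        apply (ad_pos_up d _ (x ^ 2)); auto; try lra; nra.
      * intros t [Ht At]. apply Hder. lra.
      * generalize (Qq_atmost1 d (or_intror Hd)). apply atmost_map with (h := fun t => t ^ 2).
        -- intros x y [[Hx _] _] _ Hxy. nra.
        -- intros t [[Ht At] Hz]. apply dchi_zero in Hz; try lra.
           split; [apply pow_lt; lra|exact Hz].
Qed.

(** If c0 = c1 = 0, then [f3] vanishes identically and carries no information; in that case [f2] is
    a constant multiple of c4 and the chain ends earlier, with at most two zeros. *)
Lemma gq_atmost_large (d c0 c1 c2 c3 c4 : R) : 4 < d -> ~ allzero c0 c1 c2 c3 c4 ->
  atmost 5 (fun t => 0 < t /\ gq d c0 c1 c2 c3 c4 t = 0).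
Proof.
  intros Hd Hnz.
  destruct (Req_dec c0 0) as [H0|H0]; [|apply gq_atmost_f3; [lra|apply f3_atmost; auto]].
  destruct (Req_dec c1 0) as [H1|H1]; [|apply gq_atmost_f3; [lra|apply f3_atmost; auto]].
  subst c0 c1.
  apply (atmost_mono 2 5 (fun t => 0 < t /\ f0 d 0 0 c2 c3 c4 t = 0)); [lia| |].
  { intros t [Ht Hz]. split; auto. rewrite f0_gq, Hz by lra. ring. }
  assert (F0 : forall t, 0 < t -> is_derive (f0 d 0 0 c2 c3 c4) t (t * f1 d 0 0 c2 c3 c4 t))
    by (intros t Ht; apply is_derive_f0; lra).
  destruct (Req_dec c4 0) as [H4|H4].
  - subst c4.
    destruct (Req_dec ((1 + d) * c2 + c3) 0) as [H3|H3].
    + apply (atmost_mono 0 2 (fun t => 0 < t /\ f0 d 0 0 c2 c3 0 t = 0)); [lia|auto|].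
      apply atmost0. intros t [Ht Hz]. unfold f0 in Hz.
      assert (c3 = - (1 + d) * c2) as E by lra. rewrite E in Hz.
      assert (c2 * d = 0) as E2 by lra. apply Rmult_integral in E2.
      apply Hnz. assert (c2 = 0) by lra. subst c2. repeat split; auto. lra.
    + apply (atmost_mono 1 2 (fun t => 0 < t /\ f0 d 0 0 c2 c3 0 t = 0)); [lia|auto|].
      eapply atmost_rolle; [apply convex_pos|exact F0|].
      apply atmost0. intros t [Ht Hz]. apply Rmult_integral in Hz. destruct Hz as [Hz|Hz]; [lra|].
      unfold f1, Rdiv in Hz. lra.
  - eapply atmost_rolle; [apply convex_pos|exact F0|].
    apply (atmost_mono 1 1 (fun t => 0 < t /\ f1 d 0 0 c2 c3 c4 t = 0)); [lia| |].
    { intros t [Ht Hz]. split; auto. apply Rmult_integral in Hz. lra. }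
    eapply atmost_rolle; [apply convex_pos| |].
    { intros t Ht. apply is_derive_f1; lra. }
    apply atmost0. intros t [Ht Hz].
    apply Rmult_integral in Hz. destruct Hz as [Hz|Hz].
    + apply Rmult_integral in Hz. generalize (pw_pos (- (2 / d)) t). destruct Hz as [Hz|Hz]; [lra|].
      intros _. revert Hz. apply Rinv_neq_0_compat, pow_nonzero; lra.
    + unfold f2 in Hz. apply H4.
      assert (0 < 2 / d) by (apply Rdiv_lt_0_compat; lra).
      assert (0 < 2 / d * (2 / d + 2)) by (apply Rmult_lt_0_compat; lra).
      assert (2 / d * (2 / d + 2) * c4 = 0) as E by lra.
      apply Rmult_integral in E. lra.
Qed.

Definition five (d : R) : Prop := 1 < d < 2 \/ 4 < d.

Lemma gq_zeros_le (d c0 c1 c2 c3 c4 : R) : 0 < d -> ~ allzero c0 c1 c2 c3 c4 ->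
  atmost 5 (fun t => 0 < t /\ gq d c0 c1 c2 c3 c4 t = 0) /\
  (~ five d -> atmost 4 (fun t => 0 < t /\ gq d c0 c1 c2 c3 c4 t = 0)).
Proof.
  intros Hd Hnz.
  assert (A : ~ five d -> atmost 4 (fun t => 0 < t /\ gq d c0 c1 c2 c3 c4 t = 0)).
  { intros H. apply (gq_atmost_small 0); auto; unfold five in H; try lra.
    apply Qq_none. lra. }
  split; auto.
  destruct (Rlt_le_dec 4 d) as [H|H]; [now apply gq_atmost_large|].
  destruct (Rle_lt_dec d 1) as [H1|H1].
  { apply atmost_mono with 4%nat (fun t => 0 < t /\ gq d c0 c1 c2 c3 c4 t = 0); auto. apply A. unfold five; lra. }
  destruct (Rle_lt_dec 2 d) as [H2|H2].
  { apply atmost_mono with 4%nat (fun t => 0 < t /\ gq d c0 c1 c2 c3 c4 t = 0); auto. apply A. unfold five; lra. }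
  apply (gq_atmost_small 1); auto; try lra. apply Qq_atmost1. lra.
Qed.

(** * Sharpness of the bound *)

(* gq in the variable s = 1/t; the case m < n leads to hq directly, with s = t. *)
Definition hq (d e0 e1 e2 e3 e4 s : R) : R :=
  e0 + e1 * atan s + e2 * (s / (1 + s ^ 2)) + e3 * (s / (1 + d + s ^ 2))
  + e4 * (s ^ 3 * pw (2 / d) s / ((1 + s ^ 2) * (1 + d + s ^ 2))).

Lemma gq_hq (d c0 c1 c2 c3 c4 t : R) : 0 < d -> 0 < t ->
  gq d c0 c1 c2 c3 c4 t = hq d (c0 + c1 * (PI / 2)) (- c1) c2 c3 c4 (/ t).
Proof.
  intros Hd Ht. unfold gq, hq. rewrite atan_inv by assumption.
  assert (pw (2 / d) (/ t) = pw (- (2 / d)) t) as ->.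
  { unfold pw. rewrite ln_Rinv by assumption. f_equal. ring. }
  assert (0 < t ^ 2) by (apply pow_lt; lra).
  assert (0 < (1 + d) * t ^ 2) by (apply Rmult_lt_0_compat; lra).
  field. repeat split; lra.
Qed.

(** In contrast to [atmost], this form passes through any injective change of variable, such as the
    decreasing map s = 1/t. *)
Definition zeros_le (N : nat) (Z : R -> Prop) : Prop :=
  forall l, NoDup l -> (forall x, In x l -> Z x) -> (length l <= N)%nat.

Lemma zeros_le_map (h : R -> R) (N : nat) (Z Z' : R -> Prop) :
  (forall x y, Z' x -> Z' y -> h x = h y -> x = y) ->
  (forall x, Z' x -> Z (h x)) -> zeros_le N Z -> zeros_le N Z'.
Proof.
  intros Hh HZ H l Hn Hl. rewrite <- (length_map h l). apply H.
  - clear - Hh Hn Hl. induction l as [|x l IH]; simpl; constructor.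
    + inversion Hn; subst. intros Hi. apply in_map_iff in Hi. destruct Hi as (y & Hy & Hi).
      apply H1. rewrite <- (Hh y x); auto; apply Hl; simpl; auto.
    + inversion Hn; subst. apply IH; auto. intros y Hy. apply Hl. now right.
  - intros y Hy. apply in_map_iff in Hy. destruct Hy as (x & <- & Hx). auto.
Qed.

Lemma hq_zeros_le (d e0 e1 e2 e3 e4 : R) : 0 < d -> ~ allzero e0 e1 e2 e3 e4 ->
  zeros_le 5 (fun s => 0 < s /\ hq d e0 e1 e2 e3 e4 s = 0) /\
  (~ five d -> zeros_le 4 (fun s => 0 < s /\ hq d e0 e1 e2 e3 e4 s = 0)).
Proof.
  intros Hd Hnz.
  destruct (gq_zeros_le d (e0 + e1 * (PI / 2)) (- e1) e2 e3 e4 Hd) as [H1 H2].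
  { intros (E0 & E1 & E2). apply Hnz. assert (e1 = 0) by lra. subst e1.
    repeat split; tauto || lra. }
  assert (A : forall N, atmost N (fun t => 0 < t /\ gq d (e0 + e1 * (PI / 2)) (- e1) e2 e3 e4 t = 0) ->
    zeros_le N (fun s => 0 < s /\ hq d e0 e1 e2 e3 e4 s = 0)).
  { intros N H. apply (zeros_le_map Rinv N (fun t => 0 < t /\ gq d (e0 + e1 * (PI / 2)) (- e1) e2 e3 e4 t = 0)).
    - intros x y _ _ E. now apply Rinv_eq_reg.
    - intros s [Hs Hz]. assert (0 < / s) by (apply Rinv_0_lt_compat; assumption).
      split; auto. rewrite gq_hq by assumption. rewrite Rinv_inv, <- Hz. f_equal; ring.
    - intros l Hn Hl. now apply atmost_NoDup with (fun t => 0 < t /\ gq d (e0 + e1 * (PI / 2)) (- e1) e2 e3 e4 t = 0). }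
  split; auto.
Qed.

Definition dhq (d e1 e2 e3 e4 s : R) : R :=
  e1 / (1 + s ^ 2) + e2 * ((1 - s ^ 2) / (1 + s ^ 2) ^ 2)
  + e3 * ((1 + d - s ^ 2) / (1 + d + s ^ 2) ^ 2)
  + e4 * (pw (2 / d) s * s ^ 2 * ((3 + 2 / d) * (1 + s ^ 2) * (1 + d + s ^ 2)
     - 2 * s ^ 2 * (1 + d + s ^ 2) - 2 * s ^ 2 * (1 + s ^ 2)) / ((1 + s ^ 2) * (1 + d + s ^ 2)) ^ 2).

Lemma is_derive_hq (d e0 e1 e2 e3 e4 s : R) : 0 < d -> 0 < s ->
  is_derive (hq d e0 e1 e2 e3 e4) s (dhq d e1 e2 e3 e4 s).
Proof.
  intros Hd Hs. assert (0 < s ^ 2) by (apply pow_lt; lra).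
  unfold hq, dhq, pw. auto_derive.
  - repeat split; try lra. apply Rgt_not_eq, Rmult_lt_0_compat; lra.
  - field. repeat split; lra.
Qed.

(* f has the sign of s at x and alternates along x :: l. *)
Fixpoint alt (f : R -> R) (s x : R) (l : list R) : Prop :=
  0 < s * f x /\
  match l with
  | [] => True
  | y :: l' => x < y /\ alt f (- s) y l'
  end.

(** Intermediate values between consecutive alternation points. The additional conclusion that every
    zero has a point of l to its right is what [alt_insert] asks for. *)
Lemma alt_zeros (f : R -> R) (l : list R) : forall s x,
  (forall y, x <= y -> continuity_pt f y) -> alt f s x l ->
  exists zs, length zs = length l /\ chain x zs /\ List.Forall (fun z => f z = 0 /\ exists y, In y l /\ z < y) zs.
Proof.
  induction l as [|y l IH]; intros s x Hf [Hx H].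
  - exists []. simpl. auto.
  - destruct H as [Hxy Ha].
    assert (exists z, x <= z <= y /\ f z = 0) as (z & Hz & Zz).
    { assert (Hy : 0 < - s * f y) by (destruct l; apply Ha).
      destruct (Rlt_le_dec 0 s) as [Hs|Hs].
      - destruct (IVT_interv (fun t => - f t) x y) as [z Hz].
        + intros t Ht. apply continuity_pt_opp, Hf; lra.
        + exact Hxy.
        + nra.
        + nra.
        + exists z. split; [tauto|]. lra.
      - destruct (IVT_interv f x y) as [z Hz].
        + intros t Ht. apply Hf; lra.
        + exact Hxy.
        + nra.
        + nra.
        + exists z. tauto. }
    destruct (IH (- s) y) as (zs & H1 & H2 & H3); auto.
    { intros t Ht. apply Hf. lra. }
    assert (Hy : 0 < - s * f y) by (destruct l; apply Ha).
    assert (z <> x) by (intro; subst; rewrite Zz in Hx; lra).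
    assert (z <> y) by (intro; subst; rewrite Zz in Hy; lra).
    exists (z :: zs). simpl. split; [now rewrite H1|]. split.
    2:{ constructor.
        - split; auto. exists y. split; [now left|lra].
        - revert H3. apply Forall_impl. intros w [Zw (u & Hu & Hwu)]. split; auto.
          exists u. split; auto. }
    split; [lra|]. destruct zs as [|w zs]; simpl in *; auto. destruct H2. split; auto. lra.
Qed.

Lemma alt_ext (f g : R -> R) (l : list R) : forall s x,
  (forall y, In y (x :: l) -> 0 < f y * g y) -> alt f s x l -> alt g s x l.
Proof.
  induction l as [|y l IH]; intros s x Hg [Hx Ha]; simpl.
  - split; auto. assert (0 < f x * g x) by (apply Hg; now left). nra.
  - destruct Ha as [Hxy Ha]. repeat split; auto.
    + assert (0 < f x * g x) by (apply Hg; now left). nra.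
    + apply IH; auto. intros z Hz. apply Hg. now right.
Qed.

Lemma derive_sign (g : R -> R) (z dg s : R) : is_derive g z dg -> g z = 0 -> 0 < s * dg ->
  forall e, 0 < e -> exists h, 0 < h < e /\ 0 < s * g (z + h) /\ s * g (z - h) < 0.
Proof.
  intros Hd Hz Hs e He.
  assert (0 < Rabs dg) as Hp by (apply Rabs_pos_lt; intro E; rewrite E in Hs; lra).
  apply is_derive_Reals in Hd. destruct (Hd (Rabs dg / 2)) as [del Hdel]; [lra|].
  set (h := Rmin (del / 2) (e / 2)).
  assert (0 < del) by apply cond_pos.
  assert (0 < h < e /\ h < del) as [Hh1 Hh2].
  { unfold h. generalize (Rmin_l (del / 2) (e / 2)), (Rmin_r (del / 2) (e / 2)).
    split; [split|]; try lra. apply Rmin_glb_lt; lra. }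
  exists h. split; auto.
  assert (A := Hdel h ltac:(lra)). assert (B := Hdel (- h) ltac:(lra)).
  rewrite Rabs_right in A by lra. rewrite Rabs_Ropp, Rabs_right in B by lra.
  specialize (A Hh2). specialize (B Hh2).
  rewrite Hz, Rminus_0_r in A, B.
  set (u := g (z + h)) in *. replace (z + - h) with (z - h) in B by ring. set (w := g (z - h)) in *.
  assert (u = u / h * h) as Eu by (field; lra).
  assert (w = - (w / - h * h)) as Ew by (field; lra).
  set (p := u / h) in *. set (q := w / - h) in *. clearbody p q u w.
  rewrite Eu, Ew.
  assert (0 < s * p /\ 0 < s * q) as [Hp1 Hq1].
  { apply Rabs_def2 in A. apply Rabs_def2 in B.
    destruct (Rlt_le_dec 0 dg) as [D|D].
    - rewrite Rabs_right in A, B by lra. assert (0 < s) by nra. split; nra.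
    - rewrite Rabs_left1 in A, B by lra. assert (s < 0) by nra. split; nra. }
  split; nra.
Qed.

(** Between two points where the sign changes from s to - s, a function g that keeps these signs but
    crosses zero at z in the opposite direction has two further sign changes, at z - h and z + h.
    The number s' carries the sign of f at the alternation point just before z. *)
Lemma alt_insert (f : R -> R) (z : R) (l : list R) : forall s x,
  alt f s x l -> f z = 0 -> x < z -> (exists y, In y l /\ z < y) ->
  exists s', s' <> 0 /\ forall g dg, (forall y, In y (x :: l) -> 0 < f y * g y) ->
    g z = 0 -> is_derive g z dg -> 0 < s' * dg ->
    exists l', length l' = S (S (length l)) /\ alt g s x l'.
Proof.
  induction l as [|y l IH]; intros s x Ha Hz Hxz [w [Hw Hzw]]; [destruct Hw|].
  assert (Ha' := Ha). destruct Ha' as [Hx [Hxy Hy]].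
  assert (Hyy : 0 < - s * f y) by (destruct l; apply Hy).
  assert (z <> y) as Hzy by (intro; subst; rewrite Hz in Hyy; lra).
  destruct (Rlt_le_dec z y) as [H|H].
  - exists s. split; [intro; subst; lra|].
    intros g dg Hg Hgz Hd Hs.
    destruct (derive_sign g z dg s Hd Hgz Hs (Rmin (z - x) (y - z))) as (h & Hh & H1 & H2).
    { apply Rmin_glb_lt; lra. }
    assert (h < z - x) by (apply Rlt_le_trans with (2 := Rmin_l (z - x) (y - z)); lra).
    assert (h < y - z) by (apply Rlt_le_trans with (2 := Rmin_r (z - x) (y - z)); lra).
    apply (alt_ext f g) in Ha; auto. destruct Ha as [Gx [_ Gy]].
    exists (z - h :: z + h :: y :: l). split; [reflexivity|].
    simpl. rewrite Ropp_involutive. repeat split; try lra. exact Gy.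
  - destruct (IH (- s) y) as (s' & Hs' & Hg'); auto; try lra.
    { exists w. split; auto. destruct Hw; auto. subst. lra. }
    exists s'. split; auto. intros g dg Hg Hgz Hd Hs.
    destruct (Hg' g dg) as (l' & H1 & H2); auto.
    { intros u Hu. apply Hg. now right. }
    exists (y :: l'). simpl. split; [now rewrite H1|].
    assert (0 < f x * g x) by (apply Hg; now left). repeat split; auto. nra.
Qed.

Lemma small_perturb (f u : R -> R) (l : list R) : (forall y, In y l -> f y <> 0) ->
  exists e, 0 < e /\ forall d, Rabs d < e -> forall y, In y l -> 0 < f y * (f y + d * u y).
Proof.
  induction l as [|x l IH]; intros H.
  - exists 1. split; [lra|]. intros d _ y [].
  - destruct IH as (e & He & H1); [intros y Hy; apply H; now right|].
    assert (f x <> 0) as Hx by (apply H; now left).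
    assert (0 < Rabs (f x)) by now apply Rabs_pos_lt.
    assert (0 <= Rabs (u x)) by apply Rabs_pos.
    exists (Rmin e (Rabs (f x) / (Rabs (u x) + 1))). split.
    { apply Rmin_glb_lt; auto. apply Rdiv_lt_0_compat; lra. }
    intros d Hd y [<-|Hy].
    + assert (Rabs d < Rabs (f x) / (Rabs (u x) + 1)) as Hd' by (apply Rlt_le_trans with (1 := Hd), Rmin_r).
      apply Rlt_div_r in Hd'; [|lra].
      assert (Rabs (d * u x) < Rabs (f x)) by (rewrite Rabs_mult; generalize (Rabs_pos d); nra).
      destruct (Rlt_le_dec 0 (f x)).
      * rewrite (Rabs_right (f x)) in * by lra. apply Rabs_def2 in H3. nra.
      * rewrite (Rabs_left1 (f x)) in * by lra. apply Rabs_def2 in H3. nra.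
    + apply H1; auto. apply Rlt_le_trans with (1 := Hd), Rmin_l.
Qed.

Lemma alt_nonzero (f : R -> R) (l : list R) : forall s x,
  alt f s x l -> forall y, In y (x :: l) -> f y <> 0.
Proof.
  induction l as [|y l IH]; intros s x [Hx Ha] w [<-|Hw].
  - intro E; rewrite E in Hx; lra.
  - destruct Hw.
  - intro E; rewrite E in Hx; lra.
  - destruct Ha. now apply IH with (- s) y.
Qed.

Lemma chain_lt (l : list R) : forall x y, chain x l -> In y l -> x < y.
Proof.
  induction l as [|z l IH]; intros x y H [].
  - subst. apply H.
  - destruct H as [H1 H2]. generalize (IH z y H2 H0). lra.
Qed.

Lemma chain_NoDup (l : list R) : forall x, chain x l -> NoDup l.
Proof.
  induction l as [|z l IH]; intros x H; constructor.
  - intros Hi. destruct H as [_ H]. generalize (chain_lt l z z H Hi). lra.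
  - destruct H. now apply IH with z.
Qed.

Definition zero_bound (d : R) (N : nat) : Prop :=
  forall e0 e1 e2 e3 e4, ~ allzero e0 e1 e2 e3 e4 ->
    zeros_le N (fun s => 0 < s /\ hq d e0 e1 e2 e3 e4 s = 0).

(* Adding a small multiple of atan - atan z at a degenerate zero z would create two more zeros, exceeding
   the bound. *)
Lemma hq_simple (d e0 e1 e2 e3 e4 s x : R) (l : list R) : 0 < d -> 0 < x ->
  zero_bound d (length l) -> alt (hq d e0 e1 e2 e3 e4) s x l ->
  exists zs, NoDup zs /\ length zs = length l /\
    forall z, In z zs -> 0 < z /\ hq d e0 e1 e2 e3 e4 z = 0 /\ dhq d e1 e2 e3 e4 z <> 0.
Proof.
  intros Hd Hx Hcount Ha.
  assert (Hcont : forall e0 e1 y, x <= y -> continuity_pt (hq d e0 e1 e2 e3 e4) y).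
  { intros a0 a1 y Hy. apply derivable_continuous_pt. exists (dhq d a1 e2 e3 e4 y).
    apply is_derive_Reals, is_derive_hq; lra. }
  destruct (alt_zeros _ l s x (Hcont e0 e1) Ha) as (zs & H1 & H2 & H3).
  exists zs. split; [now apply chain_NoDup with x|]. split; auto.
  intros z Hz. assert (Hxz := chain_lt _ _ _ H2 Hz).
  rewrite Forall_forall in H3. destruct (H3 z Hz) as [Zz (y & Hy & Hzy)].
  split; [lra|]. split; auto. intros Hdz.
  destruct (alt_insert _ z l s x Ha Zz Hxz) as (s' & Hs' & Hins); [now exists y|].
  destruct (small_perturb (hq d e0 e1 e2 e3 e4) (fun t => atan t - atan z) (x :: l))
    as (e & He & Hpert); [now apply alt_nonzero with s|].
  (* The sign is that of s': at a degenerate zero the perturbed function has derivative dl / (1 +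
     z^2), which must point in the direction demanded by [alt_insert]. *)
  set (dl := if Rlt_dec 0 s' then e / 2 else - (e / 2)).
  assert (Rabs dl < e) as Hdl.
  { unfold dl. destruct (Rlt_dec 0 s'); rewrite ?Rabs_Ropp, Rabs_right; lra. }
  assert (0 < s' * dl) as Hsd.
  { unfold dl. destruct (Rlt_dec 0 s'); [|assert (s' < 0) by lra]; nra. }
  set (g := hq d (e0 - dl * atan z) (e1 + dl) e2 e3 e4).
  assert (Hg : forall t, g t = hq d e0 e1 e2 e3 e4 t + dl * (atan t - atan z)).
  { intros t. unfold g, hq. ring. }
  destruct (Hins g (dhq d (e1 + dl) e2 e3 e4 z)) as (l' & Hl' & Ha').
  - intros t Ht. rewrite Hg. now apply Hpert.
  - rewrite Hg, Zz. ring.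
  - apply is_derive_hq; lra.
  - replace (dhq d (e1 + dl) e2 e3 e4 z) with (dhq d e1 e2 e3 e4 z + dl / (1 + z ^ 2))
      by (unfold dhq; unfold Rdiv; ring).
    rewrite Hdz, Rplus_0_l. unfold Rdiv. rewrite <- Rmult_assoc.
    apply Rmult_lt_0_compat; auto. apply Rinv_0_lt_compat. nra.
  - destruct (alt_zeros g l' s x) as (ws & K1 & K2 & K3); auto.
    { intros t Ht. unfold g. now apply Hcont. }
    assert (length ws <= length l)%nat; [|lia].
    assert (Hnz : ~ allzero (e0 - dl * atan z) (e1 + dl) e2 e3 e4).
    { intros (E0 & E1 & E2 & E3 & E4). assert (Gx : 0 < s * g x) by (destruct l'; apply Ha').
      unfold g in Gx. rewrite E0, E1, E2, E3, E4 in Gx. unfold hq in Gx. lra. }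
    apply (Hcount _ _ _ _ _ Hnz).
    + now apply chain_NoDup with x.
    + intros w Hw. split.
      * generalize (chain_lt _ _ _ K2 Hw). lra.
      * rewrite Forall_forall in K3. destruct (K3 w Hw); assumption.
Qed.

(** The relation f = o(u) at 0 from the right, together with positivity of u near 0. *)
Definition small (f u : R -> R) : Prop :=
  forall M, 0 < M -> exists X, 0 < X /\ forall y, 0 < y < X -> 0 < u y /\ M * Rabs (f y) < u y.

Lemma small_trans (f u w : R -> R) : small f u -> small u w -> small f w.
Proof.
  intros H1 H2 M HM.
  destruct (H1 M HM) as (X1 & P1 & H3). destruct (H2 1 Rlt_0_1) as (X2 & P2 & H4).
  exists (Rmin X1 X2). split; [now apply Rmin_glb_lt|]. intros y Hy.
  generalize (Rmin_l X1 X2), (Rmin_r X1 X2). intros L1 L2.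
  destruct (H3 y) as [A B]; [lra|]. destruct (H4 y) as [C D]; [lra|].
  rewrite Rabs_right in D by lra. split; lra.
Qed.

Lemma small_lin (f g u : R -> R) (d : R) : small f u -> small g u -> small (fun y => f y + d * g y) u.
Proof.
  intros H1 H2 M HM.
  destruct (H1 (2 * M)) as (X1 & P1 & H3); [lra|].
  destruct (H2 (2 * M * (Rabs d + 1))) as (X2 & P2 & H4).
  { generalize (Rabs_pos d). intros. apply Rmult_lt_0_compat; lra. }
  exists (Rmin X1 X2). split; [now apply Rmin_glb_lt|]. intros y Hy.
  generalize (Rmin_l X1 X2), (Rmin_r X1 X2). intros L1 L2.
  destruct (H3 y) as [A B]; [lra|]. destruct (H4 y) as [C D]; [lra|]. split; auto.
  assert (Rabs (f y + d * g y) <= Rabs (f y) + Rabs d * Rabs (g y))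
    by (rewrite <- Rabs_mult; apply Rabs_triang).
  assert (0 <= Rabs (g y)) by apply Rabs_pos.
  assert (0 <= M * Rabs (g y)) by (apply Rmult_le_pos; lra).
  assert (M * Rabs (f y + d * g y) <= M * (Rabs (f y) + Rabs d * Rabs (g y)))
    by (apply Rmult_le_compat_l; lra).
  lra.
Qed.

(** A sufficiently small multiple of u preserves the signs at the existing points, whereas
    sufficiently close to 0 it dominates f and dictates the opposite sign: one alternation is gained
    on the left. *)
Lemma alt_extend (f u : R -> R) (s x : R) (l : list R) : s * s = 1 -> 0 < x ->
  alt f s x l -> small f u ->
  exists dl y, 0 < y < x /\ alt (fun t => f t + dl * u t) (- s) y (x :: l).
Proof.
  intros Hs Hx Ha Hu.
  destruct (small_perturb f u (x :: l)) as (e & He & Hp); [now apply alt_nonzero with s|].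
  set (dl := - s * (e / 2)).
  assert (Rabs s = 1) as As.
  { destruct (Rlt_le_dec 0 s); [rewrite Rabs_right|rewrite Rabs_left1]; nra. }
  assert (Rabs dl < e) as Hdl.
  { unfold dl. rewrite Rabs_mult, Rabs_Ropp, As, Rabs_right; lra. }
  destruct (Hu (2 / e)) as (X & HX & Hs2); [apply Rdiv_lt_0_compat; lra|].
  set (y := Rmin x X / 2).
  assert (0 < Rmin x X) by now apply Rmin_glb_lt.
  generalize (Rmin_l x X), (Rmin_r x X). intros L1 L2.
  destruct (Hs2 y) as [U1 U2]; [unfold y; lra|].
  exists dl, y. split; [unfold y; lra|].
  split; [|split].
  - assert (Rabs (f y) < e / 2 * u y).
    { apply Rmult_lt_reg_l with (2 / e); [apply Rdiv_lt_0_compat; lra|].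
      apply Rlt_le_trans with (1 := U2). right. field. lra. }
    replace (- s * (f y + dl * u y)) with (- s * f y + (s * s) * (e / 2 * u y))
      by (unfold dl; ring).
    rewrite Hs, Rmult_1_l.
    assert (Rabs (- s * f y) = Rabs (f y)) as E by (rewrite Rabs_mult, Rabs_Ropp, As; ring).
    rewrite <- E in H0. apply Rabs_def2 in H0. lra.
  - unfold y. lra.
  - rewrite Ropp_involutive. apply alt_ext with f; auto.
Qed.

Lemma pw_small (a : R) : 0 < a -> forall eta, 0 < eta -> exists X, 0 < X /\
  forall y, 0 < y < X -> pw a y < eta.
Proof.
  intros Ha eta Heta. exists (exp (ln eta / a)). split; [apply exp_pos|].
  intros y [Hy1 Hy2]. unfold pw.
  rewrite <- (exp_ln eta) at 1 by assumption. apply exp_increasing.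
  apply ln_increasing in Hy2; auto. rewrite ln_exp in Hy2.
  apply Rmult_lt_compat_l with (r := a) in Hy2; auto.
  replace (a * (ln eta / a)) with (ln eta) in Hy2 by (field; lra). exact Hy2.
Qed.

Lemma pw_large (a : R) : 0 < a -> forall K, 0 < K -> exists X, 0 < X /\
  forall y, X < y -> K < pw a y.
Proof.
  intros Ha eta Heta. exists (exp (ln eta / a)). split; [apply exp_pos|].
  intros y Hy2. unfold pw.
  rewrite <- (exp_ln eta) at 1 by assumption. apply exp_increasing.
  apply ln_increasing in Hy2; [|apply exp_pos]. rewrite ln_exp in Hy2.
  apply Rmult_lt_compat_l with (r := a) in Hy2; auto.
  replace (a * (ln eta / a)) with (ln eta) in Hy2 by (field; lra). exact Hy2.
Qed.

(* gen5_b and gen5_c are the coefficients making gen5 of order s^5 at 0; the other generators are of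
   order s^(3+2/d), s^3, s and 1. *)
Definition gen5_b (d : R) : R := - (d - 2) / (3 * d).
Definition gen5_c (d : R) : R := - 2 * (1 + d) ^ 2 / (3 * d).
Definition gen5 (d : R) : R -> R := hq d 0 1 (gen5_b d) (gen5_c d) 0.
Definition gen_pw (d : R) : R -> R := hq d 0 0 0 0 1.
Definition gen3 (d : R) : R -> R := hq d 0 0 (- 1) (1 + d) 0.
Definition gen1 (d : R) : R -> R := hq d 0 0 1 0 0.
Definition gen0 (d : R) : R -> R := hq d 1 0 0 0 0.

(** The derivative of [gen5], with its zero of order four at 0 made explicit. The coefficient - 2 (1
    + d) (d - 4) is negative for d > 4; it is the source of the additional sign change in that
    range. *)
Definition dgen5 (d s : R) : R :=
  s ^ 4 * (- 2 * (1 + d) * (d - 4) + (8 + 2 * d) * s ^ 2)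
    / (3 * (1 + s ^ 2) ^ 2 * (1 + d + s ^ 2) ^ 2).

Lemma dhq_gen5 (d s : R) : 0 < d -> dhq d 1 (gen5_b d) (gen5_c d) 0 s = dgen5 d s.
Proof.
  intros Hd. unfold dhq, dgen5, gen5_b, gen5_c. assert (0 <= s ^ 2) by apply pow2_ge_0.
  field. repeat split; lra.
Qed.

Lemma gen5_mvt (d s : R) : 0 < d -> 0 < s -> exists c, 0 < c < s /\ gen5 d s = dgen5 d c * s.
Proof.
  intros Hd Hs.
  (* [hq] contains ln s even when e4 = 0, and [is_derive_hq] asks for s > 0; [k0] omits that term,
     so that the mean value theorem applies down to 0. *)
  set (k0 := fun s => atan s + gen5_b d * (s / (1 + s ^ 2)) + gen5_c d * (s / (1 + d + s ^ 2))).
  assert (E : forall s, gen5 d s = k0 s) by (intros; unfold gen5, k0, hq; unfold Rdiv; ring).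
  destruct (MVT_cor2 k0 (dgen5 d) 0 s Hs) as (c & Hc & H).
  - intros c Hc. apply is_derive_Reals. rewrite <- dhq_gen5 by lra.
    assert (0 <= c ^ 2) by apply pow2_ge_0.
    unfold k0, dhq. auto_derive; [repeat split; lra|]. field. repeat split; try lra.
  - exists c. split; auto. rewrite E.
    assert (k0 0 = 0) as E0 by (unfold k0; rewrite atan_0; unfold Rdiv; ring).
    rewrite E0 in Hc. lra.
Qed.

Lemma gen5_bound (d : R) : 0 < d -> exists K, 0 < K /\ forall s, 0 < s <= 1 -> Rabs (gen5 d s) <= K * s ^ 5.
Proof.
  intros Hd. set (A := Rabs (- 2 * (1 + d) * (d - 4)) + (8 + 2 * d)).
  assert (0 < A) as HA by (unfold A; generalize (Rabs_pos (- 2 * (1 + d) * (d - 4))); lra).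
  exists A. split; auto. intros s Hs.
  destruct (gen5_mvt d s) as (c & Hc & E); try lra.
  rewrite E, Rabs_mult, (Rabs_right s) by lra.
  replace (A * s ^ 5) with (A * s ^ 4 * s) by ring.
  apply Rmult_le_compat_r; [lra|].
  assert (0 < c ^ 2 <= 1) as Hc2 by (split; [apply pow_lt; lra|nra]).
  assert (0 <= c ^ 4 <= s ^ 4) as Hc4.
  { split; [apply pow_le; lra|apply pow_incr; lra]. }
  unfold dgen5, Rdiv. rewrite Rabs_mult.
  set (D := 3 * (1 + c ^ 2) ^ 2 * (1 + d + c ^ 2) ^ 2).
  assert (1 <= D) as HD.
  { unfold D. assert (1 <= (1 + c ^ 2) ^ 2) by nra. assert (1 <= (1 + d + c ^ 2) ^ 2) by nra. nra. }
  rewrite (Rabs_right (/ D)) by (left; apply Rinv_0_lt_compat; lra).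
  assert (/ D <= 1) as HD' by (rewrite <- Rinv_1; apply Rinv_le_contravar; lra).
  assert (0 < / D) by (apply Rinv_0_lt_compat; lra).
  rewrite Rabs_mult, (Rabs_right (c ^ 4)) by lra.
  set (B := Rabs (- 2 * (1 + d) * (d - 4) + (8 + 2 * d) * c ^ 2)).
  assert (0 <= B <= A) as HB.
  { split; [apply Rabs_pos|]. unfold B, A. eapply Rle_trans; [apply Rabs_triang|].
    apply Rplus_le_compat_l. rewrite Rabs_right by nra. nra. }
  assert (c ^ 4 * B <= s ^ 4 * A) by (apply Rmult_le_compat; lra).
  assert (0 <= c ^ 4 * B) by (apply Rmult_le_pos; lra).
  nra.
Qed.

Lemma gen_pw_bounds (d s : R) : 0 < d -> 0 < s <= 1 ->
  s ^ 3 * pw (2 / d) s / (2 * (2 + d)) <= gen_pw d s <= s ^ 3 * pw (2 / d) s.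
Proof.
  intros Hd Hs. unfold gen_pw, hq.
  set (P := s ^ 3 * pw (2 / d) s).
  assert (0 < P) as HP by (apply Rmult_lt_0_compat; [apply pow_lt; lra|apply pw_pos]).
  assert (0 < s ^ 2 <= 1) by nra.
  set (D := (1 + s ^ 2) * (1 + d + s ^ 2)).
  assert (1 <= D <= 2 * (2 + d)) as HD.
  { unfold D. split; [nra|apply Rmult_le_compat; lra]. }
  rewrite !Rmult_0_l, !Rplus_0_l, Rmult_1_l. split.
  - apply Rmult_le_compat_l; [lra|]. apply Rinv_le_contravar; lra.
  - rewrite <- (Rmult_1_r P) at 2. apply Rmult_le_compat_l; [lra|].
    rewrite <- Rinv_1. apply Rinv_le_contravar; lra.
Qed.

Lemma gen3_bounds (d s : R) : 0 < d -> 0 < s <= 1 ->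
  d * s ^ 3 / (2 * (2 + d)) <= gen3 d s <= d * s ^ 3.
Proof.
  intros Hd Hs. assert (0 < s ^ 2 <= 1) by nra.
  set (P := d * s ^ 3).
  assert (0 < P) as HP by (apply Rmult_lt_0_compat; [lra|apply pow_lt; lra]).
  assert (gen3 d s = P / ((1 + s ^ 2) * (1 + d + s ^ 2))) as ->.
  { unfold gen3, hq, P. field. split; lra. }
  set (D := (1 + s ^ 2) * (1 + d + s ^ 2)).
  assert (1 <= D <= 2 * (2 + d)) as HD.
  { unfold D. split; [nra|apply Rmult_le_compat; lra]. }
  split.
  - apply Rmult_le_compat_l; [lra|]. apply Rinv_le_contravar; lra.
  - rewrite <- (Rmult_1_r P) at 2. apply Rmult_le_compat_l; [lra|].
    rewrite <- Rinv_1. apply Rinv_le_contravar; lra.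
Qed.

Lemma gen1_bounds (d s : R) : 0 < s <= 1 -> s / 2 <= gen1 d s <= s.
Proof.
  intros Hs. assert (0 < s ^ 2 <= 1) by nra.
  assert (gen1 d s = s / (1 + s ^ 2)) as -> by (unfold gen1, hq; unfold Rdiv; ring).
  split.
  - apply Rmult_le_compat_l; [lra|]. apply Rinv_le_contravar; lra.
  - apply Rle_div_l; nra.
Qed.

Lemma small_intro (f u r : R -> R) (C : R) : 0 < C ->
  (forall s, 0 < s <= 1 -> 0 < u s /\ Rabs (f s) <= C * r s * u s) ->
  (forall s, 0 < s -> 0 <= r s) ->
  (forall eta, 0 < eta -> exists X, 0 < X /\ forall y, 0 < y < X -> r y < eta) ->
  small f u.
Proof.
  intros HC H Hr Hs M HM.
  destruct (Hs (/ (M * C))) as (X & HX & HXs).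
  { apply Rinv_0_lt_compat, Rmult_lt_0_compat; assumption. }
  exists (Rmin X 1). split; [apply Rmin_glb_lt; lra|].
  intros y Hy. generalize (Rmin_l X 1), (Rmin_r X 1). intros L1 L2.
  destruct (H y) as [Hu Hf]; [lra|]. split; auto.
  assert (Hry := HXs y ltac:(lra)).
  apply Rle_lt_trans with (M * (C * r y * u y)); [apply Rmult_le_compat_l; lra|].
  replace (M * (C * r y * u y)) with (M * C * r y * u y) by ring.
  assert (0 < M * C) by (apply Rmult_lt_0_compat; assumption).
  assert (M * C * r y < 1).
  { apply Rmult_lt_compat_l with (r := M * C) in Hry; auto.
    rewrite Rinv_r in Hry by lra. exact Hry. }
  rewrite <- (Rmult_1_l (u y)) at 2. apply Rmult_lt_compat_r; assumption.
Qed.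

Lemma id_small : forall eta, 0 < eta -> exists X, 0 < X /\ forall y, 0 < y < X -> y < eta.
Proof. intros eta H. exists eta. split; auto. intros; lra. Qed.

Lemma small_gen5_gen3 (d : R) : 0 < d -> small (gen5 d) (gen3 d).
Proof.
  intros Hd. destruct (gen5_bound d Hd) as (K & HK & Hk).
  apply small_intro with (fun s => s) (K * (2 * (2 + d)) / d).
  - apply Rdiv_lt_0_compat; nra.
  - intros s Hs. destruct (gen3_bounds d s Hd Hs) as [U1 _]. specialize (Hk s Hs).
    assert (0 < s ^ 3) by (apply pow_lt; lra).
    assert (0 < d * s ^ 3 / (2 * (2 + d))) by (apply Rdiv_lt_0_compat; nra).
    split; [lra|].
    apply Rle_trans with (1 := Hk).
    apply Rle_trans with (K * (2 * (2 + d)) / d * s * (d * s ^ 3 / (2 * (2 + d)))).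
    + replace (K * (2 * (2 + d)) / d * s * (d * s ^ 3 / (2 * (2 + d)))) with (K * s * s ^ 3)
        by (field; lra).
      replace (K * s ^ 5) with (K * s * s ^ 3 * s) by ring.
      assert (0 < K * s * s ^ 3) by (repeat apply Rmult_lt_0_compat; lra). nra.
    + apply Rmult_le_compat_l; auto. apply Rmult_le_pos; [|lra].
      left. apply Rdiv_lt_0_compat; nra.
  - intros; lra.
  - apply id_small.
Qed.

Lemma small_pw_gen3 (d : R) : 0 < d -> small (gen_pw d) (gen3 d).
Proof.
  intros Hd.
  apply small_intro with (pw (2 / d)) (2 * (2 + d) / d).
  - apply Rdiv_lt_0_compat; lra.
  - intros s Hs. destruct (gen3_bounds d s Hd Hs) as [U1 _]. destruct (gen_pw_bounds d s Hd Hs) as [G1 G2].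
    assert (0 < s ^ 3) by (apply pow_lt; lra).
    assert (0 < d * s ^ 3 / (2 * (2 + d))) by (apply Rdiv_lt_0_compat; nra).
    assert (HP := pw_pos (2 / d) s).
    split; [lra|]. rewrite Rabs_right.
    2:{ apply Rle_ge, Rle_trans with (2 := G1). left. apply Rdiv_lt_0_compat; nra. }
    apply Rle_trans with (1 := G2).
    apply Rle_trans with (2 * (2 + d) / d * pw (2 / d) s * (d * s ^ 3 / (2 * (2 + d)))).
    + right. field. lra.
    + apply Rmult_le_compat_l; auto. apply Rmult_le_pos; [|lra].
      left. apply Rdiv_lt_0_compat; lra.
  - intros s _. left. apply pw_pos.
  - apply pw_small. apply Rdiv_lt_0_compat; lra.
Qed.

(** The orders at 0 compare as 5 > 3 + 2/d exactly for d > 1; the quotient is governed by s^(2 -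
    2/d). *)
Lemma small_gen5_pw (d : R) : 1 < d -> small (gen5 d) (gen_pw d).
Proof.
  intros Hd. destruct (gen5_bound d ltac:(lra)) as (K & HK & Hk).
  apply small_intro with (pw (2 - 2 / d)) (K * (2 * (2 + d))).
  - nra.
  - intros s Hs. destruct (gen_pw_bounds d s ltac:(lra) Hs) as [U1 _]. specialize (Hk s Hs).
    assert (0 < s ^ 3) by (apply pow_lt; lra).
    assert (HP := pw_pos (2 / d) s). assert (HP' := pw_pos (2 - 2 / d) s).
    assert (0 < s ^ 3 * pw (2 / d) s / (2 * (2 + d))) by (apply Rdiv_lt_0_compat; nra).
    split; [lra|].
    apply Rle_trans with (1 := Hk).
    apply Rle_trans with (K * (2 * (2 + d)) * pw (2 - 2 / d) s * (s ^ 3 * pw (2 / d) s / (2 * (2 + d)))).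
    + assert (pw (2 - 2 / d) s * pw (2 / d) s = s ^ 2) as E.
      { unfold pw. rewrite <- exp_plus.
        replace ((2 - 2 / d) * ln s + 2 / d * ln s) with (ln s + ln s) by ring.
        rewrite exp_plus, exp_ln by lra. ring. }
      replace (K * (2 * (2 + d)) * pw (2 - 2 / d) s * (s ^ 3 * pw (2 / d) s / (2 * (2 + d))))
        with (K * s ^ 3 * (pw (2 - 2 / d) s * pw (2 / d) s)) by (field; lra).
      rewrite E. right. ring.
    + apply Rmult_le_compat_l; auto. apply Rmult_le_pos; [|lra]. nra.
  - intros s _. left. apply pw_pos.
  - apply pw_small. apply Rlt_Rminus. apply Rlt_div_l; lra.
Qed.

Lemma small_gen3_gen1 (d : R) : 0 < d -> small (gen3 d) (gen1 d).
Proof.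
  intros Hd. apply small_intro with (fun s => s) (2 * d); [lra| |intros; lra|apply id_small].
  intros s Hs. destruct (gen3_bounds d s Hd Hs) as [G1 G2]. destruct (gen1_bounds d s Hs) as [U1 _].
  assert (0 < s ^ 3) by (apply pow_lt; lra).
  assert (0 < d * s ^ 3 / (2 * (2 + d))) by (apply Rdiv_lt_0_compat; nra).
  split; [lra|]. rewrite Rabs_right by lra.
  apply Rle_trans with (1 := G2).
  apply Rle_trans with (2 * d * s * (s / 2)).
  - replace (d * s ^ 3) with (d * s * s * s) by ring. replace (2 * d * s * (s / 2)) with (d * s * s) by field.
    assert (0 < d * s * s) by (repeat apply Rmult_lt_0_compat; lra). nra.
  - apply Rmult_le_compat_l; nra.
Qed.

Lemma small_gen1_gen0 (d : R) : small (gen1 d) (gen0 d).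
Proof.
  apply small_intro with (fun s => s) 1; [lra| |intros; lra|apply id_small].
  intros s Hs. destruct (gen1_bounds d s Hs) as [U1 U2].
  assert (gen0 d s = 1) as -> by (unfold gen0, hq, Rdiv; ring).
  split; [lra|]. rewrite Rabs_right by lra. lra.
Qed.

Definition hq_span (d : R) (f : R -> R) : Prop :=
  exists e0 e1 e2 e3 e4, forall s, f s = hq d e0 e1 e2 e3 e4 s.

Lemma hq_span_lin (d dl : R) (f u : R -> R) : hq_span d f -> hq_span d u -> hq_span d (fun s => f s + dl * u s).
Proof.
  intros (a0 & a1 & a2 & a3 & a4 & Ha) (b0 & b1 & b2 & b3 & b4 & Hb).
  exists (a0 + dl * b0), (a1 + dl * b1), (a2 + dl * b2), (a3 + dl * b3), (a4 + dl * b4).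
  intros s. rewrite Ha, Hb. unfold hq, Rdiv. ring.
Qed.

Lemma hq_span_hq (d e0 e1 e2 e3 e4 : R) : hq_span d (hq d e0 e1 e2 e3 e4).
Proof. now exists e0, e1, e2, e3, e4. Qed.

Lemma small_self (f u w : R -> R) (dl : R) : small f u -> small u w ->
  small (fun y => f y + dl * u y) w.
Proof. intros H1 H2. apply small_lin; auto. now apply small_trans with u. Qed.

(** The generators of order 3, 1 and 0 are added in this order, each dominating the previous sum
    near 0 and gaining one alternation. *)
Lemma alt_extend3 (d : R) (f : R -> R) (s x : R) (l : list R) : 0 < d ->
  hq_span d f -> s * s = 1 -> 0 < x -> alt f s x l -> small f (gen3 d) ->
  exists f' s' x' l', hq_span d f' /\ 0 < x' /\ alt f' s' x' l' /\ length l' = (3 + length l)%nat.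
Proof.
  intros Hd Hf Hs Hx Ha Hu.
  destruct (alt_extend f (gen3 d) s x l) as (d1 & y1 & Hy1 & A1); auto.
  destruct (alt_extend (fun t => f t + d1 * gen3 d t) (gen1 d) (- s) y1 (x :: l))
    as (d2 & y2 & Hy2 & A2); auto; try lra.
  { apply small_self; auto. now apply small_gen3_gen1. }
  destruct (alt_extend (fun t => f t + d1 * gen3 d t + d2 * gen1 d t) (gen0 d) (- - s) y2 (y1 :: x :: l))
    as (d3 & y3 & Hy3 & A3); auto; try lra.
  { apply small_self; [|apply small_gen1_gen0]. apply small_self; auto. now apply small_gen3_gen1. }
  exists (fun t => f t + d1 * gen3 d t + d2 * gen1 d t + d3 * gen0 d t), (- - - s), y3, (y2 :: y1 :: x :: l).
  repeat split; try lra; try apply A3.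
  apply hq_span_lin; [apply hq_span_lin; [apply hq_span_lin; [exact Hf|]|]|]; apply hq_span_hq.
Qed.

(** The two rational terms are O(1/s), so only atan s survives at infinity. The lower estimate
    provides a point where [gen5] is positive, the upper one its boundedness. *)
Lemma gen5_lower (d : R) : 0 < d -> exists C, 0 < C /\ forall s, 1 < s ->
  atan s - C / s <= gen5 d s <= PI / 2 + C.
Proof.
  intros Hd. set (B := Rabs (gen5_b d) + Rabs (gen5_c d)).
  assert (0 <= Rabs (gen5_b d)) by apply Rabs_pos. assert (0 <= Rabs (gen5_c d)) by apply Rabs_pos.
  exists (B + 1). split; [unfold B; lra|]. intros s Hs.
  assert (E : gen5 d s = atan s + (gen5_b d * (s / (1 + s ^ 2)) + gen5_c d * (s / (1 + d + s ^ 2))))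
    by (unfold gen5, hq, Rdiv; ring).
  assert (A : forall a b, 0 < b -> Rabs (a * (s / (b + s ^ 2))) <= Rabs a / s).
  { intros a b Hb. rewrite Rabs_mult. unfold Rdiv. apply Rmult_le_compat_l; [apply Rabs_pos|].
    assert (0 < s ^ 2) by (apply pow_lt; lra).
    rewrite Rabs_right.
    - apply Rle_div_l; [lra|]. apply Rmult_le_reg_l with s; [lra|].
      replace (s * (/ s * (b + s ^ 2))) with (b + s ^ 2) by (field; lra). nra.
    - left. apply Rdiv_lt_0_compat; lra. }
  assert (A1 := A (gen5_b d) 1 Rlt_0_1). assert (A2 := A (gen5_c d) (1 + d) ltac:(lra)).
  set (p := gen5_b d * _) in *. set (r := gen5_c d * _) in *.
  assert (Rabs (p + r) <= B / s).
  { eapply Rle_trans; [apply Rabs_triang|]. unfold B, Rdiv in *. lra. }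
  apply Rabs_le_between in H1.
  assert (0 < / s < 1) as Hi by (split; [apply Rinv_0_lt_compat; lra|rewrite <- Rinv_1; apply Rinv_lt_contravar; lra]).
  generalize (atan_bound s). intros Hat.
  assert (B / s <= B) by (unfold Rdiv; rewrite <- (Rmult_1_r B) at 2; apply Rmult_le_compat_l; unfold B; lra).
  rewrite E. unfold Rdiv in *. split; nra.
Qed.

Lemma gen5_pos (d : R) : 0 < d -> exists x, 0 < x /\ 0 < gen5 d x.
Proof.
  intros Hd. destruct (gen5_lower d Hd) as (C & HC & H).
  set (x := 4 * C / PI + 1 + 1).
  assert (HPI := PI_RGT_0).
  assert (0 < C / PI) by (apply Rdiv_lt_0_compat; lra).
  assert (2 < x) by (unfold x; lra).
  exists x. split; [lra|]. destruct (H x) as [HL _]; [lra|].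
  assert (PI / 4 < atan x) by (rewrite <- atan_1; apply atan_increasing; lra).
  assert (C / x < PI / 4).
  { apply Rlt_div_l; [lra|]. unfold x. replace (PI / 4 * (4 * C / PI + 1 + 1)) with (C + PI / 2) by (field; lra). lra. }
  lra.
Qed.

Lemma gen5_neg (d y : R) : 4 < d -> 0 < y -> exists x, 0 < x < y /\ gen5 d x < 0.
Proof.
  intros Hd Hy.
  (* The last bound is half the root, in s^2, of the bracket in [dgen5]; since c^2 <= x when x <= 1,
     the bracket is still negative at the mean value point. *)
  set (x := Rmin (y / 2) (Rmin 1 ((1 + d) * (d - 4) / (8 + 2 * d)))).
  assert (0 < (1 + d) * (d - 4) / (8 + 2 * d)) by (apply Rdiv_lt_0_compat; nra).
  assert (0 < x) by (unfold x; repeat apply Rmin_glb_lt; lra).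
  assert (x <= y / 2) by apply Rmin_l.
  assert (x <= 1) by (eapply Rle_trans; [apply Rmin_r|apply Rmin_l]).
  assert (Hx3 : x <= (1 + d) * (d - 4) / (8 + 2 * d)) by (eapply Rle_trans; [apply Rmin_r|apply Rmin_r]).
  apply Rle_div_r in Hx3; [|lra].
  exists x. split; [lra|].
  destruct (gen5_mvt d x) as (c & Hc & ->); [lra|lra|].
  assert (0 < c ^ 2 <= x) by nra.
  assert (dgen5 d c < 0); [|nra].
  assert (0 < c ^ 4) by (apply pow_lt; lra).
  unfold dgen5.
  assert (0 < 3 * (1 + c ^ 2) ^ 2 * (1 + d + c ^ 2) ^ 2).
  { apply Rmult_lt_0_compat; [apply Rmult_lt_0_compat; [lra|]|]; apply pow_lt; lra. }
  apply Rlt_div_l; auto. rewrite Rmult_0_l.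
  assert (- 2 * (1 + d) * (d - 4) + (8 + 2 * d) * c ^ 2 < 0) by nra.
  nra.
Qed.

(* for d < 2 the function gen_pw is unbounded while gen5 is bounded *)
Lemma gen5_pw_far (d x dl : R) : 0 < d < 2 -> 0 < dl -> exists y, x < y /\ 0 < y /\ gen5 d y - dl * gen_pw d y < 0.
Proof.
  intros Hd Hdl. destruct (gen5_lower d ltac:(lra)) as (C & HC & H).
  assert (HPI := PI_RGT_0).
  set (K := (PI / 2 + C) * (2 * (2 + d)) / dl).
  assert (0 < K) as HK by (apply Rdiv_lt_0_compat; [apply Rmult_lt_0_compat; lra|lra]).
  destruct (pw_large (2 / d - 1)) with (K := K) as (X & HX & HXy); auto.
  { apply Rlt_Rminus. apply Rlt_div_r; lra. }
  set (y := Rmax (Rmax x 1) X + 1).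
  assert (x < y /\ 1 < y /\ X < y) as (Hxy & H1y & HXy').
  { unfold y. generalize (Rmax_l (Rmax x 1) X), (Rmax_r (Rmax x 1) X), (Rmax_l x 1), (Rmax_r x 1). lra. }
  exists y. split; auto. split; [lra|].
  destruct (H y H1y) as [_ HU]. specialize (HXy y HXy').
  assert (gen_pw d y >= pw (2 / d - 1) y / (2 * (2 + d))).
  { unfold gen_pw, hq. rewrite !Rmult_0_l, !Rplus_0_l, Rmult_1_l.
    assert (pw (2 / d) y = pw (2 / d - 1) y * y) as ->.
    { unfold pw. rewrite <- (exp_ln y) at 3 by lra. rewrite <- exp_plus. f_equal. ring. }
    set (P := pw (2 / d - 1) y) in *. assert (0 < P) by apply pw_pos.
    assert (1 < y ^ 2) by nra.
    set (v := y ^ 2) in *.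
    replace (y ^ 3 * (P * y)) with (P * (v * v)) by (unfold v; ring).
    apply Rle_ge. apply Rle_div_l; [lra|].
    replace (P * (v * v) / ((1 + v) * (1 + d + v)) * (2 * (2 + d))) with
     (P * ((v * v * (2 * (2 + d))) / ((1 + v) * (1 + d + v)))) by (field; lra).
    rewrite <- (Rmult_1_r P) at 1. apply Rmult_le_compat_l; [lra|].
    apply Rle_div_r; [apply Rmult_lt_0_compat; lra|].
    replace (v * v * (2 * (2 + d))) with (2 * v * ((2 + d) * v)) by ring.
    rewrite Rmult_1_l. apply Rmult_le_compat; nra. }
  assert (PI / 2 + C < dl * (pw (2 / d - 1) y / (2 * (2 + d)))).
  { replace (PI / 2 + C) with (dl * (K / (2 * (2 + d)))) by (unfold K; field; lra).
    apply Rmult_lt_compat_l; auto. apply Rmult_lt_compat_r; auto. apply Rinv_0_lt_compat; lra. }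
  assert (dl * (pw (2 / d - 1) y / (2 * (2 + d))) <= dl * gen_pw d y) by (apply Rmult_le_compat_l; lra).
  lra.
Qed.

(** The number of zeros obtained is the length of l. For d < 2 one starts from [gen5] minus a small
    multiple of [gen_pw], which is positive at x0 and negative far out; if moreover d > 1, [gen_pw]
    also dominates near 0 and adds a sign change there. For d >= 2 one starts from [gen5] alone,
    which has a sign change available if d > 4, and [gen_pw] is a further generator of lower order.
    With three more from [alt_extend3] the counts are 1 + 3, 2 + 3, 0 + 1 + 3 and 1 + 1 + 3. *)
Lemma alt_exists (d : R) : 0 < d -> exists f s x l,
  hq_span d f /\ 0 < x /\ alt f s x l /\ (five d -> length l = 5%nat) /\ (~ five d -> length l = 4%nat).
Proof.
  intros Hd. destruct (gen5_pos d Hd) as (x0 & Hx0 & K0).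
  destruct (Rlt_le_dec d 2) as [Hd2|Hd2].
  - destruct (small_perturb (gen5 d) (gen_pw d) [x0]) as (e & He & Hp).
    { intros y [<-|[]]. lra. }
    set (dl := e / 2). assert (0 < dl) as Hdl by (unfold dl; lra).
    destruct (gen5_pw_far d x0 dl) as (x1 & Hx1 & Hx1' & K1); try lra.
    set (f := fun t => gen5 d t + - dl * gen_pw d t).
    assert (hq_span d f) as Hf by (apply hq_span_lin; apply hq_span_hq).
    assert (F0 : 0 < f x0).
    { assert (0 < gen5 d x0 * f x0); [|nra]. apply Hp; [|now left].
      unfold dl. rewrite Rabs_Ropp, Rabs_right; lra. }
    assert (F1 : f x1 < 0) by (unfold f; lra).
    assert (Hsm : small f (gen3 d)).
    { apply small_lin; [now apply small_gen5_gen3|now apply small_pw_gen3]. }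
    destruct (Rle_lt_dec d 1) as [Hd1|Hd1].
    + destruct (alt_extend3 d f 1 x0 [x1]) as (f' & s' & x' & l' & V & P & A & L); auto; try lra.
      { simpl. repeat split; lra. }
      exists f', s', x', l'. rewrite L. unfold five. repeat split; auto; intros; exfalso; lra.
    + destruct (small_gen5_pw d Hd1 (/ dl)) as (X & HX & HXs); [now apply Rinv_0_lt_compat|].
      set (y := Rmin X x0 / 2).
      assert (0 < Rmin X x0) by now apply Rmin_glb_lt.
      generalize (Rmin_l X x0), (Rmin_r X x0). intros L1 L2.
      destruct (HXs y) as [U1 U2]; [unfold y; lra|].
      assert (Hy0 : 0 < y < x0) by (unfold y; lra). clearbody y.
      assert (FY : f y < 0).
      { unfold f. assert (gen5 d y < dl * gen_pw d y); [|lra].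
        apply Rle_lt_trans with (1 := Rle_abs _).
        apply Rmult_lt_compat_l with (r := dl) in U2; auto.
        rewrite <- Rmult_assoc, Rinv_r in U2; lra. }
      destruct (alt_extend3 d f (-1) y [x0; x1]) as (f' & s' & x' & l' & V & P & A & L); auto; try lra.
      { simpl. repeat split; lra. }
      exists f', s', x', l'. rewrite L. unfold five. repeat split; auto; intros; exfalso; lra.
  - assert (A : exists s x l, s * s = 1 /\ 0 < x /\ alt (gen5 d) s x l /\
      (4 < d -> length l = 1%nat) /\ (d <= 4 -> length l = 0%nat)).
    { destruct (Rlt_le_dec 4 d) as [H4|H4].
      - destruct (gen5_neg d x0 H4 Hx0) as (x1 & Hx1 & K1).
        exists (-1), x1, [x0]. simpl. repeat split; intros; auto; lra.
      - exists 1, x0, []. simpl. repeat split; intros; auto; lra. }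
    destruct A as (s & x & l & Hs & Hx & A & HL1 & HL2).
    destruct (alt_extend (gen5 d) (gen_pw d) s x l) as (dl & y & Hy & A1); auto.
    { apply small_gen5_pw; lra. }
    destruct (alt_extend3 d (fun t => gen5 d t + dl * gen_pw d t) (- s) y (x :: l))
      as (f' & s' & x' & l' & V & P & A' & L'); auto; try lra.
    { apply hq_span_lin; apply hq_span_hq. }
    { apply small_self; [apply small_gen5_pw; lra|now apply small_pw_gen3]. }
    exists f', s', x', l'. rewrite L'. simpl. unfold five. repeat split; auto; intros.
    + rewrite HL1; auto; lra.
    + rewrite HL2; auto; lra.
Qed.

Lemma hq_simple_exists (d : R) : 0 < d -> exists e0 e1 e2 e3 e4 zs,
  NoDup zs /\ (five d -> length zs = 5%nat) /\ (~ five d -> length zs = 4%nat) /\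
  forall z, In z zs -> 0 < z /\ hq d e0 e1 e2 e3 e4 z = 0 /\ dhq d e1 e2 e3 e4 z <> 0.
Proof.
  intros Hd.
  destruct (alt_exists d Hd) as (f & s & x & l & (e0 & e1 & e2 & e3 & e4 & Hf) & Hx & A & L5 & L4).
  assert (A' : alt (hq d e0 e1 e2 e3 e4) s x l).
  { apply alt_ext with f; auto. intros y Hy. rewrite <- Hf.
    assert (f y <> 0) by now apply (alt_nonzero f l s x). nra. }
  destruct (hq_simple d e0 e1 e2 e3 e4 s x l) as (zs & H1 & H2 & H3); auto.
  { intros a0 a1 a2 a3 a4 Hnz. destruct (hq_zeros_le d a0 a1 a2 a3 a4 Hd Hnz) as [B5 B4].
    assert (five d \/ ~ five d) as [F|F] by (unfold five; lra).
    - rewrite L5; auto.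
    - rewrite L4; auto. }
  exists e0, e1, e2, e3, e4, zs. rewrite H2. auto.
Qed.

(** * Smooth functions and sums of products a(r) b(theta) *)

(* Infinite differentiability on D, witnessed by a class of functions closed under differentiation. *)
Definition smooth (D : R -> Prop) (f : R -> R) : Prop :=
  exists P : (R -> R) -> Prop, P f /\
    forall g, P g -> exists g', P g' /\ forall x, D x -> is_derive g x (g' x).

(** Polynomial expressions in the members of P. By [smooth_alg] it is enough that each generator has
    its derivative among these expressions, as for atan with the generators / (1 + x^2) and x. *)
Inductive alg (P : (R -> R) -> Prop) : (R -> R) -> Prop :=
| alg_in f : P f -> alg P f
| alg_const c : alg P (fun _ => c)
| alg_plus f g : alg P f -> alg P g -> alg P (fun x => f x + g x)
| alg_mult f g : alg P f -> alg P g -> alg P (fun x => f x * g x).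

Lemma smooth_alg (D : R -> Prop) (P : (R -> R) -> Prop) :
  (forall g, P g -> exists g', alg P g' /\ forall x, D x -> is_derive g x (g' x)) ->
  forall f, alg P f -> smooth D f.
Proof.
  intros HP f Hf. exists (alg P). split; auto. clear f Hf. intros g Hg.
  induction Hg as [f Hf|c|f g Hf [f' [Af Df]] Hg [g' [Ag Dg]]|f g Hf [f' [Af Df]] Hg [g' [Ag Dg]]].
  - auto.
  - exists (fun _ => 0). split; [apply alg_const|]. intros. apply @is_derive_const.
  - exists (fun x => f' x + g' x). split; [now apply alg_plus|].
    intros x Hx. apply @is_derive_plus; auto.
  - exists (fun x => f' x * g x + f x * g' x). split.
    + apply alg_plus; apply alg_mult; auto.
    + intros x Hx. apply @is_derive_mult; auto. intros; apply Rmult_comm.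
Qed.

Lemma smooth_derive (D : R -> Prop) (f : R -> R) : smooth D f ->
  exists f', smooth D f' /\ forall x, D x -> is_derive f x (f' x).
Proof.
  intros (P & Pf & HP). destruct (HP f Pf) as (f' & Pf' & Hf').
  exists f'. split; auto. now exists P.
Qed.

Lemma smooth_union (D : R -> Prop) (f g h : R -> R) : smooth D f -> smooth D g ->
  (forall P : (R -> R) -> Prop, P f -> P g -> alg P h) -> smooth D h.
Proof.
  intros (P & Pf & HP) (Q & Qg & HQ) H.
  apply (smooth_alg D (fun u => P u \/ Q u)); [|apply H; auto].
  intros u [Pu|Qu].
  - destruct (HP u Pu) as (u' & Pu' & Hu'). exists u'. split; auto. apply alg_in; auto.
  - destruct (HQ u Qu) as (u' & Pu' & Hu'). exists u'. split; auto. apply alg_in; auto.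
Qed.

Lemma smooth_plus (D : R -> Prop) (f g : R -> R) :
  smooth D f -> smooth D g -> smooth D (fun x => f x + g x).
Proof. intros Hf Hg. apply (smooth_union D f g); auto. intros. apply alg_plus; now apply alg_in. Qed.

Lemma smooth_mult (D : R -> Prop) (f g : R -> R) :
  smooth D f -> smooth D g -> smooth D (fun x => f x * g x).
Proof. intros Hf Hg. apply (smooth_union D f g); auto. intros. apply alg_mult; now apply alg_in. Qed.

Lemma smooth_const (D : R -> Prop) (c : R) : smooth D (fun _ => c).
Proof. apply (smooth_alg D (fun _ => False)); [tauto|apply alg_const]. Qed.

Lemma smooth_id (D : R -> Prop) : smooth D (fun x => x).
Proof.
  apply (smooth_alg D (fun u => u = fun x => x)); [|now apply alg_in].
  intros g ->. exists (fun _ => 1). split; [apply alg_const|]. intros. apply @is_derive_id.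
Qed.

Lemma smooth_comp (D E : R -> Prop) (f g : R -> R) :
  smooth E f -> smooth D g -> (forall x, D x -> E (g x)) -> smooth D (fun x => f (g x)).
Proof.
  intros (P & Pf & HP) (Q & Qg & HQ) HDE.
  apply (smooth_alg D (fun u => Q u \/ exists p, P p /\ u = fun x => p (g x))).
  2:{ apply alg_in. right. now exists f. }
  intros u [Qu|(p & Pp & ->)].
  - destruct (HQ u Qu) as (u' & Pu' & Hu'). exists u'. split; auto. apply alg_in; auto.
  - destruct (HP p Pp) as (p' & Pp' & Hp'). destruct (HQ g Qg) as (g' & Pg' & Hg').
    exists (fun x => g' x * p' (g x)). split.
    + apply alg_mult; apply alg_in; [auto|right; now exists p'].
    + intros x Hx. apply (is_derive_comp p g); auto.
Qed.

Definition everywhere (_ : R) : Prop := True.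
Definition positive (x : R) : Prop := 0 < x.

Lemma smooth_continuous (D : R -> Prop) (f : R -> R) (x : R) : smooth D f -> D x -> continuous f x.
Proof.
  intros Hf Hx. destruct (smooth_derive D f Hf) as (f' & _ & H).
  apply @ex_derive_continuous. exists (f' x). auto.
Qed.

Lemma smooth_prim (f : R -> R) : smooth everywhere f ->
  exists F, smooth everywhere F /\ forall x, is_derive F x (f x).
Proof.
  intros Hf. exists (fun x => RInt f 0 x).
  assert (forall x, is_derive (fun x => RInt f 0 x) x (f x)) as HF.
  { intros x. apply @is_derive_RInt with (a := 0).
    - exists (mkposreal 1 Rlt_0_1). intros y _. apply @RInt_correct, @ex_RInt_continuous.
      intros z _. now apply (smooth_continuous everywhere f).
    - now apply (smooth_continuous everywhere f). }
  split; auto. destruct Hf as (P & Pf & HP).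
  exists (fun g => P g \/ g = fun x => RInt f 0 x). split; auto.
  intros g [Pg| ->].
  - destruct (HP g Pg) as (g' & H1 & H2). exists g'. auto.
  - exists f. auto.
Qed.

Lemma smooth_trig : smooth everywhere sin /\ smooth everywhere cos.
Proof.
  assert (H : forall g, g = sin \/ g = cos -> exists g', alg (fun g => g = sin \/ g = cos) g' /\
    forall x, everywhere x -> is_derive g x (g' x)).
  { intros g [-> | ->].
    - exists cos. split; [apply alg_in; auto|]. intros x _. auto_derive; auto. ring.
    - exists (fun x => (fun _ => -1) x * sin x). split.
      + apply (alg_mult _ (fun _ => -1)); [apply alg_const|apply alg_in; auto].
      + intros x _. auto_derive; auto. ring. }
  split; apply (smooth_alg everywhere _ H); apply alg_in; auto.
Qed.

Lemma smooth_inv : smooth positive Rinv.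
Proof.
  apply (smooth_alg positive (fun g => g = Rinv)); [|now apply alg_in].
  intros g ->. exists (fun x => (fun _ => -1) x * ((fun x => / x) x * (fun x => / x) x)). split.
  - apply alg_mult; [apply alg_const|apply alg_mult; now apply alg_in].
  - intros x Hx. unfold positive in Hx. auto_derive; [lra|field; lra].
Qed.

Lemma smooth_exp : smooth everywhere exp.
Proof.
  apply (smooth_alg everywhere (fun g => g = exp)); [|now apply alg_in].
  intros g ->. exists exp. split; [now apply alg_in|]. intros x _. auto_derive; auto. ring.
Qed.

Lemma smooth_ln : smooth positive ln.
Proof.
  apply (smooth_alg positive (fun g => g = Rinv \/ g = ln)); [|apply alg_in; auto].
  intros g [-> | ->].
  - exists (fun x => (fun _ => -1) x * ((fun x => / x) x * (fun x => / x) x)). split.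
    + apply alg_mult; [apply alg_const|apply alg_mult; apply alg_in; now left].
    + intros x Hx. unfold positive in Hx. auto_derive; [lra|field; lra].
  - exists Rinv. split; [apply alg_in; auto|]. intros x Hx. unfold positive in Hx.
    auto_derive; [lra|field; lra].
Qed.

Lemma smooth_atan : smooth everywhere atan.
Proof.
  set (I := fun x : R => / (1 + x ^ 2)).
  apply (smooth_alg everywhere (fun g => g = I \/ g = (fun x => x) \/ g = atan)); [|apply alg_in; auto].
  intros g [-> | [-> | ->]].
  - exists (fun x => (fun _ => -2) x * (x * (I x * I x))). split.
    + apply alg_mult; [apply alg_const|]. apply (alg_mult _ (fun x => x)); [apply alg_in; auto|].
      apply alg_mult; apply alg_in; auto.
    + intros x _. unfold I. assert (0 <= x ^ 2) by apply pow2_ge_0.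
      auto_derive; [lra|field; lra].
  - exists (fun _ => 1). split; [apply alg_const|]. intros. apply @is_derive_id.
  - exists I. split; [apply alg_in; auto|]. intros x _. unfold I. auto_derive; auto.
    assert (0 <= x ^ 2) by apply pow2_ge_0. field; lra.
Qed.

Lemma smooth_bounded (a b : R) (f : R -> R) : 0 < a -> smooth positive f ->
  exists C, 0 <= C /\ forall x y, a <= x <= b -> a <= y <= b ->
    Rabs (f x) <= C /\ Rabs (f x - f y) <= C * Rabs (x - y).
Proof.
  intros Ha Hf.
  assert (B : forall g, smooth positive g -> exists C, 0 <= C /\ forall x, a <= x <= b -> Rabs (g x) <= C).
  { intros g Hg. destruct (Rle_lt_dec a b) as [Hab|Hab].
    - destruct (continuity_ab_maj (fun x => Rabs (g x)) a b Hab) as (c & Hc & _).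
      + intros c Hc. apply continuity_pt_filterlim.
        apply (continuous_comp g Rabs); [apply (smooth_continuous positive); auto; unfold positive; lra|].
        apply continuous_Rabs.
      + exists (Rabs (g c)). split; [apply Rabs_pos|auto].
    - exists 0. split; [lra|intros; lra]. }
  destruct (smooth_derive _ _ Hf) as (f' & Sf' & Df).
  destruct (B f Hf) as (C1 & P1 & H1). destruct (B f' Sf') as (C2 & P2 & H2).
  exists (C1 + C2). split; [lra|]. intros x y Hx Hy. split.
  - specialize (H1 x Hx). lra.
  - destruct (MVT_gen f y x f') as (c & Hc & E).
    + intros z Hz. apply Df. unfold positive. assert (a <= Rmin y x) by (apply Rmin_glb; lra). lra.
    + intros z Hz. apply continuity_pt_filterlim. apply (smooth_continuous positive); auto.
      unfold positive. assert (a <= Rmin y x) by (apply Rmin_glb; lra). lra.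
    + rewrite E, Rabs_mult. apply Rmult_le_compat_r; [apply Rabs_pos|].
      assert (a <= c <= b).
      { assert (a <= Rmin y x) by (apply Rmin_glb; lra).
        assert (Rmax y x <= b) by (apply Rmax_lub; lra). lra. }
      specialize (H2 c H). lra.
Qed.

(** This class is closed under products, partial derivatives, primitives in theta and substitution
    of a smooth theta = tau(r), which are the operations of the averaging recursion. Calculus in two
    variables is thereby reduced to one variable. *)
Inductive Sep : (R -> R -> R) -> Prop :=
| Sep_prod a b : smooth positive a -> smooth everywhere b -> Sep (fun th r => a r * b th)
| Sep_plus f g : Sep f -> Sep g -> Sep (fun th r => f th r + g th r)
| Sep_ext f g : (forall th r, 0 < r -> f th r = g th r) -> Sep f -> Sep g.

Lemma Sep_r (a : R -> R) : smooth positive a -> Sep (fun _ r => a r).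
Proof.
  intros Ha. apply Sep_ext with (fun th r => a r * (fun _ => 1) th); [intros; ring|].
  apply Sep_prod; auto. apply smooth_const.
Qed.

Lemma Sep_th (b : R -> R) : smooth everywhere b -> Sep (fun th _ => b th).
Proof.
  intros Ha. apply Sep_ext with (fun th r => (fun _ => 1) r * b th); [intros; ring|].
  apply Sep_prod; auto. apply smooth_const.
Qed.

Lemma Sep_mult (f g : R -> R -> R) : Sep f -> Sep g -> Sep (fun th r => f th r * g th r).
Proof.
  intros Hf Hg. revert f Hf.
  assert (A : forall a b, smooth positive a -> smooth everywhere b -> forall f, Sep f ->
    Sep (fun th r => f th r * (a r * b th))).
  { intros a b Ha Hb f Hf. induction Hf as [a' b' Ha' Hb'|f1 f2 _ H1 _ H2|f1 f2 E _ H1].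
    - apply Sep_ext with (fun th r => (a' r * a r) * (b' th * b th)); [intros; ring|].
      apply (Sep_prod (fun r => a' r * a r) (fun th => b' th * b th)); now apply smooth_mult.
    - eapply Sep_ext; [|exact (Sep_plus _ _ H1 H2)]. intros; simpl; ring.
    - eapply Sep_ext; [|exact H1]. intros th r Hr; simpl. now rewrite E. }
  induction Hg as [a b Ha Hb|g1 g2 _ H1 _ H2|g1 g2 E _ H1]; intros f Hf.
  - now apply A.
  - eapply Sep_ext; [|exact (Sep_plus _ _ (H1 f Hf) (H2 f Hf))]. intros; simpl; ring.
  - eapply Sep_ext; [|exact (H1 f Hf)]. intros th r Hr; simpl. now rewrite E.
Qed.

Lemma Sep_const (c : R) : Sep (fun _ _ => c).
Proof. apply (Sep_r (fun _ => c)), smooth_const. Qed.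

Lemma Sep_scal (c : R) (f : R -> R -> R) : Sep f -> Sep (fun th r => c * f th r).
Proof. intros Hf. apply (Sep_mult (fun _ _ => c)); auto. apply Sep_const. Qed.

Lemma Sep_opp (f : R -> R -> R) : Sep f -> Sep (fun th r => - f th r).
Proof. intros Hf. apply Sep_ext with (fun th r => -1 * f th r); [intros; ring|now apply Sep_scal]. Qed.

Lemma Sep_minus (f g : R -> R -> R) : Sep f -> Sep g -> Sep (fun th r => f th r - g th r).
Proof. intros Hf Hg. apply (Sep_plus f (fun th r => - g th r)); auto. now apply Sep_opp. Qed.

(** The field [grad_chain] records the chain rule along a curve, which does not follow from the
    existence of partial derivatives alone. *)
Record is_grad (f fth fr : R -> R -> R) : Prop := {
  grad_th : forall th r, 0 < r -> is_derive (fun s => f s r) th (fth th r);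
  grad_r : forall th r, 0 < r -> is_derive (fun x => f th x) r (fr th r);
  grad_chain : forall (rho : R -> R) th l, 0 < rho th -> is_derive rho th l ->
    is_derive (fun s => f s (rho s)) th (fth th (rho th) + fr th (rho th) * l) }.

Lemma locally_pos (rho : R -> R) (th : R) : 0 < rho th -> continuous rho th ->
  locally th (fun s => 0 < rho s).
Proof. intros Hp Hc. apply (Hc (fun y => 0 < y)). apply (open_gt 0 (rho th) Hp). Qed.

Lemma Sep_grad (f : R -> R -> R) : Sep f ->
  exists fth fr, Sep fth /\ Sep fr /\ is_grad f fth fr.
Proof.
  intros Hf. induction Hf as [a b Ha Hb|f g _ [fth [fr (S1 & S2 & G)]] _ [gth [gr (T1 & T2 & K)]]
    |f g E _ [fth [fr (S1 & S2 & G)]]].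
  - destruct (smooth_derive _ _ Ha) as (a' & Sa & Da). destruct (smooth_derive _ _ Hb) as (b' & Sb & Db).
    exists (fun th r => a r * b' th), (fun th r => a' r * b th).
    split; [now apply Sep_prod|]. split; [now apply Sep_prod|]. constructor.
    + intros th r Hr. apply is_derive_scal. now apply Db.
    + intros th r Hr.
      apply is_derive_ext with (fun x => b th * a x); [intros; apply Rmult_comm|].
      rewrite Rmult_comm. apply is_derive_scal. now apply Da.
    + intros rho th l Hp Hd.
      evar_last; [apply @is_derive_mult|].
      * apply (is_derive_comp a rho); [apply Da; exact Hp|exact Hd].
      * apply Db; exact I.
      * intros; apply Rmult_comm.
      * unfold plus, mult, scal; simpl; unfold mult; simpl. ring.
  - exists (fun th r => fth th r + gth th r), (fun th r => fr th r + gr th r).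
    split; [now apply Sep_plus|]. split; [now apply Sep_plus|].
    destruct G as [G1 G2 G3], K as [K1 K2 K3]. constructor.
    + intros. apply @is_derive_plus; auto.
    + intros. apply @is_derive_plus; auto.
    + intros rho th l Hp Hd. evar_last; [apply @is_derive_plus; [apply G3|apply K3]; eassumption|].
      unfold plus; simpl. ring.
  - exists fth, fr. split; auto. split; auto. destruct G as [G1 G2 G3]. constructor.
    + intros th r Hr. apply is_derive_ext with (fun s => f s r); auto.
    + intros th r Hr. apply is_derive_ext_loc with (fun x => f th x); auto.
      apply locally_pos with (rho := fun x => x) in Hr; [|apply continuous_id].
      revert Hr. apply filter_imp. auto.
    + intros rho th l Hp Hd. apply is_derive_ext_loc with (fun s => f s (rho s)); auto.
      assert (L := locally_pos rho th Hp ltac:(apply @ex_derive_continuous; eexists; exact Hd)).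
      revert L. apply filter_imp. auto.
Qed.

Lemma Sep_prim (f : R -> R -> R) : Sep f ->
  exists F, Sep F /\ forall th r, 0 < r -> is_derive (fun s => F s r) th (f th r).
Proof.
  intros Hf. induction Hf as [a b Ha Hb|f g _ [F (S1 & D1)] _ [G (S2 & D2)]|f g E _ [F (S1 & D1)]].
  - destruct (smooth_prim b Hb) as (B & SB & DB). exists (fun th r => a r * B th).
    split; [now apply Sep_prod|]. intros th r Hr. now apply is_derive_scal.
  - exists (fun th r => F th r + G th r). split; [now apply Sep_plus|].
    intros. apply @is_derive_plus; auto.
  - exists F. split; auto. intros th r Hr. rewrite <- E; auto.
Qed.

Lemma Sep_subst (tau : R -> R) (f : R -> R -> R) : smooth positive tau -> Sep f ->
  Sep (fun _ r => f (tau r) r).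
Proof.
  intros Ht Hf. induction Hf as [a b Ha Hb|f g _ H1 _ H2|f g E _ H1].
  - apply (Sep_r (fun r => a r * b (tau r))). apply smooth_mult; auto.
    apply (smooth_comp positive everywhere); auto. intros; exact I.
  - now apply Sep_plus.
  - eapply Sep_ext; [|exact H1]. intros th r Hr; simpl; auto.
Qed.

Lemma Sep_bounded (a b T : R) (f : R -> R -> R) : 0 < a -> Sep f ->
  exists C, 0 <= C /\ forall th x y, 0 <= th <= T -> a <= x <= b -> a <= y <= b ->
    Rabs (f th x) <= C /\ Rabs (f th x - f th y) <= C * Rabs (x - y).
Proof.
  intros Ha Hf. induction Hf as [p q Hp Hq|f g _ [C (P1 & H1)] _ [K (P2 & H2)]|f g E _ [C (P1 & H1)]].
  - destruct (smooth_bounded a b p Ha Hp) as (C & PC & HC).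
    assert (exists K, 0 <= K /\ forall th, 0 <= th <= T -> Rabs (q th) <= K) as (K & PK & HK).
    { destruct (Rle_lt_dec 0 T) as [HT|HT].
      - destruct (continuity_ab_maj (fun x => Rabs (q x)) 0 T HT) as (c & Hc & _).
        + intros c Hc. apply continuity_pt_filterlim.
          apply (continuous_comp q Rabs); [apply (smooth_continuous everywhere); auto; exact I|].
          apply continuous_Rabs.
        + exists (Rabs (q c)). split; [apply Rabs_pos|auto].
      - exists 0. split; [lra|intros; lra]. }
    exists (C * K). split; [now apply Rmult_le_pos|].
    intros th x y Ht Hx Hy. destruct (HC x y Hx Hy) as [B1 B2]. specialize (HK th Ht).
    split.
    + rewrite Rabs_mult. apply Rmult_le_compat; auto; apply Rabs_pos.
    + replace (p x * q th - p y * q th) with ((p x - p y) * q th) by ring.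
      rewrite Rabs_mult. replace (C * K * Rabs (x - y)) with (C * Rabs (x - y) * K) by ring.
      apply Rmult_le_compat; auto; apply Rabs_pos.
  - exists (C + K). split; [lra|]. intros th x y Ht Hx Hy.
    destruct (H1 th x y Ht Hx Hy) as [A1 A2]. destruct (H2 th x y Ht Hx Hy) as [B1 B2]. split.
    + eapply Rle_trans; [apply Rabs_triang|lra].
    + replace (f th x + g th x - (f th y + g th y)) with ((f th x - f th y) + (g th x - g th y)) by ring.
      eapply Rle_trans; [apply Rabs_triang|lra].
  - exists C. split; auto. intros th x y Ht Hx Hy. rewrite <- !E by lra. auto.
Qed.

Lemma Sep_continuous (f : R -> R -> R) (rho : R -> R) (th : R) : Sep f -> 0 < rho th ->
  continuous rho th -> continuous (fun s => f s (rho s)) th.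
Proof.
  intros Hf Hp Hc. induction Hf as [a b Ha Hb|f g _ H1 _ H2|f g E _ H1].
  - apply @continuous_mult.
    + apply (continuous_comp rho a); auto. now apply (smooth_continuous positive).
    + now apply (smooth_continuous everywhere).
  - now apply @continuous_plus.
  - apply continuous_ext_loc with (fun s => f s (rho s)); auto.
    assert (L := locally_pos rho th Hp Hc). revert L. apply filter_imp. auto.
Qed.

(** * The switching angle *)

(* With t = exp x, a = m and b = n the equation y^n = x^m on the circle of radius r reads
   Gsw a b x = (m - n) ln r. *)
Definition Gsw (a b x : R) : R := b * x + (a - b) / 2 * ln (1 + exp (2 * x)).
Definition dGsw (a b x : R) : R := (b + a * exp (2 * x)) / (1 + exp (2 * x)).

Lemma is_derive_Gsw (a b x : R) : is_derive (Gsw a b) x (dGsw a b x).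
Proof.
  unfold Gsw, dGsw. assert (0 < exp (2 * x)) by apply exp_pos.
  auto_derive; [lra|]. field. lra.
Qed.

(** [dGsw] is a weighted mean of a and b with weights exp (2 x) and 1. The bound makes [Gsw]
    invertible with a 1-Lipschitz inverse. *)
Lemma dGsw_ge1 (a b x : R) : 1 <= a -> 1 <= b -> 1 <= dGsw a b x.
Proof.
  intros Ha Hb. unfold dGsw. assert (0 < exp (2 * x)) by apply exp_pos.
  apply Rle_div_r; nra.
Qed.

Lemma Gsw_slope (a b x y : R) : 1 <= a -> 1 <= b -> x <= y -> y - x <= Gsw a b y - Gsw a b x.
Proof.
  intros Ha Hb Hxy. destruct (MVT_gen (Gsw a b) x y (dGsw a b)) as (c & _ & E).
  - intros; apply is_derive_Gsw.
  - intros z _. apply continuity_pt_filterlim, @ex_derive_continuous. eexists; apply is_derive_Gsw.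
  - rewrite E. assert (H := dGsw_ge1 a b c Ha Hb). nra.
Qed.

Lemma Gsw_inv (a b y : R) : 1 <= a -> 1 <= b -> {x | Gsw a b x = y}.
Proof.
  intros Ha Hb. set (M := Rabs (y - Gsw a b 0)).
  assert (0 <= M) as HM by apply Rabs_pos.
  assert (- M <= y - Gsw a b 0 <= M) as HM2 by (apply Rabs_le_between; unfold M; lra).
  destruct (IVT_gen (Gsw a b) (- M) M y) as (x & _ & Hx).
  - intros z. apply continuity_pt_filterlim, @ex_derive_continuous. eexists; apply is_derive_Gsw.
  - assert (H1 := Gsw_slope a b (- M) 0 Ha Hb ltac:(lra)).
    assert (H2 := Gsw_slope a b 0 M Ha Hb HM).
    rewrite Rmin_left, Rmax_right by lra. lra.
  - now exists x.
Qed.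

Definition Xsw (a b : R) (Ha : 1 <= a) (Hb : 1 <= b) (y : R) : R := proj1_sig (Gsw_inv a b y Ha Hb).

Lemma Gsw_Xsw (a b : R) Ha Hb y : Gsw a b (Xsw a b Ha Hb y) = y.
Proof. unfold Xsw. now destruct (Gsw_inv a b y Ha Hb). Qed.

Lemma Xsw_lip (a b : R) Ha Hb x y : Rabs (Xsw a b Ha Hb x - Xsw a b Ha Hb y) <= Rabs (x - y).
Proof.
  set (u := Xsw a b Ha Hb x). set (v := Xsw a b Ha Hb y).
  assert (Eu : Gsw a b u = x) by apply Gsw_Xsw. assert (Ev : Gsw a b v = y) by apply Gsw_Xsw.
  destruct (Rle_lt_dec u v) as [H|H].
  - assert (S := Gsw_slope a b u v Ha Hb H). rewrite !Rabs_left1; lra.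
  - assert (S := Gsw_slope a b v u Ha Hb (Rlt_le _ _ H)). rewrite !Rabs_right; lra.
Qed.

Lemma is_derive_Xsw (a b : R) Ha Hb y :
  is_derive (Xsw a b Ha Hb) y (/ dGsw a b (Xsw a b Ha Hb y)).
Proof.
  apply is_derive_Reals. intros eps Heps.
  set (X := Xsw a b Ha Hb) in *.
  assert (C : continuous (fun x => / dGsw a b x) (X y)).
  { apply @ex_derive_continuous. unfold dGsw.
    assert (0 < exp (2 * X y)) by apply exp_pos.
    auto_derive. repeat split; try lra. apply Rgt_not_eq, Rdiv_lt_0_compat; nra. }
  destruct (C (ball (/ dGsw a b (X y)) (mkposreal eps Heps))) as [del Hdel]; [apply locally_ball|].
  exists del. intros h Hh Hhd.
  destruct (MVT_gen (Gsw a b) (X y) (X (y + h)) (dGsw a b)) as (c & Hc & E).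
  - intros; apply is_derive_Gsw.
  - intros z _. apply continuity_pt_filterlim, @ex_derive_continuous. eexists; apply is_derive_Gsw.
  - unfold X in E. rewrite !Gsw_Xsw in E. fold X in E.
    assert (Hd := dGsw_ge1 a b c Ha Hb).
    replace ((X (y + h) - X y) / h) with (/ dGsw a b c).
    + apply (Hdel c). unfold ball; simpl; unfold AbsRing_ball, abs, minus, plus, opp; simpl.
      apply Rle_lt_trans with (2 := Hhd).
      replace h with (y + h - y) by ring.
      apply Rle_trans with (Rabs (X (y + h) - X y)); [|apply Xsw_lip].
      unfold Rmin, Rmax in Hc. destruct (Rle_dec (X y) (X (y + h))).
      * rewrite !Rabs_right; lra.
      * rewrite !Rabs_left1; lra.
    + replace h with (dGsw a b c * (X (y + h) - X y)) at 2 by lra.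
      assert (X (y + h) - X y <> 0) by (intro Z; rewrite Z in E; apply Hh; lra).
      field. split; [assumption|lra].
Qed.

(** With E = exp (2 X) and I = 1/(b + a E) the inverse satisfies X' = (1 + E) I, and the derivatives
    of E and I are again polynomials in E and I; so X, E, I generate a class closed under
    differentiation. *)
Lemma smooth_Xsw (a b : R) Ha Hb : smooth everywhere (Xsw a b Ha Hb).
Proof.
  set (X := Xsw a b Ha Hb).
  set (E := fun y => exp (2 * X y)). set (I := fun y => / (b + a * E y)).
  assert (HE : forall y, 0 < E y) by (intros; apply exp_pos).
  assert (DX : forall y, is_derive X y ((1 + E y) * I y)).
  { intros y. evar_last; [apply is_derive_Xsw|]. unfold dGsw. fold X. fold (E y). unfold I.
    specialize (HE y). field. split; nra. }
  assert (DE : forall y, is_derive E y (2 * (E y * ((1 + E y) * I y)))).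
  { intros y. evar_last.
    - apply (is_derive_comp exp (fun y => 2 * X y)); [apply is_derive_exp|].
      apply is_derive_scal. apply DX.
    - unfold scal; simpl; unfold mult; simpl. fold (E y). ring. }
  assert (DI : forall y, is_derive I y (- a * (I y * (I y * (2 * (E y * ((1 + E y) * I y))))))).
  { intros y. specialize (HE y). unfold I at 1.
    evar_last.
    - apply is_derive_inv; [|nra].
      apply (is_derive_plus (fun _ => b) (fun y => a * E y)); [apply is_derive_const|].
      apply is_derive_scal. apply DE.
    - unfold plus, zero, scal; simpl; unfold mult; simpl. unfold I. field. nra. }
  set (P := fun g : R -> R => g = X \/ g = E \/ g = I).
  assert (AE : alg P E) by (apply alg_in; unfold P; auto).
  assert (AI : alg P I) by (apply alg_in; unfold P; auto).
  assert (AD : alg P (fun y => (1 + E y) * I y)).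
  { apply (alg_mult P (fun y => 1 + E y)); auto. apply (alg_plus P (fun _ => 1)); auto. apply alg_const. }
  assert (AD2 : alg P (fun y => 2 * (E y * ((1 + E y) * I y)))).
  { apply (alg_mult P (fun _ => 2)); [apply alg_const|]. now apply (alg_mult P E). }
  apply (smooth_alg everywhere P); [|apply alg_in; unfold P; auto].
  intros g [-> | [-> | ->]]; eexists; (split; [|intros y _]).
  - exact AD.
  - apply DX.
  - exact AD2.
  - apply DE.
  - apply (alg_mult P (fun _ => - a)); [apply alg_const|].
    apply (alg_mult P I); auto. apply (alg_mult P I); auto. exact AD2.
  - apply DI.
Qed.

Lemma INR_ge1 (n : nat) : (0 < n)%nat -> 1 <= INR n.
Proof. intros H. change 1 with (INR 1). apply le_INR. lia. Qed.

Definition switch_slope (m n : nat) (Hm : (0 < m)%nat) (Hn : (0 < n)%nat) (r : R) : R :=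
  exp (Xsw (INR m) (INR n) (INR_ge1 m Hm) (INR_ge1 n Hn) ((INR m - INR n) * ln r)).

Section Switching.

Context (m n : nat) (Hm : (0 < m)%nat) (Hn : (0 < n)%nat).
Let t := switch_slope m n Hm Hn.
Definition switch_angle (r : R) : R := atan (switch_slope m n Hm Hn r).

Lemma switch_slope_pos r : 0 < t r.
Proof. apply exp_pos. Qed.

Lemma switch_slope_eq r : INR n * ln (t r) + (INR m - INR n) / 2 * ln (1 + t r ^ 2) = (INR m - INR n) * ln r.
Proof.
  unfold t, switch_slope. set (x := Xsw _ _ _ _ _).
  rewrite ln_exp. replace (exp x ^ 2) with (exp (2 * x)).
  - apply Gsw_Xsw.
  - replace (2 * x) with (x + x) by ring. rewrite exp_plus. ring.
Qed.

Lemma smooth_switch_slope : smooth positive t.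
Proof.
  unfold t, switch_slope. apply (smooth_comp positive everywhere exp); [apply smooth_exp| |intros; exact I].
  apply (smooth_comp positive everywhere (Xsw _ _ _ _)); [apply smooth_Xsw| |intros; exact I].
  apply smooth_mult; [apply smooth_const|apply smooth_ln].
Qed.

Lemma is_derive_switch_slope r : 0 < r ->
  is_derive t r ((INR m - INR n) * t r * (1 + t r ^ 2) / (r * (INR n + INR m * t r ^ 2))).
Proof.
  intros Hr. unfold t, switch_slope. evar_last.
  - apply (is_derive_comp exp (fun r => Xsw _ _ _ _ ((INR m - INR n) * ln r))); [apply is_derive_exp|].
    apply (is_derive_comp (Xsw (INR m) (INR n) (INR_ge1 m Hm) (INR_ge1 n Hn)) (fun r => (INR m - INR n) * ln r)).
    + apply is_derive_Xsw.
    + apply is_derive_scal. apply is_derive_Reals, derivable_pt_lim_ln. exact Hr.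
  - unfold dGsw. set (x := Xsw _ _ _ _ _). unfold scal; simpl; unfold mult; simpl.
    replace (exp (2 * x)) with (exp x ^ 2).
    + set (T := exp x). assert (0 < T ^ 2) by (apply pow_lt, exp_pos).
      generalize (INR_ge1 m Hm), (INR_ge1 n Hn). intros. change (T * (T * 1)) with (T ^ 2). field.
      repeat split; try lra; nra.
    + replace (2 * x) with (x + x) by ring. rewrite exp_plus. ring.
Qed.

Lemma switch_slope_surj T : m <> n -> 0 < T -> exists r, 0 < r /\ t r = T.
Proof.
  intros Hmn HT.
  assert (INR m - INR n <> 0) as Hne by (apply not_INR in Hmn; lra).
  set (a := INR m) in *. set (b := INR n) in *.
  set (l := (b * ln T + (a - b) / 2 * ln (1 + T ^ 2)) / (a - b)).
  exists (exp l). split; [apply exp_pos|].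
  unfold t, switch_slope. fold a b. rewrite ln_exp.
  replace ((a - b) * l) with (Gsw a b (ln T)).
  2:{ unfold Gsw, l. replace (exp (2 * ln T)) with (T ^ 2).
      - field. exact Hne.
      - replace (2 * ln T) with (ln T + ln T) by ring. rewrite exp_plus, exp_ln by assumption. ring. }
  set (x := Xsw _ _ _ _ _).
  assert (x = ln T) as ->; [|now apply exp_ln].
  assert (E : Gsw a b x = Gsw a b (ln T)) by apply Gsw_Xsw.
  destruct (Rle_lt_dec x (ln T)) as [H|H].
  - assert (S := Gsw_slope a b _ _ (INR_ge1 m Hm) (INR_ge1 n Hn) H). lra.
  - assert (S := Gsw_slope a b _ _ (INR_ge1 m Hm) (INR_ge1 n Hn) (Rlt_le _ _ H)). lra.
Qed.

Lemma switch_angle_bound r : 0 < switch_angle r < PI / 2.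
Proof.
  unfold switch_angle. split; [|apply atan_bound].
  rewrite <- atan_0. apply atan_increasing. apply switch_slope_pos.
Qed.

Lemma smooth_switch_angle : smooth positive switch_angle.
Proof.
  apply (smooth_comp positive everywhere atan); [apply smooth_atan|apply smooth_switch_slope|intros; exact I].
Qed.

(** Taking logarithms turns the comparison of y^n with x^m into a comparison of values of the
    increasing function [Gsw] at ln tan th and at ln t(r). *)
Lemma swf_quadrant r th : 0 < r -> 0 < th < PI / 2 ->
  (th < switch_angle r -> swf m n (r * cos th) (r * sin th) < 0) /\
  (switch_angle r < th -> 0 < swf m n (r * cos th) (r * sin th)).
Proof.
  intros Hr Hth.
  assert (0 < cos th) as Hc by (apply cos_gt_0; lra).
  assert (0 < sin th) as Hs by (apply sin_gt_0; lra).
  set (T := tan th). assert (0 < T) as HT by (unfold T; apply tan_gt_0; lra).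
  assert (atan T = th) as Eth by (unfold T; apply atan_tan; lra).
  assert (Es : sin th = T * cos th) by (unfold T, tan; field; lra).
  assert (Ec : 1 + T ^ 2 = / (cos th * cos th)).
  { assert (cos th * cos th * (1 + T ^ 2) = 1).
    { replace (cos th * cos th * (1 + T ^ 2)) with ((T * cos th) * (T * cos th) + cos th * cos th) by ring.
      rewrite <- Es. apply (sin2_cos2 th). }
    apply Rmult_eq_reg_l with (cos th * cos th); [|nra]. rewrite Rinv_r by nra. exact H. }
  assert (Elc : ln (1 + T ^ 2) = - 2 * ln (cos th)).
  { rewrite Ec, ln_Rinv by nra. rewrite ln_mult by assumption. ring. }
  set (a := INR m). set (b := INR n).
  assert (L : ln ((r * sin th) ^ n) - ln ((r * cos th) ^ m) =
    Gsw a b (ln T) - Gsw a b (ln (t r))).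
  { rewrite !ln_pow by (apply Rmult_lt_0_compat; assumption). fold a b.
    rewrite !ln_mult by assumption.
    assert (E := switch_slope_eq r). fold a b in E.
    unfold Gsw. replace (exp (2 * ln T)) with (1 + T ^ 2 - 1).
    2:{ replace (2 * ln T) with (ln T + ln T) by ring. rewrite exp_plus, exp_ln by assumption. ring. }
    replace (exp (2 * ln (t r))) with (t r ^ 2).
    2:{ replace (2 * ln (t r)) with (ln (t r) + ln (t r)) by ring.
        rewrite exp_plus, exp_ln by apply switch_slope_pos. ring. }
    rewrite E. replace (1 + (1 + T ^ 2 - 1)) with (1 + T ^ 2) by ring. rewrite Elc.
    rewrite Es, ln_mult by assumption. field. }
  assert (Hp1 : 0 < (r * sin th) ^ n) by (apply pow_lt, Rmult_lt_0_compat; assumption).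
  assert (Hp2 : 0 < (r * cos th) ^ m) by (apply pow_lt, Rmult_lt_0_compat; assumption).
  unfold swf, switch_angle. rewrite <- Eth. fold t. split; intros H.
  - assert (T < t r).
    { destruct (Rlt_le_dec T (t r)) as [K|[K|K]]; auto.
      - apply atan_increasing in K. lra.
      - rewrite K in H. lra. }
    assert (ln T < ln (t r)) as Hl by (apply ln_increasing; assumption).
    assert (S := Gsw_slope a b _ _ (INR_ge1 m Hm) (INR_ge1 n Hn) (Rlt_le _ _ Hl)).
    rewrite Eth. apply Rlt_minus. apply ln_lt_inv; auto. lra.
  - assert (t r < T).
    { destruct (Rlt_le_dec (t r) T) as [K|[K|K]]; auto.
      - apply atan_increasing in K. lra.
      - rewrite K in H. lra. }
    assert (ln (t r) < ln T) as Hl by (apply ln_increasing; auto; apply switch_slope_pos).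
    assert (S := Gsw_slope a b _ _ (INR_ge1 m Hm) (INR_ge1 n Hn) (Rlt_le _ _ Hl)).
    rewrite Eth. apply Rlt_Rminus. apply ln_lt_inv; auto. lra.
Qed.

Context (Em : Nat.Even m) (En : Nat.Even n).

Lemma pow_even (k : nat) (x : R) : Nat.Even k -> (- x) ^ k = x ^ k.
Proof.
  intros [p ->]. rewrite !pow_mult. f_equal. ring.
Qed.

(** The sector around the positive x-axis is cut in two at theta = 0, where orbits start. This gives
    five sectors, bounded by the four switching angles and by 0 and 2 PI. *)
Definition sector_angle (j : nat) (r : R) : R :=
  match j with
  | 0%nat => 0
  | 1%nat => switch_angle r
  | 2%nat => PI - switch_angle r
  | 3%nat => PI + switch_angle r
  | 4%nat => 2 * PI - switch_angle r
  | _ => 2 * PI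
  end.

Lemma smooth_sector_angle j : smooth positive (sector_angle j).
Proof.
  assert (Hneg : forall c, smooth positive (fun r => c + -1 * switch_angle r)).
  { intros c. apply (smooth_plus positive (fun _ => c)); [apply smooth_const|].
    apply (smooth_mult positive (fun _ => -1)); [apply smooth_const|apply smooth_switch_angle]. }
  assert (Hext : forall f g : R -> R, (forall x, f x = g x) -> smooth positive f -> smooth positive g).
  { intros f g E (P & Pf & HP). exists (fun h => P h \/ h = g). split; auto.
    intros h [Ph| ->].
    - destruct (HP h Ph) as (h' & H1 & H2). exists h'. auto.
    - destruct (HP f Pf) as (h' & H1 & H2). exists h'. split; auto.
      intros x Hx. apply is_derive_ext with f; auto. }
  destruct j as [|[|[|[|[|j]]]]]; simpl.
  - exact (smooth_const positive 0).
  - exact smooth_switch_angle.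
  - apply (Hext (fun r => PI + -1 * switch_angle r)); [intros; simpl; ring|auto].
  - apply (smooth_plus positive (fun _ => PI)); [apply smooth_const|apply smooth_switch_angle].
  - apply (Hext (fun r => 2 * PI + -1 * switch_angle r)); [intros; simpl; ring|auto].
  - exact (smooth_const positive (2 * PI)).
Qed.

Lemma sector_angle_lt j r : (j <= 4)%nat -> sector_angle j r < sector_angle (S j) r.
Proof.
  intros Hj. generalize (switch_angle_bound r), PI_RGT_0. intros.
  destruct j as [|[|[|[|[|j]]]]]; simpl; try lra. lia.
Qed.

Definition insec (j : nat) (th r : R) : Prop := sector_angle j r < th < sector_angle (S j) r.

(** Evenness of both exponents makes the switching function invariant under reflection in either
    axis, which reduces everything to the first quadrant; [A0] and [A1] settle the points on the
    axes. *)
Lemma swf_sector j r th : (j <= 4)%nat -> 0 < r -> insec j th r ->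
  (Nat.even j = true -> swf m n (r * cos th) (r * sin th) < 0) /\
  (Nat.even j = false -> 0 < swf m n (r * cos th) (r * sin th)).
Proof.
  intros Hj Hr Hin. generalize (switch_angle_bound r), PI_RGT_0. intros Hp HPI.
  assert (Eswf : forall x y, swf m n x y = swf m n (- x) y /\ swf m n x y = swf m n x (- y)).
  { intros x y. unfold swf. now rewrite !pow_even. }
  assert (Q1 : forall th, 0 < th < PI / 2 -> swf m n (r * cos th) (r * sin th)
    = swf m n (r * cos (PI - th)) (r * sin (PI - th))).
  { intros u _. rewrite Rtrigo_facts.cos_pi_minus, Rtrigo_facts.sin_pi_minus.
    replace (r * - cos u) with (- (r * cos u)) by ring. apply Eswf. }
  assert (Q2 : forall th, swf m n (r * cos th) (r * sin th)
    = swf m n (r * cos (2 * PI - th)) (r * sin (2 * PI - th))).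
  { intros u. replace (2 * PI - u) with (- u + 2 * INR 1 * PI) by (simpl; ring).
    rewrite cos_period, sin_period, cos_neg, sin_neg.
    replace (r * - sin u) with (- (r * sin u)) by ring. apply Eswf. }
  assert (A0 : swf m n (r * cos 0) (r * sin 0) < 0).
  { rewrite cos_0, sin_0, Rmult_0_r, Rmult_1_r. unfold swf. rewrite pow_i by assumption.
    assert (0 < r ^ m) by now apply pow_lt. lra. }
  assert (A1 : 0 < swf m n (r * cos (PI / 2)) (r * sin (PI / 2))).
  { rewrite cos_PI2, sin_PI2, Rmult_0_r, Rmult_1_r. unfold swf. rewrite pow_i by assumption.
    assert (0 < r ^ n) by now apply pow_lt. lra. }
  assert (B : forall u, 0 <= u <= PI ->
    (u < switch_angle r \/ PI - switch_angle r < u -> swf m n (r * cos u) (r * sin u) < 0) /\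
    (switch_angle r < u < PI - switch_angle r -> 0 < swf m n (r * cos u) (r * sin u))).
  { assert (B0 : forall u, 0 <= u <= PI / 2 ->
      (u < switch_angle r -> swf m n (r * cos u) (r * sin u) < 0) /\
      (switch_angle r < u -> 0 < swf m n (r * cos u) (r * sin u))).
    { intros u [Hu1 Hu2]. destruct (Req_dec u 0) as [->|H0]; [split; intros; [exact A0|lra]|].
      destruct (Req_dec u (PI / 2)) as [->|H1]; [split; intros; [lra|exact A1]|].
      apply swf_quadrant; lra. }
    intros u Hu. destruct (Rle_lt_dec u (PI / 2)) as [H|H].
    - destruct (B0 u) as [B1 B2]; [lra|]. split; intros K; [apply B1|apply B2]; lra.
    - replace u with (PI - (PI - u)) by ring.
      replace (swf m n (r * cos (PI - (PI - u))) (r * sin (PI - (PI - u)))) with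
        (swf m n (r * cos (PI - u)) (r * sin (PI - u))).
      2:{ rewrite Rtrigo_facts.cos_pi_minus, Rtrigo_facts.sin_pi_minus.
          replace (PI - (PI - u)) with u by ring.
          replace (r * - cos u) with (- (r * cos u)) by ring. symmetry. apply Eswf. }
      destruct (B0 (PI - u)) as [B1 B2]; [lra|]. split; intros K; [apply B1|apply B2]; lra. }
  unfold insec in Hin.
  destruct j as [|[|[|[|[|j]]]]]; simpl in Hin |- *; split; intros E; try discriminate; try lia.
  - apply B; lra.
  - apply B; lra.
  - destruct (Rle_lt_dec th PI) as [H|H]; [apply B; lra|].
    rewrite Q2. apply B; lra.
  - rewrite Q2. apply B; lra.
  - rewrite Q2. apply B; lra.
Qed.

End Switching.

(** * Expansion of the polar field in eps *)

Lemma psum_ext (k : nat) (f g : nat -> R) :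
  (forall i, (1 <= i <= k)%nat -> f i = g i) -> psum k f = psum k g.
Proof. induction k as [|k IH]; intros H; simpl; auto. rewrite IH, H; auto; intros; try apply H; lia. Qed.

Lemma psum_plus (k : nat) (f g : nat -> R) : psum k (fun i => f i + g i) = psum k f + psum k g.
Proof. induction k as [|k IH]; simpl; [ring|rewrite IH; ring]. Qed.

Lemma psum_scal (k : nat) (c : R) (f : nat -> R) : psum k (fun i => c * f i) = c * psum k f.
Proof. induction k as [|k IH]; simpl; [ring|rewrite IH; ring]. Qed.

(** The Cauchy product of two power series without constant term, truncated at order k. The inner
    sum stops at s - 1 because b starts at index 1. *)
Lemma psum_cauchy (k : nat) (e : R) (a b : nat -> R) :
  psum k (fun i => e ^ i * a i * psum (k - i) (fun l => e ^ l * b l)) =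
  psum k (fun s => e ^ s * psum (pred s) (fun l => a l * b (s - l)%nat)).
Proof.
  induction k as [|k IH]; [reflexivity|].
  cbn [psum]. rewrite Nat.sub_diag. cbn [psum]. rewrite Rmult_0_r, Rplus_0_r.
  rewrite <- IH. cbn [pred]. rewrite <- psum_scal, <- psum_plus. apply psum_ext.
  intros i Hi. replace (S k - i)%nat with (S (k - i)) by lia. cbn [psum].
  replace (e ^ S k) with (e ^ i * e ^ S (k - i)); [ring|].
  rewrite <- pow_add. f_equal. lia.
Qed.

Section OrderClass.

Context (rho1 rho2 : R) (Hrho : 0 < rho1).

(* G = O(eps^N), both in value and as a Lipschitz constant in r *)
Definition OL (N : nat) (G : R -> R -> R -> R) : Prop :=
  exists C e0, 0 <= C /\ 0 < e0 /\ forall e th x y, Rabs e < e0 -> 0 <= th <= 2 * PI ->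
    rho1 <= x <= rho2 -> rho1 <= y <= rho2 ->
    Rabs (G e th x) <= C * Rabs e ^ N /\
    Rabs (G e th x - G e th y) <= C * Rabs e ^ N * Rabs (x - y).

Lemma OL_plus N f g : OL N f -> OL N g -> OL N (fun e th r => f e th r + g e th r).
Proof.
  intros (C & e0 & HC & He & H) (K & e1 & HK & He1 & H1).
  exists (C + K), (Rmin e0 e1). split; [lra|]. split; [now apply Rmin_glb_lt|].
  intros e th x y Hlt Hth Hx Hy.
  destruct (H e th x y) as [A1 A2]; auto. { apply Rlt_le_trans with (1 := Hlt), Rmin_l. }
  destruct (H1 e th x y) as [B1 B2]; auto. { apply Rlt_le_trans with (1 := Hlt), Rmin_r. }
  split.
  - eapply Rle_trans; [apply Rabs_triang|]. lra.
  - replace (f e th x + g e th x - (f e th y + g e th y))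
      with ((f e th x - f e th y) + (g e th x - g e th y)) by ring.
    eapply Rle_trans; [apply Rabs_triang|]. lra.
Qed.

Lemma OL_mult N M f g : OL N f -> OL M g -> OL (N + M) (fun e th r => f e th r * g e th r).
Proof.
  intros (C & e0 & HC & He & H) (K & e1 & HK & He1 & H1).
  exists (2 * (C * K)), (Rmin e0 e1). assert (0 <= C * K) by now apply Rmult_le_pos.
  split; [lra|]. split; [now apply Rmin_glb_lt|].
  intros e th x y Hlt Hth Hx Hy.
  destruct (H e th x y) as [A1 A2]; auto. { apply Rlt_le_trans with (1 := Hlt), Rmin_l. }
  destruct (H e th y x) as [A3 _]; auto. { apply Rlt_le_trans with (1 := Hlt), Rmin_l. }
  destruct (H1 e th x y) as [B1 B2]; auto. { apply Rlt_le_trans with (1 := Hlt), Rmin_r. }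
  rewrite pow_add.
  set (p := Rabs e ^ N) in *. set (q := Rabs e ^ M) in *.
  assert (0 <= p) by (apply pow_le, Rabs_pos). assert (0 <= q) by (apply pow_le, Rabs_pos).
  assert (0 <= Rabs (x - y)) as Hxy by apply Rabs_pos. set (d := Rabs (x - y)) in *.
  assert (0 <= C * K * (p * q)) by (repeat apply Rmult_le_pos; auto).
  split.
  - rewrite Rabs_mult. apply Rle_trans with (C * p * (K * q)); [apply Rmult_le_compat; auto; apply Rabs_pos|lra].
  - replace (f e th x * g e th x - f e th y * g e th y)
      with ((f e th x - f e th y) * g e th x + f e th y * (g e th x - g e th y)) by ring.
    eapply Rle_trans; [apply Rabs_triang|]. rewrite !Rabs_mult.
    apply Rle_trans with (C * p * d * (K * q) + C * p * (K * q * d)); [|lra].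
    apply Rplus_le_compat; apply Rmult_le_compat; auto; apply Rabs_pos.
Qed.

Lemma OL_le N M f : (M <= N)%nat -> OL N f -> OL M f.
Proof.
  intros HNM (C & e0 & HC & He & H).
  exists C, (Rmin e0 1). split; auto. split; [apply Rmin_glb_lt; lra|].
  intros e th x y Hlt Hth Hx Hy.
  destruct (H e th x y) as [A1 A2]; auto. { apply Rlt_le_trans with (1 := Hlt), Rmin_l. }
  assert (Rabs e <= 1) as He1. { left. apply Rlt_le_trans with (1 := Hlt), Rmin_r. }
  assert (Rabs e ^ N <= Rabs e ^ M).
  { replace N with (M + (N - M))%nat by lia. rewrite pow_add.
    rewrite <- (Rmult_1_r (Rabs e ^ M)) at 2. apply Rmult_le_compat_l; [apply pow_le, Rabs_pos|].
    rewrite <- (pow1 (N - M)). apply pow_incr. split; [apply Rabs_pos|exact He1]. }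
  split.
  - apply Rle_trans with (1 := A1). now apply Rmult_le_compat_l.
  - apply Rle_trans with (1 := A2). apply Rmult_le_compat_r; [apply Rabs_pos|]. now apply Rmult_le_compat_l.
Qed.

Lemma OL_ext N f g e1 : 0 < e1 ->
  (forall e th x, Rabs e < e1 -> 0 <= th <= 2 * PI -> rho1 <= x <= rho2 -> f e th x = g e th x) ->
  OL N f -> OL N g.
Proof.
  intros He1 E (C & e0 & HC & He & H).
  exists C, (Rmin e0 e1). split; auto. split; [now apply Rmin_glb_lt|].
  intros e th x y Hlt Hth Hx Hy.
  assert (Rabs e < e1) by (apply Rlt_le_trans with (1 := Hlt), Rmin_r).
  rewrite <- !E by auto. apply H; auto. apply Rlt_le_trans with (1 := Hlt), Rmin_l.
Qed.

Lemma OL_ext' N f g : (forall e th x, rho1 <= x <= rho2 -> f e th x = g e th x) -> OL N f -> OL N g.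
Proof. intros E. apply (OL_ext N f g 1 Rlt_0_1). auto. Qed.

Lemma OL_Sep f : Sep f -> OL 0 (fun _ => f).
Proof.
  intros Hf. destruct (Sep_bounded rho1 rho2 (2 * PI) f Hrho Hf) as (C & HC & H).
  exists C, 1. split; auto. split; [lra|]. intros e th x y _ Hth Hx Hy.
  simpl. rewrite Rmult_1_r. now apply H.
Qed.

Lemma OL_eps i : OL i (fun e _ _ => e ^ i).
Proof.
  exists 1, 1. split; [lra|]. split; [lra|]. intros e th x y _ _ _ _.
  rewrite RPow_abs. split; [lra|].
  replace (e ^ i - e ^ i) with 0 by ring. rewrite Rabs_R0, Rmult_1_l.
  apply Rmult_le_pos; apply Rabs_pos.
Qed.

Lemma OL_term i f : Sep f -> OL i (fun e th r => e ^ i * f th r).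
Proof.
  intros Hf. replace i with (i + 0)%nat at 1 by lia.
  apply (OL_mult i 0 (fun e _ _ => e ^ i) (fun _ => f)); [apply OL_eps|now apply OL_Sep].
Qed.

Lemma OL_0 N : OL N (fun _ _ _ => 0).
Proof.
  exists 0, 1. split; [lra|]. split; [lra|]. intros. rewrite Rminus_0_r, Rabs_R0, !Rmult_0_l. lra.
Qed.

Lemma OL_psum N k (f : nat -> R -> R -> R -> R) :
  (forall i, (1 <= i <= k)%nat -> OL N (f i)) -> OL N (fun e th r => psum k (fun i => f i e th r)).
Proof.
  induction k as [|k IH]; intros H; simpl; [apply OL_0|].
  apply (OL_plus N (fun e th r => psum k (fun i => f i e th r)) (f (S k))).
  - apply IH. intros; apply H; lia.
  - apply H; lia.
Qed.

Lemma OL_opp N f : OL N f -> OL N (fun e th r => - f e th r).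
Proof.
  intros (C & e0 & HC & He & H). exists C, e0. split; auto. split; auto.
  intros e th x y H1 H2 H3 H4. destruct (H e th x y) as [A B]; auto.
  split; [now rewrite Rabs_Ropp|].
  replace (- f e th x - - f e th y) with (- (f e th x - f e th y)) by ring. now rewrite Rabs_Ropp.
Qed.

Lemma OL_tail k M (f : nat -> R -> R -> R) : (M <= k)%nat -> (forall i, Sep (f i)) ->
  OL (S M) (fun e th r => psum k (fun i => e ^ i * f i th r) - psum M (fun i => e ^ i * f i th r)).
Proof.
  intros HMk Hf. induction HMk as [|k HMk IH].
  - apply OL_ext' with (fun _ _ _ => 0); [intros; ring|apply OL_0].
  - eapply OL_ext'; [|eapply (OL_plus _ _ (fun e th r => e ^ S k * f (S k) th r) IH)].
    2:{ apply (OL_le (S k)); [lia|apply (OL_term (S k) (f (S k))), Hf]. }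
    intros e th x _. simpl. ring.
Qed.

Lemma OL_inv_1minus b : OL 1 b ->
  OL 0 (fun e th r => / (1 - b e th r)) /\
  exists e0, 0 < e0 /\ forall e th x, Rabs e < e0 -> 0 <= th <= 2 * PI -> rho1 <= x <= rho2 ->
    1 / 2 <= 1 - b e th x.
Proof.
  intros (C & e0 & HC & He & H).
  set (e1 := Rmin (Rmin e0 1) (/ (2 * (C + 1)))).
  assert (0 < e1) as He1.
  { unfold e1. repeat apply Rmin_glb_lt; try lra. apply Rinv_0_lt_compat; lra. }
  assert (Hb : forall e th x y, Rabs e < e1 -> 0 <= th <= 2 * PI -> rho1 <= x <= rho2 -> rho1 <= y <= rho2 ->
    1 / 2 <= 1 - b e th x /\ Rabs (b e th x - b e th y) <= C * Rabs (x - y)).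
  { intros e th x y Hlt Hth Hx Hy.
    assert (Rabs e < Rmin e0 1) as L1 by (apply Rlt_le_trans with (1 := Hlt), Rmin_l).
    assert (Rabs e < e0) as L2 by (apply Rlt_le_trans with (1 := L1), Rmin_l).
    assert (Rabs e < 1) as L3 by (apply Rlt_le_trans with (1 := L1), Rmin_r).
    assert (Rabs e < / (2 * (C + 1))) as L4 by (apply Rlt_le_trans with (1 := Hlt), Rmin_r).
    destruct (H e th x y) as [A1 A2]; auto. rewrite pow_1 in A1, A2.
    assert (Rabs e * (C + 1) < 1 / 2).
    { apply Rmult_lt_compat_r with (r := C + 1) in L4; [|lra].
      replace (/ (2 * (C + 1)) * (C + 1)) with (1 / 2) in L4 by (field; lra). exact L4. }
    assert (0 <= Rabs e) by apply Rabs_pos.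
    split.
    - assert (Rabs (b e th x) <= 1 / 2) by nra. apply Rabs_le_between in H2. lra.
    - apply Rle_trans with (1 := A2). apply Rmult_le_compat_r; [apply Rabs_pos|]. nra. }
  split.
  - exists (4 * C + 2), e1. split; [lra|]. split; auto.
    intros e th x y Hlt Hth Hx Hy. simpl. rewrite Rmult_1_r.
    destruct (Hb e th x y) as [A1 A2]; auto. destruct (Hb e th y x) as [B1 _]; auto.
    set (u := 1 - b e th x) in *. set (v := 1 - b e th y) in *.
    assert (0 < / u <= 2).
    { split; [apply Rinv_0_lt_compat; lra|]. rewrite <- (Rinv_inv 2). apply Rinv_le_contravar; lra. }
    assert (0 < / v <= 2).
    { split; [apply Rinv_0_lt_compat; lra|]. rewrite <- (Rinv_inv 2). apply Rinv_le_contravar; lra. }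
    split.
    + rewrite Rabs_right; lra.
    + replace (/ u - / v) with ((b e th x - b e th y) * (/ u * / v)) by (unfold u, v; field; unfold u, v in *; lra).
      rewrite Rabs_mult, (Rabs_right (/ u * / v)) by nra.
      assert (0 <= C * Rabs (x - y)) by (apply Rmult_le_pos; auto; apply Rabs_pos).
      apply Rle_trans with (C * Rabs (x - y) * 4).
      * apply Rmult_le_compat; auto; [apply Rabs_pos|nra|nra].
      * generalize (Rabs_pos (x - y)). nra.
  - exists e1. split; auto. intros e th x Hlt Hth Hx. now apply (Hb e th x x).
Qed.

End OrderClass.

Definition radial (p q : nat -> nat -> R) (i : nat) (th r : R) : R :=
  cos th * (p 0%nat i + p 1%nat i * (r * cos th) + p 2%nat i * (r * sin th))
  + sin th * (q 0%nat i + q 1%nat i * (r * cos th) + q 2%nat i * (r * sin th)).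

Definition angular (p q : nat -> nat -> R) (i : nat) (th r : R) : R :=
  cos th * (q 0%nat i + q 1%nat i * (r * cos th) + q 2%nat i * (r * sin th))
  - sin th * (p 0%nat i + p 1%nat i * (r * cos th) + p 2%nat i * (r * sin th)).

Lemma Sep_affine (p : nat -> nat -> R) (i : nat) :
  Sep (fun th r => p 0%nat i + p 1%nat i * (r * cos th) + p 2%nat i * (r * sin th)).
Proof.
  assert (Hr : smooth positive (fun r => r)) by apply smooth_id.
  repeat apply Sep_plus; repeat apply Sep_scal; try apply Sep_const.
  - apply (Sep_prod (fun r => r) cos); [exact Hr|apply smooth_trig].
  - apply (Sep_prod (fun r => r) sin); [exact Hr|apply smooth_trig].
Qed.

Lemma Sep_radial p q i : Sep (radial p q i).
Proof.
  apply (Sep_plus (fun th r => cos th * _) (fun th r => sin th * _)).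
  - apply (Sep_mult (fun th _ => cos th)); [apply Sep_th, smooth_trig|apply Sep_affine].
  - apply (Sep_mult (fun th _ => sin th)); [apply Sep_th, smooth_trig|apply Sep_affine].
Qed.

Lemma Sep_angular p q i : Sep (angular p q i).
Proof.
  apply (Sep_minus (fun th r => cos th * _) (fun th r => sin th * _)).
  - apply (Sep_mult (fun th _ => cos th)); [apply Sep_th, smooth_trig|apply Sep_affine].
  - apply (Sep_mult (fun th _ => sin th)); [apply Sep_th, smooth_trig|apply Sep_affine].
Qed.

(* Coefficients F_i of the expansion of dr/dth: polar_table K i is F_i for i <= K. *)
Fixpoint polar_table (p q : nat -> nat -> R) (K : nat) (i : nat) (th r : R) : R :=
  match K with
  | O => 0
  | S K' => if Nat.eqb i K then
      - radial p q K th r + / r * psum K' (fun l => angular p q l th r * polar_table p q K' (K - l) th r)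
    else polar_table p q K' i th r
  end.

(** F_i depends on all F_(i-l) with 1 <= l < i. Carrying the bound K separately from the index makes
    this course-of-values recursion structural, and the diagonal recovers F_i. *)
Definition polar_coeff (p q : nat -> nat -> R) (i : nat) : R -> R -> R := polar_table p q i i.

Lemma polar_table_coeff p q K i th r : (i <= K)%nat -> polar_table p q K i th r = polar_coeff p q i th r.
Proof.
  intros H. induction H as [|K H IH]; [reflexivity|].
  cbn [polar_table]. destruct (Nat.eqb_spec i (S K)); [lia|]. exact IH.
Qed.

Lemma polar_coeff_S p q K th r : polar_coeff p q (S K) th r =
  - radial p q (S K) th r + / r * psum K (fun l => angular p q l th r * polar_coeff p q (S K - l) th r).
Proof.
  unfold polar_coeff at 1. cbn [polar_table]. rewrite Nat.eqb_refl. f_equal. f_equal.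
  apply psum_ext. intros i Hi. rewrite polar_table_coeff by lia. reflexivity.
Qed.

Lemma Sep_psum k (f : nat -> R -> R -> R) : (forall i, Sep (f i)) ->
  Sep (fun th r => psum k (fun i => f i th r)).
Proof.
  intros Hf. induction k as [|k IH]; simpl; [apply Sep_const|].
  now apply (Sep_plus (fun th r => psum k (fun i => f i th r)) (f (S k))).
Qed.

Lemma Sep_polar_table p q K : forall i, Sep (polar_table p q K i).
Proof.
  induction K as [|K IH]; intros i; cbn [polar_table]; [apply (Sep_const 0)|].
  destruct (Nat.eqb i (S K)); [|apply IH].
  apply (Sep_plus (fun th r => - radial p q (S K) th r)).
  - apply Sep_opp, Sep_radial.
  - apply (Sep_mult (fun _ r => / r)); [apply Sep_r, smooth_inv|].
    apply (Sep_psum K (fun l th r => angular p q l th r * polar_table p q K (S K - l) th r)).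
    intros l. apply Sep_mult; [apply Sep_angular|apply IH].
Qed.

Lemma Sep_polar_coeff p q i : Sep (polar_coeff p q i).
Proof. apply Sep_polar_table. Qed.

Definition polar_field (p q : nat -> nat -> R) (k : nat) (e th r : R) : R :=
  polar_rhs (fun x y => y + pert p k e x y) (fun x y => - x + pert q k e x y) th r.

Lemma pert_radial p q k e th r :
  cos th * pert p k e (r * cos th) (r * sin th) + sin th * pert q k e (r * cos th) (r * sin th)
  = psum k (fun i => e ^ i * radial p q i th r).
Proof.
  unfold pert. rewrite <- !psum_scal, <- psum_plus. apply psum_ext. intros i _. unfold radial. ring.
Qed.

Lemma pert_angular p q k e th r :
  cos th * pert q k e (r * cos th) (r * sin th) - sin th * pert p k e (r * cos th) (r * sin th)
  = psum k (fun i => e ^ i * angular p q i th r).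
Proof.
  unfold Rminus. rewrite Ropp_mult_distr_l.
  unfold pert. rewrite <- !psum_scal, <- psum_plus. apply psum_ext. intros i _. unfold angular. ring.
Qed.

(** In polar coordinates dr/dt = A and dtheta/dt = - 1 + B/r, where A and B are the eps-sums of the
    radial and angular components of the perturbation. *)
Lemma polar_field_eq p q k e th r : 0 < r ->
  1 - / r * psum k (fun i => e ^ i * angular p q i th r) <> 0 ->
  polar_field p q k e th r = - psum k (fun i => e ^ i * radial p q i th r)
    * / (1 - / r * psum k (fun i => e ^ i * angular p q i th r)).
Proof.
  intros Hr. rewrite <- pert_radial, <- pert_angular. unfold polar_field, polar_rhs.
  set (P := pert p k e (r * cos th) (r * sin th)). set (Q := pert q k e (r * cos th) (r * sin th)).
  set (B := cos th * Q - sin th * P). intros HB.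
  replace (r * cos th * (- (r * cos th) + Q) - r * sin th * (r * sin th + P))
    with (- (r * r * (1 - / r * B))).
  2:{ unfold B. replace (r * r * (1 - / r * (cos th * Q - sin th * P)))
        with (r * r * 1 - r * (cos th * Q - sin th * P)) by (field; lra).
      assert (E := sin2_cos2 th). unfold Rsqr in E. rewrite <- E. ring. }
  replace (r * cos th * (r * sin th + P) + r * sin th * (- (r * cos th) + Q))
    with (r * (cos th * P + sin th * Q)) by ring.
  field. split; [lra|].
  intro E. apply HB. apply Rmult_eq_reg_l with r; [|lra].
  replace (r * (1 - / r * B)) with (r - B) by (field; lra). lra.
Qed.

Section Expansion.

Context (rho1 rho2 : R) (Hrho : 0 < rho1) (p q : nat -> nat -> R) (k : nat).

Let A (e th r : R) := psum k (fun i => e ^ i * radial p q i th r).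
Let B (e th r : R) := psum k (fun i => e ^ i * angular p q i th r).
Let b (e th r : R) := / r * B e th r.

Lemma OL_rinv : OL rho1 rho2 0 (fun _ _ r => / r).
Proof. apply (OL_Sep rho1 rho2 Hrho (fun _ r => / r)), Sep_r, smooth_inv. Qed.

Lemma OL_poly (f : nat -> R -> R -> R) : (forall i, Sep (f i)) ->
  OL rho1 rho2 1 (fun e th r => psum k (fun i => e ^ i * f i th r)).
Proof.
  intros Hf. apply (OL_psum rho1 rho2 1 k (fun i e th r => e ^ i * f i th r)).
  intros i Hi. apply (OL_le rho1 rho2 i); [lia|]. apply OL_term; auto.
Qed.

Lemma OL_b : OL rho1 rho2 1 b.
Proof.
  apply (OL_mult rho1 rho2 0 1 (fun _ _ r => / r) B); [apply OL_rinv|].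
  apply OL_poly. intros; apply Sep_angular.
Qed.

Lemma polar_field_fix : exists e0, 0 < e0 /\ forall e th r, Rabs e < e0 -> 0 <= th <= 2 * PI ->
  rho1 <= r <= rho2 -> polar_field p q k e th r = - A e th r * / (1 - b e th r) /\ 1 / 2 <= 1 - b e th r.
Proof.
  destruct (OL_inv_1minus rho1 rho2 b OL_b) as [_ (e0 & He & H)].
  exists e0. split; auto. intros e th r H1 H2 H3. specialize (H e th r H1 H2 H3).
  split; auto. apply polar_field_eq; [lra|]. unfold b, B in H. lra.
Qed.

Lemma OL_polar_field : OL rho1 rho2 1 (polar_field p q k).
Proof.
  destruct polar_field_fix as (e0 & He & H).
  apply (OL_ext rho1 rho2 1 (fun e th r => - A e th r * / (1 - b e th r)) _ e0 He).
  - intros e th r H1 H2 H3. symmetry. now apply H.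
  - apply (OL_mult rho1 rho2 1 0 (fun e th r => - A e th r) (fun e th r => / (1 - b e th r))).
    + apply OL_opp, OL_poly. intros; apply Sep_radial.
    + apply OL_inv_1minus, OL_b.
Qed.

(** The field F satisfies F = - A + (B/r) F, and the coefficients F_i satisfy the same equation
    order by order. The difference therefore splits into tails of A and B and into terms of size
    eps^i times the error of the truncation at order N - i, which strong induction controls. *)
Lemma OL_polar_field_error N : (N <= k)%nat ->
  OL rho1 rho2 (S N) (fun e th r => polar_field p q k e th r - psum N (fun i => e ^ i * polar_coeff p q i th r)).
Proof.
  induction N as [N IH] using lt_wf_ind. intros HN. destruct N as [|M].
  { apply (OL_ext' rho1 rho2 1 (polar_field p q k)); [intros; simpl; ring|apply OL_polar_field]. }
  destruct polar_field_fix as (e0 & He & H).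
  apply (OL_ext rho1 rho2 (S (S M)) (fun e th r =>
    - (A e th r - psum (S M) (fun i => e ^ i * radial p q i th r))
    + / r * ((B e th r - psum (S M) (fun i => e ^ i * angular p q i th r)) * polar_field p q k e th r)
    + / r * psum (S M) (fun i => e ^ i * angular p q i th r *
        (polar_field p q k e th r - psum (S M - i) (fun l => e ^ l * polar_coeff p q l th r)))) _ e0 He).
  { intros e th r H1 H2 H3. destruct (H e th r H1 H2 H3) as [H4 H5].
    assert (E : polar_field p q k e th r = - A e th r + / r * (B e th r * polar_field p q k e th r)).
    { assert (E' : polar_field p q k e th r * (1 - b e th r) = - A e th r).
      { rewrite H4. generalize (b e th r) H5. intros b0 Hb0. field. lra. }
      unfold b in E'. lra. }
    assert (EF : psum (S M) (fun i => e ^ i * polar_coeff p q i th r) =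
      - psum (S M) (fun i => e ^ i * radial p q i th r)
      + / r * psum (S M) (fun i => e ^ i * angular p q i th r * psum (S M - i) (fun l => e ^ l * polar_coeff p q l th r))).
    { rewrite (psum_cauchy (S M) e (fun i => angular p q i th r) (fun l => polar_coeff p q l th r)).
      replace (- psum (S M) (fun i => e ^ i * radial p q i th r))
        with ((-1) * psum (S M) (fun i => e ^ i * radial p q i th r)) by ring.
      rewrite <- !psum_scal, <- psum_plus. apply psum_ext. intros i Hi.
      destruct i as [|i]; [lia|]. rewrite polar_coeff_S. cbn [pred]. ring. }
    rewrite EF.
    assert (EP : psum (S M) (fun i => e ^ i * angular p q i th r *
        (polar_field p q k e th r - psum (S M - i) (fun l => e ^ l * polar_coeff p q l th r)))
      = polar_field p q k e th r * psum (S M) (fun i => e ^ i * angular p q i th r)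
        + (-1) * psum (S M) (fun i => e ^ i * angular p q i th r * psum (S M - i) (fun l => e ^ l * polar_coeff p q l th r))).
    { rewrite <- !psum_scal, <- psum_plus. apply psum_ext. intros; ring. }
    rewrite EP. rewrite E at 3. ring. }
  apply (OL_plus rho1 rho2 (S (S M)) (fun e th r => _ + _) (fun e th r => / r * _)).
  - apply (OL_plus rho1 rho2 (S (S M)) (fun e th r => - _) (fun e th r => / r * _)).
    + apply OL_opp. apply OL_tail; auto. intros; apply Sep_radial.
    + apply (OL_mult rho1 rho2 0 (S (S M)) (fun _ _ r => / r)
        (fun e th r => (B e th r - psum (S M) (fun i => e ^ i * angular p q i th r)) * polar_field p q k e th r)); [apply OL_rinv|].
      apply (OL_le rho1 rho2 (S (S M) + 1)); [lia|].
      apply (OL_mult rho1 rho2 (S (S M)) 1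
        (fun e th r => B e th r - psum (S M) (fun i => e ^ i * angular p q i th r)) (polar_field p q k)); [|apply OL_polar_field].
      apply OL_tail; auto. intros; apply Sep_angular.
  - apply (OL_mult rho1 rho2 0 (S (S M)) (fun _ _ r => / r) (fun e th r => psum (S M) (fun i =>
      e ^ i * angular p q i th r *
        (polar_field p q k e th r - psum (S M - i) (fun l => e ^ l * polar_coeff p q l th r))))); [apply OL_rinv|].
    apply (OL_psum rho1 rho2 (S (S M)) (S M) (fun i e th r =>
      e ^ i * angular p q i th r *
        (polar_field p q k e th r - psum (S M - i) (fun l => e ^ l * polar_coeff p q l th r)))).
    intros i Hi. replace (S (S M)) with (i + S (S M - i))%nat by lia.
    apply (OL_mult rho1 rho2 i (S (S M - i)) (fun e th r => e ^ i * angular p q i th r)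
      (fun e th r => polar_field p q k e th r - psum (S M - i) (fun l => e ^ l * polar_coeff p q l th r))).
    + apply OL_term; auto. apply Sep_angular.
    + apply IH; lia.
Qed.

(* The total derivative of r + sum eps^i u_i along the flow, when the u_i solve the
   averaging equations. *)
Lemma OL_total (ut ur : nat -> R -> R -> R) :
  (forall i, (1 <= i <= k)%nat -> Sep (ur i) /\ forall th r, 0 < r -> ut i th r =
    - (polar_coeff p q i th r + psum (pred i) (fun l => ur l th r * polar_coeff p q (i - l) th r))) ->
  OL rho1 rho2 (S k) (fun e th r => polar_field p q k e th r
    + psum k (fun i => e ^ i * (ut i th r + ur i th r * polar_field p q k e th r))).
Proof.
  intros Hu.
  apply (OL_ext' rho1 rho2 (S k) (fun e th r =>
    (polar_field p q k e th r - psum k (fun i => e ^ i * polar_coeff p q i th r))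
    + psum k (fun i => e ^ i * ur i th r *
       (polar_field p q k e th r - psum (k - i) (fun l => e ^ l * polar_coeff p q l th r))))).
  { intros e th r Hr.
    assert (E1 : psum k (fun i => e ^ i * (ut i th r + ur i th r * polar_field p q k e th r)) =
      (-1) * psum k (fun i => e ^ i * polar_coeff p q i th r)
      + ((-1) * psum k (fun i => e ^ i * psum (pred i) (fun l => ur l th r * polar_coeff p q (i - l) th r))
      + polar_field p q k e th r * psum k (fun i => e ^ i * ur i th r))).
    { rewrite <- !psum_scal, <- !psum_plus. apply psum_ext. intros i Hi.
      destruct (Hu i Hi) as [_ ->]; [|lra]. ring. }
    rewrite E1, <- (psum_cauchy k e (fun i => ur i th r) (fun l => polar_coeff p q l th r)).
    assert (E2 : psum k (fun i => e ^ i * ur i th r *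
       (polar_field p q k e th r - psum (k - i) (fun l => e ^ l * polar_coeff p q l th r))) =
      polar_field p q k e th r * psum k (fun i => e ^ i * ur i th r)
      + (-1) * psum k (fun i => e ^ i * ur i th r * psum (k - i) (fun l => e ^ l * polar_coeff p q l th r))).
    { rewrite <- !psum_scal, <- !psum_plus. apply psum_ext. intros; ring. }
    rewrite E2. ring. }
  apply (OL_plus rho1 rho2 (S k) (fun e th r => _ - _) (fun e th r => psum k _)).
  - now apply OL_polar_field_error.
  - apply (OL_psum rho1 rho2 (S k) k (fun i e th r => e ^ i * ur i th r *
       (polar_field p q k e th r - psum (k - i) (fun l => e ^ l * polar_coeff p q l th r)))).
    intros i Hi. replace (S k) with (i + S (k - i))%nat by lia.
    apply (OL_mult rho1 rho2 i (S (k - i)) (fun e th r => e ^ i * ur i th r)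
      (fun e th r => polar_field p q k e th r - psum (k - i) (fun l => e ^ l * polar_coeff p q l th r))).
    + apply OL_term; auto. now apply Hu.
    + apply OL_polar_field_error; lia.
Qed.

End Expansion.

(** * The averaging equations in the five sectors *)

Lemma fun_choice {T : Type} (Q : nat -> T -> Prop) :
  (forall j, exists x, Q j x) -> exists f, forall j, Q j (f j).
Proof.
  intros H. exists (fun j => proj1_sig (constructive_indefinite_description _ (H j))).
  intros j. apply proj2_sig.
Qed.

Section Sectors.

Context (tau : nat -> R -> R) (Htau : forall j, smooth positive (tau j)).

(** A primitive in theta is free up to a function of r. This freedom is spent from the last sector
    backwards: the last primitive is made to vanish at 2 PI, and each earlier one to agree with its
    successor on their common boundary. *)
Lemma sector_prim (h : nat -> R -> R -> R) : (forall j, Sep (h j)) ->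
  exists u : nat -> R -> R -> R, forall j, (j <= 4)%nat ->
    Sep (u j) /\ (forall th r, 0 < r -> is_derive (fun s => u j s r) th (- h j th r)) /\
    forall r, 0 < r -> u j (tau (S j) r) r = match j with 4%nat => 0 | _ => u (S j) (tau (S j) r) r end.
Proof.
  intros Hh.
  destruct (fun_choice (fun j P => Sep P /\ forall th r, 0 < r -> is_derive (fun s => P s r) th (- h j th r)))
    as [P HP].
  { intros j. apply Sep_prim. now apply Sep_opp. }
  set (shift := fun j (c : R -> R) th r => P j th r - P j (tau (S j) r) r + c r).
  assert (Hs : forall j c, Sep (fun _ r => c r) -> Sep (shift j c) /\
    (forall th r, 0 < r -> is_derive (fun s => shift j c s r) th (- h j th r)) /\
    forall r, 0 < r -> shift j c (tau (S j) r) r = c r).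
  { intros j c Hc. destruct (HP j) as [S1 D1]. unfold shift. split; [|split].
    - apply (Sep_plus (fun th r => P j th r - P j (tau (S j) r) r) (fun _ r => c r)); auto.
      apply (Sep_minus (P j) (fun _ r => P j (tau (S j) r) r)); auto. now apply Sep_subst.
    - intros th r Hr. evar_last.
      + apply @is_derive_plus; [|apply @is_derive_const].
        apply @is_derive_minus; [|apply @is_derive_const]. now apply D1.
      + unfold plus, minus, opp, zero; simpl. unfold plus; simpl. ring.
    - intros r Hr. ring. }
  (* The index is d = 4 - j, so that the backward construction becomes a structural recursion. *)
  set (w := fix w (d : nat) : R -> R -> R := match d with
    | O => shift 4%nat (fun _ => 0)
    | S d' => shift (4 - d)%nat (fun r => w d' (tau (4 - d')%nat r) r) end).
  assert (Hw : forall d, Sep (w d)).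
  { induction d as [|d IH]; cbn [w].
    - apply Hs. apply (Sep_const 0).
    - apply Hs. apply (Sep_subst (tau (4 - d)%nat) (w d)); auto. }
  assert (Hw' : forall d, Sep (fun _ r => w d (tau (4 - d)%nat r) r)).
  { intros d. apply (Sep_subst (tau (4 - d)%nat) (w d)); auto. }
  exists (fun j => w (4 - j)%nat). intros j Hj. split; [apply Hw|].
  destruct j as [|[|[|[|[|j]]]]]; try lia.
  - exact (proj2 (Hs 0%nat (fun r => w 3%nat (tau 1%nat r) r) (Hw' 3%nat))).
  - exact (proj2 (Hs 1%nat (fun r => w 2%nat (tau 2%nat r) r) (Hw' 2%nat))).
  - exact (proj2 (Hs 2%nat (fun r => w 1%nat (tau 3%nat r) r) (Hw' 1%nat))).
  - exact (proj2 (Hs 3%nat (fun r => w 0%nat (tau 4%nat r) r) (Hw' 0%nat))).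
  - exact (proj2 (Hs 4%nat (fun _ => 0) (Sep_const 0))).
Qed.

Context (F : nat -> nat -> R -> R -> R) (HF : forall j i, Sep (F j i)).

(* u i j is the coefficient of eps^i in sector j, and ut, ur are its partial derivatives in theta and r. *)
Record avg_coeffs (K : nat) (u ut ur : nat -> nat -> R -> R -> R) : Prop := {
  avg_Sep : forall i j, (1 <= i <= K)%nat -> (j <= 4)%nat -> Sep (u i j) /\ Sep (ur i j);
  avg_grad : forall i j, (1 <= i <= K)%nat -> (j <= 4)%nat -> is_grad (u i j) (ut i j) (ur i j);
  avg_eq : forall i j th r, (1 <= i <= K)%nat -> (j <= 4)%nat -> 0 < r -> ut i j th r =
    - (F j i th r + psum (pred i) (fun l => ur l j th r * F j (i - l)%nat th r));
  avg_match : forall i j r, (1 <= i <= K)%nat -> (j <= 4)%nat -> 0 < r ->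
    u i j (tau (S j) r) r = match j with 4%nat => 0 | _ => u i (S j) (tau (S j) r) r end }.

Lemma avg_exists (K : nat) : exists u ut ur, avg_coeffs K u ut ur.
Proof.
  induction K as [|K (u & ut & ur & H)].
  { exists (fun _ _ _ _ => 0), (fun _ _ _ _ => 0), (fun _ _ _ _ => 0). constructor; intros; lia. }
  set (g := fun j th r => F j (S K) th r + psum K (fun l => ur l j th r * F j (S K - l)%nat th r)).
  set (h := fun j => if Nat.leb j 4 then g j else fun _ _ => 0).
  assert (Hh : forall j, Sep (h j)).
  { intros j. unfold h. destruct (Nat.leb_spec j 4) as [Hj|Hj]; [|apply (Sep_const 0)].
    apply (Sep_plus (F j (S K))); auto.
    assert (B : forall N, (N <= K)%nat -> Sep (fun th r => psum N (fun l => ur l j th r * F j (S K - l)%nat th r))).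
    { induction N as [|N IH]; intros HN; simpl; [apply (Sep_const 0)|].
      apply (Sep_plus (fun th r => psum N _)); [apply IH; lia|].
      apply Sep_mult; auto. apply (avg_Sep _ _ _ _ H); lia. }
    now apply B. }
  destruct (sector_prim h Hh) as (v & Hv).
  destruct (fun_choice (fun j (x : (R -> R -> R) * (R -> R -> R)) => (j <= 4)%nat ->
    Sep (snd x) /\ is_grad (v j) (fst x) (snd x))) as [vg Hvg].
  { intros j. destruct (le_lt_dec j 4) as [Hj|Hj].
    - destruct (Sep_grad (v j)) as (a & b & H1 & H2 & H3); [now apply Hv|]. now exists (a, b).
    - exists (fun _ _ => 0, fun _ _ => 0). lia. }
  exists (fun i j => if Nat.eqb i (S K) then v j else u i j),
    (fun i j => if Nat.eqb i (S K) then fst (vg j) else ut i j),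
    (fun i j => if Nat.eqb i (S K) then snd (vg j) else ur i j).
  constructor.
  - intros i j Hi Hj. destruct (Nat.eqb_spec i (S K)).
    + split; [now apply Hv|now apply Hvg].
    + apply (avg_Sep _ _ _ _ H); lia.
  - intros i j Hi Hj. destruct (Nat.eqb_spec i (S K)).
    + now apply Hvg.
    + apply (avg_grad _ _ _ _ H); lia.
  - intros i j th r Hi Hj Hr. destruct (Nat.eqb_spec i (S K)) as [->|Hne].
    + assert (D1 : is_derive (fun s => v j s r) th (fst (vg j) th r)) by (apply Hvg; auto).
      assert (D2 : is_derive (fun s => v j s r) th (- h j th r)) by (apply Hv; auto).
      (* The gradient supplied by [Sep_grad] is anonymous; uniqueness of the derivative identifies
         its theta component with - h. *)
      apply is_derive_unique in D1. apply is_derive_unique in D2. rewrite <- D1, D2.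
      unfold h. destruct (Nat.leb_spec j 4); [|lia]. unfold g. f_equal. f_equal. cbn [pred].
      apply psum_ext. intros l Hl. destruct (Nat.eqb_spec l (S K)); [lia|reflexivity].
    + rewrite (avg_eq _ _ _ _ H) by (auto; lia). f_equal. f_equal.
      apply psum_ext. intros l Hl. destruct (Nat.eqb_spec l (S K)); [lia|reflexivity].
  - intros i j r Hi Hj Hr. destruct (Nat.eqb_spec i (S K)) as [->|Hne].
    + now apply Hv.
    + apply (avg_match _ _ _ _ H); auto; lia.
Qed.

End Sectors.

(** * Solutions of the discontinuous equation *)

Lemma mvt_le (f h : R -> R) (a b : R) : a <= b ->
  (forall x, a <= x <= b -> continuous f x /\ continuous h x) ->
  (forall x, a < x < b -> exists l l', is_derive f x l /\ is_derive h x l' /\ Rabs l <= l') ->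
  Rabs (f b - f a) <= h b - h a.
Proof.
  intros Hab Hc Hd.
  destruct (Req_dec a b) as [<-|Hne]; [rewrite Rminus_diag, Rabs_R0; lra|].
  assert (A : forall s, s = 1 \/ s = -1 -> s * (f b - f a) <= h b - h a).
  { intros s Hs. set (g := fun x => h x - s * f x).
    assert (Dg : forall x, a < x < b -> exists l, is_derive g x l /\ 0 <= l).
    { intros x Hx. destruct (Hd x Hx) as (l & l' & Hl & Hl' & Hb). exists (l' - s * l). split.
      - apply @is_derive_minus; auto. now apply is_derive_scal.
      - apply Rabs_le_between in Hb. destruct Hs as [-> | ->]; lra. }
    assert (X : forall x, a < x < b -> derivable_pt g x).
    { intros x Hx. exists (Derive g x). apply is_derive_Reals, Derive_correct.
      destruct (Dg x Hx) as (l & Hl & _). now exists l. }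
    destruct (MVT g id a b X (fun c _ => derivable_pt_id c)) as (c & Hcc & E).
    - lra.
    - intros x Hx. destruct (Hc x Hx) as [C1 C2].
      apply continuity_pt_filterlim. apply @continuous_minus; auto.
      apply (continuous_scal_r s f). exact C1.
    - intros x _. apply derivable_continuous_pt, derivable_pt_id.
    - assert (D1 : 0 <= derive_pt g c (X c Hcc)).
      { destruct (Dg c Hcc) as (l & Hl & Hl0). apply is_derive_Reals in Hl.
        rewrite (derive_pt_eq_0 _ _ _ (X c Hcc) Hl). exact Hl0. }
      rewrite derive_pt_id in E. unfold id in E.
      assert (0 <= g b - g a) by nra. unfold g in H. lra. }
  assert (A1 := A 1 (or_introl eq_refl)). assert (A2 := A (-1) (or_intror eq_refl)).
  apply Rabs_le_between. lra.
Qed.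

(** Continuity allows the interval to be cut at an exceptional point, one point of L at a time. This
    is how finitely many switching angles are tolerated throughout. *)
Lemma mvt_fin (L : list R) (f h : R -> R) : forall a b, a <= b ->
  (forall x, a <= x <= b -> continuous f x /\ continuous h x) ->
  (forall x, a < x < b -> ~ In x L -> exists l l', is_derive f x l /\ is_derive h x l' /\ Rabs l <= l') ->
  Rabs (f b - f a) <= h b - h a.
Proof.
  induction L as [|y L IH]; intros a b Hab Hc Hd.
  - apply mvt_le; auto.
  - destruct (Rlt_le_dec a y) as [H1|H1]; [destruct (Rlt_le_dec y b) as [H2|H2]|].
    + assert (A1 : Rabs (f y - f a) <= h y - h a).
      { apply IH; try lra; [intros; apply Hc; lra|]. intros x Hx Hn. apply Hd; [lra|].
        intros [->|Hi]; [lra|auto]. }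
      assert (A2 : Rabs (f b - f y) <= h b - h y).
      { apply IH; try lra; [intros; apply Hc; lra|]. intros x Hx Hn. apply Hd; [lra|].
        intros [->|Hi]; [lra|auto]. }
      replace (f b - f a) with ((f b - f y) + (f y - f a)) by ring.
      eapply Rle_trans; [apply Rabs_triang|]. lra.
    + apply IH; auto. intros x Hx Hn. apply Hd; auto. intros [->|Hi]; [lra|auto].
    + apply IH; auto. intros x Hx Hn. apply Hd; auto. intros [->|Hi]; [lra|auto].
Qed.

Lemma mvt_const (L : list R) (f : R -> R) (K a b : R) : a <= b ->
  (forall x, a <= x <= b -> continuous f x) ->
  (forall x, a < x < b -> ~ In x L -> exists l, is_derive f x l /\ Rabs l <= K) ->
  Rabs (f b - f a) <= K * (b - a).
Proof.
  intros Hab Hc Hd. replace (K * (b - a)) with (K * b - K * a) by ring.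
  apply (mvt_fin L f (fun x => K * x)); auto.
  - intros x Hx. split; auto. apply @ex_derive_continuous. auto_derive; auto.
  - intros x Hx Hn. destruct (Hd x Hx Hn) as (l & H1 & H2). exists l, K. split; auto. split; auto.
    auto_derive; auto. ring.
Qed.

Definition clamp (p q x : R) : R := Rmin (Rmax x p) q.

Lemma clamp_cases (p q x : R) : p <= q ->
  (x <= p /\ clamp p q x = p) \/ (p <= x <= q /\ clamp p q x = x) \/ (q <= x /\ clamp p q x = q).
Proof.
  intros H. unfold clamp. destruct (Rle_lt_dec x p) as [H1|H1].
  - left. rewrite Rmax_right, Rmin_left by lra. auto.
  - right. rewrite Rmax_left by lra. destruct (Rle_lt_dec x q) as [H2|H2].
    + left. rewrite Rmin_left by lra. lra.
    + right. rewrite Rmin_right by lra. lra.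
Qed.

Lemma clamp_lip (p q x y : R) : p <= q -> Rabs (clamp p q x - clamp p q y) <= Rabs (x - y).
Proof.
  intros H. destruct (clamp_cases p q x H) as [[A ->]|[[A ->]|[A ->]]];
  destruct (clamp_cases p q y H) as [[B ->]|[[B ->]|[B ->]]];
  unfold Rabs; repeat destruct Rcase_abs; lra.
Qed.

Lemma lip_continuous (f : R -> R) (K x : R) : 0 <= K ->
  (exists d, 0 < d /\ forall y, Rabs (y - x) < d -> Rabs (f y - f x) <= K * Rabs (y - x)) -> continuous f x.
Proof.
  intros HK (d & Hd & H) P [eps HP].
  assert (0 < eps / (K + 1)) as He by (apply Rdiv_lt_0_compat; [apply cond_pos|lra]).
  exists (mkposreal (Rmin d (eps / (K + 1))) (Rmin_glb_lt _ _ _ Hd He)).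
  intros y Hy. apply HP. unfold ball in *; simpl in *; unfold AbsRing_ball, abs, minus, plus, opp in *; simpl in *.
  fold (y - x) in Hy. fold (f y - f x).
  assert (Rabs (y - x) < d) by (apply Rlt_le_trans with (1 := Hy), Rmin_l).
  assert (Rabs (y - x) < eps / (K + 1)) as H1 by (apply Rlt_le_trans with (1 := Hy), Rmin_r).
  apply Rle_lt_trans with (1 := H y H0).
  apply Rlt_div_r in H1; [|lra]. generalize (Rabs_pos (y - x)). nra.
Qed.

Lemma clamp_continuous (p q x : R) : p <= q -> continuous (clamp p q) x.
Proof.
  intros H. apply lip_continuous with 1; [lra|]. exists 1. split; [lra|].
  intros y _. rewrite Rmult_1_l. now apply clamp_lip.
Qed.

Lemma is_derive_clamp (W : R -> R) (p q x l : R) : p < q ->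
  (p < x < q -> is_derive W x l) -> (x < p \/ q < x -> l = 0) -> x <> p -> x <> q ->
  is_derive (fun s => W (clamp p q s)) x l.
Proof.
  intros Hpq Hin Hout Hp Hq.
  destruct (Rlt_le_dec x p) as [H1|H1]; [|destruct (Rlt_le_dec q x) as [H2|H2]].
  - rewrite Hout by auto. apply is_derive_ext_loc with (fun _ => W p); [|apply @is_derive_const].
    assert (L := open_lt p x H1). revert L. apply filter_imp. intros y Hy.
    destruct (clamp_cases p q y) as [[A ->]|[[A ->]|[A ->]]]; auto; lra.
  - rewrite Hout by auto. apply is_derive_ext_loc with (fun _ => W q); [|apply @is_derive_const].
    assert (L := open_gt q x H2). revert L. apply filter_imp. intros y Hy.
    destruct (clamp_cases p q y) as [[A ->]|[[A ->]|[A ->]]]; auto; lra.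
  - apply is_derive_ext_loc with W; [|apply Hin; lra].
    assert (L : locally x (fun y => p < y < q)).
    { apply (open_and (fun y => p < y) (fun y => y < q) (open_gt p) (open_lt q)). lra. }
    revert L. apply filter_imp. intros y Hy.
    destruct (clamp_cases p q y) as [[A ->]|[[A ->]|[A ->]]]; auto; lra.
Qed.

(* A continuous function cannot leave the band |f| <= eta if, as long as it stays in
   the band, it stays in a strictly smaller one. *)
Lemma bootstrap (f : R -> R) (T eta kap : R) : kap < eta ->
  (forall x, 0 <= x <= T -> continuous f x) ->
  (forall x, 0 <= x <= T -> (forall y, 0 <= y <= x -> Rabs (f y) <= eta) -> Rabs (f x) <= kap) ->
  Rabs (f 0) <= eta -> forall x, 0 <= x <= T -> Rabs (f x) <= eta.
Proof.
  intros Hk Hc Hb H0 x1 Hx1.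
  destruct (Rle_lt_dec (Rabs (f x1)) eta) as [|Hgt]; auto. exfalso.
  set (E := fun x => 0 <= x <= x1 /\ forall y, 0 <= y <= x -> Rabs (f y) <= eta).
  assert (E0 : E 0).
  { split; [lra|]. intros y Hy. replace y with 0 by lra. exact H0. }
  destruct (completeness E) as [s [Hs1 Hs2]].
  { exists x1. intros x [Hx _]. lra. }
  { now exists 0. }
  assert (0 <= s) by now apply Hs1.
  assert (s <= x1) by (apply Hs2; intros x [Hx _]; lra).
  assert (Hlt : forall y, 0 <= y < s -> Rabs (f y) <= eta).
  { intros y Hy. destruct (Rle_lt_dec (Rabs (f y)) eta) as [|K]; auto. exfalso.
    assert (s <= y); [|lra]. apply Hs2. intros x [Hx Hxx].
    destruct (Rle_lt_dec x y); auto. exfalso. specialize (Hxx y ltac:(lra)). lra. }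
  assert (Hcs : continuous (fun x => Rabs (f x)) s).
  { apply (continuous_comp f Rabs); [apply Hc; lra|apply continuous_Rabs]. }
  assert (Hs : Rabs (f s) <= eta).
  { destruct (Rle_lt_dec (Rabs (f s)) eta) as [|K]; auto. exfalso.
    destruct (Req_dec s 0) as [->|Hs0]; [lra|].
    destruct (Hcs (fun u => eta < u) (open_gt eta _ K)) as [d Hd].
    set (y := Rmax 0 (s - d / 2)).
    assert (0 < d) by apply cond_pos.
    assert (0 <= y < s /\ s - d < y) as [Hy1 Hy2].
    { unfold y. split; [split; [apply Rmax_l|apply Rmax_lub_lt; lra]|].
      apply Rlt_le_trans with (2 := Rmax_r _ _). lra. }
    specialize (Hlt y Hy1).
    assert (eta < Rabs (f y)); [|lra]. apply Hd.
    unfold ball; simpl; unfold AbsRing_ball, abs, minus, plus, opp; simpl.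
    rewrite Rabs_left; lra. }
  assert (Hs' : Rabs (f s) <= kap).
  { apply Hb; [lra|]. intros y Hy. destruct (Req_dec y s) as [->|]; auto. apply Hlt; lra. }
  destruct (Hcs (fun u => u < eta) (open_lt eta (Rabs (f s)) ltac:(lra))) as [d Hd].
  assert (0 < d) by apply cond_pos.
  set (y := Rmin x1 (s + d / 2)).
  assert (s < x1) by (destruct (Req_dec s x1) as [->|]; lra).
  assert (E y).
  { assert (y <= x1) by apply Rmin_l. assert (y <= s + d / 2) by apply Rmin_r.
    assert (s < y) by (unfold y; apply Rmin_glb_lt; lra).
    split; [lra|]. intros u Hu. destruct (Rlt_le_dec u s) as [|Hus]; [apply Hlt; lra|].
    left. apply Hd. unfold ball; simpl; unfold AbsRing_ball, abs, minus, plus, opp; simpl.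
    rewrite Rabs_right; lra. }
  assert (y <= s) by now apply Hs1.
  assert (s < y) by (unfold y; apply Rmin_glb_lt; lra). lra.
Qed.

Lemma max_exists (f : R -> R) (T : R) : 0 <= T -> (forall x, 0 <= x <= T -> continuous f x) ->
  exists c, 0 <= c <= T /\ forall x, 0 <= x <= T -> Rabs (f x) <= Rabs (f c).
Proof.
  intros HT Hc. destruct (continuity_ab_maj (fun x => Rabs (f x)) 0 T HT) as (c & Hm & Hcc).
  - intros x Hx. apply continuity_pt_filterlim.
    apply (continuous_comp f Rabs); [auto|apply continuous_Rabs].
  - exists c. auto.
Qed.

Lemma continuous_Rminus (f g : R -> R) (x : R) :
  continuous f x -> continuous g x -> continuous (fun y => f y - g y) x.
Proof. intros Hf Hg. now apply @continuous_minus. Qed.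

Lemma clamp_derive (p q x : R) : p <= q -> x <> p -> x <> q ->
  exists l, is_derive (clamp p q) x l /\ 0 <= l /\ (p < x < q -> 1 <= l).
Proof.
  intros Hpq Hp Hq. destruct (Req_dec p q) as [->|Hne].
  - exists 0. split; [|lra]. apply is_derive_ext with (fun _ => q); [|apply @is_derive_const].
    intros t. destruct (clamp_cases q q t) as [[A ->]|[[A ->]|[A ->]]]; lra.
  - destruct (excluded_middle_informative (p < x < q)) as [H|H].
    + exists 1. split; [|lra]. apply (is_derive_clamp (fun y => y)); auto; try lra.
      intros _. apply @is_derive_id.
    + exists 0. split; [|lra]. apply (is_derive_clamp (fun y => y)); auto; lra.
Qed.

Lemma sum5_derive (F : nat -> R -> R) (l : nat -> R) (x : R) :
  (forall i, (i <= 4)%nat -> is_derive (F i) x (l i)) ->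
  is_derive (fun y => F 0%nat y + F 1%nat y + F 2%nat y + F 3%nat y + F 4%nat y) x
    (l 0%nat + l 1%nat + l 2%nat + l 3%nat + l 4%nat).
Proof. intros H. repeat apply @is_derive_plus; apply H; lia. Qed.

Lemma sum5_continuous (F : nat -> R -> R) (x : R) :
  (forall i, (i <= 4)%nat -> continuous (F i) x) ->
  continuous (fun y => F 0%nat y + F 1%nat y + F 2%nat y + F 3%nat y + F 4%nat y) x.
Proof. intros H. repeat apply @continuous_plus; apply H; lia. Qed.

Section FixedEps.

(** The discontinuous f coincides in sector j with the Lipschitz function fl j; M, later a multiple
    of |eps|, bounds f and is a Lipschitz constant of each fl j, while Lt is one for the boundaries.
    [Hsmall1] makes curves cross the boundaries transversally, [Hsmall2] makes the Picard operator a
    contraction, and [Hsmall3] keeps the radius within eta of its initial value. *)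
Context (tau : nat -> R -> R) (rho1 rho2 Lt M eta : R) (f : R -> R -> R) (fl : nat -> R -> R -> R).

Definition insecT (j : nat) (th x : R) : Prop := tau j x < th < tau (S j) x.

Context (Hrho : 0 < rho1) (HLt : 0 <= Lt) (HM : 0 <= M)
  (Htau0 : forall x, tau 0%nat x = 0) (Htau5 : forall x, tau 5%nat x = 2 * PI)
  (Htaulip : forall j x y, rho1 <= x <= rho2 -> rho1 <= y <= rho2 ->
     Rabs (tau j x - tau j y) <= Lt * Rabs (x - y))
  (Htaucont : forall j x, 0 < x -> continuous (tau j) x)
  (Htaumono : forall j x, (j <= 4)%nat -> tau j x < tau (S j) x)
  (Hfb : forall th x, 0 <= th <= 2 * PI -> rho1 <= x <= rho2 -> Rabs (f th x) <= M)
  (Hfsec : forall j th x, (j <= 4)%nat -> 0 <= th <= 2 * PI -> rho1 <= x <= rho2 -> insecT j th x ->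
     f th x = fl j th x)
  (Hfllip : forall j th x y, (j <= 4)%nat -> 0 <= th <= 2 * PI -> rho1 <= x <= rho2 -> rho1 <= y <= rho2 ->
     Rabs (fl j th x - fl j th y) <= M * Rabs (x - y))
  (Hflcont : forall j (r : R -> R) th, (j <= 4)%nat -> 0 <= th <= 2 * PI -> rho1 <= r th <= rho2 ->
     continuous r th -> continuous (fun s => fl j s (r s)) th)
  (Hsmall1 : Lt * M <= 1 / 2) (Hsmall2 : (2 * PI + 16 * Lt) * M <= 1 / 2)
  (Hsmall3 : 2 * PI * M < eta).

Definition admissible (r : R -> R) : Prop :=
  (forall th, 0 <= th <= 2 * PI -> rho1 <= r th <= rho2 /\ continuous r th) /\
  (forall th th', 0 <= th <= 2 * PI -> 0 <= th' <= 2 * PI -> Rabs (r th - r th') <= M * Rabs (th - th')).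

Definition crosses (r : R -> R) (j : nat) (c : R) : Prop :=
  0 <= c <= 2 * PI /\ tau j (r c) = c /\ forall th, 0 <= th <= 2 * PI ->
    (th < c -> th < tau j (r th)) /\ (c < th -> tau j (r th) < th).

Lemma tau_range j x : (1 <= j <= 4)%nat -> 0 < tau j x < 2 * PI.
Proof.
  intros Hj. rewrite <- (Htau0 x), <- (Htau5 x).
  generalize (Htaumono 0 x), (Htaumono 1 x), (Htaumono 2 x), (Htaumono 3 x), (Htaumono 4 x). intros.
  destruct j as [|[|[|[|[|j]]]]]; try lia; split;
    repeat match goal with H : (_ <= 4)%nat -> _ |- _ => specialize (H ltac:(lia)) end; lra.
Qed.

(** Transversality: tau j composed with r has Lipschitz constant Lt M <= 1/2, so th - tau j (r th)
    grows at least at half speed. Hence each boundary is crossed exactly once. *)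
Lemma slope r j th th' : admissible r -> 0 <= th <= th' -> th' <= 2 * PI ->
  (th' - th) / 2 <= (th' - tau j (r th')) - (th - tau j (r th)).
Proof.
  intros [A1 A2] H H'.
  assert (E := Htaulip j (r th') (r th) (proj1 (A1 th' ltac:(lra))) (proj1 (A1 th ltac:(lra)))).
  assert (E2 := A2 th' th ltac:(lra) ltac:(lra)). rewrite (Rabs_right (th' - th)) in E2 by lra.
  apply Rabs_le_between in E.
  assert (Lt * Rabs (r th' - r th) <= Lt * (M * (th' - th))) by (apply Rmult_le_compat_l; auto).
  assert (Lt * M * (th' - th) <= 1 / 2 * (th' - th)) by (apply Rmult_le_compat_r; lra). lra.
Qed.

Lemma crosses_exist r : admissible r -> exists c, forall j, (j <= 5)%nat -> crosses r j (c j).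
Proof.
  intros Hr. assert (HPI := PI_RGT_0).
  assert (forall j, exists c, (j <= 5)%nat -> crosses r j c) as H.
  { intros j. destruct (le_lt_dec j 5) as [Hj|Hj]; [|exists 0; lia].
    destruct (Nat.eq_dec j 0) as [->|H0].
    { exists 0. intros _. split; [lra|]. split; [auto|]. intros th Hth. rewrite Htau0. split; lra. }
    destruct (Nat.eq_dec j 5) as [->|H5].
    { exists (2 * PI). intros _. split; [lra|]. split; [auto|]. intros th Hth. rewrite Htau5. split; lra. }
    destruct (IVT_interv (fun th => th - tau j (r th)) 0 (2 * PI)) as [c [Hc1 Hc2]].
    - intros th Hth. apply continuity_pt_filterlim.
      apply (continuous_Rminus (fun th => th) (fun th => tau j (r th))); [apply continuous_id|].
      apply (continuous_comp r (tau j)); [apply Hr; lra|]. apply Htaucont.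
      destruct Hr as [A1 _]. specialize (A1 th Hth). lra.
    - lra.
    - generalize (tau_range j (r 0) ltac:(lia)). lra.
    - generalize (tau_range j (r (2 * PI)) ltac:(lia)). lra.
    - exists c. intros _. split; [lra|]. split; [lra|]. intros th Hth. split; intros Hlt.
      + assert (S := slope r j th c Hr ltac:(lra) ltac:(lra)). lra.
      + assert (S := slope r j c th Hr ltac:(lra) ltac:(lra)). lra. }
  apply (fun_choice _ H).
Qed.

Lemma crosses_lt r j c c' : admissible r -> (j <= 4)%nat -> crosses r j c -> crosses r (S j) c' -> c < c'.
Proof.
  intros Hr Hj (H1 & H2 & H3) (K1 & K2 & K3).
  assert (E := Htaumono j (r c) Hj).
  destruct (Rlt_le_dec c c') as [|[Hlt|Heq]]; auto; exfalso.
  - destruct (K3 c H1) as [_ K4]. specialize (K4 Hlt). lra.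
  - subst. lra.
Qed.

Lemma crosses_sector r j c c' th : crosses r j c -> crosses r (S j) c' -> 0 <= th <= 2 * PI ->
  c < th < c' -> insecT j th (r th).
Proof.
  intros (H1 & H2 & H3) (K1 & K2 & K3) Hth H. split.
  - now apply H3.
  - now apply K3.
Qed.

(** At the crossing angle of r the curve s misses the boundary by at most Lt D, and by [slope] it
    makes up for this within twice that angle. *)
Lemma crosses_dist r s j c c' D : admissible r -> admissible s ->
  (forall th, 0 <= th <= 2 * PI -> Rabs (r th - s th) <= D) ->
  crosses r j c -> crosses s j c' -> Rabs (c - c') <= 2 * (Lt * D).
Proof.
  intros Hr Hs HD (H1 & H2 & H3) (K1 & K2 & K3).
  assert (E : Rabs (c - tau j (s c)) <= Lt * D).
  { rewrite <- H2 at 1. eapply Rle_trans; [apply Htaulip|].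
    - apply Hr; auto.
    - apply Hs; auto.
    - apply Rmult_le_compat_l; auto. }
  apply Rabs_le_between in E.
  destruct (Rle_lt_dec c c') as [H|H].
  - assert (S := slope s j c c' Hs ltac:(lra) ltac:(lra)). rewrite Rabs_left1; lra.
  - assert (S := slope s j c' c Hs ltac:(lra) ltac:(lra)). rewrite Rabs_right; lra.
Qed.

Lemma find_sector (c : nat -> R) th : c 0%nat < th < c 5%nat -> (forall j, (j <= 5)%nat -> th <> c j) ->
  exists j, (j <= 4)%nat /\ c j < th < c (S j).
Proof.
  intros H Hn.
  destruct (Rlt_le_dec th (c 1%nat)); [exists 0%nat; split; [lia|lra]|].
  destruct (Rlt_le_dec th (c 2%nat)); [exists 1%nat; split; [lia|generalize (Hn 1%nat ltac:(lia)); lra]|].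
  destruct (Rlt_le_dec th (c 3%nat)); [exists 2%nat; split; [lia|generalize (Hn 2%nat ltac:(lia)); lra]|].
  destruct (Rlt_le_dec th (c 4%nat)); [exists 3%nat; split; [lia|generalize (Hn 3%nat ltac:(lia)); lra]|].
  exists 4%nat. split; [lia|generalize (Hn 4%nat ltac:(lia)); lra].
Qed.

Lemma crosses_0 r c : crosses r 0 c -> c = 0.
Proof. intros (_ & H & _). now rewrite Htau0 in H. Qed.

Lemma crosses_5 r c : crosses r 5 c -> c = 2 * PI.
Proof. intros (_ & H & _). now rewrite Htau5 in H. Qed.

Lemma In_pts (c : nat -> R) (th : R) : ~ In th (map c (seq 0 6)) -> forall j, (j <= 5)%nat -> th <> c j.
Proof. intros H j Hj ->. apply H, in_map, in_seq. lia. Qed.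

(** The curves r and s are in a common sector except while theta lies between corresponding
    crossings. There are four such intervals, each of length at most 2 Lt D, so the larger bound c1
    + c2 on the derivative costs only c2 (8 Lt D) beyond the bound c1. *)
Lemma mismatch r s c c' D g L c1 c2 : admissible r -> admissible s ->
  (forall j, (j <= 5)%nat -> crosses r j (c j)) -> (forall j, (j <= 5)%nat -> crosses s j (c' j)) ->
  (forall th, 0 <= th <= 2 * PI -> Rabs (r th - s th) <= D) ->
  0 <= c1 -> 0 <= c2 -> (forall th, 0 <= th <= 2 * PI -> continuous g th) ->
  (forall th, 0 < th < 2 * PI -> ~ In th L -> exists l, is_derive g th l /\ Rabs l <= c1 + c2 /\
     forall j, (j <= 4)%nat -> insecT j th (r th) -> insecT j th (s th) -> Rabs l <= c1) ->
  forall th, 0 <= th <= 2 * PI -> Rabs (g th - g 0) <= 2 * PI * c1 + c2 * (8 * Lt * D).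
Proof.
  intros Hr Hs Hc Hc' HD Hc1 Hc2 Hg Hd th Hth.
  (* k j grows at unit speed between the j-th crossings of the two curves and is constant elsewhere,
     so the comparison function h charges c2 on these intervals only. Crossings 0 and 5 are at 0 and
     2 PI for both curves and contribute nothing. *)
  set (k := fun j x => clamp (Rmin (c j) (c' j)) (Rmax (c j) (c' j)) x).
  assert (Hmm : forall j, Rmin (c j) (c' j) <= Rmax (c j) (c' j)).
  { intros j. apply Rle_trans with (1 := Rmin_l _ _), Rmax_l. }
  set (h := fun x => c1 * x + c2 * (k 1%nat x + k 2%nat x + k 3%nat x + k 4%nat x)).
  assert (Hk : forall j, (j <= 5)%nat -> k j th - k j 0 <= 2 * (Lt * D)).
  { intros j Hj. assert (E := crosses_dist r s j _ _ D Hr Hs HD (Hc j Hj) (Hc' j Hj)).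
    unfold k. specialize (Hmm j).
    assert (Rmax (c j) (c' j) - Rmin (c j) (c' j) <= 2 * (Lt * D)).
    { apply Rabs_le_between in E. unfold Rmin, Rmax. destruct (Rle_dec (c j) (c' j)); lra. }
    destruct (clamp_cases _ _ th Hmm) as [[A ->]|[[A ->]|[A ->]]];
    destruct (clamp_cases _ _ 0 Hmm) as [[B ->]|[[B ->]|[B ->]]]; lra. }
  apply Rle_trans with (h th - h 0).
  2:{ unfold h.
      assert (H1 := Hk 1%nat ltac:(lia)). assert (H2 := Hk 2%nat ltac:(lia)).
      assert (H3 := Hk 3%nat ltac:(lia)). assert (H4 := Hk 4%nat ltac:(lia)).
      assert (c1 * th <= c1 * (2 * PI)) by (apply Rmult_le_compat_l; lra).
      assert (c2 * ((k 1%nat th - k 1%nat 0) + (k 2%nat th - k 2%nat 0) + (k 3%nat th - k 3%nat 0)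
        + (k 4%nat th - k 4%nat 0)) <= c2 * (8 * Lt * D)) by (apply Rmult_le_compat_l; lra). lra. }
  apply (mvt_fin (L ++ map c (seq 0 6) ++ map c' (seq 0 6))).
  - lra.
  - intros x Hx. split; [apply Hg; lra|]. unfold h.
    assert (Ck : forall j, continuous (k j) x) by (intros j; now apply clamp_continuous).
    apply @continuous_plus.
    + apply @ex_derive_continuous. auto_derive; auto.
    + apply (continuous_scal_r c2 (fun x => k 1%nat x + k 2%nat x + k 3%nat x + k 4%nat x)).
      repeat apply @continuous_plus; apply Ck.
  - intros x Hx Hn.
    assert (Hx2 : 0 <= x <= 2 * PI) by lra.
    assert (N1 : ~ In x L) by (intro; apply Hn, in_or_app; auto).
    assert (N2 := In_pts c x (fun H => Hn (in_or_app _ _ _ (or_intror (in_or_app _ _ _ (or_introl H)))))).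
    assert (N3 := In_pts c' x (fun H => Hn (in_or_app _ _ _ (or_intror (in_or_app _ _ _ (or_intror H)))))).
    destruct (Hd x ltac:(lra) N1) as (l & Hl & Hl2 & Hl1).
    assert (Dk : forall j, (j <= 5)%nat -> exists d, is_derive (k j) x d /\ 0 <= d /\
      (Rmin (c j) (c' j) < x < Rmax (c j) (c' j) -> 1 <= d)).
    { intros j Hj. specialize (N2 j Hj). specialize (N3 j Hj). apply clamp_derive; auto.
      - unfold Rmin. destruct (Rle_dec (c j) (c' j)); auto.
      - unfold Rmax. destruct (Rle_dec (c j) (c' j)); auto. }
    destruct (Dk 1%nat ltac:(lia)) as (d1 & D1 & P1 & Q1).
    destruct (Dk 2%nat ltac:(lia)) as (d2 & D2 & P2 & Q2).
    destruct (Dk 3%nat ltac:(lia)) as (d3 & D3 & P3 & Q3).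
    destruct (Dk 4%nat ltac:(lia)) as (d4 & D4 & P4 & Q4).
    exists l, (c1 + c2 * (d1 + d2 + d3 + d4)). split; auto. split.
    + unfold h. apply @is_derive_plus.
      * auto_derive; auto. ring.
      * apply (is_derive_scal (fun x => k 1%nat x + k 2%nat x + k 3%nat x + k 4%nat x)).
        repeat apply @is_derive_plus; auto.
    + destruct (find_sector c x) as (j & Hj & Hjx).
      { rewrite (crosses_0 r _ (Hc 0%nat ltac:(lia))), (crosses_5 r _ (Hc 5%nat ltac:(lia))). lra. }
      { exact N2. }
      destruct (classic (insecT j x (s x))) as [Hin|Hin].
      * apply Rle_trans with c1.
        -- apply (Hl1 j); auto. apply (crosses_sector r j (c j) (c (S j))); auto; apply Hc; lia.
        -- assert (0 <= c2 * (d1 + d2 + d3 + d4)) by (apply Rmult_le_pos; lra). lra.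
      * apply Rle_trans with (1 := Hl2). apply Rplus_le_compat_l.
        rewrite <- (Rmult_1_r c2) at 1. apply Rmult_le_compat_l; auto.
        assert (Hout : exists i, (1 <= i <= 4)%nat /\ Rmin (c i) (c' i) < x < Rmax (c i) (c' i)).
        { assert (E0 := crosses_0 s _ (Hc' 0%nat ltac:(lia))). assert (E5 := crosses_5 s _ (Hc' 5%nat ltac:(lia))).
          assert (Hin' : ~ (c' j < x < c' (S j))).
          { intro Hi. apply Hin, (crosses_sector s j (c' j) (c' (S j))); auto; apply Hc'; lia. }
          assert (N3a := N3 j ltac:(lia)). assert (N3b := N3 (S j) ltac:(lia)).
          destruct (Rlt_le_dec x (c' j)) as [Hlt|Hle].
          - exists j. split.
            + destruct j; [|lia]. lra.
            + rewrite Rmin_left, Rmax_right by lra. lra.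
          - exists (S j). split.
            + destruct (Nat.eq_dec j 4) as [->|]; [|lia]. lra.
            + rewrite Rmin_right, Rmax_left by lra. lra. }
        destruct Hout as (i & Hi & Hix).
        destruct i as [|[|[|[|[|i]]]]]; try lia;
        [specialize (Q1 Hix)|specialize (Q2 Hix)|specialize (Q3 Hix)|specialize (Q4 Hix)]; lra.
Qed.

Definition solves (r : R -> R) : Prop :=
  (forall th, 0 <= th <= 2 * PI -> 0 < r th /\ continuous r th) /\
  exists L, forall th, 0 < th < 2 * PI -> ~ In th L -> is_derive r th (f th (r th)).

Lemma solves_admissible r : solves r -> rho1 <= r 0 - eta -> r 0 + eta <= rho2 -> admissible r.
Proof.
  intros [H1 [L H2]] Hz1 Hz2. assert (HPI := PI_RGT_0).
  assert (Heta : 0 <= 2 * PI * M) by (apply Rmult_le_pos; lra).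
  assert (B : forall th, 0 <= th <= 2 * PI -> Rabs (r th - r 0) <= eta).
  { apply (bootstrap (fun th => r th - r 0) (2 * PI) eta (2 * PI * M) Hsmall3).
    - intros x Hx. apply (continuous_Rminus r (fun _ => r 0)); [now apply H1|apply continuous_const].
    - intros x Hx Hy. apply Rle_trans with (M * (x - 0)).
      + apply (mvt_const L); [lra| |].
        * intros y Hy'. apply H1; lra.
        * intros y Hy' Hn. exists (f y (r y)). split; [apply H2; auto; lra|].
          apply Hfb; [lra|]. specialize (Hy y ltac:(lra)). apply Rabs_le_between in Hy. lra.
      + rewrite Rminus_0_r, (Rmult_comm (2 * PI)). apply Rmult_le_compat_l; lra.
    - rewrite Rminus_diag, Rabs_R0. lra. }
  assert (C : forall th, 0 <= th <= 2 * PI -> rho1 <= r th <= rho2).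
  { intros th Hth. specialize (B th Hth). apply Rabs_le_between in B. lra. }
  split.
  - intros th Hth. split; [auto|]. now apply H1.
  - assert (A : forall x y, 0 <= x <= y -> y <= 2 * PI -> Rabs (r y - r x) <= M * (y - x)).
    { intros x y Hx Hy. apply (mvt_const L); [lra| |].
      - intros u Hu. apply H1; lra.
      - intros u Hu Hn. exists (f u (r u)). split; [apply H2; auto; lra|].
        apply Hfb; [lra|]. apply C; lra. }
    intros x y Hx Hy. destruct (Rle_lt_dec x y).
    + rewrite Rabs_minus_sym, (Rabs_minus_sym x y), (Rabs_right (y - x)) by lra. apply A; lra.
    + rewrite (Rabs_right (x - y)) by lra. apply A; lra.
Qed.

Lemma f_diff r s j th D : admissible r -> admissible s -> (j <= 4)%nat -> 0 <= th <= 2 * PI -> Rabs (r th - s th) <= D ->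
  insecT j th (r th) -> insecT j th (s th) -> Rabs (f th (r th) - f th (s th)) <= M * D.
Proof.
  intros [Hr _] [Hs _] Hj Hth HD Ir Is. destruct (Hr th Hth) as [R1 _]. destruct (Hs th Hth) as [S1 _].
  rewrite (Hfsec j th (r th)), (Hfsec j th (s th)) by auto.
  eapply Rle_trans; [now apply Hfllip|]. now apply Rmult_le_compat_l.
Qed.

Lemma f_diff2 r s th : admissible r -> admissible s -> 0 <= th <= 2 * PI -> Rabs (f th (r th) - f th (s th)) <= 2 * M.
Proof.
  intros [Hr _] [Hs _] Hth. destruct (Hr th Hth) as [R1 _]. destruct (Hs th Hth) as [S1 _].
  assert (A := Hfb th (r th) Hth R1). assert (B := Hfb th (s th) Hth S1).
  unfold Rminus. eapply Rle_trans; [apply Rabs_triang|]. rewrite Rabs_Ropp. lra.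
Qed.

(** In a common sector the integrands differ by at most M D, elsewhere by at most 2 M, but only on a
    set of length 8 Lt D. In total this is (2 PI + 16 Lt) M D, at most D/2 by [Hsmall2]. *)
Lemma contraction r s g L D : admissible r -> admissible s -> 0 <= D ->
  (forall th, 0 <= th <= 2 * PI -> Rabs (r th - s th) <= D) ->
  (forall th, 0 <= th <= 2 * PI -> continuous g th) ->
  (forall th, 0 < th < 2 * PI -> ~ In th L -> is_derive g th (f th (r th) - f th (s th))) ->
  forall th, 0 <= th <= 2 * PI -> Rabs (g th - g 0) <= D / 2.
Proof.
  intros Hr Hs HD0 HD Hg Hd th Hth.
  destruct (crosses_exist r Hr) as (c & Hc). destruct (crosses_exist s Hs) as (c' & Hc').
  apply Rle_trans with (2 * PI * (M * D) + 2 * M * (8 * Lt * D)).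
  - apply (mismatch r s c c' D g L); auto.
    + now apply Rmult_le_pos.
    + lra.
    + intros x Hx Hn. exists (f x (r x) - f x (s x)). split; [now apply Hd|]. split.
      * apply Rle_trans with (2 * M); [apply f_diff2; auto; lra|].
        assert (0 <= M * D) by now apply Rmult_le_pos. lra.
      * intros j Hj I1 I2. apply (f_diff r s j); auto; [lra|]. apply HD; lra.
  - replace (2 * PI * (M * D) + 2 * M * (8 * Lt * D)) with ((2 * PI + 16 * Lt) * M * D) by ring.
    apply Rle_trans with (1 / 2 * D); [now apply Rmult_le_compat_r|lra].
Qed.

(** In place of Gronwall: at the angle of maximal distance D the contraction estimate gives D <= |r
    0 - s 0| + D/2. *)
Lemma solves_close r s : solves r -> solves s -> admissible r -> admissible s ->
  forall th, 0 <= th <= 2 * PI -> Rabs (r th - s th) <= 2 * Rabs (r 0 - s 0).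
Proof.
  intros Sr Ss Hr Hs. assert (HPI := PI_RGT_0).
  assert (Cg : forall th, 0 <= th <= 2 * PI -> continuous (fun x => r x - s x) th).
  { intros th Hth. apply (continuous_Rminus r s); [now apply Sr|now apply Ss]. }
  destruct (max_exists (fun x => r x - s x) (2 * PI) ltac:(lra) Cg) as (m & Hm & Hmax).
  destruct Sr as [R1 [L1 R2]]. destruct Ss as [S1 [L2 S2]].
  set (D := Rabs (r m - s m)) in *.
  assert (C := contraction r s (fun x => r x - s x) (L1 ++ L2) D Hr Hs (Rabs_pos _) Hmax Cg).
  assert (E : Rabs (r m - s m - (r 0 - s 0)) <= D / 2).
  { apply C; auto. intros th Hth Hn. apply @is_derive_minus.
    - apply R2; auto. intro; apply Hn, in_or_app; auto.
    - apply S2; auto. intro; apply Hn, in_or_app; auto. }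
  assert (D <= Rabs (r 0 - s 0) + D / 2).
  { unfold D at 1. replace (r m - s m) with ((r 0 - s 0) + (r m - s m - (r 0 - s 0))) by ring.
    eapply Rle_trans; [apply Rabs_triang|]. lra. }
  intros th Hth. specialize (Hmax th Hth). lra.
Qed.

Lemma integrable r a b : admissible r -> 0 <= a -> a <= b -> b <= 2 * PI -> ex_RInt (fun s => f s (r s)) a b.
Proof.
  intros Hr Ha Hab Hb. destruct (crosses_exist r Hr) as (c & Hc).
  assert (E0 := crosses_0 r _ (Hc 0%nat ltac:(lia))). assert (E5 := crosses_5 r _ (Hc 5%nat ltac:(lia))).
  assert (P : forall j, (j <= 4)%nat -> ex_RInt (fun s => f s (r s)) (c j) (c (S j))).
  { intros j Hj.
    assert (Hlt := crosses_lt r j _ _ Hr Hj (Hc j ltac:(lia)) (Hc (S j) ltac:(lia))).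
    destruct (Hc j ltac:(lia)) as [C1 _]. destruct (Hc (S j) ltac:(lia)) as [C2 _].
    apply ex_RInt_ext with (fun s => fl j s (r s)).
    - rewrite Rmin_left, Rmax_right by lra. intros x Hx. symmetry.
      assert (Hx2 : 0 <= x <= 2 * PI) by lra.
      apply Hfsec; auto; [now apply Hr|].
      apply (crosses_sector r j (c j) (c (S j))); auto; apply Hc; lia.
    - apply @ex_RInt_continuous. rewrite Rmin_left, Rmax_right by lra. intros x Hx.
      assert (Hx2 : 0 <= x <= 2 * PI) by lra. destruct Hr as [R1 _]. destruct (R1 x Hx2). now apply Hflcont. }
  assert (Q : ex_RInt (fun s => f s (r s)) 0 (2 * PI)).
  { rewrite <- E0, <- E5.
    apply ex_RInt_Chasles with (c 1%nat); [apply (P 0%nat); lia|].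
    apply ex_RInt_Chasles with (c 2%nat); [apply P; lia|].
    apply ex_RInt_Chasles with (c 3%nat); [apply P; lia|].
    apply ex_RInt_Chasles with (c 4%nat); apply P; lia. }
  apply (ex_RInt_Chasles_2 (V := R_CompleteNormedModule) _ 0); [lra|].
  apply (ex_RInt_Chasles_1 (V := R_CompleteNormedModule) _ 0 b (2 * PI)); [lra|exact Q].
Qed.

(** The clamp continues the integral constantly outside [0, 2 PI], so that the iterates are
    Lipschitz on the whole line and continuous from both sides at the endpoints. *)
Definition picard (z : R) (r : R -> R) (th : R) : R :=
  z + RInt (fun s => f s (r s)) 0 (clamp 0 (2 * PI) th).

Lemma clamp_in th : 0 <= clamp 0 (2 * PI) th <= 2 * PI.
Proof.
  assert (HPI := PI_RGT_0).
  destruct (clamp_cases 0 (2 * PI) th) as [[A ->]|[[A ->]|[A ->]]]; lra.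
Qed.

Lemma clamp_id th : 0 <= th <= 2 * PI -> clamp 0 (2 * PI) th = th.
Proof. intros H. destruct (clamp_cases 0 (2 * PI) th) as [[A ->]|[[A ->]|[A ->]]]; lra. Qed.

Lemma clamp_idem th : clamp 0 (2 * PI) (clamp 0 (2 * PI) th) = clamp 0 (2 * PI) th.
Proof. apply clamp_id, clamp_in. Qed.

Lemma picard_clamp z r th : picard z r (clamp 0 (2 * PI) th) = picard z r th.
Proof. unfold picard. now rewrite clamp_idem. Qed.

Lemma picard_0 z r : picard z r 0 = z.
Proof.
  unfold picard. rewrite clamp_id by (generalize PI_RGT_0; lra). rewrite RInt_point. apply Rplus_0_r.
Qed.

Lemma picard_lip z r x y : admissible r -> Rabs (picard z r x - picard z r y) <= M * Rabs (x - y).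
Proof.
  intros Hr. assert (HPI := PI_RGT_0).
  assert (A : forall x y, 0 <= x -> x <= y -> y <= 2 * PI ->
    Rabs (RInt (fun s => f s (r s)) 0 y - RInt (fun s => f s (r s)) 0 x) <= M * (y - x)).
  { intros u v Hu Huv Hv.
    assert (E : RInt (fun s => f s (r s)) 0 v = RInt (fun s => f s (r s)) 0 u + RInt (fun s => f s (r s)) u v).
    { symmetry. apply (RInt_Chasles (V := R_CompleteNormedModule)); apply integrable; auto; lra. }
    assert (E2 : forall p q t : R, p = q + t -> p - q = t) by (intros; lra).
    rewrite (E2 _ _ _ E).
    rewrite Rmult_comm. apply abs_RInt_le_const; auto; [now apply integrable|].
    intros t Ht. apply Hfb; [lra|]. apply Hr; lra. }
  apply Rle_trans with (M * Rabs (clamp 0 (2 * PI) x - clamp 0 (2 * PI) y)).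
  2:{ apply Rmult_le_compat_l; auto. apply clamp_lip; lra. }
  unfold picard. assert (H1 := clamp_in x). assert (H2 := clamp_in y).
  set (u := clamp 0 (2 * PI) x) in *. set (v := clamp 0 (2 * PI) y) in *.
  replace (z + RInt (fun s => f s (r s)) 0 u - (z + RInt (fun s => f s (r s)) 0 v))
    with (RInt (fun s => f s (r s)) 0 u - RInt (fun s => f s (r s)) 0 v)
    by (generalize (RInt (fun s => f s (r s)) 0 u : R), (RInt (fun s => f s (r s)) 0 v : R); intros; lra).
  destruct (Rle_lt_dec u v) as [H|H].
  - rewrite Rabs_minus_sym, (Rabs_minus_sym u v), (Rabs_right (v - u)) by lra. apply A; lra.
  - rewrite (Rabs_right (u - v)) by lra. apply A; lra.
Qed.

Lemma lip_admissible z r : rho1 <= z - eta -> z + eta <= rho2 -> r 0 = z ->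
  (forall x y, Rabs (r x - r y) <= M * Rabs (x - y)) -> admissible r.
Proof.
  intros Hz1 Hz2 Hz Hl. assert (HPI := PI_RGT_0). split; auto.
  intros th Hth. split.
  - specialize (Hl th 0). rewrite Rminus_0_r, Hz, (Rabs_right th) in Hl by lra.
    assert (M * th <= M * (2 * PI)) by (apply Rmult_le_compat_l; lra).
    apply Rabs_le_between in Hl. lra.
  - apply lip_continuous with M; auto. exists 1. split; [lra|]. intros; apply Hl.
Qed.

Lemma picard_derive z r c th : admissible r -> (forall j, (j <= 5)%nat -> crosses r j (c j)) -> 0 < th < 2 * PI ->
  (forall j, (j <= 5)%nat -> th <> c j) -> is_derive (picard z r) th (f th (r th)).
Proof.
  intros Hr Hc Hth Hn.
  assert (Lth : locally th (fun y => 0 < y < 2 * PI)).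
  { apply (open_and (fun y => 0 < y) (fun y => y < 2 * PI) (open_gt 0) (open_lt (2 * PI))). lra. }
  apply is_derive_ext_loc with (fun y => z + RInt (fun s => f s (r s)) 0 y).
  { revert Lth. apply filter_imp. intros y Hy. unfold picard. rewrite clamp_id; [reflexivity|lra]. }
  evar_last; [apply @is_derive_plus; [apply @is_derive_const|]|apply Rplus_0_l].
  apply (is_derive_RInt (fun s => f s (r s)) _ 0).
  - revert Lth. apply filter_imp. intros y Hy. apply @RInt_correct. apply integrable; auto; lra.
  - destruct (find_sector c th) as (j & Hj & Hjx); auto.
    { rewrite (crosses_0 r _ (Hc 0%nat ltac:(lia))), (crosses_5 r _ (Hc 5%nat ltac:(lia))). lra. }
    apply continuous_ext_loc with (fun s => fl j s (r s)).
    + assert (L2 : locally th (fun y => c j < y < c (S j))).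
      { apply (open_and (fun y => c j < y) (fun y => y < c (S j)) (open_gt (c j)) (open_lt (c (S j)))). lra. }
      generalize (filter_and _ _ Lth L2). apply filter_imp. intros y [Hy1 Hy2]. symmetry.
      assert (Hy : 0 <= y <= 2 * PI) by lra.
      apply Hfsec; auto; [now apply Hr|].
      apply (crosses_sector r j (c j) (c (S j))); auto; apply Hc; lia.
    + assert (Hy : 0 <= th <= 2 * PI) by lra. destruct Hr as [R1 _]. destruct (R1 th Hy). now apply Hflcont.
Qed.

Fixpoint iter_picard (z : R) (k : nat) : R -> R :=
  match k with O => fun _ => z | S k' => picard z (iter_picard z k') end.

Lemma half_pow_le a b K : 0 <= K -> (forall k, a <= b + K * (1 / 2) ^ k) -> a <= b.
Proof.
  intros HK H. apply le_epsilon. intros e He.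
  destruct (pow_lt_1_zero (1 / 2)) with (y := e / (K + 1)) as (N & HN).
  - rewrite Rabs_right; lra.
  - apply Rdiv_lt_0_compat; lra.
  - specialize (HN N (le_n N)). specialize (H N).
    assert (0 < (1 / 2) ^ N) by (apply pow_lt; lra).
    rewrite Rabs_right in HN by lra. apply Rlt_div_r in HN; [|lra]. nra.
Qed.

Lemma picard_diff z r s D : admissible r -> admissible s -> 0 <= D ->
  (forall th, 0 <= th <= 2 * PI -> Rabs (r th - s th) <= D) ->
  forall th, Rabs (picard z r th - picard z s th) <= D / 2.
Proof.
  intros Hr Hs HD0 HD th. rewrite <- (picard_clamp z r), <- (picard_clamp z s).
  assert (Hth := clamp_in th). set (x := clamp 0 (2 * PI) th) in *.
  destruct (crosses_exist r Hr) as (c & Hc). destruct (crosses_exist s Hs) as (c' & Hc').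
  assert (C := contraction r s (fun y => picard z r y - picard z s y)
    (map c (seq 0 6) ++ map c' (seq 0 6)) D Hr Hs HD0 HD).
  assert (Cp : forall r y, admissible r -> continuous (picard z r) y).
  { intros u y Hu. apply lip_continuous with M; auto. exists 1. split; [lra|]. intros. now apply picard_lip. }
  assert (E : Rabs (picard z r x - picard z s x - (picard z r 0 - picard z s 0)) <= D / 2).
  { apply C; auto.
    - intros y _. now apply continuous_Rminus; apply Cp.
    - intros y Hy Hn. apply @is_derive_minus.
      + apply (picard_derive z r c); auto. apply In_pts. intro; apply Hn, in_or_app; auto.
      + apply (picard_derive z s c'); auto. apply In_pts. intro; apply Hn, in_or_app; auto. }
  rewrite !picard_0 in E. rewrite Rminus_diag, Rminus_0_r in E. exact E.
Qed.

(** Picard iteration converges geometrically because the contraction estimate tolerates the jumps.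
    The limit is a fixed point of [picard], hence differentiable away from its own finitely many
    crossings, where it lies inside a sector. *)
Lemma exists_solution z : rho1 <= z - eta -> z + eta <= rho2 ->
  exists r, r 0 = z /\ admissible r /\ exists L, forall th, 0 < th < 2 * PI -> ~ In th L ->
    is_derive r th (f th (r th)) /\ exists j, (j <= 4)%nat /\ insecT j th (r th).
Proof.
  intros Hz1 Hz2. assert (HPI := PI_RGT_0).
  assert (Heta : 0 <= 2 * PI * M) by (apply Rmult_le_pos; lra).
  set (u := iter_picard z).
  assert (U0 : forall k, u k 0 = z) by (intros [|k]; [reflexivity|apply picard_0]).
  assert (UL : forall k, admissible (u k) /\ forall x y, Rabs (u k x - u k y) <= M * Rabs (x - y)).
  { induction k as [|k [IH _]].
    - assert (forall x y, Rabs (u 0%nat x - u 0%nat y) <= M * Rabs (x - y)) as HL.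
      { intros x y. unfold u; simpl. rewrite Rminus_diag, Rabs_R0. apply Rmult_le_pos; auto. apply Rabs_pos. }
      split; auto. now apply lip_admissible with z.
    - assert (forall x y, Rabs (u (S k) x - u (S k) y) <= M * Rabs (x - y)) as HL
        by (intros; now apply picard_lip).
      split; auto. apply lip_admissible with z; auto. }
  (* The first iterate moves by at most 2 PI M < eta; [picard_diff] halves every later step. *)
  assert (UD : forall k th, Rabs (u (S k) th - u k th) <= eta * (1 / 2) ^ k).
  { induction k as [|k IH]; intros th.
    - change (Rabs (picard z (u 0%nat) th - z) <= eta * 1).
      rewrite <- (picard_clamp z (u 0%nat) th). rewrite <- (picard_0 z (u 0%nat)) at 2.
      eapply Rle_trans; [apply picard_lip; apply UL|].
      assert (Hc := clamp_in th). rewrite Rminus_0_r, Rabs_right by lra.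
      assert (M * clamp 0 (2 * PI) th <= M * (2 * PI)) by (apply Rmult_le_compat_l; lra). lra.
    - replace (eta * (1 / 2) ^ S k) with (eta * (1 / 2) ^ k / 2) by (simpl; field).
      apply (picard_diff z (u (S k)) (u k)); try apply UL; auto.
      assert (0 < (1 / 2) ^ k) by (apply pow_lt; lra). apply Rmult_le_pos; lra. }
  assert (UDD : forall k p th, Rabs (u (k + p)%nat th - u k th) <= 2 * eta * (1 / 2) ^ k - 2 * eta * (1 / 2) ^ (k + p)).
  { intros k p th. induction p as [|p IH].
    - rewrite Nat.add_0_r. rewrite !Rminus_diag, Rabs_R0. lra.
    - rewrite Nat.add_succ_r.
      replace (u (S (k + p)) th - u k th) with ((u (S (k + p)) th - u (k + p)%nat th) + (u (k + p)%nat th - u k th)) by ring.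
      eapply Rle_trans; [apply Rabs_triang|].
      specialize (UD (k + p)%nat th). simpl ((1 / 2) ^ S (k + p)). lra. }
  assert (Hpow : forall k, 0 < (1 / 2) ^ k) by (intros; apply pow_lt; lra).
  assert (Hlim : forall th, exists l, forall k, Rabs (l - u k th) <= 2 * eta * (1 / 2) ^ k).
  { intros th.
    assert (ex_finite_lim_seq (fun k => u k th)) as [l Hl].
    { apply ex_lim_seq_cauchy_corr. intros e.
      destruct (pow_lt_1_zero (1 / 2)) with (y := e / (4 * eta + 1)) as (N & HN).
      - rewrite Rabs_right; lra.
      - apply Rdiv_lt_0_compat; [apply cond_pos|lra].
      - exists N.
        assert (A : forall k, (N <= k)%nat -> Rabs (u k th - u N th) <= 2 * eta * (1 / 2) ^ N).
        { intros k Hk. replace k with (N + (k - N))%nat by lia.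
          eapply Rle_trans; [apply UDD|]. specialize (Hpow (N + (k - N))%nat). nra. }
        intros k1 k2 H1 H2. specialize (HN N (le_n N)). specialize (Hpow N).
        rewrite Rabs_right in HN by lra. apply Rlt_div_r in HN; [|lra].
        replace (u k1 th - u k2 th) with ((u k1 th - u N th) - (u k2 th - u N th)) by ring.
        eapply Rle_lt_trans; [apply Rabs_triang|]. rewrite Rabs_Ropp.
        generalize (A k1 H1), (A k2 H2). nra. }
    exists l. intros k.
    assert (Hl2 : is_lim_seq (fun p => Rabs (u (p + k)%nat th - u k th)) (Rabs (l - u k th))).
    { apply (is_lim_seq_abs _ (Finite (l - u k th))). apply is_lim_seq_minus'; [|apply is_lim_seq_const].
      apply (is_lim_seq_incr_n (fun p => u p th)). exact Hl. }
    apply (is_lim_seq_le _ (fun _ => 2 * eta * (1 / 2) ^ k) (Rabs (l - u k th)) (2 * eta * (1 / 2) ^ k)) in Hl2.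
    - exact Hl2.
    - intros p. rewrite Nat.add_comm. eapply Rle_trans; [apply UDD|]. specialize (Hpow (k + p)%nat). nra.
    - apply is_lim_seq_const. }
  set (r := fun th => proj1_sig (constructive_indefinite_description _ (Hlim th))).
  assert (Hr : forall th k, Rabs (r th - u k th) <= 2 * eta * (1 / 2) ^ k).
  { intros th. exact (proj2_sig (constructive_indefinite_description _ (Hlim th))). }
  clearbody r.
  assert (r0 : r 0 = z).
  { assert (Rabs (r 0 - z) <= 0).
    { apply half_pow_le with (2 * eta); [lra|]. intros k. rewrite <- (U0 k), Rplus_0_l. apply Hr. }
    generalize (Rabs_pos (r 0 - z)). intros. apply Rminus_diag_uniq, Rabs_eq_0. lra. }
  assert (Lr : forall x y, Rabs (r x - r y) <= M * Rabs (x - y)).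
  { intros x y. apply half_pow_le with (4 * eta); [lra|]. intros k.
    replace (r x - r y) with ((r x - u k x) + (u k x - u k y) + - (r y - u k y)) by ring.
    eapply Rle_trans; [apply Rabs_triang|]. rewrite Rabs_Ropp.
    assert (T := Rabs_triang (r x - u k x) (u k x - u k y)).
    generalize (Hr x k), (Hr y k), (proj2 (UL k) x y). lra. }
  assert (Ar : admissible r) by now apply lip_admissible with z.
  assert (Fix : forall th, picard z r th = r th).
  { intros th. apply Rminus_diag_uniq, Rabs_eq_0.
    assert (Rabs (picard z r th - r th) <= 0).
    { apply half_pow_le with (4 * eta); [lra|]. intros k.
      replace (picard z r th - r th) with ((picard z r th - picard z (u k) th) + - (r th - u (S k) th))
        by (change (u (S k) th) with (picard z (u k) th); ring).
      eapply Rle_trans; [apply Rabs_triang|]. rewrite Rabs_Ropp.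
      assert (P := picard_diff z r (u k) (2 * eta * (1 / 2) ^ k) Ar (proj1 (UL k))
        ltac:(apply Rmult_le_pos; [lra|left; apply Hpow]) (fun y _ => Hr y k) th).
      assert (0 <= eta * (1 / 2) ^ k) by (apply Rmult_le_pos; [lra|left; apply Hpow]).
      assert (Q := Hr th (S k)). simpl ((1 / 2) ^ S k) in Q. lra. }
    generalize (Rabs_pos (picard z r th - r th)). lra. }
  exists r. split; auto. split; auto.
  destruct (crosses_exist r Ar) as (c & Hc). exists (map c (seq 0 6)).
  intros th Hth Hn. assert (Hn' := In_pts c th Hn). split.
  - apply is_derive_ext with (picard z r); auto. now apply (picard_derive z r c).
  - destruct (find_sector c th) as (j & Hj & Hjx); auto.
    { rewrite (crosses_0 r _ (Hc 0%nat ltac:(lia))), (crosses_5 r _ (Hc 5%nat ltac:(lia))). lra. }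
    exists j. split; auto. apply (crosses_sector r j (c j) (c (S j))); auto; try (apply Hc; lia). lra.
Qed.

(** U j stands for r + sum eps^i u_i in sector j and DU j for its derivative along the field,
    bounded and Lipschitz with a constant K of order eps^(k+1). [HUmatch] glues the U j across the
    switching curves. *)
Context (U DU : nat -> R -> R -> R) (K : R) (HK : 0 <= K)
  (HUmatch : forall j x, (j <= 3)%nat -> rho1 <= x <= rho2 ->
     U j (tau (S j) x) x = U (S j) (tau (S j) x) x)
  (HUcont : forall j (r : R -> R) th, (j <= 4)%nat -> rho1 <= r th <= rho2 -> continuous r th ->
     continuous (fun s => U j s (r s)) th)
  (HUder : forall j (r : R -> R) th, (j <= 4)%nat -> 0 <= th <= 2 * PI -> rho1 <= r th <= rho2 ->
     is_derive r th (fl j th (r th)) -> is_derive (fun s => U j s (r s)) th (DU j th (r th)))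
  (HDU : forall j th x y, (j <= 4)%nat -> 0 <= th <= 2 * PI -> rho1 <= x <= rho2 -> rho1 <= y <= rho2 ->
     Rabs (DU j th x) <= K /\ Rabs (DU j th x - DU j th y) <= K * Rabs (x - y)).

Definition along (r : R -> R) (j : nat) (th : R) : R := U j th (r th).

Lemma along_derive r L c j th : admissible r -> (forall x, 0 < x < 2 * PI -> ~ In x L -> is_derive r x (f x (r x))) ->
  (forall i, (i <= 5)%nat -> crosses r i (c i)) -> (j <= 4)%nat -> c j < th < c (S j) -> ~ In th L ->
  is_derive (along r j) th (DU j th (r th)).
Proof.
  intros Hr Hd Hc Hj Hth Hn.
  destruct (Hc j ltac:(lia)) as [C1 _]. destruct (Hc (S j) ltac:(lia)) as [C2 _].
  assert (Hth2 : 0 <= th <= 2 * PI) by lra.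
  destruct Hr as [R1 R2]. destruct (R1 th Hth2) as [R3 R4].
  apply HUder; auto. rewrite <- Hfsec; auto; [apply Hd; auto; lra|].
  apply (crosses_sector r j (c j) (c (S j))); auto; apply Hc; lia.
Qed.

Lemma along_cont r j th : admissible r -> (j <= 4)%nat -> 0 <= th <= 2 * PI -> continuous (along r j) th.
Proof. intros [R1 R2] Hj Hth. destruct (R1 th Hth). now apply HUcont. Qed.

Lemma telescope r c : admissible r -> (forall i, (i <= 5)%nat -> crosses r i (c i)) ->
  U 4 (2 * PI) (r (2 * PI)) - U 0 0 (r 0) =
    (along r 0 (c 1%nat) - along r 0 (c 0%nat)) + (along r 1 (c 2%nat) - along r 1 (c 1%nat))
    + (along r 2 (c 3%nat) - along r 2 (c 2%nat)) + (along r 3 (c 4%nat) - along r 3 (c 3%nat))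
    + (along r 4 (c 5%nat) - along r 4 (c 4%nat)).
Proof.
  intros Hr Hc.
  assert (E : forall j, (j <= 3)%nat -> along r j (c (S j)) = along r (S j) (c (S j))).
  { intros j Hj. destruct (Hc (S j) ltac:(lia)) as (C1 & C2 & _). unfold along.
    assert (R1 : rho1 <= r (c (S j)) <= rho2) by (apply Hr; auto).
    generalize (HUmatch j (r (c (S j))) Hj R1). now rewrite C2. }
  rewrite (E 0%nat), (E 1%nat), (E 2%nat), (E 3%nat) by lia.
  rewrite (crosses_0 r _ (Hc 0%nat ltac:(lia))), (crosses_5 r _ (Hc 5%nat ltac:(lia))).
  unfold along. ring.
Qed.

(** The increment of U j along r, frozen outside sector j by the clamp. The sum of the five pieces
    is a continuous version of the glued function, without a definition by cases. *)
Definition pieces (r : R -> R) (c : nat -> R) (j : nat) (th : R) : R :=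
  along r j (clamp (c j) (c (S j)) th) - along r j (c j).

Definition glued (r : R -> R) (c : nat -> R) (th : R) : R :=
  pieces r c 0 th + pieces r c 1 th + pieces r c 2 th + pieces r c 3 th + pieces r c 4 th.

Lemma glued_derive r L c th : admissible r -> (forall x, 0 < x < 2 * PI -> ~ In x L -> is_derive r x (f x (r x))) ->
  (forall i, (i <= 5)%nat -> crosses r i (c i)) -> 0 < th < 2 * PI -> ~ In th L ->
  (forall i, (i <= 5)%nat -> th <> c i) ->
  exists j, (j <= 4)%nat /\ insecT j th (r th) /\ is_derive (glued r c) th (DU j th (r th)).
Proof.
  intros Hr Hd Hc Hth HL Hn.
  assert (Hlt : forall i, (i <= 4)%nat -> c i < c (S i)).
  { intros i Hi. apply (crosses_lt r i _ _ Hr Hi); apply Hc; lia. }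
  destruct (find_sector c th) as (j & Hj & Hjx); auto.
  { rewrite (crosses_0 r _ (Hc 0%nat ltac:(lia))), (crosses_5 r _ (Hc 5%nat ltac:(lia))). lra. }
  exists j. split; auto. split.
  { apply (crosses_sector r j (c j) (c (S j))); auto; try (apply Hc; lia). lra. }
  set (d := DU j th (r th)).
  assert (P : forall i, (i <= 4)%nat -> is_derive (pieces r c i) th (if Nat.eqb i j then d else 0)).
  { intros i Hi. specialize (Hlt i Hi) as Hi2. unfold pieces.
    evar_last; [apply @is_derive_minus; [|apply @is_derive_const]|].
    - apply (is_derive_clamp (along r i) (c i) (c (S i)) th (if Nat.eqb i j then d else 0)); auto; try (apply Hn; lia).
      + intros Hin. destruct (Nat.eqb_spec i j) as [->|Hne].
        * now apply along_derive with L c.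
        * exfalso.
          assert (Hmono : forall a b, (a <= b)%nat -> (b <= 5)%nat -> c a <= c b).
          { intros a b Hab. induction Hab as [|b Hab IH]; intros Hb; [lra|].
            specialize (Hlt b ltac:(lia)). specialize (IH ltac:(lia)). lra. }
          destruct (lt_dec i j) as [H|H].
          -- specialize (Hmono (S i) j ltac:(lia) ltac:(lia)). lra.
          -- specialize (Hmono (S j) i ltac:(lia) ltac:(lia)). lra.
      + intros Hout. destruct (Nat.eqb_spec i j) as [->|Hne]; [lra|reflexivity].
    - unfold minus, plus, opp, zero; simpl. ring. }
  evar_last; [apply (sum5_derive (pieces r c) _ th P)|].
  destruct j as [|[|[|[|[|j]]]]]; try lia; simpl; ring.
Qed.

Lemma glued_cont r c th : admissible r -> (forall i, (i <= 5)%nat -> crosses r i (c i)) -> continuous (glued r c) th.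
Proof.
  intros Hr Hc.
  assert (P : forall i, (i <= 4)%nat -> continuous (pieces r c i) th).
  { intros i Hi. assert (Hlt := crosses_lt r i _ _ Hr Hi (Hc i ltac:(lia)) (Hc (S i) ltac:(lia))).
    apply continuous_Rminus; [|apply continuous_const].
    apply (continuous_comp (clamp (c i) (c (S i))) (along r i)); [apply clamp_continuous; lra|].
    apply along_cont; auto.
    destruct (Hc i ltac:(lia)) as [C1 _]. destruct (Hc (S i) ltac:(lia)) as [C2 _].
    destruct (clamp_cases (c i) (c (S i)) th) as [[A ->]|[[A ->]|[A ->]]]; lra. }
  apply (sum5_continuous (pieces r c) th P).
Qed.

Lemma glued_total r c : admissible r -> (forall i, (i <= 5)%nat -> crosses r i (c i)) ->
  glued r c 0 = 0 /\ glued r c (2 * PI) = U 4 (2 * PI) (r (2 * PI)) - U 0 0 (r 0).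
Proof.
  intros Hr Hc. rewrite (telescope r c Hr Hc). unfold glued, pieces.
  assert (P : forall i, (i <= 4)%nat -> clamp (c i) (c (S i)) 0 = c i /\ clamp (c i) (c (S i)) (2 * PI) = c (S i)).
  { intros i Hi. assert (Hlt := crosses_lt r i _ _ Hr Hi (Hc i ltac:(lia)) (Hc (S i) ltac:(lia))).
    destruct (Hc i ltac:(lia)) as [C1 _]. destruct (Hc (S i) ltac:(lia)) as [C2 _]. split.
    - destruct (clamp_cases (c i) (c (S i)) 0) as [[A ->]|[[A ->]|[A ->]]]; lra.
    - destruct (clamp_cases (c i) (c (S i)) (2 * PI)) as [[A ->]|[[A ->]|[A ->]]]; lra. }
  destruct (P 0%nat ltac:(lia)) as [-> ->]. destruct (P 1%nat ltac:(lia)) as [-> ->].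
  destruct (P 2%nat ltac:(lia)) as [-> ->]. destruct (P 3%nat ltac:(lia)) as [-> ->].
  destruct (P 4%nat ltac:(lia)) as [-> ->]. split; ring.
Qed.

Lemma total_bound r : solves r -> admissible r ->
  Rabs (U 4 (2 * PI) (r (2 * PI)) - U 0 0 (r 0)) <= 2 * PI * K.
Proof.
  intros [_ [L Hd]] Hr. destruct (crosses_exist r Hr) as (c & Hc). assert (HPI := PI_RGT_0).
  destruct (glued_total r c Hr Hc) as [G0 G1].
  rewrite <- G1, <- (Rminus_0_r (glued r c (2 * PI))), <- G0.
  replace (2 * PI * K) with (K * (2 * PI - 0)) by ring.
  apply (mvt_const (L ++ map c (seq 0 6))); [lra| |].
  - intros x _. now apply glued_cont.
  - intros x Hx Hn.
    destruct (glued_derive r L c x) as (j & Hj & _ & Dj); auto.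
    { intro; apply Hn, in_or_app; auto. }
    { apply In_pts. intro; apply Hn, in_or_app; auto. }
    exists (DU j x (r x)). split; auto.
    assert (R1 : rho1 <= r x <= rho2) by (apply Hr; lra). apply (HDU j x (r x) (r x)); auto; lra.
Qed.

(** [mismatch] is applied to the difference of the two glued functions, whose derivative is at most
    K D in a common sector and at most 2 K elsewhere, with D = 2 |r 0 - s 0| from [solves_close]. *)
Lemma total_diff r s : solves r -> solves s -> admissible r -> admissible s ->
  Rabs ((U 4 (2 * PI) (r (2 * PI)) - U 0 0 (r 0)) - (U 4 (2 * PI) (s (2 * PI)) - U 0 0 (s 0)))
    <= (4 * PI + 32 * Lt) * K * Rabs (r 0 - s 0).
Proof.
  intros Sr Ss Hr Hs. assert (HPI := PI_RGT_0).
  set (D := 2 * Rabs (r 0 - s 0)).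
  assert (HD0 : 0 <= D) by (unfold D; generalize (Rabs_pos (r 0 - s 0)); lra).
  assert (HD := solves_close r s Sr Ss Hr Hs). fold D in HD.
  destruct Sr as [_ [L1 Hd1]]. destruct Ss as [_ [L2 Hd2]].
  destruct (crosses_exist r Hr) as (c & Hc). destruct (crosses_exist s Hs) as (c' & Hc').
  destruct (glued_total r c Hr Hc) as [G0 G1]. destruct (glued_total s c' Hs Hc') as [G0' G1'].
  assert (E : Rabs ((glued r c (2 * PI) - glued s c' (2 * PI)) - (glued r c 0 - glued s c' 0))
    <= 2 * PI * (K * D) + 2 * K * (8 * Lt * D)).
  { apply (mismatch r s c c' D (fun x => glued r c x - glued s c' x)
      ((L1 ++ L2) ++ map c (seq 0 6) ++ map c' (seq 0 6))); auto; try lra.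
    - now apply Rmult_le_pos.
    - intros x _. apply continuous_Rminus; now apply glued_cont.
    - intros x Hx Hn.
      destruct (glued_derive r L1 c x) as (j & Hj & Ij & Dj); auto.
      { intro; apply Hn, in_or_app; left; apply in_or_app; auto. }
      { apply In_pts. intro; apply Hn, in_or_app; right; apply in_or_app; auto. }
      destruct (glued_derive s L2 c' x) as (i & Hi & Ii & Di); auto.
      { intro; apply Hn, in_or_app; left; apply in_or_app; auto. }
      { apply In_pts. intro; apply Hn, in_or_app; right; apply in_or_app; auto. }
      assert (Hx2 : 0 <= x <= 2 * PI) by lra.
      assert (R1 : rho1 <= r x <= rho2) by (apply Hr; lra).
      assert (R2 : rho1 <= s x <= rho2) by (apply Hs; lra).
      exists (DU j x (r x) - DU i x (s x)). split; [now apply @is_derive_minus|]. split.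
      + destruct (HDU j x (r x) (r x)) as [B1 _]; auto. destruct (HDU i x (s x) (s x)) as [B2 _]; auto.
        apply Rle_trans with (2 * K).
        * unfold Rminus. eapply Rle_trans; [apply Rabs_triang|]. rewrite Rabs_Ropp. lra.
        * assert (0 <= K * D) by now apply Rmult_le_pos. lra.
      + intros k Hk I1 I2.
        assert (Huniq : forall y i1 i2, (i1 <= 4)%nat -> (i2 <= 4)%nat -> insecT i1 x y -> insecT i2 x y -> i1 = i2).
        { assert (Hmono : forall y a b, (a <= b)%nat -> (b <= 5)%nat -> tau a y <= tau b y).
          { intros y a b Hab. induction Hab as [|b Hab IH]; intros Hb; [lra|].
            specialize (Htaumono b y ltac:(lia)). specialize (IH ltac:(lia)). lra. }
          intros y i1 i2 H1 H2 [A1 A2] [B1 B2].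
          destruct (lt_eq_lt_dec i1 i2) as [[H|H]|H]; auto; exfalso.
          - specialize (Hmono y (S i1) i2 ltac:(lia) ltac:(lia)). lra.
          - specialize (Hmono y (S i2) i1 ltac:(lia) ltac:(lia)). lra. }
        assert (j = k) as -> by (apply (Huniq (r x)); auto).
        assert (i = k) as -> by (apply (Huniq (s x)); auto).
        destruct (HDU k x (r x) (s x)) as [_ B]; auto.
        apply Rle_trans with (1 := B). apply Rmult_le_compat_l; auto. }
  rewrite <- G1, <- G1'. rewrite G0, G0', Rminus_0_r, Rminus_0_r in E.
  apply Rle_trans with (1 := E). right. unfold D. ring.
Qed.

End FixedEps.

(** * Melnikov functions *)

Lemma continuous_psum (k : nat) (f : nat -> R -> R) (x : R) :
  (forall i, (1 <= i <= k)%nat -> continuous (f i) x) -> continuous (fun y => psum k (fun i => f i y)) x.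
Proof.
  induction k as [|k IH]; intros H; simpl; [apply continuous_const|].
  apply (continuous_plus (fun y => psum k (fun i => f i y)) (f (S k))).
  - apply IH. intros; apply H; lia.
  - apply H; lia.
Qed.

Lemma is_derive_psum (k : nat) (f : nat -> R -> R) (l : nat -> R) (x : R) :
  (forall i, (1 <= i <= k)%nat -> is_derive (f i) x (l i)) ->
  is_derive (fun y => psum k (fun i => f i y)) x (psum k l).
Proof.
  induction k as [|k IH]; intros H; simpl; [apply @is_derive_const|].
  apply (is_derive_plus (fun y => psum k (fun i => f i y)) (f (S k))).
  - apply IH. intros; apply H; lia.
  - apply H; lia.
Qed.

Lemma continuous_pert (p : nat -> nat -> R) k e (X Y : R -> R) s :
  continuous X s -> continuous Y s -> continuous (fun s => pert p k e (X s) (Y s)) s.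
Proof.
  intros HX HY. unfold pert.
  apply (continuous_psum k (fun i s => e ^ i * (p 0%nat i + p 1%nat i * X s + p 2%nat i * Y s))).
  intros i _. apply (continuous_scal_r (e ^ i) (fun s => p 0%nat i + p 1%nat i * X s + p 2%nat i * Y s)).
  apply (continuous_plus (fun s => p 0%nat i + p 1%nat i * X s) (fun s => p 2%nat i * Y s)).
  - apply (continuous_plus (fun s => p 0%nat i) (fun s => p 1%nat i * X s)).
    + apply continuous_const.
    + apply (continuous_scal_r (p 1%nat i) X), HX.
  - apply (continuous_scal_r (p 2%nat i) Y), HY.
Qed.

Lemma continuous_Rmult (f g : R -> R) x : continuous f x -> continuous g x ->
  continuous (fun y => f y * g y) x.
Proof. intros. now apply @continuous_mult. Qed.

Lemma continuous_Rplus (f g : R -> R) x : continuous f x -> continuous g x ->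
  continuous (fun y => f y + g y) x.
Proof. intros. now apply @continuous_plus. Qed.

Lemma continuous_polar_field p q k e (r : R -> R) s : continuous r s -> 0 < r s ->
  1 - / r s * psum k (fun i => e ^ i * angular p q i s (r s)) <> 0 ->
  continuous (fun s => polar_field p q k e s (r s)) s.
Proof.
  intros Hr Hp Hb.
  assert (Hx : continuous (fun s => r s * cos s) s) by (apply continuous_Rmult; [exact Hr|apply continuous_cos]).
  assert (Hy : continuous (fun s => r s * sin s) s) by (apply continuous_Rmult; [exact Hr|apply continuous_sin]).
  assert (HP : continuous (fun s => r s * sin s + pert p k e (r s * cos s) (r s * sin s)) s)
    by (apply continuous_Rplus; [exact Hy|now apply continuous_pert]).
  assert (HQ : continuous (fun s => - (r s * cos s) + pert q k e (r s * cos s) (r s * sin s)) s).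
  { apply continuous_Rplus; [|now apply continuous_pert].
    apply (continuous_opp (fun s => r s * cos s)), Hx. }
  unfold polar_field, polar_rhs, Rdiv.
  apply continuous_Rmult.
  - apply continuous_Rmult; [exact Hr|]. apply continuous_Rplus; now apply continuous_Rmult.
  - apply continuous_Rinv_comp.
    + apply continuous_Rminus; now apply continuous_Rmult.
    + rewrite <- pert_angular in Hb.
      set (P := pert p k e (r s * cos s) (r s * sin s)) in *. set (Q := pert q k e (r s * cos s) (r s * sin s)) in *.
      intro E. apply Hb. apply Rmult_eq_reg_l with (- (r s * r s)); [|nra]. rewrite Rmult_0_r, <- E.
      assert (E1 := sin2_cos2 s). unfold Rsqr in E1.
      replace (- (r s * r s) * (1 - / r s * (cos s * Q - sin s * P)))
        with (- (r s * r s * 1 - r s * (cos s * Q - sin s * P))) by (field; lra).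
      rewrite <- E1. ring.
Qed.

Lemma OL_unif rho1 rho2 N (G : nat -> R -> R -> R -> R) J :
  (forall j, (j <= J)%nat -> OL rho1 rho2 N (G j)) ->
  exists C e0, 0 <= C /\ 0 < e0 /\ forall j e th x y, (j <= J)%nat -> Rabs e < e0 -> 0 <= th <= 2 * PI ->
    rho1 <= x <= rho2 -> rho1 <= y <= rho2 ->
    Rabs (G j e th x) <= C * Rabs e ^ N /\
    Rabs (G j e th x - G j e th y) <= C * Rabs e ^ N * Rabs (x - y).
Proof.
  induction J as [|J IH]; intros H.
  - destruct (H 0%nat (le_n 0)) as (C & e0 & HC & He & HH). exists C, e0. split; auto. split; auto.
    intros j e th x y Hj. replace j with 0%nat by lia. apply HH.
  - destruct IH as (C1 & e1 & HC1 & He1 & H1); [intros; apply H; lia|].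
    destruct (H (S J) (le_n _)) as (C2 & e2 & HC2 & He2 & H2).
    exists (C1 + C2), (Rmin e1 e2). split; [lra|]. split; [now apply Rmin_glb_lt|].
    intros j e th x y Hj He Hth Hx Hy.
    assert (Rabs e < e1) by (apply Rlt_le_trans with (1 := He), Rmin_l).
    assert (Rabs e < e2) by (apply Rlt_le_trans with (1 := He), Rmin_r).
    assert (0 <= Rabs e ^ N) as Hp by (apply pow_le, Rabs_pos).
    assert (0 <= Rabs (x - y)) by apply Rabs_pos.
    assert (0 <= C1 * Rabs e ^ N) by now apply Rmult_le_pos.
    assert (0 <= C2 * Rabs e ^ N) by now apply Rmult_le_pos.
    destruct (Nat.eq_dec j (S J)) as [->|Hne].
    + destruct (H2 e th x y) as [A B]; auto. split; nra.
    + destruct (H1 j e th x y) as [A B]; auto; [lia|]. split; nra.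
Qed.

Section Expansion.

Context (m n : nat) (Hm : (0 < m)%nat) (Hn : (0 < n)%nat) (Em : Nat.Even m) (En : Nat.Even n)
  (cf : Coeffs) (k : nat).

(* Sectors 0, 2, 4 lie in the region y^n - x^m < 0, sectors 1, 3 in y^n - x^m > 0. *)
Definition pc (j : nat) : nat -> nat -> R := if Nat.even j then cal cf else ca cf.
Definition qc (j : nat) : nat -> nat -> R := if Nat.even j then cbe cf else cb cf.

Lemma Frhs_sector e j th r : (j <= 4)%nat -> 0 < r -> insec m n Hm Hn j th r ->
  swf m n (r * cos th) (r * sin th) <> 0 /\ Frhs cf k m n e th r = polar_field (pc j) (qc j) k e th r.
Proof.
  intros Hj Hr Hin. destruct (swf_sector m n Hm Hn Em En j r th Hj Hr Hin) as [A B].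
  unfold Frhs, pc, qc. destruct (Nat.even j).
  - specialize (A eq_refl). split; [lra|]. destruct (Rlt_dec 0 _); [lra|reflexivity].
  - specialize (B eq_refl). split; [lra|]. destruct (Rlt_dec 0 _); [reflexivity|lra].
Qed.

Lemma Frhs_cases e th r : exists j, (j <= 4)%nat /\ Frhs cf k m n e th r = polar_field (pc j) (qc j) k e th r.
Proof.
  unfold Frhs. destruct (Rlt_dec 0 _).
  - exists 1%nat. split; [lia|reflexivity].
  - exists 0%nat. split; [lia|reflexivity].
Qed.

Context (u ut ur : nat -> nat -> R -> R -> R)
  (Hu : avg_coeffs (sector_angle m n Hm Hn) (fun j i => polar_coeff (pc j) (qc j) i) k u ut ur).

Definition Dm (i : nat) (z : R) : R := u i 0%nat 0 z.

(** The constants are uniform for initial radii in [a, b]. The third estimate, a Lipschitz bound of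
    order eps^(k+1) on the remainder, is what isolates periodic orbits; the second alone would only
    locate them. *)
Lemma displacement a b : 0 < a -> a <= b -> exists C e0, 0 <= C /\ 0 < e0 /\ forall e, Rabs e < e0 ->
  (forall z, a <= z <= b -> exists r, IsSol cf k m n e z r) /\
  (forall z r, a <= z <= b -> IsSol cf k m n e z r ->
     Rabs (r (2 * PI) - z - psum k (fun i => e ^ i * Dm i z)) <= C * Rabs e ^ S k) /\
  (forall z z' r r', a <= z <= b -> a <= z' <= b -> IsSol cf k m n e z r -> IsSol cf k m n e z' r' ->
     Rabs ((r (2 * PI) - z - psum k (fun i => e ^ i * Dm i z))
         - (r' (2 * PI) - z' - psum k (fun i => e ^ i * Dm i z'))) <= C * Rabs e ^ S k * Rabs (z - z')).
Proof.
  intros Ha Hab. assert (HPI := PI_RGT_0).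
  (* Solutions starting in [a, b] may move by eta = a/2 and still remain at positive radii in
     [rho1, rho2]. *)
  set (rho1 := a / 2). set (rho2 := b + a / 2). set (eta := a / 2).
  assert (Hrho : 0 < rho1) by (unfold rho1; lra).
  set (tau := sector_angle m n Hm Hn) in *.
  assert (exists Lt, 0 <= Lt /\ forall j x y, rho1 <= x <= rho2 -> rho1 <= y <= rho2 ->
     Rabs (tau j x - tau j y) <= Lt * Rabs (x - y)) as (Lt & HLt & Htaulip).
  { assert (A : forall j, exists C, 0 <= C /\ forall x y, rho1 <= x <= rho2 -> rho1 <= y <= rho2 ->
      Rabs (tau j x - tau j y) <= C * Rabs (x - y)).
    { intros j. destruct (smooth_bounded rho1 rho2 (tau j) Hrho (smooth_sector_angle m n Hm Hn j)) as (C & HC & H).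
      exists C. split; auto. intros x y Hx Hy. now apply H. }
    assert (B : forall J, exists C, 0 <= C /\ forall j x y, (j <= J)%nat -> rho1 <= x <= rho2 -> rho1 <= y <= rho2 ->
      Rabs (tau j x - tau j y) <= C * Rabs (x - y)).
    { induction J as [|J (C & HC & H)].
      - destruct (A 0%nat) as (C & HC & H). exists C. split; auto. intros j x y Hj. replace j with 0%nat by lia. apply H.
      - destruct (A (S J)) as (K & HK & H'). exists (C + K). split; [lra|]. intros j x y Hj Hx Hy.
        assert (0 <= Rabs (x - y)) by apply Rabs_pos.
        destruct (Nat.eq_dec j (S J)) as [->|Hne].
        + specialize (H' x y Hx Hy). nra.
        + specialize (H j x y ltac:(lia) Hx Hy). nra. }
    destruct (B 4%nat) as (C & HC & H). exists C. split; auto. intros j x y Hx Hy.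
    destruct (le_lt_dec j 4) as [Hj|Hj]; [now apply H|].
    destruct j as [|[|[|[|[|j]]]]]; try lia. unfold tau; simpl. rewrite Rminus_diag, Rabs_R0.
    apply Rmult_le_pos; auto. apply Rabs_pos. }
  destruct (OL_unif rho1 rho2 1 (fun j => polar_field (pc j) (qc j) k) 4) as (C1 & e1 & HC1 & He1 & HF).
  { intros j _. now apply OL_polar_field. }
  set (DU := fun j e th r => polar_field (pc j) (qc j) k e th r
    + psum k (fun i => e ^ i * (ut i j th r + ur i j th r * polar_field (pc j) (qc j) k e th r))).
  destruct (OL_unif rho1 rho2 (S k) DU 4) as (C2 & e2 & HC2 & He2 & HDU).
  { intros j Hj. apply (OL_total rho1 rho2 Hrho (pc j) (qc j) k (fun i => ut i j) (fun i => ur i j)).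
    intros i Hi. split; [now apply (avg_Sep _ _ _ _ _ _ Hu)|].
    intros th r Hr. now apply (avg_eq _ _ _ _ _ _ Hu). }
  destruct (polar_field_fix rho1 rho2 Hrho (pc 0) (qc 0) k) as (e3 & He3 & H3).
  destruct (polar_field_fix rho1 rho2 Hrho (pc 1) (qc 1) k) as (e4 & He4 & H4).
  set (W := 2 * PI + 16 * Lt).
  assert (HW : 0 < W) by (unfold W; lra).
  (* For |e| < e5 the product W M, with M = C1 |e|, is below both 1/2 and eta, which gives all three
     smallness conditions. *)
  set (e5 := Rmin (1 / 2) eta / (W * (C1 + 1))).
  assert (He5 : 0 < e5).
  { apply Rdiv_lt_0_compat; [apply Rmin_glb_lt; unfold eta; lra|apply Rmult_lt_0_compat; lra]. }
  exists (C2 * (2 * W) + 2 * PI * C2), (Rmin e1 (Rmin e2 (Rmin e3 (Rmin e4 e5)))).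
  split. { apply Rplus_le_le_0_compat; apply Rmult_le_pos; lra. }
  split. { repeat apply Rmin_glb_lt; assumption. }
  intros e He.
  assert (L1 : Rabs e < e1) by (apply Rlt_le_trans with (1 := He), Rmin_l).
  assert (L2' : Rabs e < Rmin e2 (Rmin e3 (Rmin e4 e5))) by (apply Rlt_le_trans with (1 := He), Rmin_r).
  assert (L2 : Rabs e < e2) by (apply Rlt_le_trans with (1 := L2'), Rmin_l).
  assert (L3' : Rabs e < Rmin e3 (Rmin e4 e5)) by (apply Rlt_le_trans with (1 := L2'), Rmin_r).
  assert (L3 : Rabs e < e3) by (apply Rlt_le_trans with (1 := L3'), Rmin_l).
  assert (L4' : Rabs e < Rmin e4 e5) by (apply Rlt_le_trans with (1 := L3'), Rmin_r).
  assert (L4 : Rabs e < e4) by (apply Rlt_le_trans with (1 := L4'), Rmin_l).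
  assert (L5 : Rabs e < e5) by (apply Rlt_le_trans with (1 := L4'), Rmin_r).
  assert (Hae : 0 <= Rabs e) by apply Rabs_pos.
  set (M := C1 * Rabs e). assert (HM : 0 <= M) by now apply Rmult_le_pos.
  assert (HWM : W * M < Rmin (1 / 2) eta).
  { unfold e5 in L5. apply Rlt_div_r in L5; [|apply Rmult_lt_0_compat; lra].
    apply Rle_lt_trans with (2 := L5). unfold M.
    replace (W * (C1 * Rabs e)) with (Rabs e * (W * C1)) by ring.
    apply Rmult_le_compat_l; auto. nra. }
  assert (HWM1 : W * M < 1 / 2) by (apply Rlt_le_trans with (1 := HWM), Rmin_l).
  assert (HWM2 : W * M < eta) by (apply Rlt_le_trans with (1 := HWM), Rmin_r).
  assert (HLM : 0 <= Lt * M) by now apply Rmult_le_pos.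
  assert (HPM : 0 <= PI * M) by (apply Rmult_le_pos; lra).
  assert (Hsm1 : Lt * M <= 1 / 2) by (unfold W in HWM1; lra).
  assert (Hsm3 : 2 * PI * M < eta) by (unfold W in HWM2; lra).
  assert (Hsm2 : (2 * PI + 16 * Lt) * M <= 1 / 2) by (fold W; lra).
  set (f := Frhs cf k m n e). set (fl := fun j th r => polar_field (pc j) (qc j) k e th r).
  assert (Htau0 : forall x, tau 0%nat x = 0) by reflexivity.
  assert (Htau5 : forall x, tau 5%nat x = 2 * PI) by reflexivity.
  assert (Htaucont : forall j x, 0 < x -> continuous (tau j) x).
  { intros j x Hx. apply (smooth_continuous positive); [apply smooth_sector_angle|exact Hx]. }
  assert (Htaumono : forall j x, (j <= 4)%nat -> tau j x < tau (S j) x) by (intros; now apply sector_angle_lt).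
  assert (Hfb : forall th x, 0 <= th <= 2 * PI -> rho1 <= x <= rho2 -> Rabs (f th x) <= M).
  { intros th x Hth Hx. unfold f. destruct (Frhs_cases e th x) as (j & Hj & ->).
    destruct (HF j e th x x) as [A _]; auto. rewrite pow_1 in A. exact A. }
  assert (Hfsec : forall j th x, (j <= 4)%nat -> 0 <= th <= 2 * PI -> rho1 <= x <= rho2 -> insecT tau j th x ->
     f th x = fl j th x).
  { intros j th x Hj Hth Hx Hin. unfold f, fl. apply Frhs_sector; auto. lra. }
  assert (Hfllip : forall j th x y, (j <= 4)%nat -> 0 <= th <= 2 * PI -> rho1 <= x <= rho2 -> rho1 <= y <= rho2 ->
     Rabs (fl j th x - fl j th y) <= M * Rabs (x - y)).
  { intros j th x y Hj Hth Hx Hy. destruct (HF j e th x y) as [_ A]; auto. rewrite pow_1 in A. exact A. }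
  assert (Hflcont : forall j (r : R -> R) th, (j <= 4)%nat -> 0 <= th <= 2 * PI -> rho1 <= r th <= rho2 ->
     continuous r th -> continuous (fun s => fl j s (r s)) th).
  { intros j r th Hj Hth Hr Hc. unfold fl. apply continuous_polar_field; auto; [lra|].
    unfold pc, qc. destruct (Nat.even j).
    - destruct (H3 e th (r th) L3 Hth Hr) as [_ A]. unfold pc, qc in A. simpl in A. lra.
    - destruct (H4 e th (r th) L4 Hth Hr) as [_ A]. unfold pc, qc in A. simpl in A. lra. }
  set (U := fun j th r => r + psum k (fun i => e ^ i * u i j th r)).
  set (DUe := fun j th r => DU j e th r). set (K := C2 * Rabs e ^ S k).
  assert (HK : 0 <= K) by (apply Rmult_le_pos; auto; now apply pow_le).
  assert (HUmatch : forall j x, (j <= 3)%nat -> rho1 <= x <= rho2 ->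
     U j (tau (S j) x) x = U (S j) (tau (S j) x) x).
  { intros j x Hj Hx. unfold U. f_equal. apply psum_ext. intros i Hi. f_equal.
    assert (A := avg_match _ _ _ _ _ _ Hu i j x Hi ltac:(lia) ltac:(lra)). fold tau in A.
    destruct j as [|[|[|[|j]]]]; try lia; exact A. }
  assert (HUcont : forall j (r : R -> R) th, (j <= 4)%nat -> rho1 <= r th <= rho2 -> continuous r th ->
     continuous (fun s => U j s (r s)) th).
  { intros j r th Hj Hr Hc. unfold U. apply continuous_Rplus; auto.
    apply (continuous_psum k (fun i s => e ^ i * u i j s (r s))). intros i Hi.
    apply (continuous_scal_r (e ^ i) (fun s => u i j s (r s))).
    apply Sep_continuous; auto; [now apply (avg_Sep _ _ _ _ _ _ Hu)|lra]. }
  assert (HUder : forall j (r : R -> R) th, (j <= 4)%nat -> 0 <= th <= 2 * PI -> rho1 <= r th <= rho2 ->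
     is_derive r th (fl j th (r th)) -> is_derive (fun s => U j s (r s)) th (DUe j th (r th))).
  { intros j r th Hj Hth Hr Hd. unfold U, DUe, DU.
    apply (is_derive_plus r (fun s => psum k (fun i => e ^ i * u i j s (r s)))); auto.
    apply (is_derive_psum k (fun i s => e ^ i * u i j s (r s))). intros i Hi.
    apply (is_derive_scal (fun s => u i j s (r s))).
    apply (grad_chain _ _ _ (avg_grad _ _ _ _ _ _ Hu i j Hi Hj)); [lra|exact Hd]. }
  assert (HDUe : forall j th x y, (j <= 4)%nat -> 0 <= th <= 2 * PI -> rho1 <= x <= rho2 -> rho1 <= y <= rho2 ->
     Rabs (DUe j th x) <= K /\ Rabs (DUe j th x - DUe j th y) <= K * Rabs (x - y)).
  { intros j th x y Hj Hth Hx Hy. now apply HDU. }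
  (* Because the u_i vanish at 2 PI, the total variation of U along an orbit is the displacement
     minus the sum of eps^i u_i(0, z). *)
  assert (HU4 : forall x, 0 < x -> U 4%nat (2 * PI) x = x).
  { intros x Hx. unfold U.
    replace (psum k (fun i => e ^ i * u i 4%nat (2 * PI) x)) with (psum k (fun _ => 0 * 0)).
    - rewrite psum_scal. ring.
    - apply psum_ext. intros i Hi. assert (A := avg_match _ _ _ _ _ _ Hu i 4%nat x Hi ltac:(lia) Hx).
      simpl in A. rewrite A. ring. }
  assert (HIs : forall z r, a <= z <= b -> IsSol cf k m n e z r -> r 0 = z /\ solves f r /\ admissible rho1 rho2 M r).
  { intros z r Hz (S1 & S2 & L & S3). split; auto.
    assert (Ss : solves f r).
    { split; auto. exists L. intros th Hth HnL. now apply S3. }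
    split; auto. apply (solves_admissible rho1 rho2 M eta f); auto; rewrite S1; unfold rho1, rho2, eta; lra. }
  split; [|split].
  - intros z Hz.
    destruct (exists_solution tau rho1 rho2 Lt M eta f fl) with (z := z) as (r & R0 & Ar & L & HL); auto;
      try (unfold rho1, rho2, eta; lra).
    exists r. split; auto. split.
    + intros th Hth. destruct Ar as [A1 _]. destruct (A1 th Hth). split; [lra|auto].
    + exists L. intros th Hth HnL. destruct (HL th Hth HnL) as (D1 & j & Hj & Hin). split; [|exact D1].
      destruct Ar as [A1 _]. destruct (A1 th ltac:(lra)).
      apply (Frhs_sector e j); auto. lra.
  - intros z r Hz Hs. destruct (HIs z r Hz Hs) as (R0 & Ss & Ar).
    assert (B := total_bound tau rho1 rho2 Lt M f fl Hrho HLt Htau0 Htau5 Htaulip Htaucont Htaumono Hfsec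
      Hsm1 U DUe K HUmatch HUcont HUder HDUe r Ss Ar).
    rewrite HU4 in B.
    2:{ destruct Ar as [A1 _]. destruct (A1 (2 * PI) ltac:(lra)). lra. }
    rewrite R0 in B. unfold U in B. unfold Dm.
    replace (r (2 * PI) - z - psum k (fun i => e ^ i * u i 0%nat 0 z))
      with (r (2 * PI) - (z + psum k (fun i => e ^ i * u i 0%nat 0 z))) by ring.
    apply Rle_trans with (1 := B). unfold K.
    replace ((C2 * (2 * W) + 2 * PI * C2) * Rabs e ^ S k) with (2 * PI * (C2 * Rabs e ^ S k) + 2 * W * (C2 * Rabs e ^ S k)) by ring.
    assert (0 <= 2 * W * (C2 * Rabs e ^ S k)) by (apply Rmult_le_pos; [lra|exact HK]). lra.
  - intros z z' r r' Hz Hz' Hs Hs'. destruct (HIs z r Hz Hs) as (R0 & Ss & Ar).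
    destruct (HIs z' r' Hz' Hs') as (R0' & Ss' & Ar').
    assert (B := total_diff tau rho1 rho2 Lt M f fl Hrho HLt HM Htau0 Htau5 Htaulip Htaucont Htaumono Hfb Hfsec
      Hfllip Hsm1 Hsm2 U DUe K HK HUmatch HUcont HUder HDUe r r' Ss Ss' Ar Ar').
    rewrite !HU4 in B.
    2:{ destruct Ar' as [A1 _]. destruct (A1 (2 * PI) ltac:(lra)). lra. }
    2:{ destruct Ar as [A1 _]. destruct (A1 (2 * PI) ltac:(lra)). lra. }
    rewrite R0, R0' in B. unfold U in B. unfold Dm.
    replace (r (2 * PI) - z - psum k (fun i => e ^ i * u i 0%nat 0 z) -
      (r' (2 * PI) - z' - psum k (fun i => e ^ i * u i 0%nat 0 z')))
      with (r (2 * PI) - (z + psum k (fun i => e ^ i * u i 0%nat 0 z)) -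
      (r' (2 * PI) - (z' + psum k (fun i => e ^ i * u i 0%nat 0 z')))) by ring.
    apply Rle_trans with (1 := B). apply Rmult_le_compat_r; [apply Rabs_pos|].
    unfold K, W.
    replace ((C2 * (2 * (2 * PI + 16 * Lt)) + 2 * PI * C2) * Rabs e ^ S k)
      with ((4 * PI + 32 * Lt) * (C2 * Rabs e ^ S k) + 2 * PI * (C2 * Rabs e ^ S k)) by ring.
    assert (0 <= 2 * PI * (C2 * Rabs e ^ S k)) by (apply Rmult_le_pos; [lra|exact HK]). lra.
Qed.

End Expansion.

Lemma psum_shift (k : nat) (f : nat -> R) : psum (S k) f = f 1%nat + psum k (fun i => f (S i)).
Proof.
  induction k as [|k IH]; [simpl; ring|].
  change (psum (S (S k)) f) with (psum (S k) f + f (S (S k))). rewrite IH. simpl. ring.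
Qed.

Lemma psum_bound (k : nat) (d : nat -> R) : exists B, 0 <= B /\ forall e, Rabs e <= 1 ->
  Rabs (psum k (fun i => e ^ i * d i)) <= B * Rabs e.
Proof.
  induction k as [|k (B & HB & H)].
  - exists 0. split; [lra|]. intros. simpl. rewrite Rabs_R0. lra.
  - exists (B + Rabs (d (S k))). split; [generalize (Rabs_pos (d (S k))); lra|].
    intros e He. cbn [psum]. eapply Rle_trans; [apply Rabs_triang|]. specialize (H e He).
    rewrite Rabs_mult, <- RPow_abs. simpl.
    assert (Rabs e ^ k <= 1) by (rewrite <- (pow1 k); apply pow_incr; split; [apply Rabs_pos|auto]).
    assert (0 <= Rabs e ^ k) by (apply pow_le, Rabs_pos).
    assert (0 <= Rabs e * Rabs (d (S k))) by (apply Rmult_le_pos; apply Rabs_pos). nra.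
Qed.

Lemma coeffs_zero (k : nat) : forall (d : nat -> R) (C e0 : R), 0 < e0 ->
  (forall e, Rabs e < e0 -> Rabs (psum k (fun i => e ^ i * d i)) <= C * Rabs e ^ S k) ->
  forall i, (1 <= i <= k)%nat -> d i = 0.
Proof.
  induction k as [|k IH]; intros d C e0 He0 H i Hi; [lia|].
  assert (H2 : forall e, e <> 0 -> Rabs e < e0 ->
    Rabs (d 1%nat + psum k (fun i => e ^ i * d (S i))) <= C * Rabs e ^ S k).
  { intros e Hne He. specialize (H e He). rewrite psum_shift in H.
    assert (0 < Rabs e) by now apply Rabs_pos_lt.
    apply Rmult_le_reg_l with (Rabs e); auto. rewrite <- Rabs_mult.
    replace (e * (d 1%nat + psum k (fun i => e ^ i * d (S i))))
      with (e ^ 1 * d 1%nat + psum k (fun i => e ^ S i * d (S i))).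
    - apply Rle_trans with (1 := H). simpl. right. ring.
    - rewrite Rmult_plus_distr_l, <- psum_scal. f_equal; [ring|]. apply psum_ext. intros; simpl; ring. }
  assert (D1 : d 1%nat = 0).
  { destruct (psum_bound k (fun i => d (S i))) as (B & HB & HBe).
    destruct (Req_dec (d 1%nat) 0) as [|Hne]; auto. exfalso.
    assert (Hd : 0 < Rabs (d 1%nat)) by now apply Rabs_pos_lt.
    set (A := Rabs C + B + 1). assert (0 < A) by (unfold A; generalize (Rabs_pos C); lra).
    set (e := Rmin (e0 / 2) (Rmin 1 (Rabs (d 1%nat) / (2 * A)))).
    assert (0 < Rabs (d 1%nat) / (2 * A)) by (apply Rdiv_lt_0_compat; lra).
    assert (He : 0 < e) by (unfold e; repeat apply Rmin_glb_lt; lra).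
    assert (He1 : e <= e0 / 2) by apply Rmin_l.
    assert (He2 : e <= 1) by (eapply Rle_trans; [apply Rmin_r|apply Rmin_l]).
    assert (He3 : e <= Rabs (d 1%nat) / (2 * A)) by (eapply Rle_trans; [apply Rmin_r|apply Rmin_r]).
    assert (Ea : Rabs e = e) by (apply Rabs_right; lra).
    specialize (H2 e ltac:(lra) ltac:(lra)). specialize (HBe e ltac:(lra)). rewrite Ea in H2, HBe.
    assert (Rabs (d 1%nat) <= C * e ^ S k + B * e).
    { set (p := psum k (fun i => e ^ i * d (S i))) in *.
      replace (d 1%nat) with ((d 1%nat + p) + - p) by ring.
      eapply Rle_trans; [apply Rabs_triang|]. rewrite Rabs_Ropp. lra. }
    assert (C * e ^ S k <= Rabs C * e).
    { simpl. assert (e ^ k <= 1) by (rewrite <- (pow1 k); apply pow_incr; lra).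
      assert (0 <= e ^ k) by (apply pow_le; lra).
      apply Rle_trans with (Rabs C * (e * e ^ k)).
      - apply Rmult_le_compat_r; [apply Rmult_le_pos; lra|apply Rle_abs].
      - apply Rmult_le_compat_l; [apply Rabs_pos|]. nra. }
    apply Rle_div_r in He3; [|lra].
    assert (e * (2 * A) = 2 * (Rabs C * e + B * e) + 2 * e) by (unfold A; ring). lra. }
  destruct i as [|[|i]]; try lia; auto.
  apply (IH (fun i => d (S i)) (Rabs C) (Rmin e0 1)); [apply Rmin_glb_lt; lra| |lia].
  intros e He.
  assert (L1 : Rabs e < e0) by (apply Rlt_le_trans with (1 := He), Rmin_l).
  destruct (Req_dec e 0) as [->|Hne].
  - destruct (psum_bound k (fun i => d (S i))) as (B & HB & HBe).
    specialize (HBe 0). rewrite Rabs_R0 in *. eapply Rle_trans; [apply HBe; lra|].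
    rewrite Rmult_0_r. apply Rmult_le_pos; [apply Rabs_pos|apply pow_le; lra].
  - specialize (H2 e Hne L1). rewrite D1, Rplus_0_l in H2. apply Rle_trans with (1 := H2).
    apply Rmult_le_compat_r; [apply pow_le, Rabs_pos|apply Rle_abs].
Qed.

Section Melnikov.

Context (m n : nat) (Hm : (0 < m)%nat) (Hn : (0 < n)%nat) (Em : Nat.Even m) (En : Nat.Even n)
  (cf : Coeffs) (k : nat) (u ut ur : nat -> nat -> R -> R -> R)
  (Hu : avg_coeffs (sector_angle m n Hm Hn) (fun j i => polar_coeff (pc cf j) (qc cf j) i) k u ut ur).

Lemma melnikov_expansion : MelnikovExpansion cf k m n (Dm u).
Proof.
  intros r0 Hr0.
  destruct (displacement m n Hm Hn Em En cf k u ut ur Hu r0 r0 Hr0 (Rle_refl _)) as (C & e0 & HC & He0 & H).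
  exists C, e0. split; auto. intros e He. destruct (H e He) as (H1 & H2 & _). split.
  - apply H1. lra.
  - intros r Hr. apply H2; auto. lra.
Qed.

(** Two expansions of the same displacement, compared along one solution, agree to order k. This
    carries every upper bound over from the constructed functions to an arbitrary family D. *)
Lemma melnikov_unique D : MelnikovExpansion cf k m n D ->
  forall i r, (1 <= i <= k)%nat -> 0 < r -> D i r = Dm u i r.
Proof.
  intros HD i r Hi Hr.
  destruct (HD r Hr) as (C1 & e1 & He1 & H1). destruct (melnikov_expansion r Hr) as (C2 & e2 & He2 & H2).
  apply Rminus_diag_uniq.
  apply (coeffs_zero k (fun i => D i r - Dm u i r) (C1 + C2) (Rmin e1 e2)); auto.
  { now apply Rmin_glb_lt. }
  intros e He.
  destruct (H1 e) as [[rr Hs] A1]. { apply Rlt_le_trans with (1 := He), Rmin_l. }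
  destruct (H2 e) as [_ A2]. { apply Rlt_le_trans with (1 := He), Rmin_r. }
  specialize (A1 rr Hs). specialize (A2 rr Hs).
  replace (psum k (fun i => e ^ i * (D i r - Dm u i r))) with
    (psum k (fun i => e ^ i * D i r) + (-1) * psum k (fun i => e ^ i * Dm u i r)).
  2:{ rewrite <- psum_scal, <- psum_plus. apply psum_ext. intros; ring. }
  set (p := psum k (fun i => e ^ i * D i r)) in *. set (q := psum k (fun i => e ^ i * Dm u i r)) in *.
  replace (p + -1 * q) with ((rr (2 * PI) - r - q) + - (rr (2 * PI) - r - p)) by ring.
  eapply Rle_trans; [apply Rabs_triang|]. rewrite Rabs_Ropp. lra.
Qed.

End Melnikov.

(** * Persistence of simple zeros as limit cycles *)

Lemma separation (l : list R) : NoDup l -> exists eta, 0 < eta /\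
  forall x y, In x l -> In y l -> x <> y -> 2 * eta <= Rabs (x - y).
Proof.
  induction l as [|x l IH]; intros Hn.
  - exists 1. split; [lra|]. intros x y [].
  - inversion Hn as [|? ? Hx Hl]; subst. destruct (IH Hl) as (eta & He & H).
    assert (A : exists d, 0 < d /\ forall y, In y l -> d <= Rabs (x - y)).
    { clear - Hx. induction l as [|y l IH].
      - exists 1. split; [lra|]. intros y [].
      - destruct IH as (d & Hd & H); [intro; apply Hx; now right|].
        assert (x <> y) by (intro; apply Hx; now left).
        exists (Rmin d (Rabs (x - y))). split.
        + apply Rmin_glb_lt; auto. apply Rabs_pos_lt. lra.
        + intros z [<-|Hz]; [apply Rmin_r|]. apply Rle_trans with (1 := Rmin_l _ _). auto. }
    destruct A as (d & Hd & HA).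
    exists (Rmin eta (d / 2)). split; [apply Rmin_glb_lt; lra|].
    assert (Rmin eta (d / 2) <= eta) by apply Rmin_l. assert (Rmin eta (d / 2) <= d / 2) by apply Rmin_r.
    intros a b [<-|Ia] [<-|Ib] Hne; try congruence.
    + specialize (HA b Ib). lra.
    + specialize (HA a Ia). rewrite Rabs_minus_sym. lra.
    + specialize (H a b Ia Ib Hne). lra.
Qed.

(** Finitely many zeros admit a common range of eps, and neighbourhoods of radius eta around points
    at distance at least 2 eta keep the resulting orbits distinct. *)
Lemma collect (P : R -> R -> Prop) (eta : R) (zs : list R) : NoDup zs ->
  (forall x y, In x zs -> In y zs -> x <> y -> 2 * eta <= Rabs (x - y)) ->
  (forall z0, In z0 zs -> exists e0, 0 < e0 /\ forall e, 0 < Rabs e < e0 ->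
     exists z, Rabs (z - z0) < eta /\ P e z) ->
  exists e0, 0 < e0 /\ forall e, 0 < Rabs e < e0 -> exists ws, NoDup ws /\ length ws = length zs /\
    forall w, In w ws -> P e w /\ exists z0, In z0 zs /\ Rabs (w - z0) < eta.
Proof.
  induction zs as [|x zs IH]; intros Hn Hs H.
  - exists 1. split; [lra|]. intros e _. exists []. split; [constructor|]. split; auto. intros w [].
  - inversion Hn as [|? ? Hx Hl]; subst.
    destruct IH as (e1 & He1 & H1); auto.
    { intros a b Ia Ib. apply Hs; now right. }
    { intros z0 Hz0. apply H. now right. }
    destruct (H x (or_introl eq_refl)) as (e2 & He2 & H2).
    exists (Rmin e1 e2). split; [now apply Rmin_glb_lt|]. intros e He.
    assert (Rmin e1 e2 <= e1) by apply Rmin_l. assert (Rmin e1 e2 <= e2) by apply Rmin_r.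
    destruct (H1 e) as (ws & W1 & W2 & W3); [lra|]. destruct (H2 e) as (z & Z1 & Z2); [lra|].
    exists (z :: ws). split; [|split].
    + constructor; auto. intros Hi. destruct (W3 z Hi) as (_ & z0 & I0 & Hz0).
      assert (x <> z0) by (intro; subst; auto).
      specialize (Hs x z0 (or_introl eq_refl) (or_intror I0) H4).
      replace (x - z0) with (- (z - x) + (z - z0)) in Hs by ring.
      assert (T := Rabs_triang (- (z - x)) (z - z0)). rewrite Rabs_Ropp in T. lra.
    + simpl. now rewrite W2.
    + intros w [<-|Hw].
      * split; auto. exists x. split; [now left|auto].
      * destruct (W3 w Hw) as (A & z0 & I0 & Hz0). split; auto. exists z0. split; [now right|auto].
Qed.

Lemma local_slope (g g' : R -> R) (z : R) : 0 < z ->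
  (forall x, 0 < x -> is_derive g x (g' x)) -> continuous g' z -> g' z <> 0 ->
  exists s c d, (s = 1 \/ s = -1) /\ 0 < c /\ 0 < d /\ forall x y, Rabs (x - z) <= d -> Rabs (y - z) <= d -> x <= y ->
    c * (y - x) <= s * (g y - g x).
Proof.
  intros Hz Hg Hc Hne.
  assert (Hp : 0 < Rabs (g' z)) by now apply Rabs_pos_lt.
  set (c := Rabs (g' z) / 2).
  destruct (Hc (ball (g' z) (mkposreal c ltac:(unfold c; lra)))) as [d Hd]; [apply locally_ball|].
  assert (0 < d) by apply cond_pos.
  exists (if Rlt_dec 0 (g' z) then 1 else -1), c, (Rmin (d / 2) (z / 2)).
  split; [destruct (Rlt_dec 0 (g' z)); auto|]. split; [unfold c; lra|].
  split; [apply Rmin_glb_lt; lra|]. intros x y Hx Hy Hxy.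
  assert (M1 : Rmin (d / 2) (z / 2) <= d / 2) by apply Rmin_l.
  assert (M2 : Rmin (d / 2) (z / 2) <= z / 2) by apply Rmin_r.
  apply Rabs_le_between in Hx. apply Rabs_le_between in Hy.
  destruct (MVT_gen g x y g') as (w & Hw & E).
  - rewrite Rmin_left by auto. intros w Hw. apply Hg. lra.
  - rewrite Rmin_left by auto. intros w Hw. apply continuity_pt_filterlim, @ex_derive_continuous.
    eexists; apply Hg; lra.
  - rewrite Rmin_left, Rmax_right in Hw by auto. rewrite E.
    assert (B := Hd w). unfold ball in B; simpl in B; unfold AbsRing_ball, abs, minus, plus, opp in B; simpl in B.
    assert (Bw : Rabs (w + - z) < d) by (apply Rabs_lt_between; lra).
    specialize (B Bw). apply Rabs_def2 in B. unfold c in *.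
    rewrite <- Rmult_assoc. apply Rmult_le_compat_r; [lra|].
    destruct (Rlt_dec 0 (g' z)) as [H1|H1].
    + rewrite Rabs_right in * by lra. lra.
    + rewrite Rabs_left in * by lra. lra.
Qed.

Section Cycles.

Context (m n : nat) (Hm : (0 < m)%nat) (Hn : (0 < n)%nat) (Em : Nat.Even m) (En : Nat.Even n)
  (cf : Coeffs) (u ut ur : nat -> nat -> R -> R -> R)
  (Hu : avg_coeffs (sector_angle m n Hm Hn) (fun j i => polar_coeff (pc cf j) (qc cf j) i) 2 u ut ur)
  (HD1 : forall r, 0 < r -> Dm u 1 r = 0).

Lemma Dm2_grad : exists g', (forall x, 0 < x -> is_derive (Dm u 2) x (g' x)) /\
  (forall x, 0 < x -> continuous g' x).
Proof.
  exists (fun x => ur 2%nat 0%nat 0 x). split.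
  - intros x Hx. apply (grad_r _ _ _ (avg_grad _ _ _ _ _ _ Hu 2%nat 0%nat ltac:(lia) ltac:(lia))). exact Hx.
  - intros x Hx. destruct (avg_Sep _ _ _ _ _ _ Hu 2%nat 0%nat ltac:(lia) ltac:(lia)) as [_ S2].
    destruct (Sep_grad _ S2) as (a & b & _ & _ & G).
    apply @ex_derive_continuous. exists (b 0 x). now apply (grad_r _ _ _ G).
Qed.

(** The displacement is eps^2 times the second Melnikov function plus a remainder that is of order
    |eps|^3 in value and in Lipschitz constant. The sign change at the simple zero survives, and the
    slope c there beats the Lipschitz constant of the remainder, so that the zero obtained is
    isolated. *)
Lemma cycle_near z0 eta : 0 < z0 -> 0 < eta -> simple_zero (Dm u 2) z0 ->
  exists e0, 0 < e0 /\ forall e, 0 < Rabs e < e0 ->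
    exists z, Rabs (z - z0) < eta /\ 0 < z /\ limit_cycle_at cf 2 m n e z.
Proof.
  intros Hz0 Heta [Zz (l & Hl & Hl0)].
  destruct Dm2_grad as (g' & Hg & Cg).
  assert (g' z0 <> 0) as Hne.
  { assert (E := Hg z0 Hz0). apply is_derive_unique in E. apply is_derive_unique in Hl. congruence. }
  destruct (local_slope (Dm u 2) g' z0 Hz0 Hg (Cg z0 Hz0) Hne) as (s & c & d & Hs & Hc & Hd & Hsl).
  set (D2 := Dm u 2) in *.
  set (h := Rmin (Rmin d (z0 / 2)) (eta / 2)).
  assert (Hh : 0 < h) by (unfold h; repeat apply Rmin_glb_lt; lra).
  assert (h <= Rmin d (z0 / 2)) by apply Rmin_l. assert (h <= eta / 2) by apply Rmin_r.
  assert (Rmin d (z0 / 2) <= d) by apply Rmin_l. assert (Rmin d (z0 / 2) <= z0 / 2) by apply Rmin_r.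
  set (a := z0 - h). set (b := z0 + h).
  assert (Ha : 0 < a) by (unfold a; lra). assert (Hab : a <= b) by (unfold a, b; lra).
  assert (Hsl' : forall x y, a <= x <= b -> a <= y <= b -> x <= y -> c * (y - x) <= s * (D2 y - D2 x)).
  { intros x y Hx Hy. unfold a, b in *. apply Hsl; apply Rabs_le_between; lra. }
  destruct (displacement m n Hm Hn Em En cf 2 u ut ur Hu a b Ha Hab) as (C & e1 & HC & He1 & Hdis).
  (* This yields C |e| < (c/2) h, which preserves the signs at the ends of the interval, and C |e| <
     c/2, which gives isolation. *)
  set (e0 := Rmin e1 (c * Rmin h 1 / (2 * (C + 1)))).
  assert (Hmh : 0 < Rmin h 1) by (apply Rmin_glb_lt; lra).
  assert (He0 : 0 < e0).
  { unfold e0. apply Rmin_glb_lt; auto. apply Rdiv_lt_0_compat; [now apply Rmult_lt_0_compat|lra]. }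
  exists e0. split; auto. intros e [Hep He].
  assert (L1 : Rabs e < e1) by (apply Rlt_le_trans with (1 := He), Rmin_l).
  assert (L2 : Rabs e < c * Rmin h 1 / (2 * (C + 1))) by (apply Rlt_le_trans with (1 := He), Rmin_r).
  apply Rlt_div_r in L2; [|lra].
  assert (K1 : C * Rabs e < c / 2 * h).
  { assert (Rmin h 1 <= h) by apply Rmin_l. nra. }
  assert (K2 : C * Rabs e < c / 2).
  { assert (Rmin h 1 <= 1) by apply Rmin_r. nra. }
  clear L2 He0 He. destruct (Hdis e L1) as (HE & HX & HL). clear Hdis.
  assert (Psum : forall z, a <= z <= b -> psum 2 (fun i => e ^ i * Dm u i z) = e ^ 2 * D2 z).
  { intros z Hz. cbn [psum]. rewrite HD1 by lra. unfold D2. ring. }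
  assert (Hex : forall z, exists r, a <= z <= b -> IsSol cf 2 m n e z r).
  { intros z. destruct (excluded_middle_informative (a <= z <= b)) as [Hz|Hz].
    - destruct (HE z Hz) as [r Hr]. now exists r.
    - exists (fun _ => 0). tauto. }
  set (sol := fun z => proj1_sig (constructive_indefinite_description _ (Hex z))).
  assert (Hsol : forall z, a <= z <= b -> IsSol cf 2 m n e z (sol z)).
  { intros z. exact (proj2_sig (constructive_indefinite_description _ (Hex z))). }
  clearbody sol.
  assert (He2 : e ^ 2 = Rabs e * Rabs e).
  { rewrite <- Rabs_mult. rewrite Rabs_right; [ring|]. nra. }
  assert (He3 : Rabs e ^ 3 = e ^ 2 * Rabs e) by (rewrite He2; ring).
  assert (He2p : 0 < e ^ 2) by (rewrite He2; nra).
  set (e2 := e ^ 2) in *. clearbody e2.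
  set (F := fun z => sol z (2 * PI) - z).
  assert (F1 : forall z, a <= z <= b -> Rabs (F z - e2 * D2 z) <= C * Rabs e * e2).
  { intros z Hz. assert (B := HX z (sol z) Hz (Hsol z Hz)). rewrite Psum in B by auto. rewrite He3 in B.
    unfold F. lra. }
  assert (F2 : forall z r z' r', a <= z <= b -> a <= z' <= b -> IsSol cf 2 m n e z r -> IsSol cf 2 m n e z' r' ->
    Rabs ((r (2 * PI) - z - e2 * D2 z) - (r' (2 * PI) - z' - e2 * D2 z')) <= C * Rabs e * e2 * Rabs (z - z')).
  { intros z r z' r' Hz Hz' Hr Hr'. assert (B := HL z z' r r' Hz Hz' Hr Hr').
    rewrite !Psum in B by auto. rewrite He3 in B. lra. }
  assert (exists LD, 0 <= LD /\ forall x y, a <= x <= b -> a <= y <= b -> Rabs (D2 x - D2 y) <= LD * Rabs (x - y))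
    as (LD & HLD & LipD).
  { destruct (avg_Sep _ _ _ _ _ _ Hu 2%nat 0%nat ltac:(lia) ltac:(lia)) as [S2 _].
    destruct (Sep_bounded a b 0 _ Ha S2) as (K & HK & HB). exists K. split; auto.
    intros x y Hx Hy. apply (HB 0 x y); auto. lra. }
  assert (Hs1 : Rabs s = 1) by (destruct Hs as [-> | ->]; [rewrite Rabs_right|rewrite Rabs_left]; lra).
  assert (Hcl : forall z, a <= clamp a b z <= b).
  { intros z. destruct (clamp_cases a b z Hab) as [[A ->]|[[A ->]|[A ->]]]; lra. }
  (* The clamp makes the displacement continuous on the whole line, as the intermediate value
     theorem is stated with two-sided continuity at the endpoints. *)
  set (Q := fun z => s * F (clamp a b z)).
  assert (CQ : forall z, continuity_pt Q z).
  { intros z. apply continuity_pt_filterlim.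
    assert (HK : 0 <= C * Rabs e * e2 + e2 * LD).
    { apply Rplus_le_le_0_compat; repeat apply Rmult_le_pos; lra. }
    apply (lip_continuous Q (C * Rabs e * e2 + e2 * LD) z HK).
    exists 1. split; [lra|]. intros y _. unfold Q.
    rewrite <- Rmult_minus_distr_l, Rabs_mult, Hs1, Rmult_1_l.
    apply Rle_trans with ((C * Rabs e * e2 + e2 * LD) * Rabs (clamp a b y - clamp a b z)).
    2:{ apply Rmult_le_compat_l; auto. now apply clamp_lip. }
    set (y' := clamp a b y) in *. set (z' := clamp a b z) in *.
    assert (Hy' : a <= y' <= b) by apply Hcl. assert (Hz' : a <= z' <= b) by apply Hcl.
    replace (F y' - F z') with ((sol y' (2 * PI) - y' - e2 * D2 y' - (sol z' (2 * PI) - z' - e2 * D2 z'))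
      + e2 * (D2 y' - D2 z')) by (unfold F; ring).
    eapply Rle_trans; [apply Rabs_triang|].
    assert (B1 := F2 y' (sol y') z' (sol z') Hy' Hz' (Hsol y' Hy') (Hsol z' Hz')).
    assert (B2 := LipD y' z' Hy' Hz'). rewrite (Rabs_mult e2), (Rabs_right e2) by lra. nra. }
  assert (Haz : a <= a <= b) by lra. assert (Hbz : a <= b <= b) by lra.
  assert (Hz0ab : a <= z0 <= b) by (unfold a, b; lra).
  assert (Sgn : forall z, a <= z <= b -> s * (e2 * D2 z) - C * Rabs e * e2 <= s * F z <= s * (e2 * D2 z) + C * Rabs e * e2).
  { intros z Hz. specialize (F1 z Hz). apply Rabs_le_between in F1. destruct Hs as [-> | ->]; lra. }
  assert (Ca : clamp a b a = a) by (destruct (clamp_cases a b a Hab) as [[A ->]|[[A ->]|[A ->]]]; lra).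
  assert (Cb : clamp a b b = b) by (destruct (clamp_cases a b b Hab) as [[A ->]|[[A ->]|[A ->]]]; lra).
  assert (Hch : 0 < c * h) by now apply Rmult_lt_0_compat.
  assert (Qa : Q a < 0).
  { unfold Q. rewrite Ca. assert (B := Hsl' a z0 Haz Hz0ab (proj1 Hz0ab)).
    assert (Eh : z0 - a = h) by (unfold a; ring). rewrite Eh in B.
    specialize (Sgn a Haz). set (X := s * (D2 z0 - D2 a)) in *.
    replace (s * (e2 * D2 a)) with (e2 * - X) in Sgn by (unfold X; rewrite Zz; ring).
    assert (0 < e2 * (X - C * Rabs e)) by (apply Rmult_lt_0_compat; lra). lra. }
  assert (Qb : 0 < Q b).
  { unfold Q. rewrite Cb. assert (B := Hsl' z0 b Hz0ab Hbz (proj2 Hz0ab)).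
    assert (Eh : b - z0 = h) by (unfold b; ring). rewrite Eh in B.
    specialize (Sgn b Hbz). set (X := s * (D2 b - D2 z0)) in *.
    replace (s * (e2 * D2 b)) with (e2 * X) in Sgn by (unfold X; rewrite Zz; ring).
    assert (0 < e2 * (X - C * Rabs e)) by (apply Rmult_lt_0_compat; lra). lra. }
  destruct (IVT_interv Q a b) as [z [Hz Zq]]; auto; [unfold a, b; lra|].
  assert (z <> a) by (intro; subst z; lra). assert (z <> b) by (intro; subst z; lra).
  assert (Ez : clamp a b z = z) by (destruct (clamp_cases a b z Hab) as [[A ->]|[[A ->]|[A ->]]]; lra).
  assert (Fz : F z = 0).
  { unfold Q in Zq. rewrite Ez in Zq. destruct Hs as [-> | ->]; lra. }
  exists z. split; [unfold a, b in Hz; apply Rabs_lt_between; unfold a, b in *; lra|].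
  split; [lra|]. split.
  - exists (sol z). split; [now apply Hsol|]. unfold F in Fz. lra.
  - exists (Rmin (z - a) (b - z)). split; [apply Rmin_glb_lt; lra|].
    intros z' Hz'p Hz'd Hz'n r Hr Hper.
    assert (Rmin (z - a) (b - z) <= z - a) by apply Rmin_l.
    assert (Rmin (z - a) (b - z) <= b - z) by apply Rmin_r.
    apply Rabs_def2 in Hz'd. assert (Hz'ab : a <= z' <= b) by lra.
    assert (B := F2 z' r z (sol z) Hz'ab Hz Hr (Hsol z Hz)).
    unfold F in Fz. rewrite Hper in B.
    replace (z' - z' - e2 * D2 z' - (sol z (2 * PI) - z - e2 * D2 z)) with (e2 * (D2 z - D2 z')) in B by (rewrite Fz; ring).
    rewrite Rabs_mult, (Rabs_right e2) in B by lra.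
    assert (S : c * Rabs (z' - z) <= Rabs (D2 z - D2 z')).
    { rewrite <- (Rmult_1_l (Rabs (D2 z - D2 z'))), <- Hs1, <- Rabs_mult.
      destruct (Rle_lt_dec z z') as [Hle|Hlt].
      - rewrite (Rabs_right (z' - z)) by lra. assert (T := Hsl' z z' Hz Hz'ab Hle).
        apply Rle_trans with (1 := T). replace (s * (D2 z' - D2 z)) with (- (s * (D2 z - D2 z'))) by ring.
        rewrite <- Rabs_Ropp. apply Rle_abs.
      - rewrite (Rabs_left (z' - z)) by lra. assert (T := Hsl' z' z Hz'ab Hz ltac:(lra)).
        apply Rle_trans with (c * (z - z')); [lra|]. apply Rle_trans with (1 := T). apply Rle_abs. }
    assert (0 < Rabs (z' - z)) by (apply Rabs_pos_lt; lra).
    assert (e2 * (c * Rabs (z' - z)) <= C * Rabs e * e2 * Rabs (z' - z)).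
    { apply Rle_trans with (2 := B). apply Rmult_le_compat_l; lra. }
    assert (0 < e2 * Rabs (z' - z)) by now apply Rmult_lt_0_compat. nra.
Qed.

Lemma H_ge_simple zs : simple_zeros_list (Dm u 2) zs -> H_ge m n (length zs).
Proof.
  intros [Hnd Hz]. exists 2%nat, cf. split; [lia|].
  destruct (separation zs Hnd) as (eta & Heta & Hsep).
  destruct (collect (fun e z => 0 < z /\ limit_cycle_at cf 2 m n e z) eta zs Hnd Hsep) as (e0 & He0 & H).
  { intros z0 H0. destruct (Hz z0 H0) as [Hp Hs]. now apply cycle_near. }
  exists e0. split; auto. intros e He. destruct (H e He) as (ws & W1 & W2 & W3).
  exists ws. split; auto. split; auto. intros w Hw. now apply W3.
Qed.

End Cycles.

(** * Explicit formulas for the first two orders *)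

Section Primitives.

Context (p q : nat -> nat -> R).

(** The primitive in theta of the radial component is Q0 + r Q1, with Q0 from the constant terms and
    Q1 from the linear ones. *)
Definition Q0 (i : nat) (th : R) : R := p 0%nat i * sin th - q 0%nat i * cos th.
Definition Q1 (i : nat) (th : R) : R :=
  p 1%nat i * ((th + sin th * cos th) / 2) + q 2%nat i * ((th - sin th * cos th) / 2)
  + (p 2%nat i + q 1%nat i) * (sin th ^ 2 / 2).
Definition Qa (i : nat) (th r : R) : R := Q0 i th + r * Q1 i th.

Lemma cos2_sub th : cos th ^ 2 = 1 - sin th ^ 2.
Proof. assert (H := sin2_cos2 th). unfold Rsqr in H. simpl. lra. Qed.

Lemma is_derive_Qa i th r : is_derive (fun s => Qa i s r) th (radial p q i th r).
Proof.
  unfold Qa, Q0, Q1, radial. auto_derive; auto.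
  assert (H := cos2_sub th). set (s := sin th) in *. set (c := cos th) in *. clearbody s c.
  field [H].
Qed.

Lemma is_derive_Qa_r i th r : is_derive (fun x => Qa i th x) r (Q1 i th).
Proof. unfold Qa. auto_derive; auto. ring. Qed.

Lemma is_derive_Qa_comp i (tau : R -> R) r l : is_derive tau r l ->
  is_derive (fun x => Qa i (tau x) x) r (Q1 i (tau r) + radial p q i (tau r) r * l).
Proof.
  intros Ht.
  assert (H1 : is_derive (Q0 i) (tau r) (p 0%nat i * cos (tau r) + q 0%nat i * sin (tau r))).
  { unfold Q0. auto_derive; auto. ring. }
  assert (H2 : is_derive (Q1 i) (tau r) (p 1%nat i * cos (tau r) ^ 2 + q 2%nat i * sin (tau r) ^ 2
    + (p 2%nat i + q 1%nat i) * (sin (tau r) * cos (tau r)))).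
  { unfold Q1. auto_derive; auto. assert (H := cos2_sub (tau r)).
    set (s := sin (tau r)) in *. set (c := cos (tau r)) in *. clearbody s c. field [H]. }
  unfold Qa. evar_last.
  - apply @is_derive_plus.
    + apply (is_derive_comp (Q0 i) tau); [exact H1|exact Ht].
    + apply (is_derive_mult (fun x => x) (fun x => Q1 i (tau x))); [apply @is_derive_id| |intros; apply Rmult_comm].
      apply (is_derive_comp (Q1 i) tau); [exact H2|exact Ht].
  - unfold plus, scal, mult, one; simpl; unfold mult; simpl. unfold radial. ring.
Qed.

(* X0 and X1 are found by integrating the trigonometric polynomials in the second order equation; they
   are what makes is_derive_Sa below a polynomial identity. *)
Definition X0 (th : R) : R :=
  let s := sin th in let c := cos th in
  let d := (p 1%nat 1%nat - q 2%nat 1%nat) / 2 in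
  let kap := p 2%nat 1%nat + q 1%nat 1%nat in
  let y := (q 1%nat 1%nat - p 2%nat 1%nat) / 2 in
  p 0%nat 1%nat * (q 1%nat 1%nat * (s - s ^ 3 / 3) + (y - kap) * (s ^ 3 / 3) + 2 * d * (c ^ 3 / 3) + d * (- c + c ^ 3 / 3))
  + q 0%nat 1%nat * (- (q 1%nat 1%nat + kap) * (c ^ 3 / 3) + y * (- c + c ^ 3 / 3) - 2 * d * (s ^ 3 / 3) + d * (s - s ^ 3 / 3))
  + (p 1%nat 1%nat + q 2%nat 1%nat) / 2 * (Q0 1 th * th + 2 * (p 0%nat 1%nat * c + q 0%nat 1%nat * s)).

Definition X1 (th : R) : R :=
  let s := sin th in let c := cos th in
  let d := (p 1%nat 1%nat - q 2%nat 1%nat) / 2 in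
  let kap := p 2%nat 1%nat + q 1%nat 1%nat in
  let y := (q 1%nat 1%nat - p 2%nat 1%nat) / 2 in
  d * y * (s * c) + d * kap / 2 * (s * c * (c ^ 2 - s ^ 2)) - d ^ 2 * (s * c) ^ 2
  - kap * y / 4 * (c ^ 2 - s ^ 2) + kap ^ 2 / 4 * (s * c) ^ 2
  + (p 1%nat 1%nat + q 2%nat 1%nat) / 2 * (q 1%nat 1%nat * ((th + s * c) / 2)
      - p 2%nat 1%nat * ((th - s * c) / 2) - d * s ^ 2).

(** A primitive in theta of the second order averaging equation within one sector. The number kj is
    the r-derivative of the first order matching constant, so that the r-derivative of u_1 in that
    sector is Q1 + kj. *)
Definition Sa (kj th r : R) : R :=
  Qa 2 th r - Q0 1 th ^ 2 / (2 * r) + X0 th + r * (X1 th + Q1 1 th ^ 2 / 2) + kj * Qa 1 th r.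

Lemma is_derive_Sa kj th r : 0 < r -> is_derive (fun s => Sa kj s r) th
  (radial p q 2 th r + angular p q 1 th r * radial p q 1 th r / r + (Q1 1 th + kj) * radial p q 1 th r).
Proof.
  intros Hr. unfold Sa, X0, X1, Qa, Q0, Q1, radial, angular. auto_derive; [auto|].
  assert (H := cos2_sub th). set (s := sin th) in *. set (c := cos th) in *. clearbody s c.
  field [H]. lra.
Qed.

End Primitives.

Lemma constant_of_derive (h : R -> R) x y : (forall t, is_derive h t 0) -> h x = h y.
Proof.
  intros H. destruct (MVT_gen h x y (fun _ => 0)) as (c & _ & E).
  - intros; apply H.
  - intros t _. apply continuity_pt_filterlim, @ex_derive_continuous. eexists; apply H.
  - lra.
Qed.

Section Evaluation.

Context (tau : nat -> R -> R) (Htau5 : forall r, tau 5%nat r = 2 * PI).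

(* Constant (in th) by which a primitive P must be shifted in sector j to match across the
   switching curves and vanish at 2 PI. *)
Fixpoint shiftd (P : nat -> R -> R -> R) (d : nat) (r : R) : R :=
  match d with
  | O => - P 4%nat (2 * PI) r
  | S d' => P (4 - d')%nat (tau (4 - d')%nat r) r - P (4 - d)%nat (tau (4 - d')%nat r) r + shiftd P d' r
  end.

(** At fixed r the functions v and P have equal theta-derivatives, hence differ by a constant in
    each sector; the matching conditions determine these constants backwards from the last
    sector. *)
Lemma sector_eval (v P : nat -> R -> R -> R) r : 0 < r ->
  (forall j th, (j <= 4)%nat -> exists l, is_derive (fun s => v j s r) th l /\ is_derive (fun s => P j s r) th l) ->
  (forall j, (j <= 4)%nat -> v j (tau (S j) r) r = match j with 4%nat => 0 | _ => v (S j) (tau (S j) r) r end) ->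
  forall d th, (d <= 4)%nat -> v (4 - d)%nat th r = P (4 - d)%nat th r + shiftd P d r.
Proof.
  intros Hr HD HM.
  assert (C : forall j x y, (j <= 4)%nat -> v j x r - P j x r = v j y r - P j y r).
  { intros j x y Hj. apply (constant_of_derive (fun t => v j t r - P j t r)). intros t.
    destruct (HD j t Hj) as (l & H1 & H2).
    evar_last; [apply @is_derive_minus; eassumption|]. unfold minus, plus, opp; simpl. ring. }
  induction d as [|d IH]; intros th Hd.
  - assert (A := HM 4%nat (le_n 4)). simpl in A. rewrite Htau5 in A.
    assert (B := C 4%nat th (2 * PI) (le_n 4)). simpl. lra.
  - assert (A := HM (4 - S d)%nat ltac:(lia)). replace (S (4 - S d)) with (4 - d)%nat in A by lia.
    assert (A' : v (4 - S d)%nat (tau (4 - d)%nat r) r = v (4 - d)%nat (tau (4 - d)%nat r) r).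
    { rewrite A. destruct d as [|[|[|[|d]]]]; try lia; reflexivity. }
    assert (B := C (4 - S d)%nat th (tau (4 - d)%nat r) ltac:(lia)).
    cbn [shiftd]. specialize (IH (tau (4 - d)%nat r) ltac:(lia)). lra.
Qed.

End Evaluation.

Section Formulas.

Context (m n : nat) (Hm : (0 < m)%nat) (Hn : (0 < n)%nat) (cf : Coeffs) (k : nat)
  (u ut ur : nat -> nat -> R -> R -> R)
  (Hu : avg_coeffs (sector_angle m n Hm Hn) (fun j i => polar_coeff (pc cf j) (qc cf j) i) k u ut ur).

Let tau := sector_angle m n Hm Hn.
Let P1 (j : nat) := Qa (pc cf j) (qc cf j) 1.

Lemma u1_eval r d th : (1 <= k)%nat -> 0 < r -> (d <= 4)%nat ->
  u 1%nat (4 - d)%nat th r = P1 (4 - d)%nat th r + shiftd tau P1 d r.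
Proof.
  intros Hk Hr Hd. apply (sector_eval tau (fun _ => eq_refl) (u 1%nat) P1 r Hr); auto.
  - intros j x Hj. exists (radial (pc cf j) (qc cf j) 1 x r). split; [|apply is_derive_Qa].
    evar_last; [apply (grad_th _ _ _ (avg_grad _ _ _ _ _ _ Hu 1%nat j ltac:(lia) Hj)); exact Hr|].
    rewrite (avg_eq _ _ _ _ _ _ Hu) by (auto; lia). simpl. rewrite polar_coeff_S. simpl. ring.
  - intros j Hj. apply (avg_match _ _ _ _ _ _ Hu); auto; lia.
Qed.

Definition dphi (r : R) : R :=
  (INR m - INR n) * (sin (switch_angle m n Hm Hn r) * cos (switch_angle m n Hm Hn r))
    / (r * (INR n * cos (switch_angle m n Hm Hn r) ^ 2 + INR m * sin (switch_angle m n Hm Hn r) ^ 2)).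

Lemma cos_switch_angle_pos r : 0 < cos (switch_angle m n Hm Hn r).
Proof. destruct (switch_angle_bound m n Hm Hn r). apply cos_gt_0; lra. Qed.

Lemma sin_switch_angle_pos r : 0 < sin (switch_angle m n Hm Hn r).
Proof. destruct (switch_angle_bound m n Hm Hn r). apply sin_gt_0; lra. Qed.

Lemma tan_switch_angle r : sin (switch_angle m n Hm Hn r) = switch_slope m n Hm Hn r * cos (switch_angle m n Hm Hn r).
Proof.
  assert (H := cos_switch_angle_pos r). assert (E : tan (switch_angle m n Hm Hn r) = switch_slope m n Hm Hn r) by apply tan_atan.
  rewrite <- E. unfold tan. field. lra.
Qed.

Lemma is_derive_switch_angle r : 0 < r -> is_derive (switch_angle m n Hm Hn) r (dphi r).
Proof.
  intros Hr. unfold switch_angle at 1. evar_last.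
  - apply (is_derive_comp atan (switch_slope m n Hm Hn)); [apply is_derive_atan|apply is_derive_switch_slope; exact Hr].
  - unfold scal; simpl; unfold mult; simpl. unfold dphi.
    assert (Hc := cos_switch_angle_pos r). assert (Hs := tan_switch_angle r).
    set (c := cos _) in *. rewrite Hs. set (t := switch_slope m n Hm Hn r).
    generalize (INR_ge1 m Hm), (INR_ge1 n Hn). intros.
    assert (0 < c ^ 2) by (apply pow_lt; lra).
    assert (0 <= t ^ 2) by apply pow2_ge_0. unfold Rsqr.
    assert (0 < INR n + INR m * t ^ 2) by nra.
    replace (INR n * c ^ 2 + INR m * (t * c) ^ 2) with (c ^ 2 * (INR n + INR m * t ^ 2)) by ring.
    field. repeat split; nra.
Qed.

Definition dtau (j : nat) (r : R) : R :=
  match j with 1%nat => dphi r | 2%nat => - dphi r | 3%nat => dphi r | 4%nat => - dphi r | _ => 0 end.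

Lemma is_derive_tau j r : 0 < r -> is_derive (tau j) r (dtau j r).
Proof.
  intros Hr. assert (D := is_derive_switch_angle r Hr).
  unfold tau. destruct j as [|[|[|[|[|j]]]]]; simpl.
  - apply @is_derive_const.
  - exact D.
  - evar_last; [apply (is_derive_minus (fun _ => PI) (switch_angle m n Hm Hn)); [apply @is_derive_const|exact D]|].
    unfold minus, plus, opp, zero; simpl. ring.
  - evar_last; [apply (is_derive_plus (fun _ => PI) (switch_angle m n Hm Hn)); [apply @is_derive_const|exact D]|].
    unfold plus, zero; simpl. ring.
  - evar_last; [apply (is_derive_minus (fun _ => 2 * PI) (switch_angle m n Hm Hn)); [apply @is_derive_const|exact D]|].
    unfold minus, plus, opp, zero; simpl. ring.
  - apply @is_derive_const.
Qed.

Fixpoint dshift (d : nat) (r : R) : R :=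
  match d with
  | O => - Q1 (pc cf 4) (qc cf 4) 1 (2 * PI)
  | S d' => (Q1 (pc cf (4 - d')) (qc cf (4 - d')) 1 (tau (4 - d')%nat r)
        + radial (pc cf (4 - d')) (qc cf (4 - d')) 1 (tau (4 - d')%nat r) r * dtau (4 - d')%nat r)
      - (Q1 (pc cf (4 - d)) (qc cf (4 - d)) 1 (tau (4 - d')%nat r)
        + radial (pc cf (4 - d)) (qc cf (4 - d)) 1 (tau (4 - d')%nat r) r * dtau (4 - d')%nat r)
      + dshift d' r
  end.

Lemma is_derive_shift d r : 0 < r -> is_derive (shiftd tau P1 d) r (dshift d r).
Proof.
  intros Hr. induction d as [|d IH]; cbn [shiftd dshift].
  - apply (is_derive_opp (fun r => P1 4 (2 * PI) r)). apply is_derive_Qa_r.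
  - apply (is_derive_plus (fun r => P1 (4 - d)%nat (tau (4 - d)%nat r) r - P1 (4 - S d)%nat (tau (4 - d)%nat r) r));
      [|exact IH].
    apply (is_derive_minus (fun r => P1 (4 - d)%nat (tau (4 - d)%nat r) r)); apply is_derive_Qa_comp; now apply is_derive_tau.
Qed.

Lemma ur1_eval r d th : (1 <= k)%nat -> 0 < r -> (d <= 4)%nat ->
  ur 1%nat (4 - d)%nat th r = Q1 (pc cf (4 - d)) (qc cf (4 - d)) 1 th + dshift d r.
Proof.
  intros Hk Hr Hd.
  assert (D1 : is_derive (fun x => u 1%nat (4 - d)%nat th x) r (ur 1%nat (4 - d)%nat th r)).
  { apply (grad_r _ _ _ (avg_grad _ _ _ _ _ _ Hu 1%nat (4 - d)%nat ltac:(lia) ltac:(lia))). exact Hr. }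
  assert (D2 : is_derive (fun x => u 1%nat (4 - d)%nat th x) r (Q1 (pc cf (4 - d)) (qc cf (4 - d)) 1 th + dshift d r)).
  { apply is_derive_ext_loc with (fun x => P1 (4 - d)%nat th x + shiftd tau P1 d x).
    - assert (L := open_gt 0 r Hr). revert L. apply filter_imp. intros x Hx. symmetry. now apply u1_eval.
    - apply (is_derive_plus (fun x => P1 (4 - d)%nat th x)); [apply is_derive_Qa_r|now apply is_derive_shift]. }
  apply is_derive_unique in D1. apply is_derive_unique in D2. congruence.
Qed.

Definition P2 (r0 : R) (j : nat) := Sa (pc cf j) (qc cf j) (dshift (4 - j) r0).

Lemma u2_eval r d th : (2 <= k)%nat -> 0 < r -> (d <= 4)%nat ->
  u 2%nat (4 - d)%nat th r = P2 r (4 - d)%nat th r + shiftd tau (P2 r) d r.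
Proof.
  intros Hk Hr Hd. apply (sector_eval tau (fun _ => eq_refl) (u 2%nat) (P2 r) r Hr); auto.
  - intros j x Hj. eexists. split; [|apply is_derive_Sa; exact Hr].
    evar_last; [apply (grad_th _ _ _ (avg_grad _ _ _ _ _ _ Hu 2%nat j ltac:(lia) Hj)); exact Hr|].
    rewrite (avg_eq _ _ _ _ _ _ Hu) by (auto; lia). cbn [psum pred Nat.sub].
    assert (E := ur1_eval r (4 - j) x ltac:(lia) Hr ltac:(lia)). replace (4 - (4 - j))%nat with j in E by lia.
    rewrite E, !polar_coeff_S. cbn [psum Nat.sub]. rewrite polar_coeff_S. cbn [psum]. field. lra.
  - intros j Hj. apply (avg_match _ _ _ _ _ _ Hu); auto; lia.
Qed.

Lemma trig_values x :
  (sin (PI - x) = sin x /\ cos (PI - x) = - cos x) /\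
  (sin (PI + x) = - sin x /\ cos (PI + x) = - cos x) /\
  (sin (2 * PI - x) = - sin x /\ cos (2 * PI - x) = cos x).
Proof.
  repeat split.
  - apply Rtrigo_facts.sin_pi_minus.
  - apply Rtrigo_facts.cos_pi_minus.
  - rewrite Rplus_comm. apply neg_sin.
  - rewrite Rplus_comm. apply neg_cos.
  - rewrite <- (sin_neg x), <- (sin_period (- x) 1). f_equal. simpl. ring.
  - rewrite <- (cos_neg x), <- (cos_period (- x) 1). f_equal. simpl. ring.
Qed.

(** Up to the factor - r, the contribution of the linear coefficients of order i: the entire first
    Melnikov function for i = 1, and a summand of the second for i = 2. Constant terms cancel in the
    alternating sum over the four symmetric angles. *)
Definition lin_part (i : nat) (r : R) : R :=
  let ph := switch_angle m n Hm Hn r in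
  (ca cf 1 i + cb cf 2 i) * PI
  + (cal cf 1 i + cbe cf 2 i - ca cf 1 i - cb cf 2 i) * (2 * ph)
  + (cb cf 2 i - ca cf 1 i + cal cf 1 i - cbe cf 2 i) * (2 * (sin ph * cos ph)).

Lemma Dm1_formula r : (1 <= k)%nat -> 0 < r -> Dm u 1 r = - r * lin_part 1 r.
Proof.
  intros Hk Hr. unfold Dm. assert (E := u1_eval r 4 0 Hk Hr (le_n 4)).
  change (4 - 4)%nat with 0%nat in E. rewrite E. clear E. cbn [shiftd Nat.sub].
  unfold P1, tau. cbn [sector_angle]. unfold pc, qc. cbn [Nat.even].
  unfold Qa, Q0, Q1, lin_part. set (ph := switch_angle m n Hm Hn r).
  destruct (trig_values ph) as ((-> & ->) & (-> & ->) & (-> & ->)).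
  rewrite sin_0, cos_0, sin_2PI, cos_2PI. field.
Qed.

(** The conditions say that both first order traces vanish and that a_11 = alpha_11; for m <> n they
    follow from the vanishing of the first order. The denominator n c^2 + m s^2 is that of the
    derivative of the switching angle, which enters through [dshift]. Once the four angles are
    inserted, a rational identity modulo c^2 = 1 - s^2 remains. *)
Lemma Dm2_hamiltonian r : (2 <= k)%nat -> 0 < r ->
  cb cf 2 1 = - ca cf 1 1 -> cbe cf 2 1 = - ca cf 1 1 -> cal cf 1 1 = ca cf 1 1 ->
  let s := sin (switch_angle m n Hm Hn r) in let c := cos (switch_angle m n Hm Hn r) in
  Dm u 2 r = - r * lin_part 2 r
    + r * ca cf 1 1 * ((ca cf 2 1 + cb cf 1 1) - (cal cf 2 1 + cbe cf 1 1))
        * (2 * s * c * (INR n * c ^ 2 - INR m * s ^ 2)) / (INR n * c ^ 2 + INR m * s ^ 2)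
    + r * ca cf 1 1 * ((cb cf 1 1 - ca cf 2 1) - (cbe cf 1 1 - cal cf 2 1)) * (2 * s * c)
    + 4 * (INR m * (ca cf 0 1 * cb cf 0 1) - INR n * (cal cf 0 1 * cbe cf 0 1)
        - (INR m - INR n) * (cal cf 0 1 * cb cf 0 1)) * (s * c) / (r * (INR n * c ^ 2 + INR m * s ^ 2)).
Proof.
  intros Hk Hr Hb2 Hbe2 Hal1 s c. unfold Dm.
  assert (E := u2_eval r 4 0 Hk Hr (le_n 4)). change (4 - 4)%nat with 0%nat in E. rewrite E. clear E.
  cbn [shiftd Nat.sub]. unfold P2, tau. cbn [sector_angle Nat.sub dshift dtau]. unfold tau. cbn [sector_angle].
  unfold pc, qc. cbn [Nat.even].
  unfold lin_part, Sa, X0, X1, Qa, Q0, Q1, radial, dphi.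
  assert (H := cos2_sub (switch_angle m n Hm Hn r)).
  assert (0 < s) by apply sin_switch_angle_pos. assert (0 < c) by apply cos_switch_angle_pos.
  unfold s, c in *. clear s c. set (ph := switch_angle m n Hm Hn r) in *.
  destruct (trig_values ph) as ((-> & ->) & (-> & ->) & (-> & ->)).
  rewrite sin_0, cos_0, sin_2PI, cos_2PI, Hb2, Hbe2, Hal1.
  generalize (INR_ge1 m Hm), (INR_ge1 n Hn). intros H1m H1n.
  set (s := sin ph) in *. set (c := cos ph) in *.
  assert (Hden : INR n * c ^ 2 + INR m * s ^ 2 <> 0).
  { assert (0 < c ^ 2) by (apply pow_lt; lra). assert (0 < s ^ 2) by (apply pow_lt; lra). nra. }
  clearbody s c ph. field [H]. split; [exact Hden|lra].
Qed.

Lemma switch_angle_diag r : m = n -> switch_angle m n Hm Hn r = PI / 4.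
Proof.
  intros Emn. unfold switch_angle. rewrite <- atan_1. f_equal.
  assert (E := switch_slope_eq m n Hm Hn r). rewrite Emn in E at 2 4.
  unfold Rminus in E. rewrite Rplus_opp_r in E. unfold Rdiv in E. rewrite !Rmult_0_l, Rplus_0_r in E.
  assert (L : ln (switch_slope m n Hm Hn r) = 0).
  { assert (H := INR_ge1 n Hn). apply Rmult_integral in E. lra. }
  rewrite <- ln_1 in L. apply ln_inv in L; auto; [apply switch_slope_pos|lra].
Qed.

(* For m = n the switching rays do not depend on r, so every ingredient of Dm 2 is an
   explicit Laurent polynomial in r; the r^0 coefficient is a multiple of Dm 1. *)
Definition jumps (P : nat -> R -> R) : R :=
  let c := PI / 4 in
  P 0%nat 0 + (P 1%nat c - P 0%nat c) + (P 2%nat (PI - c) - P 1%nat (PI - c))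
  + (P 3%nat (PI + c) - P 2%nat (PI + c)) + (P 4%nat (2 * PI - c) - P 3%nat (2 * PI - c)) - P 4%nat (2 * PI).

Lemma Dm2_diag : m = n -> (2 <= k)%nat -> (forall r, 0 < r -> Dm u 1 r = 0) ->
  exists X Y, forall r, 0 < r -> Dm u 2 r = r * X + Y / r.
Proof.
  intros Emn Hk HD1.
  assert (Hdp : forall r, dphi r = 0).
  { intros r. unfold dphi. rewrite Emn at 1. unfold Rminus, Rdiv. rewrite Rplus_opp_r. ring. }
  set (K := fun j => dshift (4 - j) 1).
  assert (HK : forall j r, (j <= 4)%nat -> dshift (4 - j) r = K j).
  { intros j r Hj. unfold K. destruct j as [|[|[|[|[|j]]]]]; try lia; cbn [dshift dtau Nat.sub];
    unfold tau; cbn [sector_angle]; rewrite ?(switch_angle_diag r Emn), ?(switch_angle_diag 1 Emn), ?Hdp; ring. }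
  set (A2 := fun j th => Q1 (pc cf j) (qc cf j) 2 th + X1 (pc cf j) (qc cf j) th
    + Q1 (pc cf j) (qc cf j) 1 th ^ 2 / 2 + K j * Q1 (pc cf j) (qc cf j) 1 th).
  set (A1 := fun j th => Q0 (pc cf j) (qc cf j) 2 th + X0 (pc cf j) (qc cf j) th
    + K j * Q0 (pc cf j) (qc cf j) 1 th).
  set (A0 := fun j th => - Q0 (pc cf j) (qc cf j) 1 th ^ 2 / 2).
  assert (HS : forall j th r, (j <= 4)%nat -> 0 < r -> P2 r j th r = r * A2 j th + A1 j th + A0 j th / r).
  { intros j th r Hj Hr. unfold P2. rewrite HK by exact Hj. unfold Sa, Qa, A2, A1, A0. field. lra. }
  assert (HE : forall r, 0 < r -> Dm u 2 r = r * jumps A2 + jumps A1 + jumps A0 / r).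
  { intros r Hr. unfold Dm.
    assert (E := u2_eval r 4 0 Hk Hr (le_n 4)). change (4 - 4)%nat with 0%nat in E. rewrite E. clear E.
    cbn [shiftd Nat.sub]. unfold tau. cbn [sector_angle]. rewrite (switch_angle_diag r Emn).
    rewrite !HS by (auto; lia). unfold jumps. field. lra. }
  assert (H1 : jumps A1 = 0).
  { assert (C := HD1 1 Rlt_0_1). rewrite Dm1_formula in C by (lra || lia).
    unfold lin_part in C. rewrite (switch_angle_diag 1 Emn) in C.
    assert (Hs : sin (PI / 4) = cos (PI / 4)) by (rewrite sin_PI4, cos_PI4; reflexivity).
    assert (H := cos2_sub (PI / 4)). rewrite Hs in H, C.
    set (t := trig_values (PI / 4)).
    unfold jumps, A1, K. cbn [dshift dtau Nat.sub]. unfold tau. cbn [sector_angle]. rewrite (switch_angle_diag 1 Emn), Hdp.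
    unfold pc, qc. cbn [Nat.even]. unfold X0, Q0, Q1.
    destruct t as ((-> & ->) & (-> & ->) & (-> & ->)).
    rewrite Hs, sin_0, cos_0, sin_2PI, cos_2PI.
    set (c := cos (PI / 4)) in *.
    assert (H2 : c ^ 2 = 1 / 2) by lra.
    match type of C with _ * ?L = 0 => assert (C' : L = 0) by lra; set (Cond := L) in * end.
    (* A polynomial identity modulo c^2 = 1/2, where c is both the sine and the cosine of PI/4; the
       cofactor combines the constant terms beta_01 and b_01. *)
    match goal with |- ?G = 0 => assert (E : G = (cbe cf 0 1 * (1 - c) + cb cf 0 1 * c) * Cond) end.
    { unfold Cond. clear - H2. clearbody c. field [H2]. }
    rewrite E, C'. ring. }
  exists (jumps A2), (jumps A0). intros r Hr. rewrite HE, H1 by exact Hr. ring.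
Qed.

End Formulas.

(** * Reduction to the model family *)

Section Reduction.

Context (m n : nat) (Hm : (0 < m)%nat) (Hn : (0 < n)%nat) (Hmn : m <> n).

(* Normalising coordinate on the switching curve: the smaller exponent is divided out, so that
   only ratios 1 + ratio_excess > 1 have to be considered. *)
Definition m_larger : bool := Nat.ltb n m.
Definition ratio_excess : R := if m_larger then INR m / INR n - 1 else INR n / INR m - 1.
Definition Ssw (r : R) : R := if m_larger then / switch_slope m n Hm Hn r else switch_slope m n Hm Hn r.
Definition orient : R := if m_larger then -1 else 1.
Definition base_angle : R := if m_larger then PI / 2 else 0.
Definition min_exp : R := if m_larger then INR n else INR m.
Let t := switch_slope m n Hm Hn.
Let ph := switch_angle m n Hm Hn.

Lemma m_larger_spec : (m_larger = true /\ INR n < INR m) \/ (m_larger = false /\ INR m < INR n).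
Proof.
  unfold m_larger. destruct (Nat.ltb_spec n m).
  - left. split; auto. now apply lt_INR.
  - right. split; auto. apply lt_INR. lia.
Qed.

Lemma ratio_excess_pos : 0 < ratio_excess.
Proof.
  unfold ratio_excess. assert (0 < INR n) by now apply lt_0_INR. assert (0 < INR m) by now apply lt_0_INR.
  destruct m_larger_spec as [[-> H1]|[-> H1]]; apply Rlt_Rminus; apply Rlt_div_r; lra.
Qed.

Lemma Ssw_pos r : 0 < Ssw r.
Proof.
  unfold Ssw. assert (H := switch_slope_pos m n Hm Hn r). destruct m_larger; auto. now apply Rinv_0_lt_compat.
Qed.

Lemma switch_slope_inj r r' : 0 < r -> 0 < r' -> t r = t r' -> r = r'.
Proof.
  intros Hr Hr' E. assert (A := switch_slope_eq m n Hm Hn r). assert (B := switch_slope_eq m n Hm Hn r').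
  fold t in A, B. rewrite E in A. rewrite A in B.
  apply Rmult_eq_reg_l in B; [now apply ln_inv|]. apply not_INR in Hmn. lra.
Qed.

Lemma Ssw_inj r r' : 0 < r -> 0 < r' -> Ssw r = Ssw r' -> r = r'.
Proof.
  intros Hr Hr' E. apply switch_slope_inj; auto. unfold Ssw in E. destruct m_larger; auto. now apply Rinv_eq_reg.
Qed.

Lemma Ssw_surj s : 0 < s -> exists r, 0 < r /\ Ssw r = s.
Proof.
  intros Hs. unfold Ssw. destruct m_larger.
  - destruct (switch_slope_surj m n Hm Hn (/ s) Hmn) as (r & Hr & E); [now apply Rinv_0_lt_compat|].
    exists r. split; auto. now rewrite E, Rinv_inv.
  - destruct (switch_slope_surj m n Hm Hn s Hmn Hs) as (r & Hr & E). exists r. auto.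
Qed.

Lemma Ssw_derive r : 0 < r -> exists l, is_derive Ssw r l /\ l <> 0.
Proof.
  intros Hr. assert (D := is_derive_switch_slope m n Hm Hn r Hr). assert (Ht := switch_slope_pos m n Hm Hn r).
  set (l := (INR m - INR n) * _ * _ / _) in D.
  assert (l <> 0) as Hl.
  { unfold l. generalize (INR_ge1 m Hm), (INR_ge1 n Hn). intros.
    assert (0 <= switch_slope m n Hm Hn r ^ 2) by apply pow2_ge_0.
    assert (INR m - INR n <> 0) by (apply not_INR in Hmn; lra).
    apply Rmult_integral_contrapositive_currified.
    - apply Rmult_integral_contrapositive_currified; [apply Rmult_integral_contrapositive_currified|]; lra.
    - apply Rinv_neq_0_compat, Rmult_integral_contrapositive_currified; nra. }
  unfold Ssw. destruct m_larger.
  - exists (- l / switch_slope m n Hm Hn r ^ 2). split.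
    + now apply is_derive_inv; [|lra].
    + unfold Rdiv. apply Rmult_integral_contrapositive_currified; [lra|].
      apply Rinv_neq_0_compat, pow_nonzero; lra.
  - exists l. split; auto.
Qed.

Lemma ph_Ssw r : 0 < r -> ph r = base_angle + orient * atan (Ssw r).
Proof.
  intros Hr. unfold ph, switch_angle, base_angle, orient, Ssw. assert (H := switch_slope_pos m n Hm Hn r). destruct m_larger.
  - rewrite atan_inv by exact H. ring.
  - ring.
Qed.

Lemma sc_Ssw r : 0 < r -> sin (ph r) * cos (ph r) = Ssw r / (1 + Ssw r ^ 2).
Proof.
  intros Hr. assert (Hs := tan_switch_angle m n Hm Hn r). assert (Hc := cos_switch_angle_pos m n Hm Hn r).
  assert (H2 := cos2_sub (ph r)). fold ph in Hs, Hc. fold t in Hs.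
  assert (Ht := switch_slope_pos m n Hm Hn r). fold t in Ht.
  assert (E : cos (ph r) ^ 2 = / (1 + t r ^ 2)).
  { rewrite Hs in H2. apply Rmult_eq_reg_r with (1 + t r ^ 2); [|nra]. rewrite Rinv_l by nra. lra. }
  assert (E2 : sin (ph r) * cos (ph r) = t r / (1 + t r ^ 2)).
  { rewrite Hs. replace (t r * cos (ph r) * cos (ph r)) with (t r * cos (ph r) ^ 2) by ring. rewrite E. reflexivity. }
  rewrite E2. unfold Ssw. fold t. destruct m_larger; auto.
  assert (0 < t r ^ 2) by (apply pow_lt; lra). field. repeat split; nra.
Qed.

Lemma den_Ssw r : 0 < r ->
  (INR n * cos (ph r) ^ 2 - INR m * sin (ph r) ^ 2) / (INR n * cos (ph r) ^ 2 + INR m * sin (ph r) ^ 2)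
    = orient * (1 + ratio_excess - Ssw r ^ 2) / (1 + ratio_excess + Ssw r ^ 2) /\
  sin (ph r) * cos (ph r) / (INR n * cos (ph r) ^ 2 + INR m * sin (ph r) ^ 2) = Ssw r / (min_exp * (1 + ratio_excess + Ssw r ^ 2)).
Proof.
  intros Hr. assert (Hs := tan_switch_angle m n Hm Hn r). assert (Hc := cos_switch_angle_pos m n Hm Hn r).
  fold ph in Hs, Hc. fold t in Hs. assert (Ht := switch_slope_pos m n Hm Hn r). fold t in Ht.
  generalize (INR_ge1 m Hm), (INR_ge1 n Hn). intros H1 H2.
  rewrite Hs. set (c := cos (ph r)) in *. assert (0 < c ^ 2) by (apply pow_lt; lra).
  assert (0 < t r ^ 2) by (apply pow_lt; lra).
  assert (0 < INR n * c ^ 2 + INR m * (t r * c) ^ 2)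
    by (apply Rplus_lt_0_compat; apply Rmult_lt_0_compat; try lra; apply pow_lt, Rmult_lt_0_compat; lra).
  assert (0 < INR n + INR m * t r ^ 2) by (apply Rplus_lt_0_compat; [lra|apply Rmult_lt_0_compat; lra]).
  unfold orient, ratio_excess, Ssw, min_exp. fold t. destruct m_larger; split; field; repeat split; try lra; try nra.
Qed.

(** Solving the equation of the switching curve for r in terms of the slope, by logarithms. Here the
    power with exponent 2/d enters the model family. *)
Lemma r2_Ssw r : 0 < r -> / r ^ 2 = Ssw r ^ 2 * pw (2 / ratio_excess) (Ssw r) / (1 + Ssw r ^ 2).
Proof.
  intros Hr. assert (Ht := switch_slope_pos m n Hm Hn r). assert (E := switch_slope_eq m n Hm Hn r). fold t in Ht, E.
  assert (0 < t r ^ 2) by (apply pow_lt; lra).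
  generalize (INR_ge1 m Hm), (INR_ge1 n Hn). intros H1 H2.
  assert (HS : 0 < Ssw r) by apply Ssw_pos. assert (0 < Ssw r ^ 2) by (apply pow_lt; lra).
  assert (L : - 2 * ln r = 2 * ln (Ssw r) + 2 / ratio_excess * ln (Ssw r) - ln (1 + Ssw r ^ 2)).
  { unfold Ssw, ratio_excess. fold t. destruct m_larger_spec as [[-> Hb]|[-> Hb]].
    - rewrite ln_Rinv by exact Ht.
      replace (1 + (/ t r) ^ 2) with ((1 + t r ^ 2) * (/ t r * / t r)) by (field; lra).
      rewrite !ln_mult, ln_Rinv; try lra; try (apply Rinv_0_lt_compat; lra);
        try (apply Rmult_lt_0_compat; apply Rinv_0_lt_compat; lra).
      apply Rmult_eq_reg_l with (INR m - INR n); [|lra].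
      replace ((INR m - INR n) * (-2 * ln r)) with (-2 * ((INR m - INR n) * ln r)) by ring. rewrite <- E.
      field. lra.
    - apply Rmult_eq_reg_l with (INR m - INR n); [|lra].
      replace ((INR m - INR n) * (-2 * ln r)) with (-2 * ((INR m - INR n) * ln r)) by ring. rewrite <- E.
      field. lra. }
  apply ln_inv.
  - apply Rinv_0_lt_compat, pow_lt, Hr.
  - apply Rdiv_lt_0_compat; [apply Rmult_lt_0_compat; [lra|apply pw_pos]|lra].
  - assert (HP := pw_pos (2 / ratio_excess) (Ssw r)).
    rewrite (ln_Rinv (r ^ 2)) by (apply pow_lt, Hr). rewrite (ln_pow _ 2 Hr).
    rewrite ln_div; [|now apply Rmult_lt_0_compat|lra].
    rewrite (ln_mult (_ ^ 2)) by assumption. rewrite (ln_pow _ 2 HS).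
    unfold pw. rewrite ln_exp. simpl INR. lra.
Qed.

(** Since 1 + d is the larger of m/n and n/m, the ranges 1 < d < 2 and d > 4 are (2,3) and (5,
    infinity) for this ratio, and (1/3,1/2) and (0,1/5) for its inverse. *)
Lemma five_ratio : (case3 (ratio m n) -> five ratio_excess) /\ (case2 (ratio m n) -> ~ five ratio_excess).
Proof.
  unfold case2, case3, five, ratio, ratio_excess.
  assert (P1 : 0 < INR m) by now apply lt_0_INR. assert (P2 : 0 < INR n) by now apply lt_0_INR.
  destruct m_larger_spec as [[-> H]|[-> H]].
  - set (q := INR m / INR n). assert (1 < q) by (unfold q; apply Rlt_div_r; lra). lra.
  - set (q := INR m / INR n). assert (Hq : 0 < q < 1).
    { unfold q. split; [now apply Rdiv_lt_0_compat|apply Rlt_div_l; lra]. }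
    replace (INR n / INR m) with (/ q) by (unfold q; field; lra).
    assert (Hi : forall a b, 0 < a -> 0 < b -> (a < b -> / b < / a) /\ (a <= b -> / b <= / a)).
    { intros a b Ha Hb. split; intros; [apply Rinv_lt_contravar; nra|apply Rinv_le_contravar; lra]. }
    assert (I2 : / (1 / 2) = 2) by field. assert (I3 : / (1 / 3) = 3) by field. assert (I5 : / (1 / 5) = 5) by field.
    destruct (Hi q (1 / 2)) as [A1 A2]; try lra. destruct (Hi (1 / 2) q) as [B1 B2]; try lra.
    destruct (Hi q (1 / 3)) as [C1 C2]; try lra. destruct (Hi (1 / 3) q) as [D1 D2]; try lra.
    destruct (Hi q (1 / 5)) as [E1 E2]; try lra. destruct (Hi (1 / 5) q) as [F1 F2]; try lra.
Qed.

End Reduction.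

(** * Zeros of the first Melnikov function *)

Section Order1.

Context (A B C : R).

Definition trig_fn (x : R) : R := A + B * (2 * x) + C * (2 * (sin x * cos x)).

(** The derivative is 2 B + 2 C cos (2 x), and cos (2 x) is strictly decreasing on the quadrant, so
    one application of Rolle suffices. *)
Lemma trig_fn_atmost : ~ (A = 0 /\ B = 0 /\ C = 0) -> atmost 2 (fun x => 0 < x < PI / 2 /\ trig_fn x = 0).
Proof.
  intros Hnz. assert (HPI := PI_RGT_0).
  destruct (Req_dec B 0) as [HB|HB]; [destruct (Req_dec C 0) as [HC|HC]|].
  - apply atmost_mono with 0%nat (fun x => 0 < x < PI / 2 /\ trig_fn x = 0); auto.
    apply atmost0. intros x [_ Hx]. apply Hnz. unfold trig_fn in Hx. subst. repeat split; lra.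
  - apply (atmost_rolle _ trig_fn (fun x => 2 * B + 2 * C * cos (2 * x))).
    + intros x y z Hx Hz Hy. lra.
    + intros x _. unfold trig_fn. auto_derive; auto. rewrite cos_2a. ring.
    + apply atmost1. intros x y [Hx Zx] [Hy Zy] Hxy.
      assert (cos (2 * y) < cos (2 * x)) by (apply cos_decreasing_1; lra).
      assert (C * cos (2 * x) = C * cos (2 * y)) by lra. apply Rmult_eq_reg_l in H0; [lra|exact HC].
  - apply (atmost_rolle _ trig_fn (fun x => 2 * B + 2 * C * cos (2 * x))).
    + intros x y z Hx Hz Hy. lra.
    + intros x _. unfold trig_fn. auto_derive; auto. rewrite cos_2a. ring.
    + apply atmost1. intros x y [Hx Zx] [Hy Zy] Hxy.
      assert (cos (2 * y) < cos (2 * x)) by (apply cos_decreasing_1; lra).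
      assert (C * cos (2 * x) = C * cos (2 * y)) by lra.
      destruct (Req_dec C 0) as [HC|HC]; [subst; lra|]. apply Rmult_eq_reg_l in H0; lra.
Qed.

End Order1.

(** * Transfer to [m_ell] and [H_ge]; the case m = n *)

Section Counting.

Context (m n : nat) (Hm : (0 < m)%nat) (Hn : (0 < n)%nat) (Em : Nat.Even m) (En : Nat.Even n).

Definition averaging (cf : Coeffs) (k : nat) (u : nat -> nat -> R -> R -> R) : Prop :=
  exists ut ur, avg_coeffs (sector_angle m n Hm Hn) (fun j i => polar_coeff (pc cf j) (qc cf j) i) k u ut ur.

Lemma averaging_exists cf k : exists u, averaging cf k u.
Proof.
  destruct (avg_exists (sector_angle m n Hm Hn) (smooth_sector_angle m n Hm Hn) (fun j i => polar_coeff (pc cf j) (qc cf j) i)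
    (fun j i => Sep_polar_coeff _ _ _) k) as (u & ut & ur & H).
  exists u, ut, ur. exact H.
Qed.

(** The functions [Dm u] provide an expansion for the lower bound, and by uniqueness represent every
    other one in orders 1 to k. The upper bound is asked for all zeros, not merely the simple
    ones. *)
Lemma m_ell_intro k l M : (1 <= l <= k)%nat ->
  (exists cf, forall u, averaging cf k u -> first_nonzero (Dm u) l /\
     exists zs, simple_zeros_list (Dm u l) zs /\ length zs = M) ->
  (forall cf u, averaging cf k u -> first_nonzero (Dm u) l -> zeros_le M (fun r => 0 < r /\ Dm u l r = 0)) ->
  m_ell k m n l M.
Proof.
  intros Hl [cf Hlow] Hup. split.
  - destruct (averaging_exists cf k) as [u Hu]. destruct (Hlow u Hu) as [H1 H2].
    exists cf, (Dm u). split; auto. destruct Hu as (ut & ur & Hu).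
    exact (melnikov_expansion m n Hm Hn Em En cf k u ut ur Hu).
  - clear cf Hlow. intros cf D HD [Hz (r0 & Hr0 & Hnz)] zs [Hnd Hzs].
    destruct (averaging_exists cf k) as [u Hu]. assert (Hu' := Hu). destruct Hu' as (ut & ur & Hu').
    assert (E := melnikov_unique m n Hm Hn Em En cf k u ut ur Hu' D HD).
    apply (Hup cf u Hu); auto.
    + split.
      * intros i Hi r Hr. rewrite <- E by (auto; lia). now apply Hz.
      * exists r0. split; auto. rewrite <- E by (auto; lia). exact Hnz.
    + intros z Hin. destruct (Hzs z Hin) as [Hp [H0 _]]. split; auto. rewrite <- E by (auto; lia). exact H0.
Qed.

Lemma H_ge_intro M : (exists cf, forall u, averaging cf 2 u -> first_nonzero (Dm u) 2 /\
     exists zs, simple_zeros_list (Dm u 2) zs /\ length zs = M) -> H_ge m n M.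
Proof.
  intros [cf H]. destruct (averaging_exists cf 2) as [u Hu]. destruct (H u Hu) as [[H1 _] (zs & Hz & <-)].
  destruct Hu as (ut & ur & Hu). apply (H_ge_simple m n Hm Hn Em En cf u ut ur Hu); auto.
Qed.

Lemma is_derive_pos_ext (f g : R -> R) z l : (forall r, 0 < r -> f r = g r) -> 0 < z ->
  is_derive g z l -> is_derive f z l.
Proof.
  intros H Hz. apply is_derive_ext_loc. exists (mkposreal z Hz). intros y Hy. symmetry. apply H.
  unfold ball in Hy; simpl in Hy; unfold AbsRing_ball, abs, minus, plus, opp in Hy; simpl in Hy.
  apply Rabs_def2 in Hy. lra.
Qed.

(** Primed arguments are second order coefficients. Everything unlisted is 0, in particular the
    constant terms on the side y^n - x^m < 0. *)
Definition coeffs12 (a0 a1 a2 b0 b1 b2 al1 be2 a1' b2' al1' be2' : R) : Coeffs :=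
  mkCoeffs
    (fun j i => match i, j with 1, 0 => a0 | 1, 1 => a1 | 1, 2 => a2 | 2, 1 => a1' | _, _ => 0%R end%nat)
    (fun j i => match i, j with 1, 0 => b0 | 1, 1 => b1 | 1, 2 => b2 | 2, 2 => b2' | _, _ => 0%R end%nat)
    (fun j i => match i, j with 1, 1 => al1 | 2, 1 => al1' | _, _ => 0%R end%nat)
    (fun j i => match i, j with 1, 2 => be2 | 2, 2 => be2' | _, _ => 0%R end%nat).

Section Diagonal.

Context (Emn : m = n).

Lemma lin_part_diag cf i r : lin_part m n Hm Hn cf i r = lin_part m n Hm Hn cf i 1.
Proof. unfold lin_part. now rewrite !(switch_angle_diag m n Hm Hn _ Emn). Qed.

Lemma order1_diag k : (1 <= k)%nat -> m_ell k m n 1 0.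
Proof.
  intros Hk. apply m_ell_intro; [lia| |].
  - exists (coeffs12 0 1 0 0 0 1 1 1 0 0 0 0). intros u (ut & ur & Hu).
    assert (E : Dm u 1 1 <> 0).
    { rewrite (Dm1_formula m n Hm Hn _ k u ut ur Hu) by (auto; lra). unfold lin_part. simpl.
      assert (H := PI_RGT_0). lra. }
    split.
    + split; [intros; lia|]. exists 1. split; auto; lra.
    + exists nil. split; auto. split; [constructor|]. intros z [].
  - intros cf u (ut & ur & Hu) [_ (r0 & Hr0 & Hnz)] l Hl Hz.
    apply (atmost_NoDup 0 (fun r => 0 < r /\ Dm u 1 r = 0)); auto. apply atmost0. intros x [Hx H0].
    rewrite (Dm1_formula m n Hm Hn _ k u ut ur Hu) in H0, Hnz by auto.
    rewrite lin_part_diag in H0, Hnz. apply Rmult_integral in H0. destruct H0 as [H0|H0]; [lra|].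
    apply Hnz. rewrite H0. ring.
Qed.

Lemma order2_diag_lower k : (2 <= k)%nat -> exists cf, forall u, averaging cf k u ->
  first_nonzero (Dm u) 2 /\ exists zs, simple_zeros_list (Dm u 2) zs /\ length zs = 1%nat.
Proof.
  intros Hk. assert (HPI := PI_RGT_0).
  (* The second order linear coefficients 1/PI contribute - 2 r and the first order constants a_01 =
     b_01 = 1 contribute 2/r, with a simple zero at 1. *)
  exists (coeffs12 1 0 0 1 0 0 0 0 (/ PI) (/ PI) (/ PI) (/ PI)). intros u (ut & ur & Hu).
  assert (E : forall r, 0 < r -> Dm u 2 r = - 2 * r + 2 / r).
  { intros r Hr. rewrite (Dm2_hamiltonian m n Hm Hn _ k u ut ur Hu) by (simpl; auto; lra).
    unfold lin_part. rewrite (switch_angle_diag m n Hm Hn _ Emn). simpl.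
    rewrite <- Emn. rewrite sin_PI4, cos_PI4.
    assert (H2 : sqrt 2 * sqrt 2 = 2) by (apply sqrt_sqrt; lra).
    assert (Hs : 0 < sqrt 2) by (apply sqrt_lt_R0; lra).
    assert (Hm' : 0 < INR m) by now apply lt_0_INR.
    assert (Hx : 1 / sqrt 2 * (1 / sqrt 2) = / 2) by (rewrite <- H2 at 3; field; lra).
    set (x := 1 / sqrt 2) in *. rewrite !Rmult_1_r, !Hx.
    field. lra. }
  assert (E1 : forall r, 0 < r -> Dm u 1 r = 0).
  { intros r Hr. rewrite (Dm1_formula m n Hm Hn _ k u ut ur Hu) by (auto; lia). unfold lin_part. simpl. ring. }
  split.
  - split.
    + intros i Hi. replace i with 1%nat by lia. exact E1.
    + exists 2. split; [lra|]. rewrite E by lra. lra.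
  - exists [1]. split; auto. split; [repeat constructor; intros []|].
    intros z [<-|[]]. split; [lra|]. split; [rewrite E; lra|].
    exists (-4). split; [|lra]. apply (is_derive_pos_ext _ (fun r => - 2 * r + 2 / r) _ _ E); [lra|].
    auto_derive; [lra|field].
Qed.

Lemma order2_diag k : (2 <= k)%nat -> m_ell k m n 2 1.
Proof.
  intros Hk. apply m_ell_intro; [lia|now apply order2_diag_lower|].
  intros cf u (ut & ur & Hu) [HD1 (r0 & Hr0 & Hnz)] l Hl Hz.
  destruct (Dm2_diag m n Hm Hn cf k u ut ur Hu Emn Hk) as (X & Y & E).
  { apply HD1; lia. }
  apply (atmost_NoDup 1 (fun r => 0 < r /\ Dm u 2 r = 0)); auto.
  assert (Q : forall r, 0 < r -> Dm u 2 r = 0 -> X * r ^ 2 + Y = 0).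
  { intros r Hr H. rewrite E in H by auto. apply Rmult_eq_reg_r with (/ r); [|apply Rinv_neq_0_compat; lra].
    rewrite Rmult_0_l, <- H. field. lra. }
  apply atmost1. intros x y [Hx X0] [Hy Y0] Hxy. apply Q in X0; auto. apply Q in Y0; auto.
  assert (0 < y ^ 2 - x ^ 2) by nra.
  assert (X * (y ^ 2 - x ^ 2) = 0) by lra. apply Rmult_integral in H0. destruct H0 as [H0|H0]; [|lra].
  apply Hnz. rewrite E, H0 by auto. replace Y with 0 by (rewrite H0 in X0; lra). field. lra.
Qed.

End Diagonal.

End Counting.

(** * The case of different exponents *)

Lemma simple_zeros_comp (f g h : R -> R) (c : R) (zs : list R) : c <> 0 ->
  (forall r, 0 < r -> f r = c * r * g (h r)) ->
  (forall r, 0 < r -> exists l, is_derive h r l /\ l <> 0) ->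
  NoDup zs ->
  (forall z, In z zs -> (exists r, 0 < r /\ h r = z) /\ simple_zero g z) ->
  exists ws, simple_zeros_list f ws /\ length ws = length zs.
Proof.
  intros Hc Hf Hh Hnd Hz.
  assert (P : exists ws, map h ws = zs /\ forall w, In w ws -> 0 < w).
  { clear Hnd. induction zs as [|z zs IH].
    - exists nil. split; auto. intros w [].
    - destruct IH as (ws & E & Hw). { intros y Hy. apply Hz. now right. }
      destruct (Hz z (or_introl eq_refl)) as [(r & Hr & Er) _].
      exists (r :: ws). split; [simpl; congruence|]. intros w [<-|H]; auto. }
  destruct P as (ws & E & Hw). exists ws. split; [|now rewrite <- E, length_map].
  split; [apply (NoDup_map_inv h); now rewrite E|].
  intros w Hin. split; auto. assert (Hp := Hw w Hin).
  destruct (Hz (h w)) as [_ (H0 & l1 & D1 & N1)]. { rewrite <- E. now apply in_map. }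
  destruct (Hh w Hp) as (l2 & D2 & N2).
  split; [rewrite Hf, H0 by auto; ring|]. exists (c * w * (l2 * l1)). split.
  - apply (is_derive_pos_ext _ _ _ _ Hf Hp). evar_last.
    + apply (is_derive_mult (fun r => c * r) (fun r => g (h r)) w c (l2 * l1)).
      * auto_derive; auto; ring.
      * now apply (is_derive_comp g h).
      * intros. apply Rmult_comm.
    + unfold plus, mult; simpl. rewrite H0. ring.
  - repeat apply Rmult_integral_contrapositive_currified; auto. lra.
Qed.

Lemma simple_zeros_nonzero (f : R -> R) (zs : list R) : simple_zeros_list f zs -> (0 < length zs)%nat ->
  exists r, 0 < r /\ f r <> 0.
Proof.
  intros [_ Hz] Hl. destruct zs as [|z zs]; [simpl in Hl; lia|].
  destruct (Hz z (or_introl eq_refl)) as [Hp (H0 & l & D & N)].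
  apply NNPP. intros Hn. apply N.
  assert (E : forall r, 0 < r -> f r = 0).
  { intros r Hr. apply NNPP. intros C. apply Hn. now exists r. }
  rewrite <- (is_derive_unique _ _ _ D). apply is_derive_unique.
  apply (is_derive_pos_ext f (fun _ => 0) z 0 E Hp). apply (is_derive_const 0).
Qed.

Section Generic.

Context (m n : nat) (Hm : (0 < m)%nat) (Hn : (0 < n)%nat) (Em : Nat.Even m) (En : Nat.Even n) (Hmn : m <> n).

Let t := switch_slope m n Hm Hn.
Let ph := switch_angle m n Hm Hn.
Let d := ratio_excess m n.

Lemma ph_inj r r' : 0 < r -> 0 < r' -> ph r = ph r' -> r = r'.
Proof.
  intros Hr Hr' E. apply (switch_slope_inj m n Hm Hn Hmn); auto.
  rewrite <- (tan_atan (switch_slope _ _ _ _ r)), <- (tan_atan (switch_slope _ _ _ _ r')).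
  unfold ph, switch_angle in E. now rewrite E.
Qed.

Lemma ph_surj T : 0 < T -> exists r, 0 < r /\ ph r = atan T.
Proof.
  intros HT. destruct (switch_slope_surj m n Hm Hn T Hmn HT) as (r & Hr & E). exists r. split; auto.
  unfold ph, switch_angle. now rewrite E.
Qed.

Lemma ph_derive r : 0 < r -> exists l, is_derive ph r l /\ l <> 0.
Proof.
  intros Hr. exists (dphi m n Hm Hn r). split; [now apply is_derive_switch_angle|].
  assert (Hs := sin_switch_angle_pos m n Hm Hn r). assert (Hc := cos_switch_angle_pos m n Hm Hn r).
  generalize (INR_ge1 m Hm), (INR_ge1 n Hn). intros H1 H2.
  unfold dphi. set (s := sin _) in *. set (c := cos _) in *.
  assert (0 < c ^ 2) by now apply pow_lt. assert (0 < s ^ 2) by now apply pow_lt.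
  assert (0 < INR n * c ^ 2 + INR m * s ^ 2) by (apply Rplus_lt_0_compat; apply Rmult_lt_0_compat; lra).
  assert (INR m - INR n <> 0) by (apply not_INR in Hmn; lra).
  unfold Rdiv. apply Rmult_integral_contrapositive_currified.
  - repeat apply Rmult_integral_contrapositive_currified; lra.
  - apply Rinv_neq_0_compat, Rmult_integral_contrapositive_currified; lra.
Qed.

Section Formula.

Context (cf : Coeffs).

Definition lA (i : nat) : R := (ca cf 1 i + cb cf 2 i) * PI.
Definition lB (i : nat) : R := cal cf 1 i + cbe cf 2 i - ca cf 1 i - cb cf 2 i.
Definition lC (i : nat) : R := cb cf 2 i - ca cf 1 i + cal cf 1 i - cbe cf 2 i.
Definition W1 : R := ca cf 1 1 * ((ca cf 2 1 + cb cf 1 1) - (cal cf 2 1 + cbe cf 1 1)).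
Definition W2 : R := ca cf 1 1 * ((cb cf 1 1 - ca cf 2 1) - (cbe cf 1 1 - cal cf 2 1)).
Definition K2 : R := INR m * (ca cf 0 1 * cb cf 0 1) - INR n * (cal cf 0 1 * cbe cf 0 1)
  - (INR m - INR n) * (cal cf 0 1 * cb cf 0 1).

Lemma lin_part_trig i r : lin_part m n Hm Hn cf i r = trig_fn (lA i) (lB i) (lC i) (ph r).
Proof. reflexivity. Qed.

Context (k : nat) (u ut ur : nat -> nat -> R -> R -> R)
  (Hu : avg_coeffs (sector_angle m n Hm Hn) (fun j i => polar_coeff (pc cf j) (qc cf j) i) k u ut ur).

Lemma Dm1_trig r : (1 <= k)%nat -> 0 < r -> Dm u 1 r = -1 * r * trig_fn (lA 1) (lB 1) (lC 1) (ph r).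
Proof.
  intros Hk Hr. rewrite (Dm1_formula m n Hm Hn cf k u ut ur Hu r Hk Hr), lin_part_trig. ring.
Qed.

(** Writing S for [Ssw], the factors (2 + d)/d and (1 + d)/d come from the partial fraction
    decomposition of S (1 + d - S^2) / ((1 + S^2) (1 + d + S^2)). *)
Lemma Dm2_hq r : (2 <= k)%nat -> 0 < r ->
  cb cf 2 1 = - ca cf 1 1 -> cbe cf 2 1 = - ca cf 1 1 -> cal cf 1 1 = ca cf 1 1 ->
  Dm u 2 r = 1 * r * hq d (- lA 2 - 2 * lB 2 * base_angle m n) (- 2 * orient m n * lB 2)
    (- 2 * lC 2 + 2 * W2 + 2 * W1 * orient m n * ((2 + d) / d))
    (- 4 * W1 * orient m n * ((1 + d) / d)) (4 * K2 / min_exp m n) (Ssw m n Hm Hn r).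
Proof.
  intros Hk Hr Ha Hb Hc.
  assert (E := Dm2_hamiltonian m n Hm Hn cf k u ut ur Hu r Hk Hr Ha Hb Hc). cbv zeta in E. rewrite E. clear E.
  fold ph. rewrite lin_part_trig. unfold trig_fn.
  assert (Hs := sin_switch_angle_pos m n Hm Hn r). assert (Hco := cos_switch_angle_pos m n Hm Hn r).
  assert (E1 := ph_Ssw m n Hm Hn r Hr). assert (E2 := sc_Ssw m n Hm Hn r Hr).
  destruct (den_Ssw m n Hm Hn r Hr) as [E3 E4]. assert (E5 := r2_Ssw m n Hm Hn Hmn r Hr).
  assert (HS := Ssw_pos m n Hm Hn r). assert (Hd := ratio_excess_pos m n Hm Hn Hmn).
  generalize (INR_ge1 m Hm), (INR_ge1 n Hn). intros H1 H2.
  assert (Hmin : min_exp m n <> 0) by (unfold min_exp; destruct (m_larger m n); lra).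
  fold ph in Hs, Hco, E1, E2, E3, E4. fold d in E3, E4, E5, Hd. fold W1 W2 K2.
  set (s := sin (ph r)) in *. set (c := cos (ph r)) in *. set (S := Ssw m n Hm Hn r) in *.
  assert (0 < c ^ 2) by now apply pow_lt. assert (0 < s ^ 2) by now apply pow_lt. assert (0 < S ^ 2) by now apply pow_lt.
  set (D := INR n * c ^ 2 + INR m * s ^ 2) in *.
  assert (0 < D) by (apply Rplus_lt_0_compat; apply Rmult_lt_0_compat; lra).
  set (N := INR n * c ^ 2 - INR m * s ^ 2) in *.
  replace (r * ca cf 1 1 * (ca cf 2 1 + cb cf 1 1 - (cal cf 2 1 + cbe cf 1 1)) * (2 * s * c * N) / D)
    with (r * W1 * (2 * (s * c)) * (N / D)) by (unfold W1; field; lra).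
  replace (r * ca cf 1 1 * (cb cf 1 1 - ca cf 2 1 - (cbe cf 1 1 - cal cf 2 1)) * (2 * s * c))
    with (r * W2 * (2 * (s * c))) by (unfold W2; ring).
  replace (4 * K2 * (s * c) / (r * D)) with (4 * K2 * (s * c / D) * r * / r ^ 2) by (field; lra).
  rewrite E1, E4, E2, E3, E5. unfold hq. field. repeat split; lra.
Qed.

End Formula.

Lemma Dm1_zeros cf k u ut ur : (1 <= k)%nat ->
  avg_coeffs (sector_angle m n Hm Hn) (fun j i => polar_coeff (pc cf j) (qc cf j) i) k u ut ur ->
  ~ (lA cf 1 = 0 /\ lB cf 1 = 0 /\ lC cf 1 = 0) -> zeros_le 2 (fun r => 0 < r /\ Dm u 1 r = 0).
Proof.
  intros Hk Hu H.
  apply (zeros_le_map ph 2 (fun x => 0 < x < PI / 2 /\ trig_fn (lA cf 1) (lB cf 1) (lC cf 1) x = 0)).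
  - intros x y [Hx _] [Hy _]. now apply ph_inj.
  - intros x [Hx H0]. split; [apply switch_angle_bound|].
    rewrite (Dm1_trig cf k u ut ur Hu x Hk Hx) in H0. apply Rmult_integral in H0. destruct H0; [lra|auto].
  - intros l. apply atmost_NoDup. now apply trig_fn_atmost.
Qed.

Lemma order1_generic k : (1 <= k)%nat -> m_ell k m n 1 2.
Proof.
  intros Hk. apply (m_ell_intro m n Hm Hn Em En); [lia| |].
  - assert (HPI := PI_RGT_0).
    (* These coefficients turn [trig_fn] into sin (2 x) - 4/5, which vanishes in the quadrant at tan
       x = 1/2 and tan x = 2. *)
    exists (coeffs12 0 (- 2 / (5 * PI) - 1 / 2) 0 0 0 (- 2 / (5 * PI) + 1 / 2) (- 2 / (5 * PI)) (- 2 / (5 * PI)) 0 0 0 0).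
    intros u (ut & ur & Hu). set (cf := coeffs12 _ _ _ _ _ _ _ _ _ _ _ _) in *.
    assert (E : exists ws, simple_zeros_list (Dm u 1) ws /\ length ws = length [atan (1 / 2); atan 2]).
    { apply (simple_zeros_comp _ (trig_fn (lA cf 1) (lB cf 1) (lC cf 1)) ph (-1)); [lra| | | |].
      - intros r Hr. exact (Dm1_trig cf k u ut ur Hu r Hk Hr).
      - exact ph_derive.
      - assert (H := atan_increasing (1 / 2) 2). repeat constructor; simpl; intuition lra.
      - assert (EA : lA cf 1 = - 4 / 5) by (unfold lA; simpl; field; lra).
        assert (EB : lB cf 1 = 0) by (unfold lB; simpl; field; lra).
        assert (EC : lC cf 1 = 1) by (unfold lC; simpl; field; lra).
        rewrite EA, EB, EC.
        assert (P : forall T, 0 < T -> 5 * T = 2 * (1 + T ^ 2) -> T ^ 2 <> 1 -> simple_zero (trig_fn (- 4 / 5) 0 1) (atan T)).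
        { intros T HT Q HT1. assert (0 < 1 + T ^ 2) by nra.
          assert (Hc : 0 < cos (atan T)) by (destruct (atan_bound T); apply cos_gt_0; lra).
          assert (Hs : sin (atan T) = T * cos (atan T)).
          { rewrite <- (tan_atan T) at 2. unfold tan. field. lra. }
          assert (H2 := cos2_sub (atan T)). rewrite Hs in H2.
          set (c := cos (atan T)) in *.
          assert (Hc2 : c ^ 2 * (1 + T ^ 2) = 1) by lra.
          split.
          - unfold trig_fn. rewrite Hs. fold c.
            replace (-4 / 5 + 0 * (2 * atan T) + 1 * (2 * (T * c * c))) with (- 4 / 5 + 2 / 5 * (5 * T) * c ^ 2) by field.
            rewrite Q. lra.
          - exists (2 * (c ^ 2 * (1 - T ^ 2))). split.
            + unfold trig_fn. auto_derive; auto. fold c. rewrite Hs. fold c. ring.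
            + apply Rmult_integral_contrapositive_currified; [lra|].
              apply Rmult_integral_contrapositive_currified; [|lra]. apply pow_nonzero. lra. }
        intros z [<-|[<-|[]]]; (split; [apply ph_surj; lra|apply P; lra]). }
    destruct E as (ws & H1 & H2). split; [|now exists ws].
    split; [intros; lia|]. apply (simple_zeros_nonzero _ _ H1). rewrite H2. simpl. lia.
  - intros cf u (ut & ur & Hu) [_ (r0 & Hr0 & Hnz)]. apply (Dm1_zeros cf k u ut ur); auto.
    intros (A & B & C). apply Hnz. rewrite (Dm1_trig cf k u ut ur Hu r0 Hk Hr0), A, B, C. unfold trig_fn. ring.
Qed.

(** A nontrivial combination has at most two zeros, whereas the first Melnikov function vanishes in
    particular at the radii 1, 2, 3; so all three coefficients are 0, and these are linear equations
    for the first order terms. *)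
Lemma order1_vanishes cf k u ut ur : (1 <= k)%nat ->
  avg_coeffs (sector_angle m n Hm Hn) (fun j i => polar_coeff (pc cf j) (qc cf j) i) k u ut ur ->
  (forall r, 0 < r -> Dm u 1 r = 0) ->
  cb cf 2 1 = - ca cf 1 1 /\ cbe cf 2 1 = - ca cf 1 1 /\ cal cf 1 1 = ca cf 1 1.
Proof.
  intros Hk Hu H0. assert (HPI := PI_RGT_0).
  assert (Z : lA cf 1 = 0 /\ lB cf 1 = 0 /\ lC cf 1 = 0).
  { apply NNPP. intros Hn0. assert (H3 := Dm1_zeros cf k u ut ur Hk Hu Hn0 [1; 2; 3]). simpl in H3.
    enough (3 <= 2)%nat by lia. apply H3.
    - repeat constructor; simpl; intuition lra.
    - intros x [<-|[<-|[<-|[]]]]; (split; [lra|apply H0; lra]). }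
  destruct Z as (A & B & C). unfold lA, lB, lC in *. apply Rmult_integral in A. destruct A; lra.
Qed.

Lemma order2_zeros cf k u : (2 <= k)%nat -> averaging m n Hm Hn cf k u -> first_nonzero (Dm u) 2 ->
  zeros_le 5 (fun r => 0 < r /\ Dm u 2 r = 0) /\
  (~ five d -> zeros_le 4 (fun r => 0 < r /\ Dm u 2 r = 0)).
Proof.
  intros Hk (ut & ur & Hu) [H1 (r0 & Hr0 & Hnz)].
  assert (Hk1 : (1 <= k)%nat) by lia.
  destruct (order1_vanishes cf k u ut ur Hk1 Hu) as (Ha & Hb & Hc). { apply H1; lia. }
  pose proof (fun r Hr => Dm2_hq cf k u ut ur Hu r Hk Hr Ha Hb Hc) as E. cbv beta in E.
  set (e0 := - lA cf 2 - _) in E. set (e1 := - 2 * orient m n * _) in E. set (e2 := - 2 * lC cf 2 + _ + _) in E.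
  set (e3 := - 4 * W1 cf * _ * _) in E. set (e4 := 4 * _ / _) in E.
  destruct (hq_zeros_le d e0 e1 e2 e3 e4 (ratio_excess_pos m n Hm Hn Hmn)) as [Z5 Z4].
  { intros Z. apply Hnz. rewrite E by auto. unfold allzero in Z. destruct Z as (-> & -> & -> & -> & ->). unfold hq. ring. }
  assert (P : forall N, zeros_le N (fun s => 0 < s /\ hq d e0 e1 e2 e3 e4 s = 0) -> zeros_le N (fun r => 0 < r /\ Dm u 2 r = 0)).
  { intros N. apply (zeros_le_map (Ssw m n Hm Hn)).
    - intros x y [Hx _] [Hy _]. now apply Ssw_inj.
    - intros x [Hx H0]. split; [apply Ssw_pos|]. rewrite E in H0 by auto.
      apply Rmult_integral in H0. destruct H0; [lra|auto]. }
  auto.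
Qed.

Lemma order2_lower k : (2 <= k)%nat -> exists cf, forall u, averaging m n Hm Hn cf k u ->
  first_nonzero (Dm u) 2 /\ exists zs, simple_zeros_list (Dm u 2) zs /\
    (five d -> length zs = 5%nat) /\ (~ five d -> length zs = 4%nat).
Proof.
  intros Hk. assert (Hd := ratio_excess_pos m n Hm Hn Hmn). fold d in Hd.
  destruct (hq_simple_exists d Hd) as (e0 & e1 & e2 & e3 & e4 & zs & Hnd & L5 & L4 & Hz).
  assert (HPI := PI_RGT_0).
  assert (Hsg : orient m n * orient m n = 1) by (unfold orient; destruct (m_larger m n); ring).
  assert (Hsg0 : orient m n <> 0) by (unfold orient; destruct (m_larger m n); lra).
  generalize (INR_ge1 m Hm), (INR_ge1 n Hn). intros G1 G2.
  assert (Hmin : min_exp m n <> 0) by (unfold min_exp; destruct (m_larger m n); lra).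
  (* The coefficients in [Dm2_hq] are solved for W1 = w, lB = B, lA = X PI, lC = C and K2 = K, with
     W2 set to 0. *)
  set (w := - e3 * d / (4 * orient m n * (1 + d))).
  set (B := - e1 / (2 * orient m n)).
  set (X := - (e0 + 2 * B * base_angle m n) / PI).
  set (C := - (e2 - 2 * w * orient m n * ((2 + d) / d)) / 2).
  set (K := e4 * min_exp m n / 4).
  (* The first order entries 1 and - 1 make both traces zero with a_11 = alpha_11, so the first
     order vanishes; a_21 = b_11 = w/2 gives W1 = w and W2 = 0, and a_01 b_01 = K/m gives K2 = K.
     The four second order entries realise X, B and C. *)
  exists (coeffs12 (K / INR m) 1 (w / 2) 1 (w / 2) (-1) 1 (-1) ((X - C) / 2) ((X + C) / 2) ((X + B) / 2) ((X + B) / 2)).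
  set (cf := coeffs12 _ _ _ _ _ _ _ _ _ _ _ _) in *.
  intros u (ut & ur & Hu).
  assert (E1 : forall r, 0 < r -> Dm u 1 r = 0).
  { intros r Hr. rewrite (Dm1_formula m n Hm Hn _ k u ut ur Hu) by (auto; lia). unfold lin_part. simpl. ring. }
  assert (E2 : forall r, 0 < r -> Dm u 2 r = 1 * r * hq d e0 e1 e2 e3 e4 (Ssw m n Hm Hn r)).
  { intros r Hr. rewrite (Dm2_hq cf k u ut ur Hu r Hk Hr) by (simpl; ring).
    assert (QA : lA cf 2 = X * PI) by (unfold lA; simpl; field).
    assert (QB : lB cf 2 = B) by (unfold lB; simpl; field).
    assert (QC : lC cf 2 = C) by (unfold lC; simpl; field).
    assert (Q1 : W1 cf = w) by (unfold W1; simpl; field).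
    assert (Q2 : W2 cf = 0) by (unfold W2; simpl; field).
    assert (Q3 : K2 cf = K) by (unfold K2; simpl; field; lra).
    rewrite QA, QB, QC, Q1, Q2, Q3. f_equal. f_equal.
    - unfold X. field. lra.
    - unfold B. field. lra.
    - unfold C. field. lra.
    - unfold w. field. lra.
    - unfold K. field. lra. }
  destruct (simple_zeros_comp (Dm u 2) (hq d e0 e1 e2 e3 e4) (Ssw m n Hm Hn) 1 zs) as (ws & H1 & H2); auto.
  - intros r Hr. now apply Ssw_derive.
  - intros z Hin. destruct (Hz z Hin) as (Hp & H0 & H1). split; [now apply Ssw_surj|].
    split; auto. exists (dhq d e1 e2 e3 e4 z). split; auto. now apply is_derive_hq.
  - split.
    + split.
      * intros i Hi. replace i with 1%nat by lia. exact E1.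
      * apply (simple_zeros_nonzero _ _ H1). rewrite H2.
        destruct (classic (five d)) as [F|F]; [rewrite L5 by auto|rewrite L4 by auto]; lia.
    + exists ws. rewrite H2. auto.
Qed.

Lemma order2_generic M : (five d -> M = 5%nat) -> (~ five d -> M = 4%nat) ->
  (forall k, (2 <= k)%nat -> m_ell k m n 2 M) /\ H_ge m n M.
Proof.
  intros H5 H4.
  assert (L : forall k, (2 <= k)%nat -> exists cf, forall u, averaging m n Hm Hn cf k u ->
    first_nonzero (Dm u) 2 /\ exists zs, simple_zeros_list (Dm u 2) zs /\ length zs = M).
  { intros k Hk. destruct (order2_lower k Hk) as [cf H]. exists cf. intros u Hu.
    destruct (H u Hu) as [H1 (zs & H2 & L5 & L4)]. split; auto. exists zs. split; auto.
    destruct (classic (five d)) as [F|F]; [rewrite H5, L5|rewrite H4, L4]; auto. }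
  split.
  - intros k Hk. apply (m_ell_intro m n Hm Hn Em En); [lia|auto|].
    intros cf u Hu Hf. destruct (order2_zeros cf k u Hk Hu Hf) as [Z5 Z4].
    destruct (classic (five d)) as [F|F]; [rewrite H5|rewrite H4]; auto.
  - apply (H_ge_intro m n Hm Hn Em En). auto.
Qed.

End Generic.

Theorem theoremA (m n : nat) :
  (0 < m)%nat -> (0 < n)%nat -> Nat.Even m -> Nat.Even n ->
  (case1 (ratio m n) ->
     (forall k, (1 <= k)%nat -> m_ell k m n 1 0) /\
     (forall k, (2 <= k)%nat -> m_ell k m n 2 1) /\
     H_ge m n 1) /\
  (case2 (ratio m n) ->
     (forall k, (1 <= k)%nat -> m_ell k m n 1 2) /\
     (forall k, (2 <= k)%nat -> m_ell k m n 2 4) /\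
     H_ge m n 4) /\
  (case3 (ratio m n) ->
     (forall k, (1 <= k)%nat -> m_ell k m n 1 2) /\
     (forall k, (2 <= k)%nat -> m_ell k m n 2 5) /\
     H_ge m n 5).
Proof.
  intros Hm Hn Em En.
  assert (Hn0 : INR n <> 0) by (apply not_0_INR; lia).
  assert (Hd : ratio m n <> 1 -> m <> n).
  { intros H E. apply H. subst. unfold ratio. now field. }
  split; [|split].
  - intros H. assert (Emn : m = n).
    { apply INR_eq. unfold case1, ratio in H. apply Rmult_eq_reg_r with (/ INR n); [|now apply Rinv_neq_0_compat].
      unfold Rdiv in H. rewrite H. now field. }
    split; [|split].
    + intros k Hk. now apply (order1_diag m n Hm Hn Em En Emn).
    + intros k Hk. now apply (order2_diag m n Hm Hn Em En Emn).
    + apply (H_ge_intro m n Hm Hn Em En), order2_diag_lower; auto.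
  - intros H. assert (Hmn : m <> n) by (apply Hd; unfold case2 in H; lra).
    assert (F := proj2 (five_ratio m n Hm Hn Hmn) H).
    split; [intros k Hk; now apply (order1_generic m n Hm Hn Em En Hmn)|].
    apply (order2_generic m n Hm Hn Em En Hmn); auto. now intros.
  - intros H. assert (Hmn : m <> n) by (apply Hd; unfold case3 in H; lra).
    assert (F := proj1 (five_ratio m n Hm Hn Hmn) H).
    split; [intros k Hk; now apply (order1_generic m n Hm Hn Em En Hmn)|].
    apply (order2_generic m n Hm Hn Em En Hmn); auto. now intros.
Qed.
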